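(* Let $Y$ be any left $S^1$-space. Then there is a DCSH quasi-isomorphism $$H_*BS^1\otimes_{\widehat\zeta\circ t_\Omega}CU_*Y\xrightarrow{\simeq}CU_*Y_{hS^1}.$$ In particular, $$H^*\Big(\big(H_*BS^1\otimes_{\widehat\zeta\circ t_\Omega}CU_*Y\big)^\sharp\Big)\cong H^*(Y_{hS^1})$$ as graded algebras.
   Context: Fix a commutative ring $\Bbbk$ of coefficients; tensor products are over $\Bbbk$ with the Koszul sign rule; $(-)^\sharp$ is the $\Bbbk$-linear dual. $CU_*X$ is the (normalized, i.e. modulo degenerate cubes) cubical chain complex of a space $X$, with differential $dT=\sum_{i=1}^n(-1)^i\big(T|_{\text{$i$-th coordinate}=0}-T|_{\text{$i$-th coordinate}=1}\big)$ on an $n$-cube $T:I^n\to X$, and with its usual coassociative cubical (Serre) comultiplication $\delta_X$, dual to the cup product. $EZ$ denotes the cubical cross product $CU_*X\otimes CU_*W\to CU_*(X\times W)$. $CU_*S^1$ is a chain Hopf algebra with product $(T\cdot S)(t,s)=T(t)S(s)$ on cubes. If $g:S^1\times Y\to Y$ is the action, $\kappa:CU_*S^1\otimes CU_*Y\xrightarrow{EZ}CU_*(S^1\times Y)\xrightarrow{CU_*g}CU_*Y$. $Y_{hS^1}=ES^1\times_{S^1}Y$ is the homotopy orbit space, where $ES^1$ is a contractible free (right) $S^1$-space (Milnor's construction), and $BS^1=ES^1/S^1$. The chains $T_n\in CU_{2n+1}S^1$: in $CU_*\mathbb R$, with product $(A\cdot B)(t,s)=A(t)+B(s)$ on cubes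 and the linear operation $\sigma(A)(t_0,\dots,t_n)=t_0\,A(t_1,\dots,t_n)$ on $n$-cubes $A$, put $\widetilde T_0(t)=t$ and $\widetilde T_n=\sigma\big(\sum_{i=1}^n\widetilde T_{i-1}\cdot\widetilde T_{n-i}\big)$ for $n\ge1$; $T_n$ is the image of $\widetilde T_n$ under the map induced by $x\mapsto e^{2\pi i x}$. E.g. $T_0(t)=e^{2\pi i t}$, $T_1(t_0,t_1,t_2)=e^{2\pi i t_0(t_1+t_2)}$. $H_*BS^1$ is identified with the divided power Hopf algebra $\Gamma v=\bigoplus_{n\ge0}\Bbbk\cdot v(n)$, $|v(n)|=2n$, $v(0)=1$, with comultiplication $\Delta v(n)=\sum_{k=0}^nv(k)\otimes v(n-k)$. Let $\Omega H_*BS^1$ be the (reduced) cobar construction, $t_\Omega:H_*BS^1\to\Omega H_*BS^1$, $c\mapsto s^{-1}c$, the universal twisting cochain, and $\widehat\zeta:\Omega H_*BS^1\to CU_*S^1$ the chain algebra map with $\widehat\zeta(s^{-1}v(k))=T_{k-1}$, $k\ge1$. The twisted tensor product $H_*BS^1\otimes_{\widehat\zeta\circ t_\Omega}CU_*Y$ is, explicitly, $\Gamma v\otimes CU_*Y$ with differential $$D(v(n)\otimes U)=v(n)\otimes dU-\sum_{k=0}^{n-1}v(k)\otimes\kappa(T_{n-k-1}\otimes U)$$ and comultiplication $$\widetilde\psi(v(n)\otimes U)=\sum_{k=0}^n\sum_i(v(k)\otimes U_i)\otimes(v(n-k)\otimes U^i),\qquad \delta_Y(U)=\sum_iU_i\otimes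 U^i.$$ DCSH quasi-isomorphism: for chain coalgebras $C,C'$, a chain map $f:C\to C'$ is a DCSH-map if there are $\Bbbk$-linear maps $\varphi_k:C\to(C')^{\otimes k}$, $k\ge1$, of degree $k-1$, with $\varphi_1=f$ and, for all $k$, $$d\varphi_k+(-1)^k\varphi_kd=\sum_{i=1}^{k-1}(-1)^{i+1}(\varphi_i\otimes\varphi_{k-i})\Delta_C-\sum_{i=0}^{k-2}(-1)^i(1^{\otimes i}\otimes\Delta_{C'}\otimes1^{\otimes k-i-2})\varphi_{k-1};$$ it is a DCSH quasi-isomorphism if moreover $f$ is a quasi-isomorphism. *)

(* Defs.v *)
From HB Require Import structures.
From mathcomp Require Import all_boot all_order all_algebra finmap ring.
From mathcomp Require Import all_classical all_reals all_analysis.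

Set Implicit Arguments.
Unset Strict Implicit.
Unset Printing Implicit Defensive.

Import Order.TTheory GRing.Theory Num.Theory.
Import numFieldNormedType.Exports.

Local Open Scope classical_set_scope.
Local Open Scope quotient_scope.
Local Open Scope ring_scope.

(* All modules below are free with a preferred basis, and the tensor product  *)
(* of the free modules on A and B is the free module on A * B. The library's  *)
(* {malg k[B]} requires 1 != 0 in k; here k is any commutative ring.          *)
Section FreeModule.
Variable k : comPzRingType.

Definition finsupp (B : choiceType) : {pred B -> k^o} :=
  fun x => `[< finite_set [set b | x b != 0] >].
Arguments finsupp : clear implicits.

Lemma finsupp_submod_closed (B : choiceType) : submod_closed (finsupp B).
Proof.
split=> [|a x y]; rewrite !unfold_in.
  apply/asboolP; rewrite (_ : [set _ | _] = set0)//.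
  by apply/seteqP; split=> b //=; rewrite eqxx.
move=> /asboolP fx /asboolP fy; apply/asboolP.
apply: (@sub_finite_set _ _ ([set b | x b != 0] `|` [set b | y b != 0])).
  move=> b /= axyb; apply/orP; apply: contraNT axyb.
  rewrite negb_or !negbK => /andP[/eqP xb0 /eqP yb0].
  by rewrite -[_ b]/(a * x b + y b) xb0 yb0 mulr0 addr0.
by rewrite finite_setU.
Qed.

HB.instance Definition _ (B : choiceType) :=
  GRing.isSubmodClosed.Build k (B -> k^o) (finsupp B)
    (@finsupp_submod_closed B).

Record freemod (B : choiceType) := FreeMod {
  coef :> B -> k^o;
  coefP : coef \in finsupp B
}.

Section Instances.
Variable B : choiceType.

HB.instance Definition _ := [isSub for @coef B].
HB.instance Definition _ := [Choice of freemod B by <:].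
HB.instance Definition _ :=
  [SubChoice_isSubLmodule of freemod B by <:].
End Instances.

Lemma fbasis_subproof (B : choiceType) (b : B) :
  (fun c => (c == b)%:R : k^o) \in finsupp B.
Proof.
rewrite unfold_in; apply/asboolP; apply: (@sub_finite_set _ _ [set b]) => //.
by move=> c /=; have [->//|_] := eqVneq c b; rewrite mulr0n eqxx.
Qed.

Definition fbasis (B : choiceType) (b : B) : freemod B :=
  FreeMod (fbasis_subproof b).

Section Lift.
Variables (B : choiceType) (V : lmodType k).

Definition flift (f : B -> V) (x : freemod B) : V :=
  \sum_(b \in [set: B]) x b *: f b.

Lemma flift_is_linear (f : B -> V) : linear (flift f).
Proof.
move=> a x y; rewrite /flift.
have fin (z : freemod B) : finite_set [set b | z b != 0].
  by have := coefP z; rewrite unfold_in => /asboolP.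
pose A := fset_set ([set b | x b != 0] `|` [set b | y b != 0]).
have zA (b : B) : b \notin A -> x b = 0 /\ y b = 0.
  rewrite in_fset_set ?finite_setU// => /negP bA.
  by split; apply/eqP/negPn/negP => nz; apply: bA; rewrite inE/=; [left|right].
rewrite !(@fsbigTE _ _ _ _ A).
- rewrite scaler_sumr -big_split/=; apply: eq_bigr => b _.
  by rewrite scalerA -scalerDl.
- by move=> b /zA[_ ->]; rewrite scale0r.
- by move=> b /zA[-> _]; rewrite scale0r.
- move=> b /zA[xb yb]; have -> : (a *: x + y) b = a * x b + y b by [].
  by rewrite xb yb mulr0 addr0 scale0r.
Qed.

HB.instance Definition _ (f : B -> V) :=
  GRing.isLinear.Build k (freemod B) V _ (flift f) (flift_is_linear f).

Lemma flift_linearl (x : freemod B) a (f g : B -> V) :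
  flift (fun b => a *: f b + g b) x = a *: flift f x + flift g x.
Proof.
have fx : finite_set [set b | x b != 0].
  by have := coefP x; rewrite unfold_in => /asboolP.
rewrite /flift !(@fsbigTE _ _ _ _ (fset_set [set b | x b != 0])).
- rewrite scaler_sumr -big_split/=; apply: eq_bigr => b _.
  by rewrite scalerDr !scalerA mulrC.
all: move=> b; rewrite in_fset_set// => /negP bA.
all: have -> : x b = 0 by apply/eqP/negPn/negP => nz; apply: bA; rewrite inE.
all: by rewrite scale0r.
Qed.

Lemma flift_fbasis (f : B -> V) b : flift f (fbasis b) = f b.
Proof.
rewrite /flift (@fsbigTE _ _ _ _ [fset b]%fset) ?big_seq_fset1.
  by rewrite /= eqxx mulr1n scale1r.
by move=> c; rewrite in_fset1 /= => /negbTE->; rewrite mulr0n scale0r.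
Qed.

Lemma flift_eq_supp (x : freemod B) (f g : B -> V) :
  (forall b, x b != 0 -> f b = g b) -> flift f x = flift g x.
Proof.
move=> fg; apply: eq_fsbigr => b _.
by have [->|/fg->//] := eqVneq (x b) 0; rewrite !scale0r.
Qed.
End Lift.

Lemma flift_id (B : choiceType) (x : freemod B) : flift (@fbasis B) x = x.
Proof.
have fx : finite_set [set b | x b != 0].
  by have := coefP x; rewrite unfold_in => /asboolP.
have zA b : b \notin fset_set [set b | x b != 0] -> x b = 0.
  rewrite in_fset_set// => /negP bA.
  by apply/eqP/negPn/negP => nz; apply: bA; rewrite inE.
rewrite /flift (@fsbigTE _ _ _ _ (fset_set [set b | x b != 0])); last first.
  by move=> b /zA->; rewrite scale0r.
apply/val_inj/funext => c /=.
pose ev (y : freemod B) : k^o := y c.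
have evM (s : seq B) : ev (\sum_(i <- s) x i *: fbasis i) =
    \sum_(i <- s) x i * (c == i)%:R.
  by elim: s => [|i s IHs]; rewrite ?big_nil// !big_cons -IHs.
rewrite -[LHS]/(ev _) evM; have [cA|cA] := boolP (c \in fset_set [set b | x b != 0]).
  rewrite (bigD1_seq c)//= eqxx mulr1 big1 ?addr0// => i ic.
  by rewrite eq_sym (negbTE ic) mulr0.
rewrite zA// big_seq big1// => i iA.
by case: eqP => [ci|_]; [rewrite -ci (negbTE cA) in iA|rewrite mulr0].
Qed.

Lemma linear_flift (B : choiceType) (V : lmodType k)
    (phi : {linear freemod B -> V}) x :
  phi x = flift (fun b => phi (fbasis b)) x.
Proof.
rewrite -{1}[x]flift_id /flift.
have fx : finite_set [set b | x b != 0].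
  by have := coefP x; rewrite unfold_in => /asboolP.
rewrite !(@fsbigTE _ _ _ _ (fset_set [set b | x b != 0])).
- by rewrite linear_sum; apply: eq_bigr => b _; rewrite linearZ.
all: move=> b; rewrite in_fset_set// => /negP bA.
all: have -> : x b = 0 by apply/eqP/negPn/negP => nz; apply: bA; rewrite inE.
all: by rewrite scale0r.
Qed.

Lemma flift_comp (B : choiceType) (V W : lmodType k)
    (phi : {linear V -> W}) (f : B -> V) x :
  phi (flift f x) = flift (fun b => phi (f b)) x.
Proof.
rewrite -[LHS]/((phi \o flift f) x) linear_flift; congr flift.
by apply/funext => b /=; rewrite flift_fbasis.
Qed.

Definition flift2 (A B : choiceType) (V : lmodType k) (f : A -> B -> V)
    (x : freemod A) (y : freemod B) : V :=
  flift (fun a => flift (f a) y) x.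

Definition tens (A B : choiceType) (x : freemod A) (y : freemod B) :
    freemod (A * B)%type :=
  flift2 (fun a b => fbasis (a, b)) x y.

Definition homog (B : choiceType) (deg : B -> nat) (n : nat)
    (x : freemod B) : Prop :=
  forall b, x b != 0 -> deg b = n.

End FreeModule.

Section ChainCoalgebra.
Variable k : comPzRingType.

(* The underlying data of a (based) chain coalgebra; the axioms are the       *)
(* predicate chain_coalgebra below, which is part of dcsh_map.                *)
Record precoalg := PreCoalg {
  cgen : choiceType;
  cdeg : cgen -> nat;
  cdiff : {linear freemod k cgen -> freemod k cgen};
  ccomul : {linear freemod k cgen -> freemod k (cgen * cgen)%type};
  ccounit : {linear freemod k cgen -> k^o}
}.

(* C^{(x) m} is the span of the words of length m in the free module on words *)
(* (the tensor algebra of C), and fcat is the tensor product                  *)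
(* C^{(x) m} (x) C^{(x) n} -> C^{(x) (m + n)}.                                *)
Definition word (C : precoalg) : choiceType := seq (cgen C).

Definition wdeg (C : precoalg) (w : word C) : nat := (\sum_(b <- w) cdeg b)%N.

Definition fcat (C : precoalg) (u v : freemod k (word C)) :
    freemod k (word C) :=
  flift2 (fun s t : word C => fbasis k (s ++ t : word C)) u v.

Definition word1 (C : precoalg) (x : freemod k (cgen C)) :
    freemod k (word C) :=
  flift (fun b => fbasis k ([:: b] : word C)) x.

Definition word2 (C : precoalg) (x : freemod k (cgen C * cgen C)%type) :
    freemod k (word C) :=
  flift (fun p => fbasis k ([:: p.1; p.2] : word C)) x.

(* d(b1 (x) w) = d b1 (x) w + (-1)^|b1| b1 (x) d w *)
Fixpoint wdiff (C : precoalg) (w : seq (cgen C)) : freemod k (word C) :=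
  if w is b :: w' then
    fcat (word1 (cdiff C (fbasis k b))) (fbasis k (w' : word C)) +
    (-1) ^+ cdeg b *: fcat (word1 (fbasis k b)) (wdiff w')
  else 0.

(* 1^{(x) i} (x) Delta (x) 1^{(x) (m - i - 1)} on words of length m > i *)
Fixpoint wcomul (C : precoalg) (i : nat) (w : seq (cgen C)) :
    freemod k (word C) :=
  match w, i with
  | [::], _ => 0
  | b :: w', 0%N => fcat (word2 (ccomul C (fbasis k b))) (fbasis k (w' : word C))
  | b :: w', j.+1 => fcat (word1 (fbasis k b)) (wcomul j w')
  end.

Definition tdiff (C : precoalg) (x : freemod k (word C)) :
  freemod k (word C) := flift (@wdiff C) x.

Definition tcomul (C : precoalg) (i : nat) (x : freemod k (word C)) :
  freemod k (word C) := flift (@wcomul C i) x.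

Record chain_coalgebra (C : precoalg) : Prop := ChainCoalgebra {
  cdiff_deg : forall b c : cgen C,
    cdiff C (fbasis k b) c != 0 -> (cdeg c).+1 = cdeg b;
  ccomul_deg : forall (b : cgen C) (p : cgen C * cgen C),
    ccomul C (fbasis k b) p != 0 -> (cdeg p.1 + cdeg p.2)%N = cdeg b;
  ccounit_deg : forall b : cgen C,
    ccounit C (fbasis k b) != 0 -> cdeg b = 0%N;
  cdiffK : forall x, cdiff C (cdiff C x) = 0;
  ccomul_diff : forall x,
    tdiff (word2 (ccomul C x)) = word2 (ccomul C (cdiff C x));
  ccounit_diff : forall x, ccounit C (cdiff C x) = 0;
  ccomulA : forall x,
    tcomul 0 (word2 (ccomul C x)) = tcomul 1 (word2 (ccomul C x));
  ccounitl : forall x,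
    flift (fun p => (ccounit C (fbasis k p.1) : k) *: fbasis k p.2)
      (ccomul C x) = x;
  ccounitr : forall x,
    flift (fun p => (ccounit C (fbasis k p.2) : k) *: fbasis k p.1)
      (ccomul C x) = x
}.

Section Maps.
Variables C C' : precoalg.

Record chain_map (f : {linear freemod k (cgen C) -> freemod k (cgen C')}) :
    Prop := ChainMap {
  chain_map_deg : forall b c, f (fbasis k b) c != 0 -> cdeg c = cdeg b;
  chain_map_diff : forall x, f (cdiff C x) = cdiff C' (f x)
}.

(* H_n(f) is injective and surjective for every n *)
Definition quasi_iso (f : freemod k (cgen C) -> freemod k (cgen C')) : Prop :=
  forall n : nat,
    (forall x, homog (@cdeg C) n x -> cdiff C x = 0 ->
      (exists2 y', homog (@cdeg C') n.+1 y' & f x = cdiff C' y') ->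
      exists2 y, homog (@cdeg C) n.+1 y & x = cdiff C y) /\
    (forall x', homog (@cdeg C') n x' -> cdiff C' x' = 0 ->
      exists x y', [/\ homog (@cdeg C) n x, cdiff C x = 0,
        homog (@cdeg C') n.+1 y' & x' = f x + cdiff C' y']).

(* (phi (x) psi) with psi of degree e; the Koszul sign is (-1)^(e |a|) *)
Definition tens_map (e : nat)
    (phi psi : freemod k (cgen C) -> freemod k (word C'))
    (x : freemod k (cgen C * cgen C)%type) : freemod k (word C') :=
  flift (fun p => (-1) ^+ (e * cdeg p.1) *:
    fcat (phi (fbasis k p.1)) (psi (fbasis k p.2))) x.

Definition dcsh_family
    (phi : nat -> {linear freemod k (cgen C) -> freemod k (word C')}) : Prop :=
  forall m : nat, (0 < m)%N ->
    (forall b w, phi m (fbasis k b) w != 0 ->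
      size w = m /\ wdeg w = (cdeg b + m.-1)%N) /\
    (forall x,
      tdiff (phi m x) + (-1) ^+ m *: phi m (cdiff C x) =
      \sum_(1 <= i < m) (-1) ^+ i.+1 *:
        tens_map (m - i).-1 (phi i) (phi (m - i)%N) (ccomul C x) -
      \sum_(0 <= i < m.-1) (-1) ^+ i *: tcomul i (phi m.-1 x)).

Definition dcsh_map
    (f : {linear freemod k (cgen C) -> freemod k (cgen C')}) : Prop :=
  [/\ chain_coalgebra C, chain_coalgebra C', chain_map f &
    exists2 phi, dcsh_family phi & forall x, phi 1%N x = word1 (f x)].

Definition dcsh_quasi_iso
    (f : {linear freemod k (cgen C) -> freemod k (cgen C')}) : Prop :=
  dcsh_map f /\ quasi_iso f.

End Maps.

Section Cohomology.
Variable C : precoalg.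

(* the degree n part of the dual: Hom(C_n, k), C_n being free on cgenn n *)
Definition cgenn (n : nat) : choiceType := {b : cgen C | cdeg b == n}.

Definition cochain (n : nat) : lmodType k := cgenn n -> k^o.

Definition ceval (n : nat) (f : cochain n) : freemod k (cgen C) -> k^o :=
  flift (fun b => oapp f 0 (insub b : option (cgenn n))).

(* d f = - (-1)^|f| f o d *)
Definition codiff (n : nat) (f : cochain n) : cochain n.+1 :=
  fun b => (-1) ^+ n.+1 * ceval f (cdiff C (fbasis k (val b))).

(* (f g)(c) = (f (x) g)(Delta c), with the Koszul sign *)
Definition cup (p q : nat) (f : cochain p) (g : cochain q) :
    cochain (p + q)%N :=
  fun b => flift (fun ac => ((-1) ^+ (q * cdeg ac.1) *
      (ceval f (fbasis k ac.1) * ceval g (fbasis k ac.2)) : k^o))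
    (ccomul C (fbasis k (val b))).

Definition counit_cochain : cochain 0 := fun b => ccounit C (fbasis k (val b)).

Lemma ceval_linearl n (x : freemod k (cgen C)) a (f g : cochain n) :
  ceval (a *: f + g) x = a * ceval f x + ceval g x.
Proof.
apply: etrans (flift_linearl x a _ _).
congr flift; apply/funext => b.
by case: insub => [c|] //=; rewrite scaler0 addr0.
Qed.

Lemma codiff_is_linear n : linear (@codiff n).
Proof.
move=> a f g; apply/funext => b; rewrite /codiff ceval_linearl mulrDr.
by rewrite mulrCA.
Qed.

HB.instance Definition _ n :=
  GRing.isLinear.Build k (cochain n) (cochain n.+1) _ (@codiff n)
    (@codiff_is_linear n).

Definition is_cocycle n : {pred cochain n} := fun f => codiff f == 0.
Arguments is_cocycle : clear implicits.

Lemma is_cocycle_submod_closed n : submod_closed (is_cocycle n).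
Proof.
split=> [|a f g]; rewrite !unfold_in /is_cocycle ?linear0//.
by move=> /eqP df /eqP dg; rewrite linearP/= df dg scaler0 addr0.
Qed.

HB.instance Definition _ n :=
  GRing.isSubmodClosed.Build k (cochain n) (is_cocycle n)
    (@is_cocycle_submod_closed n).

Record cocycle n := Cocycle {
  cochain_of : cochain n;
  cocycleP : cochain_of \in is_cocycle n
}.

HB.instance Definition _ n := [isSub for @cochain_of n].
HB.instance Definition _ n := [Choice of cocycle n by <:].
HB.instance Definition _ n := [SubChoice_isSubLmodule of cocycle n by <:].

Definition is_coboundary n : {pred cocycle n} :=
  match n with
  | 0%N => fun z => z == 0
  | m.+1 => fun z => `[< exists g, cochain_of z = @codiff m g >]
  end.
Arguments is_coboundary : clear implicits.

Lemma is_coboundary_submod_closed n : submod_closed (is_coboundary n).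
Proof.
case: n => [|m]; split=> [|a f g]; rewrite !unfold_in/=.
- by [].
- by move=> /eqP-> /eqP->; rewrite scaler0 addr0.
- by apply/asboolP; exists 0; rewrite linear0.
- move=> /asboolP[u fu] /asboolP[v gv]; apply/asboolP; exists (a *: u + v).
  by rewrite linearP/= -fu -gv.
Qed.

HB.instance Definition _ n :=
  GRing.isSubmodClosed.Build k (cocycle n) (is_coboundary n)
    (@is_coboundary_submod_closed n).

Definition cohomology n := Quotient.quot (is_coboundary n).

HB.instance Definition _ n := GRing.Zmodule.on (cohomology n).
HB.instance Definition _ n := EqQuotient.on (cohomology n).

Section CohomologyModule.
Variable n : nat.
Local Notation H := (cohomology n).

Lemma cohomology_eqP (x y : cocycle n) :
  (\pi_H x == \pi_H y) = (x - y \in is_coboundary n).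
Proof. by rewrite Quotient.idealrBE. Qed.

Lemma cohomology_piD (x y : cocycle n) :
  \pi_H (x + y) = \pi_H x + \pi_H y.
Proof. by rewrite !piE. Qed.

Definition cohomology_scale (a : k) (x : H) : H := \pi_H (a *: repr x).

Lemma cohomology_piZ a (x : cocycle n) :
  cohomology_scale a (\pi_H x) = \pi_H (a *: x).
Proof.
apply/eqP; rewrite /cohomology_scale cohomology_eqP -scalerBr rpredZ//.
by rewrite -cohomology_eqP reprK.
Qed.

Lemma cohomology_scaleA a b x :
  cohomology_scale a (cohomology_scale b x) = cohomology_scale (a * b) x.
Proof. by elim/quotW: x => x; rewrite (cohomology_piZ b x) !cohomology_piZ scalerA. Qed.

Lemma cohomology_scale1 : left_id 1 cohomology_scale.
Proof. by elim/quotW=> x; rewrite cohomology_piZ scale1r. Qed.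

Lemma cohomology_scaleDr : right_distributive cohomology_scale +%R.
Proof.
move=> a; elim/quotW=> x; elim/quotW=> y.
by rewrite -cohomology_piD !cohomology_piZ scalerDr cohomology_piD.
Qed.

Lemma cohomology_scaleDl x :
  {morph cohomology_scale^~ x : a b / a + b}.
Proof.
elim/quotW: x => x a b.
by rewrite !cohomology_piZ scalerDl cohomology_piD.
Qed.

HB.instance Definition _ := GRing.Zmodule_isLmodule.Build k H
  cohomology_scaleA cohomology_scale1 cohomology_scaleDr cohomology_scaleDl.

(* the class of a cochain that is known to be a cocycle *)
Definition class_of (f : cochain n) : H :=
  oapp (fun z : cocycle n => \pi_H z) 0 (insub f).

End CohomologyModule.

(* Independent of the representatives when C is a chain coalgebra: hcup_pi.   *)
Definition hcup p q (x : cohomology p) (y : cohomology q) :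
    cohomology (p + q)%N :=
  class_of (cup (cochain_of (repr x)) (cochain_of (repr y))).

Definition hone : cohomology 0 := class_of counit_cochain.

Lemma ceval_val n (f : cochain n) (b : cgenn n) :
  ceval f (fbasis k (val b)) = f b.
Proof. by rewrite /ceval flift_fbasis valK. Qed.

Lemma ceval_deg n (f : cochain n) b : cdeg b != n -> ceval f (fbasis k b) = 0.
Proof. by move=> bn; rewrite /ceval flift_fbasis insubN. Qed.

Lemma flift_scale (B : choiceType) (h1 h2 : B -> k^o) (a : k) x :
  (forall b, h1 b = a * h2 b) -> flift h1 x = a * flift h2 x.
Proof.
move=> h12; transitivity (flift (fun b => a *: h2 b + (0 : k^o)) x).
  by congr flift; apply/funext => b; rewrite h12 addr0.
rewrite flift_linearl [X in _ + X](_ : _ = 0) ?addr0//.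
by rewrite /flift fsbig1// => b _; rewrite scaler0.
Qed.

Lemma ceval_scale n (f : cochain n) (h : cgen C -> k^o) (a : k) x :
  (forall b, h b = a * ceval f (fbasis k b)) -> flift h x = a * ceval f x.
Proof.
by move=> hE; apply: flift_scale => b; rewrite hE /ceval flift_fbasis.
Qed.

Lemma fcat_basis (s t : word C) :
  fcat (fbasis k s) (fbasis k t) = fbasis k (s ++ t : word C).
Proof. by rewrite /fcat /flift2 !flift_fbasis. Qed.

Lemma fcat0 (x : freemod k (word C)) : fcat x 0 = 0.
Proof.
rewrite /fcat /flift2 (_ : (fun _ => _) = fun=> 0); last first.
  by apply/funext => s; rewrite linear0.
by rewrite /flift fsbig1// => s _; rewrite scaler0.
Qed.

Lemma word1_basis b : word1 (fbasis k b) = fbasis k ([:: b] : word C).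
Proof. by rewrite /word1 flift_fbasis. Qed.

Lemma fcat_word1l x (t : word C) :
  fcat (word1 x) (fbasis k t) = flift (fun b => fbasis k (b :: t : word C)) x.
Proof.
rewrite /fcat /flift2 /word1 flift_comp; congr flift; apply/funext => b /=.
by rewrite !flift_fbasis.
Qed.

Lemma fcat_word1r (s : word C) x :
  fcat (fbasis k s) (word1 x) =
  flift (fun b => fbasis k (s ++ [:: b] : word C)) x.
Proof.
rewrite /fcat /flift2 flift_fbasis /word1 flift_comp.
by congr flift; apply/funext => b /=; rewrite flift_fbasis.
Qed.

Lemma fcat_word1_nil x : fcat (word1 x) (fbasis k ([::] : word C)) = word1 x.
Proof. exact: fcat_word1l. Qed.

Section CupProduct.
Hypothesis HC : chain_coalgebra C.

Lemma ceval_codiff n (f : cochain n) b :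
  ceval (codiff f) (fbasis k b) = (-1) ^+ n.+1 * ceval f (cdiff C (fbasis k b)).
Proof.
have [bn|bn] := eqVneq (cdeg b) n.+1.
  have bP : cdeg b == n.+1 by rewrite bn.
  by rewrite -[b in LHS]/(val (Sub b bP : cgenn n.+1)) ceval_val /codiff SubK.
rewrite ceval_deg// (_ : ceval _ _ = 0) ?mulr0//.
rewrite /ceval (@flift_eq_supp _ _ _ _ _ (fun=> 0)).
  by rewrite /flift fsbig1// => c _; rewrite scaler0.
move=> c /(cdiff_deg HC) cb; rewrite insubN//.
by apply: contra bn => /eqP cn; rewrite -cb cn.
Qed.

Definition pairing p q (f : cochain p) (g : cochain q) :
    freemod k (cgen C * cgen C)%type -> k^o :=
  flift (fun ac => ((-1) ^+ (q * p) *
    (ceval f (fbasis k ac.1) * ceval g (fbasis k ac.2)) : k^o)).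

Lemma cupE p q (f : cochain p) (g : cochain q) b :
  cup f g b = pairing f g (ccomul C (fbasis k (val b))).
Proof.
rewrite /cup /pairing; congr flift; apply/funext => ac /=.
have [->//|acp] := eqVneq (cdeg ac.1) p.
by rewrite ceval_deg// !(mul0r, mulr0).
Qed.

Lemma ceval_cup p q (f : cochain p) (g : cochain q) x :
  ceval (cup f g) x = pairing f g (ccomul C x).
Proof.
rewrite -[RHS]/((pairing f g \o ccomul C) x) [RHS]linear_flift {1}/ceval.
congr flift; apply/funext => b /=; case: insubP => [c _ <-|bpq] /=.
  by rewrite cupE.
rewrite /pairing (@flift_eq_supp _ _ _ _ _ (fun=> 0)).
  by rewrite /flift fsbig1// => c _; rewrite scaler0.
move=> ac /(ccomul_deg HC) acb.
have [acp|acp] := eqVneq (cdeg ac.1) p; last first.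
  by rewrite ceval_deg// !(mul0r, mulr0).
rewrite (@ceval_deg q)// ?mulr0//.
by apply: contra bpq => /eqP acq; rewrite -acb acp acq.
Qed.

Definition word_pairing p q (f : cochain p) (g : cochain q) :
    freemod k (word C) -> k^o :=
  flift (fun w : word C => if w is [:: a; c] then
    (-1) ^+ (q * p) * (ceval f (fbasis k a) * ceval g (fbasis k c)) else 0).

Lemma word_pairing2 p q (f : cochain p) (g : cochain q) y :
  word_pairing f g (word2 y) = pairing f g y.
Proof.
rewrite /word2 /word_pairing flift_comp; congr flift; apply/funext => ac /=.
by rewrite flift_fbasis.
Qed.

Lemma word_pairing_diff p q (f : cochain p) (g : cochain q) a c :
  word_pairing f g (wdiff [:: a; c]) =
  (-1) ^+ (q * p) *
    (ceval f (cdiff C (fbasis k a)) * ceval g (fbasis k c) +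
     (-1) ^+ p *
       (ceval f (fbasis k a) * ceval g (cdiff C (fbasis k c)))).
Proof.
rewrite /word_pairing /= fcat0 scaler0 addr0 fcat_word1_nil word1_basis fcat_word1r.
rewrite fcat_word1l linearD linearZ /= !flift_comp mulrDr; congr (_ + _).
  rewrite mulrCA mulrC; apply: ceval_scale => b /=.
  by rewrite flift_fbasis/=; ring.
rewrite !mulrA; apply: ceval_scale => b /=; rewrite flift_fbasis/=.
rewrite -[_ *: _]/(_ * _).
have [->|ap] := eqVneq (cdeg a) p; first by ring.
by rewrite ceval_deg//; ring.
Qed.

Lemma pairing_diff p q (f : cochain p) (g : cochain q) x :
  pairing f g (ccomul C (cdiff C x)) =
  flift (fun ac => ((-1) ^+ (q * p) *
    (ceval f (cdiff C (fbasis k ac.1)) * ceval g (fbasis k ac.2) +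
     (-1) ^+ p *
       (ceval f (fbasis k ac.1) * ceval g (cdiff C (fbasis k ac.2)))) : k^o))
    (ccomul C x).
Proof.
rewrite -word_pairing2 -(ccomul_diff HC) /word2 /tdiff flift_comp.
rewrite {1}/word_pairing flift_comp; congr flift; apply/funext => -[a c] /=.
by rewrite flift_fbasis -word_pairing_diff.
Qed.

Lemma cocycle_ceval n (f : cocycle n) x :
  ceval (cochain_of f) (cdiff C x) = 0.
Proof.
have fd b : ceval (cochain_of f) (cdiff C (fbasis k b)) = 0.
  have := ceval_codiff (cochain_of f) b.
  have := cocycleP f; rewrite unfold_in => /eqP->.
  rewrite [ceval 0 _](_ : _ = 0) => [/esym/(congr1 ( *%R ((-1) ^+ n.+1)))|].
    by rewrite signrMK mulr0.
  by rewrite /ceval flift_fbasis; case: insub.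
rewrite {1}/ceval -[LHS]/((flift _ \o cdiff C) x) linear_flift.
rewrite (@flift_eq_supp _ _ _ _ _ (fun=> 0)) => [|b _].
  by rewrite /flift fsbig1// => b _; rewrite scaler0.
exact: fd.
Qed.

Lemma cup_cocycle p q (f : cocycle p) (g : cocycle q) :
  cup (cochain_of f) (cochain_of g) \in is_cocycle (p + q)%N.
Proof.
rewrite unfold_in; apply/eqP/funext => b.
rewrite /codiff ceval_cup pairing_diff.
rewrite (@flift_eq_supp _ _ _ _ _ (fun=> 0)) => [|ac _].
  by rewrite /flift fsbig1 ?mulr0// => ac _; rewrite scaler0.
by rewrite !cocycle_ceval !(mul0r, mulr0, addr0).
Qed.

Lemma is_coboundaryI n (z : cocycle n) m (h : cochain m) (a : k) :
  m.+1 = n ->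
  (forall b, cochain_of z b = a * ceval h (cdiff C (fbasis k (val b)))) ->
  z \in is_coboundary n.
Proof.
move=> mn; move: z; rewrite -mn => z zE; rewrite unfold_in /=; apply/asboolP.
exists (((-1) ^+ m.+1 * a) *: h); apply/funext => b.
rewrite linearZ /= zE -[RHS]/(_ * ((-1) ^+ m.+1 * _)).
by rewrite mulrCA !mulrA -expr2 sqrr_sign mul1r.
Qed.

Lemma cup_coboundaryl p q (e : cocycle p) (g : cocycle q) (z : cocycle (p + q)) :
  e \in is_coboundary p ->
  cochain_of z = cup (cochain_of e) (cochain_of g) ->
  z \in is_coboundary (p + q)%N.
Proof.
case: p e z => [|p] e z; rewrite unfold_in/=.
  move=> /eqP-> zE; rewrite (_ : z = 0) ?rpred0//; apply/val_inj; rewrite /= zE.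
  apply/funext => b; rewrite cupE /pairing.
  rewrite (@flift_eq_supp _ _ _ _ _ (fun=> 0)) => [|ac _].
    by rewrite /flift fsbig1// => ac _; rewrite scaler0.
  rewrite [X in _ * (X * _)](_ : _ = 0) ?(mul0r, mulr0)//.
  by rewrite /ceval flift_fbasis; case: insub.
move=> /asboolP[u eu] zE.
apply: (@is_coboundaryI _ z _ (cup u (cochain_of g))
  ((-1) ^+ (q * p.+1) * (-1) ^+ p.+1 * (-1) ^+ (q * p))) => // b.
rewrite zE eu cupE ceval_cup pairing_diff; apply: flift_scale => -[a c] /=.
rewrite cocycle_ceval mulr0 mulr0 addr0 ceval_codiff.
have sq (r s t x y : k) : t ^+ 2 = 1 -> r * (s * x * y) = r * s * t * (t * (x * y)).
  by move=> t1; transitivity (r * s * t ^+ 2 * (x * y)); [rewrite t1|]; ring.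
by apply: sq; rewrite sqrr_sign.
Qed.

Lemma cup_coboundaryr p q (f : cocycle p) (e : cocycle q) (z : cocycle (p + q)) :
  e \in is_coboundary q ->
  cochain_of z = cup (cochain_of f) (cochain_of e) ->
  z \in is_coboundary (p + q)%N.
Proof.
case: q e z => [|q] e z; rewrite [e \in _]unfold_in/=.
  move=> /eqP-> zE; rewrite (_ : z = 0) ?rpred0//; apply/val_inj; rewrite /= zE.
  apply/funext => b; rewrite cupE /pairing.
  rewrite (@flift_eq_supp _ _ _ _ _ (fun=> 0)) => [|ac _].
    by rewrite /flift fsbig1// => ac _; rewrite scaler0.
  rewrite [X in _ * (_ * X)](_ : _ = 0) ?mulr0//.
  by rewrite /ceval flift_fbasis; case: insub.
move=> /asboolP[u eu] zE.
apply: (@is_coboundaryI _ z _ (cup (cochain_of f) u)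
  ((-1) ^+ (q.+1 * p) * (-1) ^+ q.+1 * ((-1) ^+ (q * p) * (-1) ^+ p))) => [|b].
  by rewrite addnS.
rewrite zE eu cupE ceval_cup pairing_diff; apply: flift_scale => -[a c] /=.
rewrite cocycle_ceval mul0r add0r ceval_codiff.
have sq (r s t w x y : k) : t ^+ 2 = 1 -> w ^+ 2 = 1 ->
    r * (x * (s * y)) = r * s * (t * w) * (t * (w * (x * y))).
  by move=> t1 w1; transitivity (r * s * t ^+ 2 * w ^+ 2 * (x * y));
    [rewrite t1 w1|]; ring.
by apply: sq; rewrite sqrr_sign.
Qed.

Lemma class_ofE n (z : cocycle n) :
  class_of (cochain_of z) = \pi_(cohomology n) z.
Proof. by rewrite /class_of valK. Qed.

Lemma cup_linearl p q a (f1 f2 : cochain p) (g : cochain q) :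
  cup (a *: f1 + f2) g = a *: cup f1 g + cup f2 g.
Proof.
apply/funext => b; rewrite -[RHS]/(a *: cup f1 g b + cup f2 g b) !cupE.
rewrite /pairing -flift_linearl; congr flift; apply/funext => ac /=.
rewrite ceval_linearl -[_ *: _]/(a * _); ring.
Qed.

Lemma cup_linearr p q a (f : cochain p) (g1 g2 : cochain q) :
  cup f (a *: g1 + g2) = a *: cup f g1 + cup f g2.
Proof.
apply/funext => b; rewrite -[RHS]/(a *: cup f g1 b + cup f g2 b) !cupE.
rewrite /pairing -flift_linearl; congr flift; apply/funext => ac /=.
rewrite ceval_linearl -[_ *: _]/(a * _); ring.
Qed.

Lemma hcup_pi p q (f : cocycle p) (g : cocycle q) :
  hcup (\pi_(cohomology p) f) (\pi_(cohomology q) g) =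
  class_of (cup (cochain_of f) (cochain_of g)).
Proof.
rewrite /hcup; set f' := repr _; set g' := repr _.
have ff' : f - f' \in is_coboundary p by rewrite -cohomology_eqP reprK.
have gg' : g - g' \in is_coboundary q by rewrite -cohomology_eqP reprK.
pose z1 := Cocycle (cup_cocycle f' g'); pose z2 := Cocycle (cup_cocycle f g).
pose e1 := Cocycle (cup_cocycle (f - f') g).
pose e2 := Cocycle (cup_cocycle f' (g - g')).
rewrite -[cup (cochain_of f') _]/(cochain_of z1).
rewrite -[cup (cochain_of f) _]/(cochain_of z2) !class_ofE.
apply/eqP; rewrite eq_sym cohomology_eqP.
have -> : z2 - z1 = e1 + e2.
  apply/val_inj => /=; rewrite -[cochain_of f - cochain_of f']/(_ + _).
  rewrite [cochain_of f - _]addrC [cochain_of g - _]addrC.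
  by rewrite -!scaleN1r cup_linearl cup_linearr !scaleN1r; ring.
by rewrite rpredD//; [apply: cup_coboundaryl ff' _|apply: cup_coboundaryr gg' _].
Qed.

End CupProduct.

End Cohomology.

Definition graded_alg_iso (C C' : precoalg) : Prop :=
  exists Phi : forall n, {linear cohomology C n -> cohomology C' n},
    [/\ forall n, bijective (Phi n),
        forall p q (x : cohomology C p) (y : cohomology C q),
          Phi (p + q)%N (hcup x y) = hcup (Phi p x) (Phi q y) &
        Phi 0%N (hone C) = hone C'].

End ChainCoalgebra.

Lemma pair_continuous (X Y Z : topologicalType) (f : X -> Y) (g : X -> Z) :
  continuous f -> continuous g -> continuous (fun x => (f x, g x)).
Proof. by move=> cf cg x; apply: cvg_pair; [exact: cf|exact: cg]. Qed.

Lemma continuous_comp_all (X Y Z : topologicalType) (f : X -> Y) (g : Y -> Z) :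
  continuous f -> continuous g -> continuous (g \o f).
Proof. by move=> cf cg x; apply: continuous_comp; [exact: cf|exact: cg]. Qed.

Section Circle.
Variable R : realType.

Definition S1 := set_type [set p : R * R | p.1 ^+ 2 + p.2 ^+ 2 = 1].

Lemma S1P (p : S1) : (val p).1 ^+ 2 + (val p).2 ^+ 2 = 1.
Proof. by case: p => p /= /set_mem. Qed.

Definition mkS1 (p : R * R) (h : p.1 ^+ 2 + p.2 ^+ 2 = 1) : S1 :=
  exist _ p (mem_set h).

Lemma mulS1_subproof (x y : S1) :
  ((val x).1 * (val y).1 - (val x).2 * (val y).2) ^+ 2 +
  ((val x).1 * (val y).2 + (val x).2 * (val y).1) ^+ 2 = 1.
Proof.
have := S1P x; have := S1P y.
move: (val x).1 (val x).2 (val y).1 (val y).2 => a b c d cd ab.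
transitivity ((a ^+ 2 + b ^+ 2) * (c ^+ 2 + d ^+ 2)); last by rewrite ab cd mulr1.
by ring.
Qed.

(* multiplication of complex numbers of modulus 1 *)
Definition mulS1 (x y : S1) : S1 :=
  @mkS1 ((val x).1 * (val y).1 - (val x).2 * (val y).2,
         (val x).1 * (val y).2 + (val x).2 * (val y).1) (mulS1_subproof x y).

Lemma oneS1_subproof : (1 : R) ^+ 2 + 0 ^+ 2 = 1.
Proof. by rewrite expr1n expr0n addr0. Qed.

Definition oneS1 : S1 := @mkS1 (1, 0) oneS1_subproof.

Lemma invS1_subproof (x : S1) : (val x).1 ^+ 2 + (- (val x).2) ^+ 2 = 1.
Proof. by rewrite sqrrN S1P. Qed.

Definition invS1 (x : S1) : S1 :=
  @mkS1 ((val x).1, - (val x).2) (invS1_subproof x).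

Lemma S1_eq (x y : S1) : (val x).1 = (val y).1 -> (val x).2 = (val y).2 -> x = y.
Proof. by move=> h1 h2; apply: val_inj; exact: injective_projections. Qed.

Lemma mulS1A : associative mulS1.
Proof. by move=> x y z; apply: S1_eq => /=; ring. Qed.

Lemma mul1S1 : left_id oneS1 mulS1.
Proof. by move=> x; apply: S1_eq => /=; ring. Qed.

Lemma mulS11 : right_id oneS1 mulS1.
Proof. by move=> x; apply: S1_eq => /=; ring. Qed.

Lemma mulVS1 : left_inverse oneS1 invS1 mulS1.
Proof. by move=> x; apply: S1_eq => /=; [rewrite -[RHS](S1P x)|]; ring. Qed.

Lemma mulS1V : right_inverse oneS1 invS1 mulS1.
Proof. by move=> x; apply: S1_eq => /=; [rewrite -[RHS](S1P x)|]; ring. Qed.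

Lemma expi_subproof (x : R) : cos (2 * pi * x) ^+ 2 + sin (2 * pi * x) ^+ 2 = 1.
Proof. exact: cos2Dsin2. Qed.

(* x |-> e^(2 pi i x) *)
Definition expi_fun (x : R) : S1 :=
  @mkS1 (cos (2 * pi * x), sin (2 * pi * x)) (expi_subproof x).

Lemma expi_continuous : continuous expi_fun.
Proof.
apply: (@continuous_comp_initial _ _ _ set_val).
have cx : continuous (fun y : R => 2 * pi * y).
  by move=> x; apply: cvgM; [exact: cvg_cst|exact: cvg_id].
apply: (@pair_continuous _ _ _ (cos \o _) (sin \o _)) => x.
  by apply: (continuous_comp (cx x)); exact: continuous_cos.
by apply: (continuous_comp (cx x)); exact: continuous_sin.
Qed.

Definition expi : continuousType R S1 := mkcts expi_continuous.

Record circle_action (Y : topologicalType) := CircleAction {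
  act :> S1 * Y -> Y;
  act_continuous : continuous act;
  act1 : forall y, act (oneS1, y) = y;
  actM : forall a b y, act (mulS1 a b, y) = act (a, act (b, y))
}.

Definition actc (Y : topologicalType) (g : circle_action Y) :
  continuousType (S1 * Y)%type Y := mkcts (@act_continuous Y g).

(* A point of Milnor's infinite join S^1 * S^1 * ... is a formal convex       *)
(* combination (+)_i t_i x_i, in which x_i is only recorded when t_i != 0.    *)
Definition join_weight (e : nat -> option (R * S1)) (i : nat) : R :=
  if e i is Some (t, _) then t else 0.

Record milnorE := MilnorE {
  jcoord :> nat -> option (R * S1);
  jcoord_gt0 : forall i t x, jcoord i = Some (t, x) -> 0 < t;
  jcoord_sum : exists2 N : nat, (forall i, (N <= i)%N -> jcoord i = None) &
    \sum_(i < N) join_weight jcoord i = 1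
}.

Lemma milnorE_eq (e e' : milnorE) : jcoord e =1 jcoord e' -> e = e'.
Proof.
case: e e' => [e e1 e2] [e' e1' e2'] /= /funext ee'; subst e'.
by congr MilnorE; exact: Prop_irrelevance.
Qed.

HB.instance Definition _ := gen_eqMixin milnorE.
HB.instance Definition _ := gen_choiceMixin milnorE.

(* Milnor's topology: the coarsest one for which the t_i and the              *)
(* x_i : {t_i > 0} -> S^1 are continuous, with open domains.                  *)
Definition milnor_subbase : set (set milnorE) :=
  [set A | (exists i (U : set R), open U /\ A = [set e : milnorE | U (join_weight e i)]) \/
    (exists i (V : set S1), open V /\
      A = [set e : milnorE | exists t x, jcoord e i = Some (t, x) /\ V x])].

HB.instance Definition _ :=
  isSubBaseTopological.Build milnorE milnor_subbase id.

Lemma milnor_act_gt0 (e : milnorE) (a : S1) i t x :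
  omap (fun tx => (tx.1, mulS1 tx.2 a)) (e i) = Some (t, x) -> 0 < t.
Proof.
by case ei: (e i) => [[s y]|]//= [<- _]; exact: (jcoord_gt0 ei).
Qed.

Lemma milnor_act_sum (e : milnorE) (a : S1) :
  let f := fun i => omap (fun tx => (tx.1, mulS1 tx.2 a)) (e i) in
  exists2 N : nat, (forall i, (N <= i)%N -> f i = None) &
    \sum_(i < N) join_weight f i = 1.
Proof.
have [N eN e1] := jcoord_sum e; exists N => [i /eN->//|].
rewrite -e1; apply: eq_bigr => i _; rewrite /join_weight.
by case: (e i) => [[]|].
Qed.

(* (+)_i t_i x_i . a = (+)_i t_i (x_i a) *)
Definition milnor_act (e : milnorE) (a : S1) : milnorE :=
  MilnorE (@milnor_act_gt0 e a) (milnor_act_sum e a).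

Lemma milnor_act1 e : milnor_act e oneS1 = e.
Proof.
by apply: milnorE_eq => i /=; case: (jcoord e i) => [[t x]|]//=; rewrite mulS11.
Qed.

Lemma milnor_actM e a b :
  milnor_act e (mulS1 a b) = milnor_act (milnor_act e a) b.
Proof.
by apply: milnorE_eq => i /=; case: (jcoord e i) => [[t x]|]//=; rewrite mulS1A.
Qed.

Section HomotopyOrbits.
Variables (Y : topologicalType) (g : circle_action Y).

(* (e a, y) ~ (e, a y) *)
Definition orbit_rel : rel (milnorE * Y) := fun p q =>
  `[< exists a : S1, p.1 = milnor_act q.1 a /\ q.2 = g (a, p.2) >].

Lemma orbit_rel_refl : reflexive orbit_rel.
Proof. by move=> p; apply/asboolP; exists oneS1; rewrite milnor_act1 act1. Qed.

Lemma orbit_rel_sym : symmetric orbit_rel.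
Proof.
suff H p q : orbit_rel p q -> orbit_rel q p by move=> p q; apply/idP/idP; exact: H.
move=> /asboolP[a [pa qa]]; apply/asboolP; exists (invS1 a); rewrite pa qa.
by rewrite -milnor_actM mulS1V milnor_act1 -actM mulVS1 act1.
Qed.

Lemma orbit_rel_trans : transitive orbit_rel.
Proof.
move=> q p r /asboolP[a [pa qa]] /asboolP[b [qb rb]]; apply/asboolP.
by exists (mulS1 b a); rewrite pa qb rb qa milnor_actM actM.
Qed.

Definition orbit_equiv : equiv_rel (milnorE * Y)%type :=
  EquivRel orbit_rel orbit_rel_refl orbit_rel_sym orbit_rel_trans.

Definition homotopy_orbits : topologicalType :=
  quotient_topology {eq_quot orbit_equiv}.

End HomotopyOrbits.
End Circle.

Section Cubes.
Variable R : realType.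

Definition I01 := set_type (`[0, 1]%classic : set R).

Definition Icube (n : nat) : topologicalType := {ptws 'I_n -> I01}.

Definition cube (n : nat) (X : topologicalType) := continuousType (Icube n) X.

HB.instance Definition _ n X := Choice.on (cube n X).

Lemma Icube_continuous (S : topologicalType) n (f : S -> Icube n) :
  (forall i, continuous (fun s => f s i)) -> continuous f.
Proof.
move=> cf s; apply/cvg_sup => i.
by apply: (@continuous_comp_initial _ _ _ (fun t : forall i, _ => t i)); exact: cf.
Qed.

Lemma Icoord_continuous n (i : 'I_n) : continuous (fun t : Icube n => t i).
Proof. exact: proj_continuous. Qed.

Lemma Icoord_val_continuous n (i : 'I_n) :
  continuous (fun t : Icube n => set_val (t i) : R).
Proof.
apply: (@continuous_comp_all _ _ _ (fun t : Icube n => t i) set_val).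
  exact: Icoord_continuous.
exact: initial_continuous.
Qed.

Lemma endpt_subproof (b : bool) : `[0, 1]%classic (b%:R : R).
Proof. by case: b; rewrite /= in_itv/= ?lexx ?ler01. Qed.

Definition endpt (b : bool) : I01 := exist _ b%:R (mem_set (endpt_subproof b)).

(* T does not depend on one of its coordinates *)
Definition degenerate n (X : topologicalType) (T : cube n X) : Prop :=
  exists i : 'I_n, forall s t : Icube n,
    (forall j, j != i -> s j = t j) -> T s = T t.

(* The face of the n-cube on which the coordinates outside H are equal to e,  *)
(* the coordinates in H being renumbered increasingly.                        *)
Definition face_fun n (H : {set 'I_n}) (e : bool) (t : Icube #|H|) : Icube n :=
  fun j => oapp t (endpt e) [pick i : 'I_#|H| | enum_val i == j].

Lemma face_continuous n (H : {set 'I_n}) e : continuous (@face_fun n H e).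
Proof.
apply: Icube_continuous => j; rewrite /face_fun.
case: pickP => [i _|_] /=; first exact: Icoord_continuous.
exact: cst_continuous.
Qed.

Definition face_map n (H : {set 'I_n}) e :
  continuousType (Icube #|H|) (Icube n) := mkcts (@face_continuous n H e).

Definition face n (X : topologicalType) (H : {set 'I_n}) (e : bool)
  (T : cube n X) : cube #|H| X := T \o face_map H e.

Definition Iproj_fun m n (f : 'I_m -> 'I_n) (t : Icube n) : Icube m :=
  fun i => t (f i).

Lemma Iproj_continuous m n (f : 'I_m -> 'I_n) : continuous (Iproj_fun f).
Proof. by apply: Icube_continuous => i; exact: Icoord_continuous. Qed.

Section Cross.
Variables (m n : nat) (X W : topologicalType) (T : cube m X) (S : cube n W).

(* (t, s) |-> (T t, S s) *)
Definition cross_fun (u : Icube (m + n)) : (X * W)%type :=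
  (T (Iproj_fun (@lshift m n) u), S (Iproj_fun (@rshift m n) u)).

Lemma cross_continuous : continuous cross_fun.
Proof.
apply: (@pair_continuous _ _ _ (T \o _) (S \o _)) => u;
  apply: continuous_comp; by [exact: Iproj_continuous|exact: cts_fun].
Qed.

Definition cross : cube (m + n) (X * W)%type := mkcts cross_continuous.
End Cross.

Section Sigma.
Variables (n : nat) (A : cube n R).

Definition sigma_fun (t : Icube n.+1) : R :=
  set_val (t ord0) * A (Iproj_fun (lift ord0) t).

Lemma sigma_continuous : continuous sigma_fun.
Proof.
have c1 : continuous (fun t : Icube n.+1 => set_val (t ord0) : R).
  exact: Icoord_val_continuous.
have c2 : continuous (A \o Iproj_fun (lift ord0)).
  by move=> t; apply: continuous_comp;
    [exact: Iproj_continuous|exact: cts_fun].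
by move=> t; exact: (cvgM (c1 t) (c2 t)).
Qed.

Definition sigma_cube : cube n.+1 R := mkcts sigma_continuous.
End Sigma.

Definition id_cube_fun (t : Icube 1) : R := set_val (t ord0).

Lemma id_cube_continuous : continuous id_cube_fun.
Proof. exact: Icoord_val_continuous. Qed.

Definition id_cube : cube 1 R := mkcts id_cube_continuous.

Definition add_fun (p : R * R) : R := p.1 + p.2.

Lemma add_fun_continuous : continuous add_fun.
Proof. exact: add_continuous. Qed.

Definition addc : continuousType (R * R)%type R := mkcts add_fun_continuous.

End Cubes.

Section CubicalChains.
Variables (k : comPzRingType) (R : realType).

(* CU_* X, the quotient of the free module on all cubes by the degenerate     *)
(* ones, is free on the nondegenerate cubes; chain_of T is the class of T.    *)
Definition cell (X : topologicalType) : choiceType :=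
  {T : {n : nat & cube R n X} | `[< ~ degenerate (tagged T) >]}.

Definition cell_dim (X : topologicalType) (c : cell X) : nat := tag (val c).

Definition cell_cube (X : topologicalType) (c : cell X) :
  cube R (cell_dim c) X := tagged (val c).

Definition chains (X : topologicalType) : lmodType k := freemod k (cell X).

Definition chain_of (X : topologicalType) n (T : cube R n X) : chains X :=
  oapp (@fbasis k (cell X)) 0
    (insub (Tagged (fun n => cube R n X) T) : option (cell X)).

(* The i-th coordinate, 1 <= i <= n, has index i - 1 in 'I_n. *)
Definition CU_diff (X : topologicalType) : chains X -> chains X :=
  flift (fun c : cell X => \sum_(i < cell_dim c) (-1) ^+ i.+1 *:
    (chain_of (face [set~ i]%SET false (cell_cube c)) -
     chain_of (face [set~ i]%SET true (cell_cube c)))).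

(* the number of inversions of the shuffle (H, ~: H) *)
Definition shuffle_inv n (H : {set 'I_n}) : nat :=
  #|[set ij : 'I_n * 'I_n | [&& ij.1 \in H, ij.2 \notin H & (ij.2 < ij.1)%N]]%SET|.

(* Serre's diagonal: the sum over H of +- (T restricted to t_j = 0, j not in  *)
(* H) (x) (T restricted to t_j = 1, j in H).                                  *)
Definition CU_comul (X : topologicalType) :
    chains X -> freemod k (cell X * cell X)%type :=
  flift (fun c : cell X => \sum_(H : {set 'I_(cell_dim c)})
    (-1) ^+ shuffle_inv H *:
      tens (chain_of (face H false (cell_cube c)))
           (chain_of (face (~: H)%SET true (cell_cube c)))).

Definition CU_counit (X : topologicalType) : chains X -> k^o :=
  flift (fun c : cell X => (cell_dim c == 0%N)%:R : k^o).

Definition CU (X : topologicalType) : precoalg k :=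
  @PreCoalg k (cell X) (@cell_dim X) (@CU_diff X) (@CU_comul X) (@CU_counit X).

Definition CU_map (X W : topologicalType) (f : continuousType X W) :
    chains X -> chains W :=
  flift (fun c : cell X => chain_of (f \o cell_cube c : cube R _ W)).

Definition EZ (X W : topologicalType) (x : chains X) (w : chains W) :
    chains (X * W)%type :=
  flift2 (fun (c : cell X) (e : cell W) =>
    chain_of (cross (cell_cube c) (cell_cube e))) x w.

Definition chains_mul (x y : chains R) : chains R := CU_map (addc R) (EZ x y).

Definition sigma (x : chains R) : chains R :=
  flift (fun c : cell R => chain_of (sigma_cube (cell_cube c))) x.

(* [:: T~_0; ...; T~_(n-1)] *)
Fixpoint Ttilde_seq (n : nat) : seq (chains R) :=
  if n is m.+1 then
    let L := Ttilde_seq m in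
    rcons L (if m is 0%N then chain_of (id_cube R) else
      sigma (\sum_(i < m) chains_mul L`_i L`_(m - i.+1)))
  else [::].

Definition Ttilde (n : nat) : chains R := (Ttilde_seq n.+1)`_n.

Lemma size_Ttilde_seq n : size (Ttilde_seq n) = n.
Proof. by elim: n => //= n IHn; rewrite size_rcons IHn. Qed.

Lemma nth_Ttilde_seq n i : (i < n)%N -> (Ttilde_seq n)`_i = Ttilde i.
Proof.
elim: n => // n IHn; rewrite ltnS leq_eqVlt => /orP[/eqP->//|lin].
by rewrite -(IHn lin) /= nth_rcons size_Ttilde_seq lin.
Qed.

Lemma Ttilde0 : Ttilde 0 = chain_of (id_cube R).
Proof. by []. Qed.

Lemma TtildeS n : (0 < n)%N ->
  Ttilde n =
    sigma (\sum_(1 <= i < n.+1) chains_mul (Ttilde i.-1) (Ttilde (n - i))).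
Proof.
case: n => // n _; rewrite {1}/Ttilde.
have -> : Ttilde_seq n.+2 = rcons (Ttilde_seq n.+1) (sigma (\sum_(i < n.+1)
    chains_mul (Ttilde_seq n.+1)`_i (Ttilde_seq n.+1)`_(n.+1 - i.+1))) by [].
rewrite nth_rcons size_Ttilde_seq ltnn eqxx big_add1 big_mkord; congr sigma.
by apply: eq_bigr => i _; rewrite !nth_Ttilde_seq// subSS ltnS leq_subr.
Qed.

Definition Tchain (n : nat) : chains (S1 R) := CU_map (expi R) (Ttilde n).

Section Action.
Variables (Y : topologicalType) (g : circle_action R Y).

Definition kappa (t : chains (S1 R)) (u : chains Y) : chains Y :=
  CU_map (actc g) (EZ t u).

(* Gamma v (x) CU_* Y is free on the v(n) (x) U; tw_gen n x is v(n) (x) x. *)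
Definition tw_cell : choiceType := (nat * cell Y)%type.

Definition tw_deg (b : tw_cell) : nat := (b.1.*2 + cell_dim b.2)%N.

Definition tw_gen (n : nat) (x : chains Y) : freemod k tw_cell :=
  flift (fun c : cell Y => fbasis k ((n, c) : tw_cell)) x.

Definition tw_diff : freemod k tw_cell -> freemod k tw_cell :=
  flift (fun b : tw_cell =>
    let: (n, c) := b in
    tw_gen n (CU_diff (fbasis k c)) -
    \sum_(j < n) tw_gen j (kappa (Tchain (n - j).-1) (fbasis k c))).

Definition tw_comul :
    freemod k tw_cell -> freemod k (tw_cell * tw_cell)%type :=
  flift (fun b : tw_cell =>
    let: (n, c) := b in
    \sum_(j < n.+1) flift (fun cc : cell Y * cell Y =>
        fbasis k (((j : nat), cc.1) : tw_cell, ((n - j)%N, cc.2) : tw_cell))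
      (CU_comul (fbasis k c))).

Definition tw_counit : freemod k tw_cell -> k^o :=
  flift (fun b : tw_cell =>
    let: (n, c) := b in
    if n is 0%N then CU_counit (fbasis k c) else 0).

Definition twisted_tensor : precoalg k :=
  @PreCoalg k tw_cell tw_deg tw_diff tw_comul tw_counit.

End Action.
End CubicalChains.

(* Main.v *)
(* A twisting cochain on the twisted tensor product with values in the cobar  *)
(* construction of CU_* Y_{hS^1} is the same thing as a DCSH map. It is built *)
(* by recursion on n on v(n) (x) CU_* Y: the pointed contraction of Milnor's  *)
(* space E induces a contraction of the cobar construction of CU_*(E x Y),    *)
(* and one projects along E x Y -> Y_{hS^1}. All choices being canonical, the *)
(* map f is natural in the S^1-space Y.                                       *)
(* Both its source and its target are, as graded modules, functorial in all   *)
(* continuous maps: for the target, a cube of Y_{hS^1} is the class of a pair *)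
(* (e, y), with e a lift of its image in BS^1 that has been chosen once and   *)
(* for all. Inserting 1 in S^1 x Y therefore contracts the bar resolutions by *)
(* the spaces (S^1)^r x Y, and dimension shifting reduces the proof that f is *)
(* a quasi-isomorphism to the case of S^1 x Z. There f is compared with the   *)
(* map to CU_* Z induced by (x, z) |-> x^-1 z; its homology is computed from  *)
(* the exact sequence of the covering R x Z -> S^1 x Z,                       *)
(*   0 -> CU_*(R x Z) -> CU_*(R x Z) -> CU_*(S^1 x Z) -> 0.                   *)
(* The mapping cone of f, being based, bounded below and acyclic, is          *)
(* contractible, so f has a homotopy inverse and its dual is an isomorphism   *)
(* on cohomology, multiplicative by the second map of the DCSH family.        *)
Require Import Defs.
From HB Require Import structures.
From mathcomp Require Import all_boot all_order all_algebra finmap ring lra zify.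
From mathcomp Require Import all_classical all_reals all_analysis.
Set Implicit Arguments.
Unset Strict Implicit.
Unset Printing Implicit Defensive.
Import Order.TTheory GRing.Theory Num.Theory.
Import numFieldNormedType.Exports.
Local Open Scope classical_set_scope.
Local Open Scope ring_scope.

(** * Linear maps between free modules *)

(** A DCSH map from [twisted_tensor] to the cubical chains of a space amounts to a twisting cochain
    with values in the cobar construction of those chains. Two things are therefore needed: such a
    twisting cochain, and the homology of its one-letter part.

    Construction. Let E be Milnor's space. The twisting cochain comes from operations Phi_n, one for
    each v(n), from the chains of Y to the cobar construction of the chains of E x Y. A contraction
    of E that fixes its base point e0 induces a homotopy [contr] on that cobar construction between
    the identity and a collapse ([dA_contr]); it exists because the diagonal of a cone has the
    simple form [cm_cone]. Put Phi_0 (U) = [(e0, U)] and Phi_n = contr (Rhs_n), where Rhs_n collects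
    the terms of lower index in the equation to be solved. The equation ([Phi_twisting]) holds by
    induction, because Rhs_n satisfies the linear equation [dA_Rhs] and collapses to zero. The
    chains T_n enter through two facts: the boundary of T_n is a sum of products of earlier ones
    ([bd_sC]), and T_n is primitive ([cm_sC]). In the orbit space (e a, y) and (e, a y) coincide, so
    the correction Theta turns into the twisted part of the differential ([twist_twisting]). Sorting
    words by length then gives the DCSH family ([dcsh_map_of_twisting]).

    Quasi-isomorphism. Source and target are functors on spaces with a circle action. As graded
    modules they are even functors for all continuous maps, on the target by a coherent choice of
    lifts of cubes to E ([gcube]). Hence inserting 1 contracts the bar resolution by the spaces
    obtained from Y by repeated products with the circle ([bar_homotopy]), and dimension shifting
    ([dimension_shift]) leaves the case of S^1 x P. There the Borel construction is E x P, which
    maps to P, and the composite with the map under study is the evaluation v(0) (x) x |-> [untwist]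
    x. That it is injective on homology ([evaluation_inj]) is a descent along the index of v(n). Its
    input is the homology of a product with the circle ([circle_cycle], [circle_boundary]), obtained
    from the covering by the line.

    Cohomology. An acyclic based complex that is bounded below is contractible; applied to the
    mapping cone this provides a homotopy inverse ([homotopy_inverse]), hence an isomorphism of
    cohomology over any ring. The second map of the DCSH family is the homotopy that makes it
    multiplicative ([cup_homotopy]).

    All identities between cubes are reduced to identities between words in 0, 1 and a free letter,
    by the coalgebra maps [ev] ([bd_ev], [cm_ev]). *)

(* The definitions are sealed: otherwise failed unifications unfold flift.    *)
HB.lock Definition tns (k : comPzRingType) (A B : choiceType)
    (x : freemod k A) (y : freemod k B) : freemod k (A * B)%type := tens x y.

(** Only the values of [m] on pairs of basis elements enter, so the result is linear for every [m].
    Bilinearity is asked for only where the value on a general tensor matters ([tlift_tens]). *)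
HB.lock Definition tlift (k : comPzRingType) (A B : choiceType)
    (V : lmodType k) (m : freemod k A -> freemod k B -> V)
    (z : freemod k (A * B)%type) : V :=
  flift (fun p => m (fbasis k p.1) (fbasis k p.2)) z.

HB.lock Definition tmap (k : comPzRingType) (A B A' B' : choiceType)
    (f : freemod k A -> freemod k A') (g : freemod k B -> freemod k B')
    (z : freemod k (A * B)%type) : freemod k (A' * B')%type :=
  tlift (fun x y => tns (f x) (g y)) z.

(* The sign involution turns Leibniz rules into identities without a         *)
(* homogeneity side condition: d(xy) = dx y + nu(x) dy.                       *)
HB.lock Definition nu (k : comPzRingType) (B : choiceType) (deg : B -> nat)
    (x : freemod k B) : freemod k B :=
  flift (fun b => (-1) ^+ deg b *: fbasis k b) x.

Section LinearExtension.
Variable k : comPzRingType.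

Lemma lin_id (V : lmodType k) : linear (fun x : V => x).
Proof. by []. Qed.

Lemma lin_zero (V W : lmodType k) : linear (fun _ : V => 0 : W).
Proof. by move=> a x y; rewrite scaler0 addr0. Qed.

Lemma lin_comp (U V W : lmodType k) (f : V -> W) (g : U -> V) :
  linear f -> linear g -> linear (fun x => f (g x)).
Proof. by move=> lf lg a x y; rewrite lg lf. Qed.

Lemma lin_add (V W : lmodType k) (f g : V -> W) :
  linear f -> linear g -> linear (fun x => f x + g x).
Proof. by move=> lf lg a x y; rewrite lf lg scalerDr addrACA. Qed.

Lemma lin_opp (V W : lmodType k) (f : V -> W) :
  linear f -> linear (fun x => - f x).
Proof. by move=> lf a x y; rewrite lf opprD scalerN. Qed.

Lemma lin_scale (V W : lmodType k) (c : k) (f : V -> W) :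
  linear f -> linear (fun x => c *: f x).
Proof. by move=> lf a x y; rewrite lf scalerDr !scalerA mulrC. Qed.

Lemma lin_sum (V W : lmodType k) (I : Type) (r : seq I) (P : pred I)
    (f : I -> V -> W) :
  (forall i, linear (f i)) -> linear (fun x => \sum_(i <- r | P i) f i x).
Proof.
move=> lf a x y; rewrite scaler_sumr -big_split; apply: eq_bigr => i _.
exact: lf.
Qed.

Lemma lin_flift2r (A B : choiceType) (U V : lmodType k) (f : A -> B -> V)
    (x : freemod k A) (g : U -> freemod k B) :
  linear g -> linear (fun y => flift2 f x (g y)).
Proof.
move=> lg a y z; rewrite lg /flift2 -flift_linearl; congr flift.
by apply/funext => b; rewrite linearP.
Qed.

Lemma lin_flift2l (A B : choiceType) (U V : lmodType k) (f : A -> B -> V)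
    (y : freemod k B) (g : U -> freemod k A) :
  linear g -> linear (fun x => flift2 f (g x) y).
Proof. by move=> lg a x z; rewrite lg /flift2 linearP. Qed.

Lemma lin_flift (A : choiceType) (U V : lmodType k) (x : freemod k A)
    (g : A -> U -> V) :
  (forall b, linear (g b)) -> linear (fun y => flift (g^~ y) x).
Proof.
move=> lg a y z; rewrite -flift_linearl; congr flift.
by apply/funext => b; rewrite lg.
Qed.

Lemma flin_ext (B : choiceType) (V : lmodType k) (f g : freemod k B -> V) :
  linear f -> linear g -> (forall b, f (fbasis k b) = g (fbasis k b)) ->
  forall x, f x = g x.
Proof.
move=> lf lg fg x.
pose F : {linear freemod k B -> V} :=
  HB.pack f (GRing.isLinear.Build k (freemod k B) V *:%R f lf).
pose G : {linear freemod k B -> V} :=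
  HB.pack g (GRing.isLinear.Build k (freemod k B) V *:%R g lg).
rewrite -[f x]/(F x) -[g x]/(G x) linear_flift [RHS]linear_flift.
by congr flift; apply/funext.
Qed.

Lemma lin0 (V W : lmodType k) (f : V -> W) : linear f -> f 0 = 0.
Proof.
by move=> lf; have := lf (-1) 0 0; rewrite scaler0 addr0 scaleN1r addNr.
Qed.

Lemma linZ (V W : lmodType k) (f : V -> W) a x :
  linear f -> f (a *: x) = a *: f x.
Proof.
by move=> lf; have := lf a x 0; rewrite (lin0 lf) !addr0.
Qed.

Lemma linD (V W : lmodType k) (f : V -> W) x y :
  linear f -> f (x + y) = f x + f y.
Proof. by move=> lf; have := lf 1 x y; rewrite !scale1r. Qed.

Lemma linN (V W : lmodType k) (f : V -> W) x :
  linear f -> f (- x) = - f x.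
Proof. by move=> lf; rewrite -scaleN1r (linZ _ _ lf) scaleN1r. Qed.

Lemma linsum (V W : lmodType k) (f : V -> W) I (r : seq I) P (F : I -> V) :
  linear f -> f (\sum_(i <- r | P i) F i) = \sum_(i <- r | P i) f (F i).
Proof.
move=> lf; apply: (big_morph f) => [x y|]; [exact: linD|exact: lin0].
Qed.

Definition bilin (U V W : lmodType k) (m : U -> V -> W) : Prop :=
  (forall y, linear (m^~ y)) /\ (forall x, linear (m x)).

Lemma bilin_flift2 (A B : choiceType) (V : lmodType k) (f : A -> B -> V) :
  bilin (flift2 (k := k) f).
Proof.
by split=> [y|x]; [exact: (lin_flift2l _ _ (@lin_id _))|
  exact: (lin_flift2r _ _ (@lin_id _))].
Qed.

Lemma lin_bilinl (T U V W : lmodType k) (m : U -> V -> W) (g : T -> U) y :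
  bilin m -> linear g -> linear (fun x => m (g x) y).
Proof. by move=> [lm _] lg; apply: lin_comp (lm y) lg. Qed.

Lemma lin_bilinr (T U V W : lmodType k) (m : U -> V -> W) (g : T -> V) x :
  bilin m -> linear g -> linear (fun y => m x (g y)).
Proof. by move=> [_ lm] lg; apply: lin_comp (lm x) lg. Qed.

Lemma bilin_comp (T U V W X : lmodType k) (m : U -> V -> W) (f : T -> U)
    (g : X -> V) : bilin m -> linear f -> linear g ->
  bilin (fun x y => m (f x) (g y)).
Proof.
by move=> bm lf lg; split=> ?; [apply: lin_bilinl|apply: lin_bilinr].
Qed.

Lemma bilin_app (U V W X : lmodType k) (m : U -> V -> W) (f : W -> X) :
  bilin m -> linear f -> bilin (fun x y => f (m x y)).
Proof.
by move=> bm lf; split=> ?; apply: lin_comp => //;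
  [apply: lin_bilinl|apply: lin_bilinr].
Qed.

Section Tensor.
Variables A B : choiceType.

Lemma bilin_tns : bilin (@tns k A B).
Proof. by rewrite tns.unlock; exact: bilin_flift2. Qed.

Lemma tns_basis a b : tns (fbasis k a) (fbasis k b) = fbasis k (a, b) :> freemod k (A * B)%type.
Proof. by rewrite tns.unlock /tens /flift2 !flift_fbasis. Qed.

Lemma lin_tlift (V : lmodType k) (m : freemod k A -> freemod k B -> V) : linear (tlift m).
Proof. by move=> a x y; rewrite tlift.unlock linearP. Qed.

Lemma lin_tliftf (U V : lmodType k) (m : U -> freemod k A -> freemod k B -> V) z :
  (forall x y, linear (fun u => m u x y)) -> linear (fun u => tlift (m u) z).
Proof.
move=> lm; rewrite tlift.unlock.
exact: (@lin_flift _ U V z (fun p u => m u (fbasis k p.1) (fbasis k p.2))).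
Qed.

Lemma tlift_basis (V : lmodType k) (m : freemod k A -> freemod k B -> V) a b :
  tlift m (fbasis k (a, b)) = m (fbasis k a) (fbasis k b).
Proof. by rewrite tlift.unlock flift_fbasis. Qed.

Lemma tlift_tens (V : lmodType k) (m : freemod k A -> freemod k B -> V) x y : bilin m ->
  tlift m (tns x y) = m x y.
Proof.
move=> bm; move: x; apply: flin_ext => [||a].
- apply: lin_comp; [exact: lin_tlift|exact: (bilin_tns.1 y)].
- exact: bm.1.
move: y; apply: flin_ext => [||b].
- apply: lin_comp; [exact: lin_tlift|exact: bilin_tns.2].
- exact: bm.2.
by rewrite tns_basis tlift_basis.
Qed.

Lemma tlift_ext (V : lmodType k) (m m' : freemod k A -> freemod k B -> V) z :
  (forall x y, m x y = m' x y) -> tlift m z = tlift m' z.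
Proof. by move=> mm; rewrite tlift.unlock; congr flift; apply/funext => p; rewrite mm. Qed.

Lemma tens_ext (V : lmodType k) (f g : freemod k (A * B)%type -> V) : linear f -> linear g ->
  (forall x y, f (tns x y) = g (tns x y)) -> forall z, f z = g z.
Proof.
by move=> lf lg fg; apply: flin_ext => // -[a b]; rewrite -tns_basis fg.
Qed.

Lemma tlift_app (V W : lmodType k) (f : V -> W) (m : freemod k A -> freemod k B -> V) z :
  linear f -> f (tlift m z) = tlift (fun x y => f (m x y)) z.
Proof.
move=> lf; move: z; apply: flin_ext => [||[a b]].
- by apply: lin_comp => //; exact: lin_tlift.
- exact: lin_tlift.
by rewrite !tlift_basis.
Qed.

Lemma tlift_id z : tlift (@tns k A B) z = z.
Proof.
move: z; apply: flin_ext => [||[a b]]; [exact: lin_tlift|exact: lin_id|].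
by rewrite tlift_basis tns_basis.
Qed.

Lemma tliftD (V : lmodType k) (m m' : freemod k A -> freemod k B -> V) z :
  tlift (fun x y => m x y + m' x y) z = tlift m z + tlift m' z.
Proof.
move: z; apply: flin_ext => [||[a b]]; [exact: lin_tlift| |by rewrite !tlift_basis].
by apply: lin_add; exact: lin_tlift.
Qed.

Lemma tliftN (V : lmodType k) (m : freemod k A -> freemod k B -> V) z :
  tlift (fun x y => - m x y) z = - tlift m z.
Proof.
move: z; apply: flin_ext => [||[a b]]; [exact: lin_tlift| |by rewrite !tlift_basis].
by apply: lin_opp; exact: lin_tlift.
Qed.

Lemma tlift0 (V : lmodType k) (z : freemod k (A * B)%type) : tlift (fun _ _ => 0 : V) z = 0.
Proof.
move: z; apply: flin_ext => [||[a b]]; [exact: lin_tlift|exact: lin_zero|].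
by rewrite tlift_basis.
Qed.

Lemma tlift_sum (V : lmodType k) I (r : seq I) P (m : I -> freemod k A -> freemod k B -> V) z :
  tlift (fun x y => \sum_(i <- r | P i) m i x y) z = \sum_(i <- r | P i) tlift (m i) z.
Proof.
move: z; apply: flin_ext => [||[a b]]; [exact: lin_tlift| |].
  by apply: lin_sum => i; exact: lin_tlift.
by rewrite tlift_basis; apply: eq_bigr => i _; rewrite tlift_basis.
Qed.
End Tensor.

Lemma lin_tmap (A B A' B' : choiceType) (f : freemod k A -> freemod k A')
    (g : freemod k B -> freemod k B') : linear (tmap f g).
Proof. by rewrite tmap.unlock; exact: lin_tlift. Qed.

Lemma tmapE (A B A' B' : choiceType) (f : freemod k A -> freemod k A')
    (g : freemod k B -> freemod k B') z :
  tmap f g z = tlift (fun x y => tns (f x) (g y)) z.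
Proof. by rewrite tmap.unlock. Qed.

Section TensorMaps.
Variables (A B A' B' : choiceType).
Variables (f : freemod k A -> freemod k A') (g : freemod k B -> freemod k B').
Hypotheses (lf : linear f) (lg : linear g).

Lemma bilin_tnsfg : bilin (fun x y => tns (f x) (g y)).
Proof. by apply: bilin_comp => //; exact: bilin_tns. Qed.

Lemma tmap_tens x y : tmap f g (tns x y) = tns (f x) (g y).
Proof. by rewrite tmap.unlock tlift_tens //; exact: bilin_tnsfg. Qed.

Lemma tlift_tmap (V : lmodType k) (m : freemod k A' -> freemod k B' -> V) z : bilin m ->
  tlift m (tmap f g z) = tlift (fun x y => m (f x) (g y)) z.
Proof.
move=> bm; rewrite tmap.unlock (tlift_app (f := tlift m)); last exact: lin_tlift.
by apply: tlift_ext => x y; rewrite tlift_tens.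
Qed.

End TensorMaps.

Lemma tmapM (A B A' B' A'' B'' : choiceType) (f : freemod k A' -> freemod k A'')
    (g : freemod k B' -> freemod k B'') (f' : freemod k A -> freemod k A')
    (g' : freemod k B -> freemod k B') z :
  linear f -> linear g -> linear f' -> linear g' ->
  tmap f g (tmap f' g' z) = tmap (fun x => f (f' x)) (fun y => g (g' y)) z.
Proof.
by move=> lf lg lf' lg'; rewrite {1}tmap.unlock tlift_tmap// ?[in RHS]tmap.unlock//; exact: bilin_tnsfg.
Qed.

Lemma tmap_ext (A B A' B' : choiceType) (f f' : freemod k A -> freemod k A')
    (g g' : freemod k B -> freemod k B') z :
  f =1 f' -> g =1 g' -> tmap f g z = tmap f' g' z.
Proof. by move=> ff gg; rewrite tmap.unlock; apply: tlift_ext => x y; rewrite ff gg. Qed.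

Lemma tmap_id (A B : choiceType) (z : freemod k (A * B)%type) : tmap (fun x => x) (fun y => y) z = z.
Proof. by rewrite tmap.unlock; exact: tlift_id. Qed.

Lemma nu_basis (B : choiceType) (deg : B -> nat) b :
  nu deg (fbasis k b) = (-1) ^+ deg b *: fbasis k b.
Proof. by rewrite nu.unlock flift_fbasis. Qed.

Lemma lin_nu (B : choiceType) (deg : B -> nat) : linear (@nu k B deg).
Proof. by move=> a x y; rewrite nu.unlock linearP. Qed.

Lemma nuK (B : choiceType) (deg : B -> nat) : involutive (@nu k B deg).
Proof.
apply: flin_ext => [||b]; [|exact: lin_id|].
  by apply: lin_comp; exact: lin_nu.
by rewrite nu_basis (linZ _ _ (@lin_nu _ deg)) nu_basis scalerA -expr2 sqrr_sign scale1r.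
Qed.

End LinearExtension.

(* Purely syntactic dispatch: leaving the choice of the rule to unification   *)
(* unfolds flift.                                                             *)
Create HintDb linear_maps.
Create HintDb bilinear_maps.
#[local] Hint Extern 0 (GRing.linear_for _ (tmap _ _)) => exact: lin_tmap : linear_maps.
#[local] Hint Extern 0 (GRing.linear_for _ (tlift _)) => exact: lin_tlift : linear_maps.
#[local] Hint Extern 0 (GRing.linear_for _ (nu _)) => exact: lin_nu : linear_maps.
#[local] Hint Extern 0 (GRing.linear_for _ (flift _)) => exact: linearP : linear_maps.
#[local] Hint Extern 0 (GRing.linear_for _ (GRing.Linear.sort _)) => exact: linearP : linear_maps.
#[local] Hint Extern 0 (GRing.linear_for _ (tns _)) => exact: (bilin_tns _ _ _).2 : linear_maps.
Ltac lin_known := solve [auto 1 with linear_maps nocore].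
Ltac bilin_known := solve [auto 1 with bilinear_maps nocore].
Ltac bilin_base :=
  lazymatch goal with
  | |- bilin (@tns _ _ _) => exact: bilin_tns
  | |- _ => bilin_known
  end.
Ltac lin_atom :=
  first [ assumption | lin_known
        | match goal with H : forall _, GRing.linear_for _ _ |- _ => exact: H end ].
Ltac lin :=
  lazymatch goal with
  | |- GRing.linear_for _ ?F =>
    lazymatch F with
    | (fun x => x) => exact: lin_id
    | (fun x => ?h x) => change (linear h); lin_atom
    | (fun x => 0) => exact: lin_zero
    | (fun x => GRing.add (@?f x) (@?g x)) => refine (@lin_add _ _ _ f g _ _); lin
    | (fun x => GRing.opp (@?f x)) => refine (@lin_opp _ _ _ f _); lin
    | (fun x => GRing.scale ?c (@?f x)) => refine (@lin_scale _ _ _ c f _); lin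
    | (fun x => \sum_(i <- ?r | @?P i) (@?f i x)) =>
        refine (@lin_sum _ _ _ _ _ _ (fun i x => f i x) _); intro; cbv beta; lin
    | (fun x => ?h (@?g x)) =>
        first [ refine (@lin_comp _ _ _ _ h g _ _)
              | match F with (fun x => ?m (@?f x) ?y) =>
                  refine (@lin_bilinl _ _ _ _ _ m f y _ _); [solve [bilin_base]|] end ];
        lin
    | _ => lin_atom
    end
  end.

HB.lock Definition asl (k : comPzRingType) (A B C : choiceType)
    (z : freemod k ((A * B) * C)%type) : freemod k (A * (B * C))%type :=
  flift (fun p => fbasis k (p.1.1, (p.1.2, p.2))) z.

(** * Supports, which express homogeneity of elements of a free module *)

Section Support.
Variable k : comPzRingType.

Lemma freemod_eqP (B : choiceType) (x y : freemod k B) :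
  (forall b, x b = y b) -> x = y.
Proof. by move=> xy; apply/val_inj/funext. Qed.

Lemma coefD (B : choiceType) (x y : freemod k B) b : (x + y) b = x b + y b.
Proof. by []. Qed.
Lemma coefN (B : choiceType) (x : freemod k B) b : (- x) b = - x b.
Proof. by []. Qed.
Lemma coefZ (B : choiceType) a (x : freemod k B) b : (a *: x) b = a * x b.
Proof. by []. Qed.
Lemma coef0 (B : choiceType) b : (0 : freemod k B) b = 0.
Proof. by []. Qed.
Definition coefE := (coefD, coefN, coefZ, coef0).

Definition supp (B : choiceType) (P : B -> Prop) (x : freemod k B) : Prop :=
  forall b, x b != 0 -> P b.

Lemma supp0 (B : choiceType) (P : B -> Prop) : supp P 0.
Proof. by move=> b; rewrite coef0 eqxx. Qed.

Lemma suppD (B : choiceType) (P : B -> Prop) x y :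
  supp P x -> supp P y -> supp P (x + y).
Proof.
move=> Px Py b; rewrite coefD => nz.
have [xb|/Px//] := eqVneq (x b) 0; apply: Py; apply: contraNneq nz => ->.
by rewrite xb addr0.
Qed.

Lemma suppN (B : choiceType) (P : B -> Prop) x : supp P x -> supp P (- x).
Proof. by move=> Px b; rewrite coefN oppr_eq0; exact: Px. Qed.

Lemma suppZ (B : choiceType) (P : B -> Prop) a x : supp P x -> supp P (a *: x).
Proof.
move=> Px b nz; apply: Px; apply: contraNneq nz; rewrite coefZ => ->.
by rewrite mulr0.
Qed.

Lemma supp_sum (B : choiceType) (P : B -> Prop) I (r : seq I) (Q : pred I) F :
  (forall i, Q i -> supp P (F i)) -> supp P (\sum_(i <- r | Q i) F i).
Proof.
by move=> PF; elim/big_ind: _ => //; [exact: supp0|move=> *; exact: suppD].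
Qed.

Lemma supp_basis (B : choiceType) (P : B -> Prop) b : P b -> supp P (fbasis k b).
Proof. by move=> Pb c /=; have [->|_] := eqVneq c b; rewrite ?mulr0n ?eqxx. Qed.

Lemma suppW (B : choiceType) (P Q : B -> Prop) x :
  (forall b, P b -> Q b) -> supp P x -> supp Q x.
Proof. by move=> PQ Px b /Px/PQ. Qed.

Lemma fsum_eq (B : choiceType) (x : freemod k B) :
  exists s : seq B, (forall b, b \in s -> x b != 0) /\
    forall (V : lmodType k) (f : B -> V), flift f x = \sum_(b <- s) x b *: f b.
Proof.
have fx : finite_set [set b | x b != 0].
  by have := coefP x; rewrite unfold_in => /asboolP.
exists (fset_set [set b | x b != 0]); split=> [b|V f].
  by rewrite in_fset_set// inE.
rewrite /flift (@fsbigTE _ _ _ _ (fset_set [set b | x b != 0]))//.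
move=> b; rewrite in_fset_set// => /negP bA.
have -> : x b = 0 by apply/eqP/negPn/negP => nz; apply: bA; rewrite inE.
by rewrite scale0r.
Qed.

Lemma flift_ind (B : choiceType) (V : lmodType k) (Q : B -> Prop)
    (P : V -> Prop) (f : B -> V) x :
  P 0 -> (forall u v, P u -> P v -> P (u + v)) -> (forall a u, P u -> P (a *: u)) ->
  (forall b, Q b -> P (f b)) -> supp Q x -> P (flift f x).
Proof.
move=> P0 PD PZ Pf Qx; have [s [sx ->]] := fsum_eq x.
by rewrite big_seq; elim/big_ind: _ => // b /sx/Qx/Pf; exact: PZ.
Qed.

Lemma supp_flift (B B' : choiceType) (Q : B -> Prop) (P : B' -> Prop)
    (f : B -> freemod k B') x :
  (forall b, Q b -> supp P (f b)) -> supp Q x -> supp P (flift f x).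
Proof.
move=> Pf Qx; apply: (flift_ind (P := supp P) _ _ _ Pf Qx).
- exact: supp0.
- by move=> *; exact: suppD.
- by move=> *; exact: suppZ.
Qed.

(** Extension by linearity for homogeneous elements: when [Q] fixes the degree, signs that depend on
    the degree become constants. *)
Lemma lin_supp_ext (B : choiceType) (V : lmodType k) (Q : B -> Prop)
    (f g : freemod k B -> V) x : linear f -> linear g -> supp Q x ->
  (forall b, Q b -> f (fbasis k b) = g (fbasis k b)) -> f x = g x.
Proof.
move=> lf lg Qx fg; rewrite -[x]flift_id.
have [s [sx ->]] := fsum_eq x.
rewrite (linsum _ _ _ lf) (linsum _ _ _ lg) big_seq [RHS]big_seq.
by apply: eq_bigr => b /sx/Qx/fg fgb; rewrite !linZ ?fgb.
Qed.

Lemma supp_lin (B B' : choiceType) (Q : B -> Prop) (P : B' -> Prop)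
    (f : freemod k B -> freemod k B') x : linear f ->
  (forall b, Q b -> supp P (f (fbasis k b))) -> supp Q x -> supp P (f x).
Proof.
move=> lf Pf Qx; rewrite (@lin_supp_ext _ _ Q f (flift (fun b => f (fbasis k b))))//.
- exact: supp_flift Pf Qx.
- by move=> a y z; rewrite linearP.
- by move=> b _; rewrite flift_fbasis.
Qed.

Lemma supp_tens (A B : choiceType) (P : A -> Prop) (Q : B -> Prop) x y :
  supp P x -> supp Q y -> supp (fun p => P p.1 /\ Q p.2) (tns x y : freemod k (A * B)%type).
Proof.
move=> Px Qy; apply: (@supp_lin _ _ P _ (fun x => tns x y) x _ _ Px).
  exact: (bilin_tns _ _ _).1.
move=> a Pa; apply: (@supp_lin _ _ Q _ (tns (fbasis k a)) y _ _ Qy).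
  exact: (bilin_tns _ _ _).2.
by move=> b Qb; rewrite tns_basis; exact: supp_basis.
Qed.

Lemma nu_supp (B : choiceType) (deg : B -> nat) n x :
  supp (fun b => deg b = n) x -> nu deg x = (-1) ^+ n *: x :> freemod k B.
Proof.
move=> nx; apply: (lin_supp_ext _ _ nx) => [||b <-]; first exact: lin_nu.
  by apply: lin_scale; exact: lin_id.
by rewrite nu_basis.
Qed.

Lemma tensDl (A B : choiceType) (x x' : freemod k A) (y : freemod k B) :
  tns (x + x') y = tns x y + tns x' y.
Proof. exact: linD ((bilin_tns _ _ _).1 y). Qed.
Lemma tensDr (A B : choiceType) (x : freemod k A) (y y' : freemod k B) :
  tns x (y + y') = tns x y + tns x y'.
Proof. exact: linD ((bilin_tns _ _ _).2 x). Qed.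
Lemma tensNl (A B : choiceType) (x : freemod k A) (y : freemod k B) :
  tns (- x) y = - tns x y.
Proof. exact: linN ((bilin_tns _ _ _).1 y). Qed.
Lemma tensNr (A B : choiceType) (x : freemod k A) (y : freemod k B) :
  tns x (- y) = - tns x y.
Proof. exact: linN ((bilin_tns _ _ _).2 x). Qed.
Lemma tensZl (A B : choiceType) a (x : freemod k A) (y : freemod k B) :
  tns (a *: x) y = a *: tns x y.
Proof. exact: linZ ((bilin_tns _ _ _).1 y). Qed.
Lemma tensZr (A B : choiceType) a (x : freemod k A) (y : freemod k B) :
  tns x (a *: y) = a *: tns x y.
Proof. exact: linZ ((bilin_tns _ _ _).2 x). Qed.
Lemma tens0l (A B : choiceType) (y : freemod k B) : tns (0 : freemod k A) y = 0.
Proof. exact: lin0 ((bilin_tns _ _ _).1 y). Qed.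
Lemma tens0r (A B : choiceType) (x : freemod k A) : tns x (0 : freemod k B) = 0.
Proof. exact: lin0 ((bilin_tns _ _ _).2 x). Qed.
Definition tensE := (tensDl, tensDr, tensNl, tensNr, tensZl, tensZr, tens0l, tens0r).

Section Assoc.
Variables A B C : choiceType.

Lemma lin_asl : linear (@asl k A B C).
Proof. by move=> a x y; rewrite asl.unlock linearP. Qed.

Lemma asl_tens (x : freemod k A) (y : freemod k B) (z : freemod k C) : asl (tns (tns x y) z) = tns x (tns y z).
Proof.
move: x; apply: flin_ext => [||a].
- by apply: lin_comp; [exact: lin_asl|apply: lin_bilinl (bilin_tns _ _ _) _; exact: (bilin_tns _ _ _).1].
- exact: (bilin_tns _ _ _).1.
move: y; apply: flin_ext => [||b].
- by apply: lin_comp; [exact: lin_asl|apply: lin_bilinl (bilin_tns _ _ _) _; exact: (bilin_tns _ _ _).2].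
- by apply: lin_bilinr (bilin_tns _ _ _) _; exact: (bilin_tns _ _ _).1.
move: z; apply: flin_ext => [||c].
- by apply: lin_comp; [exact: lin_asl|exact: (bilin_tns _ _ _).2].
- by apply: lin_bilinr (bilin_tns _ _ _) _; exact: (bilin_tns _ _ _).2.
by rewrite !tns_basis asl.unlock flift_fbasis.
Qed.
End Assoc.

Lemma tens3_ext (A B C : choiceType) (V : lmodType k)
    (f g : freemod k ((A * B) * C)%type -> V) : linear f -> linear g ->
  (forall x y z, f (tns (tns x y) z) = g (tns (tns x y) z)) -> forall u, f u = g u.
Proof.
by move=> lf lg fg; apply: flin_ext => // -[[a b] c]; rewrite -!tns_basis fg.
Qed.

Lemma asl_tmap (A B C A' B' C' : choiceType) (f : freemod k A -> freemod k A')
    (g : freemod k B -> freemod k B') (h : freemod k C -> freemod k C') u :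
  linear f -> linear g -> linear h ->
  asl (tmap (tmap f g) h u) = tmap f (tmap g h) (asl u).
Proof.
move=> lf lg lh; have ltm := lin_tmap; move: u; apply: tens3_ext => [||x y z].
- by apply: lin_comp; [exact: lin_asl|exact: lin_tmap].
- by apply: lin_comp; [exact: lin_tmap|exact: lin_asl].
by rewrite tmap_tens// ?tmap_tens// asl_tens ?asl_tens ?tmap_tens// ; exact: lin_tmap.
Qed.

End Support.

Ltac zring := apply: freemod_eqP => ?; rewrite !coefE; ring.

(* A word in {0, 1, *} is a face of a cube, with None for the free            *)
(* coordinates *; the words of length n span the n-th tensor power of the     *)
(* cellular chain coalgebra of the interval.                                  *)
Definition wd : choiceType := seq (option bool).

Definition stars (w : wd) : nat := count_mem None w.

HB.lock Definition consw (k : comPzRingType) (o : option bool)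
    (x : freemod k wd) : freemod k wd :=
  flift (fun w : wd => fbasis k (o :: w : wd)) x.

(** The Leibniz rule on the first letter: the free letter has degree one and boundary 1 - 0, while a
    [Some] letter is a cycle of degree zero. *)
Fixpoint dWb (k : comPzRingType) (w : seq (option bool)) : freemod k wd :=
  match w with
  | [::] => 0
  | Some b :: w' => consw (Some b) (dWb k w')
  | None :: w' => fbasis k (Some true :: w' : wd) -
      fbasis k (Some false :: w' : wd) - consw None (dWb k w')
  end.

(** The diagonal of the interval sends the free letter to (free (x) 1) + (0 (x) free). In the second
    summand the free letter passes the left factor of the diagonal of [w'], whence the sign [nu]. *)
Fixpoint comWb (k : comPzRingType) (w : seq (option bool)) :
    freemod k (wd * wd)%type :=
  match w with
  | [::] => fbasis k ([::] : wd, [::] : wd)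
  | Some b :: w' => tmap (consw (Some b)) (consw (Some b)) (comWb k w')
  | None :: w' => tmap (consw None) (consw (Some true)) (comWb k w') +
      tmap (fun x => consw (Some false) (nu stars x)) (consw None) (comWb k w')
  end.

HB.lock Definition dW (k : comPzRingType) (x : freemod k wd) : freemod k wd :=
  flift (@dWb k) x.

HB.lock Definition comW (k : comPzRingType) (x : freemod k wd) :
    freemod k (wd * wd)%type := flift (@comWb k) x.

Arguments dW.body {k} x.
Arguments comW.body {k} x.

#[local] Hint Extern 0 (GRing.linear_for _ (@asl _ _ _ _)) => exact: lin_asl : linear_maps.
#[local] Hint Extern 0 (GRing.linear_for _ (consw _)) => (rewrite consw.unlock; exact: linearP) : linear_maps.
#[local] Hint Extern 0 (GRing.linear_for _ (@dW _)) => (rewrite dW.unlock; exact: linearP) : linear_maps.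
#[local] Hint Extern 0 (GRing.linear_for _ (@comW _)) => (rewrite comW.unlock; exact: linearP) : linear_maps.

(** * The cellular chain coalgebra of the cube *)

Section Words.
Variable k : comPzRingType.

Lemma lin_consw o : linear (@consw k o).
Proof. by move=> a x y; rewrite consw.unlock linearP. Qed.

Lemma consw_basis o (w : wd) : consw o (fbasis k w) = fbasis k (o :: w : wd).
Proof. by rewrite consw.unlock flift_fbasis. Qed.

Notation nuW := (@nu k wd stars).

Lemma lin_dW : linear (@dW k).
Proof. by move=> a x y; rewrite dW.unlock linearP. Qed.
Lemma lin_comW : linear (@comW k).
Proof. by move=> a x y; rewrite comW.unlock linearP. Qed.
Lemma dW_basis w : dW (fbasis k w) = dWb k w.
Proof. by rewrite dW.unlock flift_fbasis. Qed.
Lemma comW_basis w : comW (fbasis k w) = comWb k w.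
Proof. by rewrite comW.unlock flift_fbasis. Qed.

Lemma nu_consw_Some b (x : freemod k wd) : nuW (consw (Some b) x) = consw (Some b) (nuW x).
Proof.
move: x; apply: flin_ext => [||w]; [lin|lin|].
by rewrite consw_basis !nu_basis (linZ _ _ (lin_consw _)) consw_basis.
Qed.

Lemma nu_consw_None (x : freemod k wd) : nuW (consw None x) = - consw None (nuW x).
Proof.
move: x; apply: flin_ext => [||w]; [lin|lin|].
rewrite consw_basis !nu_basis (linZ _ _ (lin_consw _)) consw_basis.
by rewrite /stars/= exprS mulN1r scaleNr.
Qed.

Lemma dW_Some b (x : freemod k wd) : dW (consw (Some b) x) = consw (Some b) (dW x).
Proof.
move: x; apply: flin_ext => [||w]; [lin|lin|].
by rewrite consw_basis !dW_basis.
Qed.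

Lemma dW_None (x : freemod k wd) :
  dW (consw None x) = consw (Some true) x - consw (Some false) x - consw None (dW x).
Proof.
move: x; apply: flin_ext => [||w]; [lin|lin|].
by rewrite !consw_basis !dW_basis.
Qed.

Lemma comW_Some b (x : freemod k wd) :
  comW (consw (Some b) x) = tmap (consw (Some b)) (consw (Some b)) (comW x).
Proof.
move: x; apply: flin_ext => [||w]; [lin|lin|].
by rewrite !consw_basis !comW_basis.
Qed.

Lemma comW_None (x : freemod k wd) :
  comW (consw None x) = tmap (consw None) (consw (Some true)) (comW x) +
      tmap (fun x => consw (Some false) (nuW x)) (consw None) (comW x).
Proof.
move: x; apply: flin_ext => [||w]; [lin|lin|].
by rewrite !consw_basis !comW_basis.
Qed.

Lemma wd_ind (P : freemod k wd -> Prop) : P (fbasis k ([::] : wd)) ->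
  (forall o (w : wd), P (fbasis k w) -> P (consw o (fbasis k w))) ->
  forall w : wd, P (fbasis k w).
Proof. by move=> P0 Pc; elim=> // o w Pw; rewrite -consw_basis; exact: Pc. Qed.

Let conswD o := fun x y => linD x y (lin_consw o).
Let conswN o := fun x => linN x (lin_consw o).

Lemma dW_nu (x : freemod k wd) : dW (nuW x) = - nuW (dW x).
Proof.
move: x; apply: flin_ext => [||w]; [lin|lin|].
move: w; apply: (@wd_ind (fun x => dW (nuW x) = - nuW (dW x))) => [|[b|] w IH].
- by rewrite nu_basis dW_basis /stars/= expr0 scale1r dW_basis (lin0 (@lin_nu _ _ stars)) oppr0.
- by rewrite nu_consw_Some !dW_Some IH nu_consw_Some conswN.
rewrite nu_consw_None (linN _ lin_dW) !dW_None IH.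
rewrite !(linD _ _ (@lin_nu _ _ stars)) !(linN _ (@lin_nu _ _ stars)).
by rewrite !nu_consw_Some nu_consw_None conswN; zring.
Qed.

Lemma dWK (x : freemod k wd) : dW (dW x) = 0.
Proof.
move: x; apply: flin_ext => [||w]; [lin|lin|].
move: w; apply: (@wd_ind (fun x => dW (dW x) = 0)) => [|[b|] w IH].
- by rewrite dW_basis (lin0 lin_dW).
- by rewrite !dW_Some IH (lin0 (lin_consw _)).
rewrite dW_None !(linD _ _ lin_dW) !(linN _ lin_dW) dW_None !dW_Some IH.
by rewrite (lin0 (lin_consw _)); zring.
Qed.

Lemma comW_nu (x : freemod k wd) : comW (nuW x) = tmap nuW nuW (comW x).
Proof.
move: x; apply: flin_ext => [||w]; [lin|lin|].
move: w; apply: (@wd_ind (fun x => comW (nuW x) = tmap nuW nuW (comW x))) => [|[b|] w IH].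
- rewrite nu_basis /stars/= expr0 scale1r comW_basis/= tmap.unlock tlift_basis !nu_basis/=.
  by rewrite /stars/= !expr0 !scale1r tns_basis.
- rewrite nu_consw_Some !comW_Some IH !tmapM; [|lin..].
  by apply: tmap_ext => x; rewrite nu_consw_Some.
rewrite nu_consw_None (linN _ lin_comW) !comW_None IH.
rewrite (linD _ _ (@lin_tmap _ _ _ _ _ nuW nuW)) !tmapM; [|lin..].
rewrite opprD tmap.unlock -!tliftN; congr (_ + _); apply: tlift_ext => x y.
  by rewrite nu_consw_None nu_consw_Some tensNl.
by rewrite nu_consw_None nu_consw_Some tensNr.
Qed.

Lemma comW_dW (x : freemod k wd) : comW (dW x) = tmap dW (fun y => y) (comW x) + tmap nuW dW (comW x).
Proof.
move: x; apply: flin_ext => [||w]; [lin|lin|].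
move: w; apply: (@wd_ind (fun x => comW (dW x) = tmap dW (fun y => y) (comW x) + tmap nuW dW (comW x))) => [|[b|] w IH].
- rewrite dW_basis comW_basis (lin0 lin_comW) tmap.unlock !tlift_basis/= !dW_basis.
  by rewrite !tensE addr0.
- rewrite dW_Some !comW_Some IH (linD _ _ (@lin_tmap _ _ _ _ _ (consw (Some b)) (consw (Some b)))).
  rewrite !tmapM; [|lin..]; congr (_ + _); apply: tmap_ext => x //; rewrite ?dW_Some//.
  by rewrite nu_consw_Some.
rewrite dW_None !(linD _ _ lin_comW) !(linN _ lin_comW) !comW_Some !comW_None IH.
rewrite !(linD _ _ (@lin_tmap _ _ _ _ _ _ _)) !tmapM; [|lin..].
rewrite tmap.unlock -!(tliftN, tliftD); apply: tlift_ext => x y.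
rewrite !(dW_None, dW_Some, nu_consw_None, nu_consw_Some, dW_nu, tensE, conswN, conswD, nuK).
by zring.
Qed.

(** Coassociativity of the interval, one letter at a time: for a free letter both sides have three
    terms, with that letter in the first, second or third factor. [comW_nu] carries the sign through
    the inner diagonal. *)
Lemma comWA (x : freemod k wd) : tmap (fun y => y) comW (comW x) = asl (tmap comW (fun y => y) (comW x)).
Proof.
have la := @lin_asl k wd wd wd.
move: x; apply: flin_ext => [||w]; [lin|by apply: lin_comp; lin|].
move: w; apply: (@wd_ind (fun x => tmap (fun y => y) comW (comW x) = asl (tmap comW (fun y => y) (comW x)))) => [|[b|] w IH].
- rewrite comW_basis tmap.unlock !tlift_basis/= !comW_basis/= !tns_basis.
  by rewrite asl.unlock flift_fbasis.
- rewrite !comW_Some !tmapM; [|lin..].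
  rewrite (@tmap_ext _ _ _ _ _ _ (fun x => consw (Some b) x) _ (fun y => tmap (consw (Some b)) (consw (Some b)) (comW y)))//; last by move=> y; rewrite comW_Some.
  rewrite -(@tmapM _ _ _ _ _ _ _ _ _ (fun y => y)); [|lin..].
  rewrite IH -asl_tmap; [|lin..]; rewrite tmapM; [|lin..].
  by congr asl; apply: tmap_ext => x //; rewrite comW_Some.
rewrite !comW_None !(linD _ _ (@lin_tmap _ _ _ _ _ _ _)) !tmapM; [|lin..].
have ->: tmap (fun x => consw None x) (fun y => comW (consw (Some true) y)) (comW (fbasis k w)) =
   tmap (consw None) (tmap (consw (Some true)) (consw (Some true))) (asl (tmap comW (fun y => y) (comW (fbasis k w)))).
  by rewrite -IH tmapM; [apply: tmap_ext => y //; rewrite comW_Some|lin..].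
have ->: tmap (fun x => consw (Some false) (nuW x)) (fun y => comW (consw None y)) (comW (fbasis k w)) =
   tmap (fun x => consw (Some false) (nuW x)) (tmap (consw None) (consw (Some true))) (asl (tmap comW (fun y => y) (comW (fbasis k w)))) +
   tmap (fun x => consw (Some false) (nuW x)) (tmap (fun x => consw (Some false) (nuW x)) (consw None)) (asl (tmap comW (fun y => y) (comW (fbasis k w)))).
  rewrite -IH !tmapM; [|lin..]; rewrite tmap.unlock -tliftD; apply: tlift_ext => x y.
  by rewrite comW_None tmap.unlock tensDr.
rewrite -!asl_tmap; [|lin..]; rewrite !tmapM; [|lin..].
rewrite -!(linD _ _ la); congr asl; rewrite tmap.unlock -!tliftD; apply: tlift_ext => x y.
rewrite comW_None comW_Some comW_nu tmapM; [|lin..].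
by rewrite tmap.unlock tensDl addrA.
Qed.

End Words.

(** * Cubes and their chains *)

Section InfiniteCubes.
Variable R : realType.

(* Cubes of all dimensions are extended to a common domain, so that no        *)
(* identity between cubes mentions a cast between dimensions.                 *)
Definition Iinf : topologicalType := {ptws nat -> I01 R}.

Lemma Iinf_continuous (S : topologicalType) (f : S -> Iinf) :
  (forall j, continuous (fun s => f s j)) -> continuous f.
Proof.
move=> cf s; apply/cvg_sup => i.
by apply: (@continuous_comp_initial _ _ _ (fun t : forall i, _ => t i)); exact: cf.
Qed.

Lemma coord_continuous j : continuous (fun t : Iinf => t j).
Proof. exact: proj_continuous. Qed.

Definition consI (a : I01 R) (t : Iinf) : Iinf :=
  fun j => if j is j'.+1 then t j' else a.
Definition tailI (t : Iinf) : Iinf := fun j => t j.+1.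
Definition dropI m (t : Iinf) : Iinf := fun j => t (m + j)%N.

Lemma tail_continuous : continuous tailI.
Proof. by apply: Iinf_continuous => j; exact: coord_continuous. Qed.

Lemma drop_continuous m : continuous (dropI m).
Proof. by apply: Iinf_continuous => j; exact: coord_continuous. Qed.
Definition dropc m : continuousType Iinf Iinf := mkcts (@drop_continuous m).

Definition pad n (t : Icube R n) : Iinf :=
  fun j => oapp t (endpt R false) (insub j).

Lemma pad_continuous n : continuous (@pad n).
Proof.
apply: Iinf_continuous => j; rewrite /pad.
by case: insub => [i|] /=; [exact: Icoord_continuous|exact: cst_continuous].
Qed.
Definition padc n : continuousType (Icube R n) Iinf := mkcts (@pad_continuous n).

Definition res n (t : Iinf) : Icube R n := fun i => t i.
Arguments res : clear implicits.

Lemma res_continuous n : continuous (res n).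
Proof. by apply: Icube_continuous => j; exact: coord_continuous. Qed.
Definition resc n : continuousType Iinf (Icube R n) := mkcts (@res_continuous n).

Lemma padK n : cancel (@pad n) (res n).
Proof. by move=> t; apply/funext => i; rewrite /res /pad valK. Qed.

Definition truncI n (t : Iinf) : Iinf := pad (res n t).
Definition truncc n : continuousType Iinf Iinf := padc n \o resc n.

Lemma truncE n t j : truncI n t j = if (j < n)%N then t j else endpt R false.
Proof.
by rewrite /truncI /pad /res; case: insubP => [i -> <-|/negbTE->].
Qed.

Fixpoint fill (w : seq (option bool)) (t : Iinf) : Iinf :=
  match w with
  | [::] => t
  | Some b :: w' => consI (endpt R b) (fill w' t)
  | None :: w' => consI (t 0%N) (fill w' (tailI t))
  end.

Lemma fill_continuous w : continuous (fill w).
Proof.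
suff fc j : continuous (fun t => fill w t j) by exact: Iinf_continuous.
elim: w j => [|[b|] w IH] j /=; first exact: coord_continuous.
  by case: j => [|j] /=; [exact: cst_continuous|exact: IH].
case: j => [|j] /=; first exact: coord_continuous.
by apply: (@continuous_comp_all _ _ _ tailI (fun t => fill w t j)) => //; exact: tail_continuous.
Qed.
Definition fillc w : continuousType Iinf Iinf := mkcts (@fill_continuous w).

Lemma fillE w t j : fill w t j =
  if (j < size w)%N then
    (if nth None w j is Some b then endpt R b else t (stars (take j w)))
  else t (stars w + (j - size w))%N.
Proof.
elim: w t j => [|[b|] w IH] t [|j] //=; rewrite ?subn0// IH ltnS subSS.
Qed.

Fixpoint subw (w w' : seq (option bool)) : seq (option bool) :=
  match w, w' with
  | [::], _ => w'
  | Some b :: v, _ => Some b :: subw v w'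
  | None :: v, [::] => w
  | None :: v, o :: v' => o :: subw v v'
  end.

Lemma fill_subw w w' t : fill w (fill w' t) = fill (subw w w') t.
Proof.
elim: w w' t => [|[b|] w IH] w' t //=; first by rewrite IH.
by case: w' => [|[b|] w'] //=; rewrite -IH.
Qed.

Lemma stars_subw w w' : size w' = stars w -> stars (subw w w') = stars w'.
Proof.
elim: w w' => [|[b|] w IH] [|o w'] //=; rewrite /stars /= ?add0n ?add1n => // e.
- exact: (IH [::]).
- exact: (IH (_ :: _)).
- by congr addn; apply: IH; case: e.
Qed.

End InfiniteCubes.
Arguments res {R} n t.
Arguments resc {R} n.

(** The class of the restriction of [F] to the first [n] coordinates, all others being 0. In this
    form equalities of chains follow from equalities of functions on one fixed domain. *)
HB.lock Definition cc (k : comPzRingType) (R : realType) (X : topologicalType)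
    (n : nat) (F : continuousType (Iinf R) X) : chains k R X :=
  chain_of k (F \o padc R n : cube R n X).
Arguments cc.body k {R X} n F.

Section CubeChains.
Variables (k : comPzRingType) (R : realType).
Notation icube X := (continuousType (Iinf R) X).

Lemma chain_of_eq (X : topologicalType) m n (T : cube R m X) (S : cube R n X) :
  m = n -> (forall t : Iinf R, T (res m t) = S (res n t)) ->
  chain_of k T = chain_of k S.
Proof.
move=> mn; subst n => TS; congr chain_of; apply/continuousEP => t.
by rewrite -(padK t).
Qed.

Lemma chain_of_degenerate (X : topologicalType) n (T : cube R n X) :
  degenerate T -> chain_of k T = 0.
Proof. by move=> dT; rewrite /chain_of insubN//; apply/asboolPn => /(_ dT). Qed.

(** An operation on all cubes that kills the degenerate ones descends to normalized chains; its
    value can then be computed without asking whether [T] is degenerate. *)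
Lemma flift_chain_of (X : topologicalType) (V : lmodType k)
    (g : forall n, cube R n X -> V) :
  (forall n T, degenerate T -> g n T = 0) ->
  forall n T, flift (fun c : cell R X => g (cell_dim c) (cell_cube c)) (chain_of k T) = g n T.
Proof.
move=> g0 n T; rewrite /chain_of; case: insubP => [c _ cE|] /=.
  by rewrite flift_fbasis /cell_dim /cell_cube cE.
by rewrite linear0 => /asboolP/contrapT/g0.
Qed.

Lemma chain_of_cc (X : topologicalType) n (T : cube R n X) :
  chain_of k T = cc k n (T \o resc n : icube X).
Proof. by rewrite cc.unlock; apply: chain_of_eq => // t; rewrite -[RHS]/(T (res n (pad (res n t)))) padK. Qed.

Lemma cell_chain (X : topologicalType) (c : cell R X) :
  fbasis k c = chain_of k (cell_cube c).
Proof.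
rewrite /chain_of (_ : Tagged _ _ = val c); first by rewrite valK.
by rewrite /cell_cube /cell_dim; case: (val c).
Qed.

Lemma cell_cc (X : topologicalType) (c : cell R X) :
  fbasis k c = cc k (cell_dim c) (cell_cube c \o resc _ : icube X).
Proof. by rewrite cell_chain chain_of_cc. Qed.

Lemma cc_ext (X : topologicalType) n (F G : icube X) :
  (forall t, F (truncI n t) = G (truncI n t)) -> cc k n F = cc k n G.
Proof. by rewrite cc.unlock => FG; apply: chain_of_eq => // t; exact: FG. Qed.

Lemma cc_eq (X : topologicalType) n m (F G : icube X) :
  n = m -> (forall t, F t = G t) -> cc k n F = cc k m G.
Proof. by move=> <- FG; apply: cc_ext. Qed.

Definition indep (X : Type) i (F : Iinf R -> X) : Prop :=
  forall s t, (forall j, j != i -> s j = t j) -> F s = F t.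

Lemma cc_degenerate (X : topologicalType) n i (F : icube X) :
  (i < n)%N -> indep i F -> cc k n F = 0.
Proof.
move=> ltin iF; rewrite cc.unlock; apply: chain_of_degenerate.
exists (Ordinal ltin) => s t st /=; apply: iF => j ji.
change (pad s j = pad t j); rewrite /pad; case: insubP => //= l _ lj; apply: st.
by apply: contraNneq ji => lE; rewrite -lj lE.
Qed.

Lemma indep_degenerate (X : topologicalType) n (T : cube R n X) :
  degenerate T -> exists2 i, (i < n)%N & indep i (T \o resc n).
Proof.
move=> [i Ti]; exists i => // s t st; apply: Ti => j ji; apply: st.
by apply: contra_neq ji; exact: val_inj.
Qed.

Lemma chains_ext (X : topologicalType) (V : lmodType k) (f g : chains k R X -> V) :
  linear f -> linear g -> (forall n F, f (cc k n F) = g (cc k n F)) ->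
  forall x, f x = g x.
Proof. by move=> lf lg fg; apply: flin_ext => // c; rewrite cell_cc. Qed.

Lemma supp_cc (X : topologicalType) n (F : icube X) :
  supp (fun c => cell_dim c = n) (cc k n F).
Proof.
rewrite cc.unlock /chain_of; case: insubP => [c _ cE|_] /=; last exact: supp0.
by apply: supp_basis; rewrite /cell_dim cE.
Qed.

Definition mkw n (P : 'I_n -> bool) (e : bool) : wd :=
  [seq if P i then None else Some e | i <- enum 'I_n].

Lemma mkwS n (P : 'I_n.+1 -> bool) e :
  mkw P e = (if P ord0 then None else Some e) :: mkw (P \o lift ord0) e.
Proof. by rewrite /mkw enum_ordSl /= -map_comp. Qed.

Lemma mkw0 (P : 'I_0 -> bool) e : mkw P e = [::].
Proof. by rewrite /mkw enum_ord0. Qed.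

Lemma size_mkw n (P : 'I_n -> bool) (e : bool) : size (mkw P e) = n.
Proof. by rewrite size_map size_enum_ord. Qed.

Lemma eq_mkw n (P Q : 'I_n -> bool) e : P =1 Q -> mkw P e = mkw Q e.
Proof. by move=> PQ; apply: eq_map => i; rewrite PQ. Qed.

Lemma count_mkw n (P : 'I_n -> bool) (e : bool) s :
  count_mem None [seq if P i then None else Some e | i <- s] = count P s.
Proof. by rewrite count_map; apply: eq_count => i /=; case: (P i). Qed.

Lemma index_filter (T : eqType) (p : pred T) (s : seq T) x : p x ->
  x \in s -> index x [seq y <- s | p y] = count p (take (index x s) s).
Proof.
move=> px; elim: s => //= y s IH; rewrite inE => /predU1P[<-|xs].
  by rewrite px /= eqxx.
have [->|yx] := eqVneq y x; first by rewrite px/= eqxx.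
by rewrite /=; case: (p y); rewrite /= ?(negbTE yx) IH.
Qed.

Lemma stars_mkw n (H : {set 'I_n}) e : stars (mkw (fun i => i \in H) e) = #|H|.
Proof.
by rewrite /stars count_mkw -sum1_count -sum1_card big_enum_cond; apply: eq_bigl.
Qed.

(** The position of a coordinate in [enum H] is the number of free letters before it in the word.
    This links faces given by subsets with faces given by words. *)
Lemma face_fill n (H : {set 'I_n}) (e : bool) (t : Iinf R) :
  pad (face_fun (H:=H) e (res #|H| t)) = fill (mkw (fun i => i \in H) e) (truncI #|H| t).
Proof.
apply/funext => j; rewrite fillE size_mkw /pad.
case: insubP => [i ltjn ij|]; last first.
  by rewrite -leqNgt => lenj; rewrite ltnNge lenj /= truncE stars_mkw ltnNge leq_addr.
rewrite -ij ltn_ord /= (nth_map i) ?size_enum_ord// nth_ord_enum /face_fun.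
have sE : stars (take i (mkw (fun i => i \in H) e)) = index i (enum H) \/ i \notin H.
  have [iH|] := boolP (i \in H); [left|by right].
  rewrite /stars -map_take count_mkw.
  rewrite (_ : enum H = [seq x <- enum 'I_n | x \in H]); last by rewrite enumT.
  by rewrite index_filter ?mem_enum// index_enum_ord.
case: pickP => [l /eqP lE|none] /=.
  have lH : i \in H by rewrite -lE enum_valP.
  rewrite lH; case: sE => [->|]; last by rewrite lH.
  have -> : index i (enum H) = l.
    by rewrite -[X in index X _]lE (enum_val_nth i) index_uniq ?enum_uniq// -cardE.
  by rewrite truncE ltn_ord.
case: ifP => // iH; have := none (enum_rank_in iH i).
by rewrite enum_rankK_in// eqxx.
Qed.

Lemma face_cc (X : topologicalType) n (F : icube X) (H : {set 'I_n}) e :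
  chain_of k (face H e (F \o padc R n : cube R n X)) =
  cc k #|H| (F \o fillc R (mkw (fun i => i \in H) e) : icube X).
Proof.
rewrite cc.unlock; apply: chain_of_eq => // t.
rewrite -[LHS]/(F (pad (face_fun (H:=H) e (res #|H| t)))) face_fill.
by [].
Qed.

End CubeChains.

HB.lock Definition catW (k : comPzRingType) (x y : freemod k wd) : freemod k wd :=
  flift2 (fun u v : wd => fbasis k (u ++ v : wd)) x y.

Section WordSupport.
Variable k : comPzRingType.

Lemma bilin_catW : bilin (@catW k).
Proof. by rewrite catW.unlock; exact: bilin_flift2. Qed.

Lemma catW_basis (u v : wd) : catW (fbasis k u) (fbasis k v) = fbasis k (u ++ v : wd).
Proof. by rewrite catW.unlock /flift2 !flift_fbasis. Qed.

Lemma catW_cons o (x y : freemod k wd) : catW (consw o x) y = consw o (catW x y).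
Proof.
have [bl br] := bilin_catW; have lc := @lin_consw k.
move: x; apply: flin_ext => [||u].
- by apply: lin_comp (bl y) (lc o).
- by apply: lin_comp (lc o) (bl y).
move: y; apply: flin_ext => [||v]; [exact: br|by apply: lin_comp (lc o) (br _)|].
by rewrite consw_basis !catW_basis consw_basis.
Qed.

Lemma dW_cat (x y : freemod k wd) :
  dW (catW x y) = catW (dW x) y + catW (nu stars x) (dW y).
Proof.
have [bl br] := bilin_catW; have lc := @lin_consw k; have ld := @lin_dW k.
move: x; apply: flin_ext => [||u].
- by apply: lin_comp ld (bl y).
- by apply: lin_add; [apply: lin_comp (bl y) ld|apply: lin_comp (bl _) (@lin_nu _ _ _)].
move: u; apply: (@wd_ind k (fun x => dW (catW x y) = catW (dW x) y + catW (nu stars x) (dW y))) => [|[b|] w IH].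
- rewrite nu_basis /stars expr0 scale1r dW_basis (lin0 (bl y)) add0r.
  have c0 z : catW (fbasis k ([::] : wd)) z = z.
    by move: z; apply: flin_ext => [||v]; [exact: br|exact: lin_id|rewrite catW_basis].
  by rewrite !c0.
- by rewrite catW_cons !dW_Some IH nu_consw_Some !catW_cons (linD _ _ (lc _)).
rewrite catW_cons !dW_None IH nu_consw_None (linN _ (bl _)) !(linD _ _ (bl _)).
rewrite !(linN _ (bl _)) !catW_cons (linD _ _ (lc _)) opprD.
by rewrite !addrA.
Qed.

Lemma supp_consw o n (x : freemod k wd) :
  supp (fun w : wd => size w = n) x -> supp (fun w : wd => size w = n.+1) (consw o x).
Proof.
apply: supp_lin => [|w <-]; first exact: lin_consw.
by rewrite consw_basis; exact: supp_basis.
Qed.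

Lemma supp_dWb (w : wd) : supp (fun w' : wd => size w' = size w) (dWb k w).
Proof.
elim: w => [|[b|] w IH] /=; [exact: supp0|exact: supp_consw|].
apply: suppD; last by apply: suppN; exact: supp_consw.
by apply: suppD; [|apply: suppN]; exact: supp_basis.
Qed.

Definition complementary n (p : wd * wd) : Prop :=
  [/\ size p.1 = n, size p.2 = n &
    forall i, (i < n)%N -> nth None p.1 i = None \/ nth None p.2 i = None].

(** Each coordinate is free in at least one factor of every term of the diagonal. A cube that is
    constant in some direction therefore has a degenerate factor in every term, and the diagonal
    descends to normalized chains. *)
Lemma supp_comWb (n : nat) : supp (complementary n) (comWb k (nseq n None)).
Proof.
elim: n => [|n IH] /=; first by apply: supp_basis; split.
have step (f g : freemod k wd -> freemod k wd) o o' :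
    (o = None \/ o' = None) ->
    (forall w : wd, exists a, f (fbasis k w) = a *: fbasis k (o :: w : wd)) ->
    (forall w : wd, g (fbasis k w) = fbasis k (o' :: w : wd)) ->
    supp (complementary n.+1) (tmap f g (comWb k (nseq n None))).
  move=> oo fE gE; rewrite tmap.unlock.
  apply: (@supp_lin _ _ _ (complementary n) _ (tlift (fun x y => tns (f x) (g y))) _ _ _ IH).
    exact: lin_tlift.
  move=> [u v] [/= su sv uv]; rewrite tlift_basis gE; have [a ->] := fE u.
  rewrite tensZl tns_basis; apply: suppZ; apply: supp_basis; split=> /=.
  - by rewrite su.
  - by rewrite sv.
  - by case=> //= i; exact: uv.
apply: suppD.
- apply: (step _ _ None (Some true)); [by left| |by move=> w; rewrite consw_basis].
  by move=> w; exists 1; rewrite scale1r consw_basis.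
- apply: (step _ _ (Some false) None); [by right| |by move=> w; rewrite consw_basis].
  move=> w; exists ((-1) ^+ stars w); rewrite nu_basis.
  by rewrite (linZ _ _ (@lin_consw k _)) consw_basis.
Qed.

Lemma tlift_supp_ext (A B : choiceType) (V : lmodType k) (S : A * B -> Prop)
    (m m' : freemod k A -> freemod k B -> V) z : supp S z ->
  (forall a b, S (a, b) -> m (fbasis k a) (fbasis k b) = m' (fbasis k a) (fbasis k b)) ->
  tlift m z = tlift m' z.
Proof.
move=> Sz mm; apply: (lin_supp_ext _ _ Sz) => [||[a b] /mm]; [exact: lin_tlift..|].
by rewrite !tlift_basis.
Qed.

End WordSupport.

HB.lock Definition ev (k : comPzRingType) (R : realType) (X : topologicalType)
    (F : continuousType (Iinf R) X) (x : freemod k wd) : chains k R X :=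
  flift (fun w : wd => cc k (stars w) (F \o fillc R w : continuousType (Iinf R) X)) x.

HB.lock Definition bd (k : comPzRingType) (R : realType) (X : topologicalType)
  (x : chains k R X) : chains k R X := CU_diff x.
HB.lock Definition cm (k : comPzRingType) (R : realType) (X : topologicalType)
  (x : chains k R X) : freemod k (cell R X * cell R X)%type := CU_comul x.
HB.lock Definition cmap (k : comPzRingType) (R : realType) (X W : topologicalType)
  (f : continuousType X W) (x : chains k R X) : chains k R W := CU_map f x.
HB.lock Definition ez (k : comPzRingType) (R : realType) (X W : topologicalType)
  (x : chains k R X) (w : chains k R W) : chains k R (X * W)%type := EZ x w.
HB.lock Definition eps (k : comPzRingType) (R : realType) (X : topologicalType)
  (x : chains k R X) : k^o := CU_counit x.
Arguments bd.body {k R X} x.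
Arguments cm.body {k R X} x.
Arguments eps.body {k R X} x.
Arguments ez.body {k R X W} x w.
Arguments catW.body {k} x y.

Section ConeFunction.
Variables (R : realType) (X W : topologicalType).
Variables (H : continuousType (I01 R * X)%type W) (F : continuousType (Iinf R) X).

Lemma cone_continuous : continuous (fun t : Iinf R => H (t 0%N, F (tailI t))).
Proof.
apply: (@continuous_comp_all _ _ _ (fun t : Iinf R => (t 0%N, F (tailI t))) H); last exact: cts_fun.
apply: pair_continuous; first exact: coord_continuous.
by apply: (@continuous_comp_all _ _ _ (@tailI R) F); [exact: tail_continuous|exact: cts_fun].
Qed.
Definition coneF : continuousType (Iinf R) W := mkcts cone_continuous.
End ConeFunction.

HB.lock Definition cone (k : comPzRingType) (R : realType) (X W : topologicalType)
    (H : continuousType (I01 R * X)%type W) (x : chains k R X) : chains k R W :=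
  flift (fun c => cc k (cell_dim c).+1
    (coneF H (cell_cube c \o resc _ : continuousType (Iinf R) X))) x.

Section ProdFunction.
Variables (R : realType) (X W : topologicalType) (m : nat).
Variables (F : continuousType (Iinf R) X) (G : continuousType (Iinf R) W).

Lemma prodF_continuous :
  continuous (fun t : Iinf R => (F (truncI m t), G (dropI m t)) : X * W).
Proof.
apply: pair_continuous.
  by apply: (@continuous_comp_all _ _ _ (truncc R m) F); exact: cts_fun.
by apply: (@continuous_comp_all _ _ _ (dropc R m) G); exact: cts_fun.
Qed.
Definition prodF : continuousType (Iinf R) (X * W)%type := mkcts prodF_continuous.
End ProdFunction.

#[local] Hint Extern 0 (GRing.linear_for _ (ev _)) => (rewrite ev.unlock; exact: linearP) : linear_maps.
#[local] Hint Extern 0 (GRing.linear_for _ (@bd _ _ _)) => (rewrite bd.unlock; exact: linearP) : linear_maps.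
#[local] Hint Extern 0 (GRing.linear_for _ (@cm _ _ _)) => (rewrite cm.unlock; exact: linearP) : linear_maps.
#[local] Hint Extern 0 (GRing.linear_for _ (cmap _)) => (rewrite cmap.unlock; exact: linearP) : linear_maps.
#[local] Hint Extern 0 (GRing.linear_for _ (@eps _ _ _)) => (rewrite eps.unlock; exact: linearP) : linear_maps.
#[local] Hint Extern 0 (GRing.linear_for _ (cone _)) => (rewrite cone.unlock; exact: linearP) : linear_maps.
#[local] Hint Extern 0 (GRing.linear_for _ (ez _)) => (rewrite ez.unlock; exact: (bilin_flift2 _).2) : linear_maps.
#[local] Hint Extern 0 (GRing.linear_for _ (catW _)) => exact: (bilin_catW _).2 : linear_maps.
#[local] Hint Extern 0 (bilin (@ez _ _ _ _)) => (rewrite ez.unlock; exact: bilin_flift2) : bilinear_maps.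
#[local] Hint Extern 0 (bilin (@catW _)) => exact: bilin_catW : bilinear_maps.

Section Faces.
Variables (k : comPzRingType) (R : realType).
Notation icube X := (continuousType (Iinf R) X).
Notation stx n := (nseq n None : wd).

Lemma dsum n : \sum_(i < n) (-1) ^+ i.+1 *:
   (fbasis k (mkw (fun j : 'I_n => j \in [set~ i]%SET) false) -
    fbasis k (mkw (fun j : 'I_n => j \in [set~ i]%SET) true)) = dWb k (stx n).
Proof.
elim: n => [|n IH] /=; first by rewrite big_ord0.
rewrite big_ord_recl /= expr1 scaleN1r opprB -IH (linsum _ _ _ (@lin_consw k None)).
rewrite -sumrN; congr (_ + _); last first.
  apply: eq_bigr => i _; rewrite (linZ _ _ (@lin_consw k None)).
  rewrite (linD _ _ (@lin_consw k None)) (linN _ (@lin_consw k None)) !consw_basis.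
  rewrite /bump/= [(-1) ^+ _.+2]exprS mulN1r scaleNr; congr (- (_ *: _)).
  rewrite !mkwS; congr (_ - _); congr fbasis.
    by rewrite !inE /=; congr cons; apply: eq_mkw => j /=; rewrite !inE (inj_eq lift_inj).
  by rewrite !inE /=; congr cons; apply: eq_mkw => j /=; rewrite !inE (inj_eq lift_inj).
have mkT e : mkw (fun j : 'I_n => true) e = stx n.
  apply: (@eq_from_nth _ None); rewrite ?size_mkw ?size_nseq// => i ltin.
  by rewrite (nth_map (Ordinal ltin)) ?size_enum_ord// nth_nseq ltin.
congr (_ - _); congr fbasis; rewrite mkwS !inE eqxx /=; congr cons;
  by [rewrite -(mkT true); apply: eq_mkw => j /=; rewrite !inE|
      rewrite -(mkT false); apply: eq_mkw => j /=; rewrite !inE].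
Qed.

Definition set_cons n (b : bool) (H : {set 'I_n}) : {set 'I_n.+1} :=
  [set i | if unlift ord0 i is Some j then j \in H else b]%SET.

Lemma sum_set_cons n (V : lmodType k) (G : {set 'I_n.+1} -> V) :
  \sum_H G H = \sum_H (G (set_cons true H) + G (set_cons false H)).
Proof.
rewrite big_split /= (bigID (fun H : {set 'I_n.+1} => ord0 \in H)) /=.
have re b : \sum_(H : {set 'I_n.+1} | (ord0 \in H) == b) G H = \sum_H G (set_cons b H).
  rewrite (reindex (set_cons b)) /=.
    by apply: eq_bigl => H; rewrite inE unlift_none eqxx.
  exists (fun H : {set 'I_n.+1} => [set i : 'I_n | lift ord0 i \in H]%SET) => H.
    by move=> _; apply/setP => i; rewrite !inE liftK.
  rewrite inE => /eqP Hb; apply/setP => i; rewrite inE.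
  by case: unliftP => [j ->|->]; rewrite ?inE.
rewrite -!re; congr (_ + _); apply: eq_bigl => H.
  by rewrite eqb_id.
by rewrite eqbF_neg.
Qed.

(** A new first coordinate outside [H] precedes all of [H] but comes after it in the shuffle, so it
    forms an inversion with each element of [H]; inside [H] it forms none. This is the sign [nu] in
    [comWb]. *)
Lemma shuffle_inv_cons n b (H : {set 'I_n}) :
  shuffle_inv (set_cons b H) = (shuffle_inv H + ~~ b * #|H|)%N.
Proof.
have E m (K : {set 'I_m}) : shuffle_inv K =
    (\sum_(i < m) \sum_(j < m) [&& i \in K, j \notin K & (j < i)%N])%N.
  rewrite /shuffle_inv -sum1_card big_mkcond pair_bigA /=.
  by apply: eq_bigr => p _; rewrite inE; case: ifP.
rewrite !E big_ord_recl /=.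
rewrite [X in (X + _)%N]big1 ?add0n => [|j _]; last by rewrite ltn0 !andbF.
under eq_bigr => i _.
  rewrite big_ord_recl /= !inE unlift_none liftK /= andbT.
  under eq_bigr => j _ do rewrite inE liftK /bump/= !add1n ltnS.
  over.
rewrite big_split /= addnC; congr addn.
rewrite -sum1_card big_distrr /= [RHS]big_mkcond /=; apply: eq_bigr => i _.
by case: (i \in H); case: b.
Qed.

Lemma csum n : \sum_(H : {set 'I_n}) (-1) ^+ shuffle_inv H *:
    fbasis k (mkw (fun i => i \in H) false, mkw (fun i => i \in ~: H)%SET true) =
  comWb k (stx n).
Proof.
elim: n => [|n IH] /=.
  rewrite (big_pred1 (finset.set0 : {set 'I_0})) => [|H]; last by apply/esym/eqP/setP => -[].
  by rewrite !mkw0 /shuffle_inv eq_card0 ?scale1r// => -[[]].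
rewrite sum_set_cons big_split /= -IH; congr (_ + _).
  rewrite (linsum _ _ _ (@lin_tmap _ _ _ _ _ _ _)); apply: eq_bigr => H _.
  rewrite (linZ _ _ (@lin_tmap _ _ _ _ _ _ _)) shuffle_inv_cons mul0n addn0.
  rewrite tmap.unlock tlift_basis !consw_basis tns_basis !mkwS !inE unlift_none /=.
  congr (_ *: fbasis _ (_ :: _, _ :: _)); apply: eq_mkw => i /=; by rewrite !inE liftK.
rewrite (linsum _ _ _ (@lin_tmap _ _ _ _ _ _ _)); apply: eq_bigr => H _.
rewrite (linZ _ _ (@lin_tmap _ _ _ _ _ _ _)) shuffle_inv_cons mul1n exprD -scalerA.
rewrite tmap.unlock tlift_basis nu_basis stars_mkw (linZ _ _ (@lin_consw _ _)) tensZl.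
rewrite !consw_basis tns_basis !mkwS !inE unlift_none /=.
congr (_ *: (_ *: fbasis _ (_ :: _, _ :: _))); apply: eq_mkw => i /=; by rewrite !inE liftK.
Qed.

Lemma ev_basis (X : topologicalType) (F : icube X) (w : wd) :
  ev F (fbasis k w) = cc k (stars w) (F \o fillc R w : icube X).
Proof. by rewrite ev.unlock flift_fbasis. Qed.

Lemma ev_stars (X : topologicalType) (F : icube X) n : ev F (fbasis k (stx n)) = cc k n F.
Proof.
have sn : stars (stx n) = n by rewrite /stars count_nseq mul1n.
rewrite ev_basis; apply: cc_eq => // t.
rewrite -[LHS]/(F (fill (stx n) t)); congr (F _); apply/funext => j.
rewrite fillE size_nseq sn nth_nseq if_same; case: ltnP => [ltjn|/subnKC->//].
by rewrite /stars take_nseq ?(ltnW ltjn)// count_nseq mul1n.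
Qed.

Lemma ev_indep (X : topologicalType) (F : icube X) i (w : wd) : indep i F ->
  (i < size w)%N -> nth None w i = None -> cc k (stars w) (F \o fillc R w : icube X) = 0.
Proof.
move=> iF iw wi.
have sE j : (j < size w)%N -> stars (take j.+1 w) = (stars (take j w) + (nth None w j == None))%N.
  by move=> jw; rewrite /stars (take_nth None jw) -cats1 count_cat /= addn0.
have mono j l : (j <= l)%N -> (stars (take j w) <= stars (take l w))%N.
  by move=> /subnKC <-; rewrite /stars takeD count_cat leq_addr.
apply: (@cc_degenerate _ _ _ _ (stars (take i w))).
  have := mono i.+1 (size w) iw; rewrite take_size sE// wi eqxx addn1.
  by [].
move=> s t st; apply: iF => j ji; rewrite -[LHS]/(fill w s j) -[RHS]/(fill w t j) !fillE.
case: ifP => jw; last first.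
  apply: st; have := mono i.+1 (size w) iw; rewrite take_size sE// wi eqxx addn1 => lt.
  by rewrite gtn_eqF// (leq_trans lt) ?leq_addr.
case wj: nth => [b|] //; apply: st; rewrite neq_ltn.
have [ltji|ltij|ij] := ltngtP j i; last by rewrite ij eqxx in ji.
  by have := mono j.+1 i ltji; rewrite sE// wj eqxx addn1 => ->.
by have := mono i.+1 j ltij; rewrite sE// wi eqxx addn1 => ->; rewrite orbT.
Qed.

(** Faces in the other directions keep the coordinate [i] free and are degenerate; the two faces in
    direction [i] coincide and have opposite signs. *)
Lemma ev_dW_indep (X : topologicalType) (F : icube X) i n : indep i F ->
  (i < n)%N -> ev F (dWb k (stx n)) = 0.
Proof.
move=> iF ltin.
have bc := bilin_catW k; have le : linear (@ev k R X F) by lin.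
have -> : stx n = (stx i ++ None :: stx (n - i.+1) : wd).
  by rewrite -[None :: _]/(stx (n - i.+1).+1) -nseqD -subSn// subSS subnKC// ltnW.
have nz (x : freemod k wd) v : supp (fun w : wd => size w = i) x ->
    ev F (catW x (consw None v)) = 0.
  move=> sx; apply: (@lin_supp_ext _ _ _ _ (fun x => ev F (catW x (consw None v))) (fun=> 0) _ _ _ sx); [lin..|].
  move=> w wi; move: v; apply: flin_ext => [||v]; [lin..|].
  rewrite consw_basis catW_basis ev_basis; apply: (ev_indep iF).
    by rewrite size_cat /= wi addnS ltnS leq_addr.
  by rewrite nth_cat wi ltnn subnn.
rewrite -dW_basis -catW_basis -[fbasis k (None :: _)]consw_basis dW_cat (linD _ _ le).
rewrite nz ?add0r; last by rewrite dW_basis; have := @supp_dWb k (stx i); rewrite size_nseq.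
rewrite nu_basis dW_None (linZ _ _ (bc.1 _)) (linZ _ _ le).
rewrite !(linD _ _ (bc.2 _)) !(linN _ (bc.2 _)).
rewrite !(linD _ _ le) !(linN _ le) nz ?oppr0 ?addr0; last first.
  by apply: supp_basis; rewrite size_nseq.
rewrite !consw_basis !catW_basis !ev_basis (_ : cc _ _ _ = cc k (stars (stx i ++ Some false :: stx (n - i.+1))) (F \o fillc R (stx i ++ Some false :: stx (n - i.+1)) : icube X)).
  by rewrite subrr scaler0.
apply: cc_eq => [|t]; first by rewrite /stars !count_cat.
apply: iF => j ji; rewrite -[LHS]/(fill _ t j) -[RHS]/(fill _ t j) !fillE !size_cat /=.
rewrite !nth_cat !size_nseq !take_cat !size_nseq /stars !count_cat /=.
case: ltnP => [jn|//]; case: ltnP => [//|ij].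
have {ij ji} ij : (i < j)%N by rewrite ltn_neqAle eq_sym ji.
by rewrite -[(j - i)%N]subSS subSn// /=; case: nth => //; rewrite !count_cat.
Qed.

Lemma bd_cc (X : topologicalType) n (F : icube X) :
  bd (cc k n F) = ev F (dW (fbasis k (stx n))).
Proof.
rewrite bd.unlock dW_basis.
pose g n (T : cube R n X) : chains k R X := \sum_(i < n) (-1) ^+ i.+1 *:
    (chain_of k (face [set~ i]%SET false T) - chain_of k (face [set~ i]%SET true T)).
have gE m (G : icube X) : g m (G \o padc R m : cube R m X) = ev G (dWb k (stx m)).
  have le : linear (@ev k R X G) by lin.
  rewrite /g -dsum (linsum _ _ _ le); apply: eq_bigr => i _.
  rewrite !face_cc (linZ _ _ le) (linD _ _ le) (linN _ le) !ev_basis.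
  by rewrite !stars_mkw.
have -> : CU_diff (cc k n F) = g n (F \o padc R n : cube R n X); last exact: gE.
rewrite cc.unlock; apply: (flift_chain_of (g := g)) => m T dT.
rewrite (_ : T = ((T \o resc m : icube X) \o padc R m : cube R m X)).
  by have [i im iT] := indep_degenerate dT; rewrite gE (ev_dW_indep iT im).
by apply/continuousEP => t; rewrite -[RHS]/(T (res m (pad t))) padK.
Qed.

Lemma cm_cc (X : topologicalType) n (F : icube X) :
  cm (cc k n F) = tmap (ev F) (ev F) (comW (fbasis k (stx n))).
Proof.
rewrite cm.unlock comW_basis.
pose g n (T : cube R n X) : freemod k (cell R X * cell R X)%type :=
  \sum_(H : {set 'I_n}) (-1) ^+ shuffle_inv H *:
      tens (chain_of k (face H false T)) (chain_of k (face (~: H)%SET true T)).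
have gE m (G : icube X) : g m (G \o padc R m : cube R m X) = tmap (ev G) (ev G) (comWb k (stx m)).
  have lt := @lin_tmap _ _ _ _ _ (@ev k R X G) (@ev k R X G).
  rewrite /g -csum (linsum _ _ _ lt); apply: eq_bigr => H _.
  rewrite !face_cc (linZ _ _ lt) tmap.unlock tlift_basis !ev_basis.
  by rewrite !stars_mkw tns.unlock.
have -> : CU_comul (cc k n F) = g n (F \o padc R n : cube R n X); last exact: gE.
rewrite cc.unlock; apply: (flift_chain_of (g := g)) => m T dT.
rewrite (_ : T = ((T \o resc m : icube X) \o padc R m : cube R m X)); last first.
  by apply/continuousEP => t; rewrite -[RHS]/(T (res m (pad t))) padK.
have [i im iT] := indep_degenerate dT; rewrite gE tmap.unlock.
rewrite (tlift_supp_ext (m' := fun _ _ => 0) (@supp_comWb k m)) => [|u v [/= su sv uv]].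
  by rewrite tlift.unlock (lin_supp_ext (f := flift _) (g := fun=> 0) _ _ (@supp_comWb k m))//; [lin|lin|move=> b _; rewrite flift_fbasis].
rewrite !ev_basis; have [ui|vi] := uv i im.
  by rewrite (ev_indep iT) ?su ?tens0l.
by rewrite [X in tns _ X](ev_indep iT) ?sv ?tens0r.
Qed.

End Faces.

Section CubicalCalculus.
Variables (k : comPzRingType) (R : realType).
Notation icube X := (continuousType (Iinf R) X).
Notation stx n := (nseq n None : wd).
Notation nuC := (@nu k _ (@cell_dim R _)).

Lemma cmap_cc (X W : topologicalType) (f : continuousType X W) n (F : icube X) :
  cmap f (cc k n F) = cc k n (f \o F : icube W).
Proof.
rewrite cmap.unlock cc.unlock.
have := @flift_chain_of k R X (chains k R W)
  (fun n T => chain_of k (f \o T : cube R n W)).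
rewrite /CU_map => ->; first exact: chain_of_eq.
move=> m T [i Ti]; apply: chain_of_degenerate; exists i => s t st /=.
by rewrite (Ti s t st).
Qed.

Lemma eps_cc (X : topologicalType) n (F : icube X) : eps (cc k n F) = (n == 0%N)%:R.
Proof.
rewrite eps.unlock cc.unlock.
apply: (@flift_chain_of k R X k^o (fun n T => (n == 0%N)%:R)).
by move=> [|m] T [] //= [].
Qed.

Lemma cone_cc (X W : topologicalType) (H : continuousType (I01 R * X)%type W) n (F : icube X) :
  cone H (cc k n F) = cc k n.+1 (coneF H F).
Proof.
rewrite cone.unlock {2}cc.unlock.
have := @flift_chain_of k R X (chains k R W)
  (fun n T => cc k n.+1 (coneF H (T \o resc n : icube X))).
move=> -> => [|m T dT].
  apply: cc_ext => t.
  rewrite -[LHS]/(H (truncI n.+1 t 0, F (pad (res n (tailI (truncI n.+1 t))))))%N.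
  rewrite -[RHS]/(H (truncI n.+1 t 0, F (tailI (truncI n.+1 t))))%N.
  congr (H (_, F _)); apply/funext => j; rewrite -/(truncI n _) truncE /tailI !truncE !ltnS.
  by case: (j < n)%N.
have [i im iT] := indep_degenerate dT.
apply: (@cc_degenerate _ _ _ _ i.+1); first by rewrite ltnS.
move=> s t st; rewrite -[LHS]/(H (s 0, (T \o resc m) (tailI s)))%N.
rewrite -[RHS]/(H (t 0, (T \o resc m) (tailI t)))%N st//; congr (H (_, _)).
by apply: iT => j ji; apply: st.
Qed.

Lemma ez_cc (X W : topologicalType) m n (F : icube X) (G : icube W) :
  ez (cc k m F) (cc k n G) = cc k (m + n) (prodF m F G).
Proof.
rewrite ez.unlock {1 2}cc.unlock /EZ /flift2.
pose g m (T : cube R m X) := flift (fun e : cell R W =>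
  chain_of k (cross T (cell_cube e))) (chain_of k (G \o padc R n : cube R n W)).
have gE l (T : cube R l X) : g l T = chain_of k (cross T (G \o padc R n : cube R n W)).
  apply: (@flift_chain_of k R W _ (fun n S => chain_of k (cross T S))) => q S [i Si].
  apply: chain_of_degenerate; exists (rshift l i) => s t st.
  rewrite -[LHS]/(T _, S _) -[RHS]/(T _, S _); congr (_, _).
    congr (T _); apply/funext => j; rewrite /Iproj_fun; apply: st.
    by rewrite eq_lrshift.
  by apply: Si => j ji; rewrite /Iproj_fun; apply: st; rewrite (inj_eq (@rshift_inj _ _)).
have -> := @flift_chain_of k R X _ g _ m (F \o padc R m : cube R m X); last first.
  move=> l T [i Ti]; rewrite gE; apply: chain_of_degenerate; exists (lshift n i) => s t st.
  rewrite -[LHS]/(T _, (G \o padc R n) _) -[RHS]/(T _, (G \o padc R n) _); congr (_, _).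
    by apply: Ti => j ji; rewrite /Iproj_fun; apply: st; rewrite (inj_eq (@lshift_inj _ _)).
  congr (G _); congr (padc R n _); apply/funext => j; rewrite /Iproj_fun; apply: st.
  by rewrite eq_rlshift.
rewrite gE cc.unlock; apply: chain_of_eq => // t.
rewrite -[LHS]/(F (pad _), G (pad _)) -[RHS]/(F (truncI m (pad (res (m + n) t))), G (dropI m (pad (res (m + n) t)))).
congr (F _, G _); apply/funext => j.
  rewrite truncE -/(truncI (m + n) t) truncE /pad /res; case: insubP => [i jm <-|/negbTE->//] /=.
  by rewrite ltn_ord /Iproj_fun /= ltn_addr.
rewrite /dropI -/(truncI (m + n) t) truncE ltn_add2l /pad /res /Iproj_fun.
by case: insubP => [i -> <-|/negbTE->].
Qed.

Lemma nu_cc (X : topologicalType) n (F : icube X) : nuC (cc k n F) = (-1) ^+ n *: cc k n F.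
Proof. by apply: nu_supp; exact: supp_cc. Qed.

Lemma nu_ev (X : topologicalType) (F : icube X) (x : freemod k wd) : nuC (ev F x) = ev F (nu stars x).
Proof.
have le : linear (@ev k R X F) by lin.
move: x; apply: flin_ext => [||w]; [lin|lin|].
by rewrite nu_basis (linZ _ _ le) !ev_basis nu_cc.
Qed.

Section Substitution.
Implicit Types (w : wd) (x : freemod k wd).

Definition subW w : freemod k wd -> freemod k wd :=
  flift (fun w' : wd => fbasis k (subw w w' : wd)).

Lemma lin_subW w : linear (subW w).
Proof. by rewrite /subW; exact: linearP. Qed.

Lemma subW_Some b w x : subW (Some b :: w : wd) x = consw (Some b) (subW w x).
Proof.
have ls := lin_subW; move: x; apply: flin_ext => [||w']; [exact: ls|apply: lin_comp (@lin_consw k _) (ls w)|].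
by rewrite /subW !flift_fbasis consw_basis; case: w'.
Qed.

Lemma subW_None o w x : subW (None :: w : wd) (consw o x) = consw o (subW w x).
Proof.
have ls := lin_subW; have lc := @lin_consw k.
move: x; apply: flin_ext => [||w']; [exact: lin_comp (ls _) (lc o)|exact: lin_comp (lc o) (ls w)|].
by rewrite consw_basis /subW !flift_fbasis consw_basis.
Qed.

Lemma subW_dW w : subW w (dWb k (stx (stars w))) = dWb k w.
Proof.
have ls := lin_subW.
elim: w => [|[b|] w IH] /=; first by rewrite (lin0 (ls _)).
  by rewrite /stars/= add0n subW_Some IH.
rewrite -!consw_basis !(linD _ _ (ls _)) !(linN _ (ls _)) !subW_None IH.
have -> : subW w (fbasis k (stx (stars w))) = fbasis k w; last by [].
rewrite /subW flift_fbasis; congr fbasis.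
by elim: w {IH} => //= -[b|] w IH; rewrite /stars/= ?add0n ?IH//= add1n /= IH.
Qed.

Lemma nu_subW w x : supp (fun w' : wd => size w' = stars w) x ->
  nu stars (subW w x) = subW w (nu stars x).
Proof.
move=> sx; have ls := lin_subW w.
apply: (@lin_supp_ext _ _ _ _ (fun x => nu stars (subW w x)) (fun x => subW w (nu stars x)) _ _ _ sx); [lin..|].
move=> w' sw; rewrite nu_basis (linZ _ _ ls) /subW flift_fbasis nu_basis.
by rewrite stars_subw.
Qed.

Lemma subW_comW w : tmap (subW w) (subW w) (comWb k (stx (stars w))) = comWb k w.
Proof.
have ls := lin_subW.
elim: w => [|[b|] w IH] /=.
- by rewrite tmap.unlock tlift_basis /subW !flift_fbasis tns_basis.
- rewrite /stars/= add0n -IH tmapM; [|lin..]; first by apply: tmap_ext => x; rewrite subW_Some.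
rewrite (linD _ _ (@lin_tmap _ _ _ _ _ _ _)) -IH !tmapM; [|lin..].
congr (_ + _); first by apply: tmap_ext => x; rewrite subW_None.
rewrite [LHS]tmapE [RHS]tmapE; apply: (tlift_supp_ext (@supp_comWb k _)) => u v [/= su sv _].
by rewrite !subW_None nu_subW//; exact: supp_basis.
Qed.

Lemma ev_subW (X : topologicalType) (F : icube X) w x : supp (fun w' : wd => size w' = stars w) x ->
  ev (F \o fillc R w : icube X) x = ev F (subW w x).
Proof.
move=> sx; have ls := lin_subW w.
apply: (@lin_supp_ext _ _ _ _ _ (fun x => ev F (subW w x)) _ _ _ sx); [lin|lin|].
move=> w' sw; rewrite /subW flift_fbasis !ev_basis; apply: cc_eq; first by rewrite stars_subw.
by move=> t; rewrite -[LHS]/(F (fill w (fill w' t))) fill_subw.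
Qed.

End Substitution.

(** Together with [cm_ev]: [ev F] is a map of coalgebras from the cellular chains of the cube to the
    chains of the space. A proper face is reduced to a whole cube by substitution of words
    ([subW_dW]). *)
Lemma bd_ev (X : topologicalType) (F : icube X) (x : freemod k wd) : bd (ev F x) = ev F (dW x).
Proof.
move: x; apply: flin_ext => [||w]; [lin|lin|].
rewrite ev_basis bd_cc !dW_basis ev_subW ?subW_dW//.
by have := @supp_dWb k (stx (stars w)); rewrite size_nseq.
Qed.

Lemma cm_ev (X : topologicalType) (F : icube X) (x : freemod k wd) :
  cm (ev F x) = tmap (ev F) (ev F) (comW x).
Proof.
move: x; apply: flin_ext => [||w]; [lin|lin|].
have ls := lin_subW.
rewrite ev_basis cm_cc !comW_basis -[in RHS]subW_comW tmapM; [|lin..].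
rewrite [LHS]tmapE [RHS]tmapE; apply: (tlift_supp_ext (@supp_comWb k _)) => u v [/= su sv _].
by rewrite !ev_subW//; exact: supp_basis.
Qed.

Section Augmentation.

Definition epsW : freemod k wd -> k^o := flift (fun w : wd => (stars w == 0%N)%:R : k^o).

Lemma lin_epsW : linear epsW.
Proof. by rewrite /epsW; exact: linearP. Qed.

Lemma lin_eps (X : topologicalType) : linear (@eps k R X).
Proof. by lin. Qed.

Lemma epsW_None x : epsW (consw None x) = 0.
Proof.
have le := lin_epsW; move: x; apply: (@flin_ext k wd k^o) => [||w]; [lin|exact: lin_zero|].
by rewrite consw_basis /epsW flift_fbasis.
Qed.

Lemma epsW_Some b x : epsW (consw (Some b) x) = epsW x.
Proof.
have le := lin_epsW; move: x; apply: (@flin_ext k wd k^o) => [||w]; [lin|lin|].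
by rewrite consw_basis /epsW !flift_fbasis.
Qed.

Lemma epsW_nu x : epsW (nu stars x) = epsW x.
Proof.
have le := lin_epsW; move: x; apply: (@flin_ext k wd k^o) => [||w]; [lin|lin|].
rewrite nu_basis (linZ _ _ le) /epsW flift_fbasis.
by case: (stars w) => [|i]; rewrite ?expr0 ?scale1r ?scaler0.
Qed.

Lemma eps_ev (X : topologicalType) (F : icube X) (x : freemod k wd) : eps (ev F x) = epsW x.
Proof.
have le := lin_epsW; move: x; apply: (@flin_ext k wd k^o) => [||w]; [lin|lin|].
by rewrite /epsW flift_fbasis ev_basis eps_cc.
Qed.

Lemma bilin_scalel (U V : lmodType k) (e : U -> k^o) :
  linear e -> bilin (fun (a : U) (b : V) => (e a : k) *: b).
Proof.
by move=> le; split=> [b|a] c u v; rewrite ?le ?scalerDl ?scalerDr ?scalerA// mulrC.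
Qed.

Lemma bilin_scaler (U V : lmodType k) (e : V -> k^o) :
  linear e -> bilin (fun (a : U) (b : V) => (e b : k) *: a).
Proof.
by move=> le; split=> [b|a] c u v; rewrite ?le ?scalerDl ?scalerDr ?scalerA// mulrC.
Qed.

Lemma comW_epsl x : tlift (fun a b : freemod k wd => (epsW a : k) *: b) (comW x) = x.
Proof.
have le := lin_epsW; have be := @bilin_scalel _ (freemod k wd) _ le.
have lc := @lin_consw k.
move: x; apply: flin_ext => [||w]; [lin|lin|].
move: w; apply: (@wd_ind k (fun x => tlift (fun a b : freemod k wd => (epsW a : k) *: b) (comW x) = x)) => [|[b|] w IH].
- by rewrite comW_basis tlift_basis /epsW flift_fbasis scale1r.
- rewrite comW_Some tlift_tmap// -[in RHS]IH (tlift_app _ _ (lc _)).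
  by apply: tlift_ext => u v; rewrite (linZ _ _ (lc _)) epsW_Some.
rewrite comW_None (linD _ _ (lin_tlift _)) !tlift_tmap//; [|lin..].
rewrite -tliftD -[in RHS]IH (tlift_app _ _ (lc _)); apply: tlift_ext => u v.
by rewrite (linZ _ _ (lc _)) epsW_None scale0r add0r epsW_Some epsW_nu.
Qed.

Lemma comW_epsr x : tlift (fun a b : freemod k wd => (epsW b : k) *: a) (comW x) = x.
Proof.
have le := lin_epsW; have be := @bilin_scaler (freemod k wd) _ _ le.
have lc := @lin_consw k.
move: x; apply: flin_ext => [||w]; [lin|lin|].
move: w; apply: (@wd_ind k (fun x => tlift (fun a b : freemod k wd => (epsW b : k) *: a) (comW x) = x)) => [|[b|] w IH].
- by rewrite comW_basis tlift_basis /epsW flift_fbasis scale1r.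
- rewrite comW_Some tlift_tmap// -[in RHS]IH (tlift_app _ _ (lc _)).
  by apply: tlift_ext => u v; rewrite (linZ _ _ (lc _)) epsW_Some.
rewrite comW_None (linD _ _ (lin_tlift _)) !tlift_tmap//; [|lin..].
rewrite -tliftD -[in RHS]IH (tlift_app _ _ (lc _)); apply: tlift_ext => u v.
by rewrite (linZ _ _ (lc _)) epsW_None scale0r addr0 epsW_Some.
Qed.

End Augmentation.

(** * The coalgebra identities of cubical chains *)

Section Coalgebra.
Variable X : topologicalType.
Implicit Types x y : chains k R X.

Lemma nu_bd x : bd (nuC x) = - nuC (bd x).
Proof.
have lb : linear (@bd k R X) by lin.
move: x; apply: chains_ext => [||n F]; [lin|lin|].
have le : linear (@ev k R X F) by lin.
by rewrite -ev_stars nu_ev !bd_ev dW_nu (linN _ le) nu_ev.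
Qed.

Lemma bdK x : bd (bd x) = 0.
Proof.
move: x; apply: chains_ext => [||n F]; [lin|lin|].
have le : linear (@ev k R X F) by lin.
by rewrite -ev_stars !bd_ev dWK (lin0 le).
Qed.

Lemma cm_nu x : cm (nuC x) = tmap nuC nuC (cm x).
Proof.
move: x; apply: chains_ext => [||n F]; [lin|lin|].
rewrite -ev_stars nu_ev !cm_ev comW_nu !tmapM; [|lin..].
by apply: tmap_ext => x; rewrite nu_ev.
Qed.

Lemma cm_bd x : cm (bd x) = tmap bd (fun y => y) (cm x) + tmap nuC bd (cm x).
Proof.
move: x; apply: chains_ext => [||n F]; [lin|lin|].
rewrite -ev_stars bd_ev !cm_ev comW_dW (linD _ _ (@lin_tmap _ _ _ _ _ _ _)) !tmapM; [|lin..].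
by congr (_ + _); apply: tmap_ext => x; rewrite ?bd_ev ?nu_ev.
Qed.

Lemma cmA x : tmap (fun y => y) cm (cm x) = asl (tmap cm (fun y => y) (cm x)).
Proof.
move: x; apply: chains_ext => [||n F]; [lin|lin|].
rewrite -ev_stars cm_ev !tmapM; [|lin..].
have -> : tmap (fun y : freemod k wd => ev F y) (fun y : freemod k wd => cm (ev F y)) (comW (fbasis k (stx n))) =
    tmap (ev F) (tmap (ev F) (ev F)) (tmap (fun y : freemod k wd => y) comW (comW (fbasis k (stx n)))).
  by rewrite tmapM; [apply: tmap_ext => y //; rewrite cm_ev|lin..].
rewrite comWA -asl_tmap; [|lin..]; rewrite tmapM; [|lin..].
by congr asl; apply: tmap_ext => y //; rewrite cm_ev.
Qed.

Lemma cm_epsl x : tlift (fun a b => (eps a : k) *: b) (cm x) = x.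
Proof.
move: x; apply: chains_ext => [||n F]; [lin|lin|].
have le : linear (@ev k R X F) by lin.
have be := @bilin_scalel _ (chains k R X) _ (@lin_eps X).
rewrite cm_cc tlift_tmap//; [|lin..].
rewrite -[in RHS]ev_stars -[in RHS](comW_epsl (fbasis k (stx n))) (tlift_app _ _ le).
by apply: tlift_ext => u v; rewrite (linZ _ _ le) eps_ev.
Qed.

Lemma cm_epsr x : tlift (fun a b => (eps b : k) *: a) (cm x) = x.
Proof.
move: x; apply: chains_ext => [||n F]; [lin|lin|].
have le : linear (@ev k R X F) by lin.
have be := @bilin_scaler (chains k R X) _ _ (@lin_eps X).
rewrite cm_cc tlift_tmap//; [|lin..].
rewrite -[in RHS]ev_stars -[in RHS](comW_epsr (fbasis k (stx n))) (tlift_app _ _ le).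
by apply: tlift_ext => u v; rewrite (linZ _ _ le) eps_ev.
Qed.

End Coalgebra.

End CubicalCalculus.

(** The product of tensor squares with its Koszul sign; comultiplicativity of concatenation, of the
    cross product and of continuous pairings is stated with it ([comW_cat], [cm_ez], [cm_pr]). *)
HB.lock Definition mul2 (k : comPzRingType) (A A' B B' D D' : choiceType)
    (dA : A' -> nat) (dB : B -> nat)
    (m : freemod k A -> freemod k B -> freemod k D)
    (m' : freemod k A' -> freemod k B' -> freemod k D')
    (z : freemod k (A * A')%type) (z' : freemod k (B * B')%type) :
    freemod k (D * D')%type :=
  flift2 (fun p q => (-1) ^+ (dA p.2 * dB q.1) *:
    tns (m (fbasis k p.1) (fbasis k q.1)) (m' (fbasis k p.2) (fbasis k q.2))) z z'.

Section Mul2.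
Variables (k : comPzRingType) (A A' B B' D D' : choiceType).
Variables (dA : A' -> nat) (dB : B -> nat).
Variables (m : freemod k A -> freemod k B -> freemod k D).
Variables (m' : freemod k A' -> freemod k B' -> freemod k D').
Hypotheses (bm : bilin m) (bm' : bilin m').

Lemma bilin_mul2 : bilin (mul2 dA dB m m').
Proof. by rewrite mul2.unlock; exact: bilin_flift2. Qed.

Lemma mul2_basis a a' b b' :
  mul2 dA dB m m' (fbasis k (a, a')) (fbasis k (b, b')) =
  (-1) ^+ (dA a' * dB b) *:
    tns (m (fbasis k a) (fbasis k b)) (m' (fbasis k a') (fbasis k b')).
Proof. by rewrite mul2.unlock /flift2 !flift_fbasis. Qed.

(** For homogeneous [x'] the sign depends on the parity of its degree only, so it can be absorbed
    into one [nu]. *)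
Lemma mul2_tns n x x' z : supp (fun a => dA a = n) x' ->
  mul2 dA dB m m' (tns x x') z =
  tmap (fun b => m x (if odd n then nu dB b else b)) (m' x') z.
Proof.
move=> sx'; have [bl br] := bilin_mul2.
have lodd : linear (fun b => if odd n then nu dB b else b : freemod k B).
  by case: (odd n); lin.
have bt := @bilin_tns k D D'.
pose g x x' : freemod k (B * B')%type -> freemod k (D * D')%type :=
  tlift (fun b b' => tns (m x (if odd n then nu dB b else b)) (m' x' b')).
have lg1 x'' z0 : linear (fun x => g x x'' z0).
  apply: (@lin_tliftf _ _ _ _ _ (fun x b b' => tns (m x (if odd n then nu dB b else b)) (m' x'' b'))) => b b'.
  by apply: (lin_bilinl _ bt) (bm.1 _).
have lg2 x0 z0 : linear (fun x' => g x0 x' z0).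
  apply: (@lin_tliftf _ _ _ _ _ (fun x' b b' => tns (m x0 (if odd n then nu dB b else b)) (m' x' b'))) => b b'.
  by apply: (lin_bilinr _ bt) (bm'.1 _).
rewrite tmapE -/(g x x' z); move: x; apply: flin_ext => [||a].
- by apply: lin_comp (bl z) ((bilin_tns _ _ _).1 _).
- exact: lg1.
apply: (@lin_supp_ext _ _ _ _ (fun x' => mul2 dA dB m m' (tns (fbasis k a) x') z)
  (fun x' => g (fbasis k a) x' z) _ _ _ sx').
- by apply: lin_comp (bl z) ((bilin_tns _ _ _).2 _).
- exact: lg2.
move=> a' an; move: z; apply: flin_ext => [||[b b']]; [exact: br|exact: lin_tlift|].
rewrite tns_basis mul2_basis an /g tlift_basis -signr_odd oddM.
case: (odd n); rewrite /= ?expr0 ?scale1r//.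
by rewrite nu_basis (linZ _ _ (bm.2 _)) tensZl signr_odd.
Qed.

Lemma mul2_tmap (E E' G G' : choiceType) (dE : E' -> nat) (dG : G -> nat)
    (f : freemod k E -> freemod k A) (f' : freemod k E' -> freemod k A')
    (g : freemod k G -> freemod k B) (g' : freemod k G' -> freemod k B') z z' :
  linear f -> linear f' -> linear g -> linear g' ->
  (forall e, supp (fun a => dA a = dE e) (f' (fbasis k e))) ->
  (forall x, nu dB (g x) = g (nu dG x)) ->
  mul2 dA dB m m' (tmap f f' z) (tmap g g' z') =
  mul2 dE dG (fun x y => m (f x) (g y)) (fun x y => m' (f' x) (g' y)) z z'.
Proof.
move=> lf lf' lg lg' sf ng; have [bl br] := bilin_mul2.
have bc : bilin (mul2 dE dG (fun x y => m (f x) (g y)) (fun x y => m' (f' x) (g' y))).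
  by rewrite mul2.unlock; exact: bilin_flift2.
move: z; apply: flin_ext => [||[e e']].
- by apply: lin_comp (bl _) (@lin_tmap _ _ _ _ _ _ _).
- exact: bc.1.
rewrite [in LHS]tmapE tlift_basis (mul2_tns _ _ (sf e')).
move: z'; apply: flin_ext => [||[b b']].
- by lin.
- exact: bc.2.
have lb : bilin (fun b b' => tns (m (f (fbasis k e)) (if odd (dE e') then nu dB b else b)) (m' (f' (fbasis k e')) b')).
  apply: bilin_comp (@bilin_tns _ _ _) _ (bm'.2 _).
  by case: (odd _); [apply: lin_comp (bm.2 _) (@lin_nu _ _ _)|exact: bm.2].
rewrite tmapE tlift_tmap// tlift_basis mul2.unlock /flift2 !flift_fbasis /=.
rewrite -signr_odd oddM; case: (odd (dE e')); rewrite /= ?expr0 ?scale1r//.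
rewrite ng nu_basis (linZ _ _ lg) (linZ _ _ (bm.2 _)) tensZl.
by rewrite signr_odd.
Qed.

End Mul2.

Section WordProduct.
Variable k : comPzRingType.

Notation mulW := (mul2 stars stars (@catW k) (@catW k)).

Lemma comW_cat (x y : freemod k wd) : comW (catW x y) = mulW (comW x) (comW y).
Proof.
have bc := bilin_catW k; have [bl br] := bilin_mul2 stars stars (@catW k) (@catW k).
have [bcl bcr] := bc; have lm := @lin_tmap k wd wd wd wd; have lc := @lin_consw k.
have ltf (f g : freemod k wd -> freemod k wd) (z' : freemod k (wd * wd)%type) : linear (fun z => mulW (tmap f g z) z') by exact: (@lin_comp _ _ _ _ (fun z => mulW z z') (tmap f g) (bl z') (lm f g)).
have lft (f g : freemod k wd -> freemod k wd) (z' : freemod k (wd * wd)%type) : linear (fun z => tmap f g (mulW z z')) by exact: (@lin_comp _ _ _ _ (tmap f g) (fun z => mulW z z') (lm f g) (bl z')).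
have lft2 (f g : freemod k wd -> freemod k wd) (z : freemod k (wd * wd)%type) : linear (fun z' => tmap f g (mulW z z')) by exact: (@lin_comp _ _ _ _ (tmap f g) (mulW z) (lm f g) (br z)).
have key o o' z z' : stars [:: o'] = 0%N ->
    tmap (consw o) (consw o') (mulW z z') = mulW (tmap (consw o) (consw o') z) z'.
  move=> so; move: z; apply: flin_ext => [||[p1 p2]] //.
  move: z'; apply: flin_ext => [||[q1 q2]] //.
  rewrite mul2_basis (linZ _ _ (lm _ _)) tmap_tens// ?tmapE ?tlift_basis// !consw_basis tns_basis mul2_basis.
  rewrite -!consw_basis -!catW_cons !consw_basis; congr ((-1) ^+ (_ * _) *: _).
  by move: so; rewrite /stars /= addn0 => ->.
have key2 z z' : tmap (fun x => consw (Some false) (nu stars x)) (consw None) (mulW z z') =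
    mulW (tmap (fun x => consw (Some false) (nu stars x)) (consw None) z) z'.
  move: z; apply: flin_ext => [||[p1 p2]] //.
  move: z'; apply: flin_ext => [||[q1 q2]] //.
  rewrite mul2_basis (linZ _ _ (lm _ _)) tmap_tens// ?tmapE ?tlift_basis//; [|lin].
  rewrite !catW_basis !nu_basis !(linZ _ _ (lc _)) !consw_basis !tensZl !tns_basis.
  rewrite (linZ _ _ (bl _)) mul2_basis !catW_basis tns_basis !scalerA /=.
  by congr (_ *: _); rewrite /stars /= count_cat mulnDl mul1n !exprD; ring.
move: x; apply: flin_ext => [||w]; [lin|by apply: lin_comp (bl _) (@lin_comW _)|].
move: w; apply: (@wd_ind k (fun x => comW (catW x y) = mulW (comW x) (comW y))) => [|[b|] w IH].
- have c0 z : catW (fbasis k ([::] : wd)) z = z.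
    by move: z; apply: flin_ext => [||v]; [exact: bcr|exact: lin_id|rewrite catW_basis].
  rewrite c0 comW_basis /=; move: (comW y) => z; move: z; apply: flin_ext => [||[u v]]; [lin|exact: br|].
  by rewrite mul2_basis /stars /= mul0n expr0 scale1r !catW_basis tns_basis.
- by rewrite catW_cons !comW_Some IH key.
rewrite catW_cons !comW_None IH key// key2 -(linD _ _ (bl _)).
by [].
Qed.

End WordProduct.

Section WordDegrees.
Variable k : comPzRingType.

Lemma supp_stars_dWb (w : wd) : supp (fun w' : wd => (stars w').+1 = stars w) (dWb k w).
Proof.
elim: w => [|[b|] w IH] /=; first exact: supp0.
  apply: (supp_lin (lin_consw _) _ IH) => w' w'w; rewrite consw_basis.
  exact: supp_basis.
apply: suppD; first by apply: suppD; [|apply: suppN]; apply: supp_basis; rewrite /stars/= add1n.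
apply: suppN; apply: (supp_lin (lin_consw _) _ IH) => w' w'w; rewrite consw_basis.
by apply: supp_basis; move: w'w; rewrite /stars/= !add1n => ->.
Qed.

Lemma supp_stars_comWb (w : wd) :
  supp (fun p : wd * wd => (stars p.1 + stars p.2)%N = stars w) (comWb k w).
Proof.
have lc := @lin_consw k.
elim: w => [|[b|] w IH] /=; first exact: supp_basis.
  apply: (supp_lin (@lin_tmap _ _ _ _ _ _ _) _ IH) => -[u v] uv.
  by rewrite tmapE tlift_basis !consw_basis tns_basis; apply: supp_basis.
apply: suppD; apply: (supp_lin (@lin_tmap _ _ _ _ _ _ _) _ IH) => -[u v] /= uv;
  rewrite tmapE tlift_basis ?nu_basis ?(linZ _ _ (lc _)) !consw_basis ?tensZl tns_basis.
  by apply: supp_basis; move: uv; rewrite /stars/= => <-; rewrite !add0n addnA.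
by apply: suppZ; apply: supp_basis; move: uv; rewrite /stars/= => <-; rewrite !add0n addnCA.
Qed.

End WordDegrees.

Section EndMap.
Variables (R : realType) (X W : topologicalType) (H : continuousType (I01 R * X)%type W).
Lemma cone_end_continuous b : continuous (fun x : X => H (endpt R b, x)).
Proof.
apply: (@continuous_comp_all _ _ _ (fun x : X => (endpt R b, x)) H); last exact: cts_fun.
by apply: pair_continuous; [exact: cst_continuous|move=> x; exact: cvg_id].
Qed.
Definition cone_end b : continuousType X W := mkcts (@cone_end_continuous b).
End EndMap.

Lemma fst_cts (X Z : topologicalType) : continuous (@fst X Z).
Proof. by move=> x; exact: cvg_fst. Qed.

Lemma snd_cts (X Z : topologicalType) : continuous (@snd X Z).
Proof. by move=> x; exact: cvg_snd. Qed.

Section PairMaps.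
Variables (X Y Z W : topologicalType) (f : continuousType X Y) (g : continuousType Z W).
Lemma prodmap_continuous : continuous (fun p : X * Z => (f p.1, g p.2)).
Proof.
apply: pair_continuous.
  by apply: (@continuous_comp_all _ _ _ fst f); [exact: fst_cts|exact: cts_fun].
by apply: (@continuous_comp_all _ _ _ snd g); [exact: snd_cts|exact: cts_fun].
Qed.
Definition prodmap : continuousType (X * Z)%type (Y * W)%type := mkcts prodmap_continuous.
End PairMaps.

Section AssocMap.
Variables (X Y Z : topologicalType).
Lemma assocmap_continuous : continuous (fun p : X * Y * Z => (p.1.1, (p.1.2, p.2))).
Proof.
apply: pair_continuous; last apply: pair_continuous; last exact: snd_cts.
  by apply: (@continuous_comp_all _ _ _ fst fst); exact: fst_cts.
by apply: (@continuous_comp_all _ _ _ fst snd); [exact: fst_cts|exact: snd_cts].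
Qed.
Definition assocmap : continuousType (X * Y * Z)%type (X * (Y * Z))%type :=
  mkcts assocmap_continuous.

Lemma inpair_continuous (x : X) : continuous (fun y : Y => (x, y)).
Proof. by apply: pair_continuous; [exact: cst_continuous|move=> y; exact: cvg_id]. Qed.
Definition inpair (x : X) : continuousType Y (X * Y)%type := mkcts (@inpair_continuous x).
End AssocMap.

(** * Induced maps and cross products *)

Section CubicalOperations.
Variables (k : comPzRingType) (R : realType).
Notation icube X := (continuousType (Iinf R) X).
Notation stx n := (nseq n None : wd).
Notation nuC := (@nu k _ (@cell_dim R _)).

Lemma cmap_ev (X W : topologicalType) (f : continuousType X W) (F : icube X) (x : freemod k wd) :
  cmap f (ev F x) = ev (f \o F : icube W) x.
Proof.
move: x; apply: flin_ext => [||w]; [lin|lin|].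
by rewrite !ev_basis cmap_cc; exact: cc_eq.
Qed.

Section Cmap.
Variables (X W : topologicalType) (f : continuousType X W).
Implicit Types x : chains k R X.

Lemma cmap_bd x : cmap f (bd x) = bd (cmap f x).
Proof.
move: x; apply: chains_ext => [||n F]; [lin|lin|].
by rewrite -ev_stars bd_ev !cmap_ev bd_ev.
Qed.

Lemma cm_cmap x : cm (cmap f x) = tmap (cmap f) (cmap f) (cm x).
Proof.
move: x; apply: chains_ext => [||n F]; [lin|lin|].
rewrite -ev_stars cmap_ev !cm_ev tmapM; [|lin..].
by apply: tmap_ext => x; rewrite cmap_ev.
Qed.

Lemma nu_cmap x : nuC (cmap f x) = cmap f (nuC x).
Proof.
move: x; apply: chains_ext => [||n F]; [lin|lin|].
have lf : linear (@cmap k R _ _ f) by lin.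
by rewrite cmap_cc !nu_cc (linZ _ _ lf) cmap_cc.
Qed.

Lemma eps_cmap x : eps (cmap f x) = eps x.
Proof.
move: x; apply: (@chains_ext k R X k^o) => [||n F]; [lin|lin|].
by rewrite cmap_cc !eps_cc.
Qed.

Lemma supp_cmap n x :
  supp (fun c => cell_dim c = n) x -> supp (fun c => cell_dim c = n) (cmap f x).
Proof.
apply: supp_lin => [|c <-]; first by lin.
by rewrite cell_cc cmap_cc; exact: supp_cc.
Qed.

Lemma cmap_ext (g : continuousType X W) x : f =1 g -> cmap f x = cmap g x.
Proof. by move=> /continuousEP ->. Qed.

Lemma cmap_comp (V : topologicalType) (g : continuousType W V) x :
  cmap g (cmap f x) = cmap (g \o f : continuousType X V) x.
Proof.
move: x; apply: chains_ext => [||n F]; [lin|lin|].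
by rewrite !cmap_cc; exact: cc_eq.
Qed.
End Cmap.

Lemma cmap_id (X : topologicalType) (f : continuousType X X) (x : chains k R X) :
  f =1 id -> cmap f x = x.
Proof.
move=> fid; move: x; apply: chains_ext => [||n F]; [lin|lin|].
by rewrite cmap_cc; apply: cc_eq => // t /=; rewrite fid.
Qed.

Lemma supp_bd (X : topologicalType) n (x : chains k R X) :
  supp (fun c => cell_dim c = n) x -> supp (fun c => (cell_dim c).+1 = n) (bd x).
Proof.
apply: supp_lin => [|c <-]; first by lin.
rewrite cell_cc bd_cc dW_basis.
have lev : linear (@ev k R X (cell_cube c \o resc _ : icube X)) by lin.
apply: (supp_lin lev _ (@supp_stars_dWb k (stx (cell_dim c)))) => w.
rewrite /stars count_nseq mul1n => wd; rewrite ev_basis.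
by apply: suppW (@supp_cc _ _ _ _ _) => c' ->.
Qed.

Lemma supp_cm (X : topologicalType) n (x : chains k R X) :
  supp (fun c => cell_dim c = n) x ->
  supp (fun p => (cell_dim p.1 + cell_dim p.2)%N = n) (cm x).
Proof.
apply: supp_lin => [|c <-]; first by lin.
rewrite cell_cc cm_cc comW_basis.
apply: (supp_lin (@lin_tmap _ _ _ _ _ _ _) _ (@supp_stars_comWb k (stx (cell_dim c)))) => -[u v] /=.
rewrite {3}/stars count_nseq mul1n => uv; rewrite tmapE tlift_basis !ev_basis.
by apply: suppW (supp_tens (@supp_cc _ _ _ _ _) (@supp_cc _ _ _ _ _)) => -[c1 c2] /= [-> ->].
Qed.

Section Product.
Variables X W : topologicalType.
Implicit Types (x : chains k R X) (w : chains k R W).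

Lemma bilin_ez : bilin (@ez k R X W).
Proof. by rewrite ez.unlock; exact: bilin_flift2. Qed.

Lemma fill_cat_trunc (u v : seq (option bool)) (t : Iinf R) :
  truncI (size u) (fill (u ++ v) t) = fill u (truncI (stars u) t).
Proof.
elim: u t => [|[b|] u IH] t; first by apply/funext => j; rewrite /= !truncE.
  apply/funext => -[|j]; first by rewrite truncE.
  by rewrite truncE ltnS -[RHS]/(fill u (truncI (stars u) t) j) -IH truncE.
have tT : tailI (truncI (stars (None :: u)) t) = truncI (stars u) (tailI t).
  by apply/funext => j; rewrite /tailI !truncE /stars /= add1n ltnS.
apply/funext => -[|j]; first by rewrite /= !truncE.
by rewrite truncE ltnS -[RHS]/(fill u (tailI _) j) tT -IH truncE.
Qed.

Lemma fill_cat_drop (u v : seq (option bool)) (t : Iinf R) :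
  dropI (size u) (fill (u ++ v) t) = fill v (dropI (stars u) t).
Proof.
elim: u t => [|[b|] u IH] t //.
  by rewrite -[RHS]/(fill v (dropI (stars u) t)) -IH.
by rewrite -[RHS]/(fill v (dropI (stars u) (tailI t))) -IH.
Qed.

(** The product cube reads [F] from the first [m] coordinates and [G] from the others. Hence
    concatenation of words describes its faces only if the left words have length exactly [m]. *)
Lemma ez_ev m (F : icube X) (G : icube W) (x y : freemod k wd) :
  supp (fun w : wd => size w = m) x ->
  ez (ev F x) (ev G y) = ev (prodF m F G) (catW x y).
Proof.
move=> sx; have be := bilin_ez; have bc := bilin_catW k.
have leF : linear (@ev k R _ F) by lin.
have leG : linear (@ev k R _ G) by lin.
apply: (@lin_supp_ext _ _ _ _ (fun u : freemod k wd => ez (ev F u) (ev G y)) (fun u : freemod k wd => ev (prodF m F G) (catW u y)) _ _ _ sx).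
- by apply: lin_comp (be.1 _) leF.
- by apply: lin_comp (bc.1 _); lin.
move=> u um; move: y; apply: flin_ext => [||v].
- by apply: lin_comp (be.2 _) leG.
- by apply: lin_comp (bc.2 _); lin.
rewrite catW_basis !ev_basis ez_cc; apply: cc_eq; first by rewrite /stars count_cat.
move=> t; rewrite -[LHS]/(F (fill u (truncI (stars u) t)), G (fill v (dropI (stars u) t))).
rewrite -[RHS]/(F (truncI m (fill (u ++ v) t)), G (dropI m (fill (u ++ v) t))) -um.
by rewrite fill_cat_trunc fill_cat_drop.
Qed.

Let supp_stx m : supp (fun w : wd => size w = m) (fbasis k (stx m)).
Proof. by apply: supp_basis; rewrite size_nseq. Qed.

Lemma bd_ez x w : bd (ez x w) = ez (bd x) w + ez (nuC x) (bd w).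
Proof.
have be := bilin_ez; have [bl br] := be.
move: x; apply: chains_ext => [||m F]; [lin|lin|].
move: w; apply: chains_ext => [||n G]; [lin|lin|].
have le (V : topologicalType) (F' : icube V) : linear (@ev k R V F') by lin.
rewrite -!ev_stars nu_ev !bd_ev !(@ez_ev m)//.
- by rewrite bd_ev dW_cat (linD _ _ (le _ _)).
- by rewrite nu_basis; apply: suppZ.
by rewrite dW_basis; have := @supp_dWb k (stx m); rewrite size_nseq.
Qed.

Lemma nu_ez x w : nuC (ez x w) = ez (nuC x) (nuC w).
Proof.
have be := bilin_ez; have [bl br] := be.
move: x; apply: chains_ext => [||m F]; [lin|lin|].
move: w; apply: chains_ext => [||n G]; [lin|lin|].
rewrite ez_cc !nu_cc (linZ _ _ (bl _)) (linZ _ _ (br _)) ez_cc scalerA.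
by rewrite exprD.
Qed.

Lemma supp_ez m n x w : supp (fun c => cell_dim c = m) x ->
  supp (fun c => cell_dim c = n) w -> supp (fun c => cell_dim c = (m + n)%N) (ez x w).
Proof.
move=> sx sw; have [bl br] := bilin_ez.
apply: (supp_lin (bl w) _ sx) => c cm; apply: (supp_lin (br _) _ sw) => e en.
by rewrite !cell_cc ez_cc -cm -en; exact: supp_cc.
Qed.

(** Concatenation of words is comultiplicative, and [ev] carries concatenation to the cross
    product. *)
Lemma cm_ez x w :
  cm (ez x w) = mul2 (@cell_dim R X) (@cell_dim R W) ez ez (cm x) (cm w).
Proof.
have be := bilin_ez; have [bl br] := be.
have [bml bmr] := bilin_mul2 (@cell_dim R X) (@cell_dim R W) (@ez k R X W) (@ez k R X W).
move: x; apply: chains_ext => [||m F]; [lin|by apply: lin_comp (bml _) _; lin|].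
move: w; apply: chains_ext => [||n G]; [lin|by apply: lin_comp (bmr _) _; lin|].
have bc := bilin_catW k.
rewrite -!ev_stars (@ez_ev m)// !cm_ev comW_cat.
rewrite (@mul2_tmap k _ _ _ _ _ _ _ _ _ _ be be _ _ _ _ stars stars) //; [|lin..| |]; first last.
- by move=> x; rewrite nu_ev.
- by move=> w; rewrite ev_basis; exact: supp_cc.
have le (V : topologicalType) (F' : icube V) : linear (@ev k R V F') by lin.
have [wl wr] := bilin_mul2 stars stars (@catW k) (@catW k).
have bm' : bilin (mul2 stars stars (fun u v : freemod k wd => ez (ev F u) (ev G v)) (fun u v : freemod k wd => ez (ev F u) (ev G v))).
  by rewrite mul2.unlock; exact: bilin_flift2.
have lt := @lin_tmap _ _ _ _ _ (ev (prodF m F G) : freemod k wd -> _) (ev (prodF m F G) : freemod k wd -> _).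
have sc := @supp_comWb k m; rewrite -comW_basis in sc.
apply: (@lin_supp_ext _ _ _ _ (fun z => tmap (ev (prodF m F G)) (ev (prodF m F G)) (mul2 stars stars (@catW k) (@catW k) z (comW (fbasis k (stx n)))))
  (fun z => mul2 stars stars _ _ z (comW (fbasis k (stx n)))) _ _ _ sc).
- by apply: lin_comp lt (wl _).
- exact: bm'.1.
move=> [u u'] [/= su su' _]; move: (comW (fbasis k (stx n))) => z'; move: z'; apply: flin_ext => [||[v v']].
- by apply: lin_comp lt (wr _).
- exact: bm'.2.
rewrite !mul2_basis (linZ _ _ lt) tmap_tens//=; [|exact: le|exact: le].
by rewrite !(@ez_ev m)//; exact: supp_basis.
Qed.

End Product.
End CubicalOperations.

(** * Cones of homotopies, and products with points *)

Section ConeAndPoints.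
Variables (k : comPzRingType) (R : realType).
Notation icube X := (continuousType (Iinf R) X).
Notation nuC := (@nu k _ (@cell_dim R _)).

Section Cone.
Variables (X W : topologicalType) (H : continuousType (I01 R * X)%type W).
Implicit Types x : chains k R X.

Lemma cone_ev (F : icube X) (x : freemod k wd) :
  cone H (ev F x) = ev (coneF H F) (consw None x).
Proof.
move: x; apply: flin_ext => [||w]; [lin|lin|].
by rewrite consw_basis !ev_basis cone_cc; apply: cc_eq.
Qed.

Lemma ev_coneF_end b (F : icube X) (x : freemod k wd) :
  ev (coneF H F) (consw (Some b) x) = cmap (cone_end H b) (ev F x).
Proof.
move: x; apply: flin_ext => [||w]; [lin|lin|].
by rewrite consw_basis !ev_basis cmap_cc; apply: cc_eq.
Qed.

(** The homotopy parameter is a new first coordinate, so this is the boundary of a word that begins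
    with the free letter. *)
Lemma bd_cone x :
  bd (cone H x) = cmap (cone_end H true) x - cmap (cone_end H false) x - cone H (bd x).
Proof.
move: x; apply: chains_ext => [||n F]; [lin|lin|].
have le : linear (@ev k R _ (coneF H F)) by lin.
rewrite -ev_stars cone_ev !bd_ev dW_None !(linD _ _ le) !(linN _ le).
by rewrite !ev_coneF_end cone_ev.
Qed.

Lemma nu_cone x : nuC (cone H x) = - cone H (nuC x).
Proof.
have lc : linear (@cone k R _ _ H) by lin.
move: x; apply: chains_ext => [||n F]; [lin|lin|].
by rewrite cone_cc !nu_cc (linZ _ _ lc) cone_cc exprS mulN1r scaleNr.
Qed.

(** Read off from the diagonal of a leading free letter. It makes the cone a coderivation homotopy
    between its two ends, which is what the extension to the cobar construction requires. *)
Lemma cm_cone x :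
  cm (cone H x) = tmap (cone H) (cmap (cone_end H true)) (cm x) +
    tmap (fun x => cmap (cone_end H false) (nuC x)) (cone H) (cm x).
Proof.
move: x; apply: chains_ext => [||n F]; [lin|lin|].
rewrite -ev_stars cone_ev !cm_ev comW_None (linD _ _ (@lin_tmap _ _ _ _ _ _ _)).
rewrite !tmapM; [|lin..].
by congr (_ + _); apply: tmap_ext => u; rewrite ?ev_coneF_end ?cone_ev ?nu_ev.
Qed.

Lemma supp_cone n x : supp (fun c => cell_dim c = n) x ->
  supp (fun c => cell_dim c = n.+1) (cone H x).
Proof.
apply: supp_lin => [|c <-]; first by lin.
by rewrite cell_cc cone_cc; exact: supp_cc.
Qed.

Lemma cmap_cone (V : topologicalType) (g : continuousType W V) x :
  cmap g (cone H x) = cone (g \o H : continuousType (I01 R * X)%type V) x.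
Proof.
move: x; apply: chains_ext => [||n F]; [lin|lin|].
by rewrite !cone_cc cmap_cc; apply: cc_eq.
Qed.

Lemma cone_const x : (forall s t y, H (s, y) = H (t, y)) -> cone H x = 0.
Proof.
move=> Hc; move: x; apply: chains_ext => [||n F]; [lin|exact: lin_zero|].
rewrite cone_cc; apply: (@cc_degenerate _ _ _ _ 0) => // s t st.
rewrite -[LHS]/(H (s 0%N, F (tailI s))) -[RHS]/(H (t 0%N, F (tailI t))) (Hc _ (t 0%N)).
by congr (H (_, F _)); apply/funext => j; apply: st.
Qed.

Lemma cone_cmap (V : topologicalType) (f : continuousType V X)
    (H' : continuousType (I01 R * V)%type W) (x : chains k R V) :
  (forall t v, H' (t, v) = H (t, f v)) -> cone H (cmap f x) = cone H' x.
Proof.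
move=> HH; move: x; apply: chains_ext => [||n F]; [lin|lin|].
by rewrite cmap_cc !cone_cc; apply: cc_eq => // t; rewrite -[RHS]/(H' (t 0%N, F (tailI t))) HH.
Qed.

End Cone.

Definition ptc (X : topologicalType) (a : X) : chains k R X := cc k 0 (cst a : icube X).

Lemma ptc_eq (X : topologicalType) (F : icube X) a : (forall t, F t = a) -> cc k 0 F = ptc a.
Proof. by move=> Fa; apply: cc_eq. Qed.

Lemma supp_ptc (X : topologicalType) (a : X) : supp (fun c => cell_dim c = 0%N) (ptc a).
Proof. exact: supp_cc. Qed.

Lemma cmap_ptc (X W : topologicalType) (f : continuousType X W) a :
  cmap f (ptc a) = ptc (f a).
Proof. by rewrite /ptc cmap_cc; apply: cc_eq. Qed.

Lemma eps_ptc (X : topologicalType) (a : X) : eps (ptc a) = 1.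
Proof. by rewrite /ptc eps_cc. Qed.

Lemma bd_ptc (X : topologicalType) (a : X) : bd (ptc a) = 0.
Proof.
have le : linear (@ev k R X (cst a)) by lin.
by rewrite /ptc bd_cc dW_basis /= (lin0 le).
Qed.

Lemma nu_ptc (X : topologicalType) (a : X) : nuC (ptc a) = ptc a.
Proof. by rewrite /ptc nu_cc expr0 scale1r. Qed.

Lemma cm_ptc (X : topologicalType) (a : X) : cm (ptc a) = tns (ptc a) (ptc a).
Proof.
rewrite /ptc cm_cc comW_basis /= tmapE tlift_basis ev_basis.
by congr tns; apply: cc_eq.
Qed.

Section Cross.
Variables X W : topologicalType.
Implicit Types (x : chains k R X) (w : chains k R W).

Lemma ez_ptl (a : X) w : ez (ptc a) w = cmap (inpair W a) w.
Proof.
have [bl br] := @bilin_ez k R X W.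
move: w; apply: chains_ext => [||n F]; [exact: br|lin|].
by rewrite /ptc ez_cc cmap_cc; apply: cc_eq.
Qed.

Lemma ez_ptr x (b : W) (f : continuousType X (X * W)%type) : (forall a, f a = (a, b)) ->
  ez x (ptc b) = cmap f x.
Proof.
move=> fE; have [bl br] := @bilin_ez k R X W.
move: x; apply: chains_ext => [||n F]; [exact: bl|lin|].
rewrite /ptc ez_cc cmap_cc addn0; apply: cc_ext => t.
rewrite -[LHS]/(F (truncI n (truncI n t)), b) -[RHS]/(f (F (truncI n t))) fE.
by congr (F _, _); apply/funext => j; rewrite !truncE; case: (j < n)%N.
Qed.

Lemma cmap_ez (X' W' : topologicalType) (f : continuousType X X') (g : continuousType W W')
    x w : ez (cmap f x) (cmap g w) = cmap (prodmap f g) (ez x w).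
Proof.
have [bl br] := @bilin_ez k R X W; have [bl' br'] := @bilin_ez k R X' W'.
have lf : linear (@cmap k R _ _ f) by lin.
have lg : linear (@cmap k R _ _ g) by lin.
have lp : linear (@cmap k R _ _ (prodmap f g)) by lin.
move: x; apply: chains_ext => [||m F].
- exact: (@lin_comp _ _ _ _ (fun u => ez u (cmap g w)) _ (bl' _) lf).
- exact: (@lin_comp _ _ _ _ _ (fun x => ez x w) lp (bl _)).
move: w; apply: chains_ext => [||n G].
- exact: (@lin_comp _ _ _ _ _ _ (br' _) lg).
- exact: (@lin_comp _ _ _ _ _ _ lp (br _)).
by rewrite !cmap_cc !ez_cc cmap_cc; apply: cc_eq.
Qed.

(** The composite does not see its first coordinate, which belongs to the factor of positive
    dimension. *)
Lemma cmap_ez_degenerate (V : topologicalType) (f : continuousType (X * W)%type V) n x w :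
  (forall a a' b, f (a, b) = f (a', b)) -> supp (fun c => cell_dim c = n.+1) x ->
  cmap f (ez x w) = 0.
Proof.
move=> fE sx; have [bl br] := @bilin_ez k R X W.
have lf : linear (@cmap k R _ _ f) by lin.
apply: (@lin_supp_ext _ _ _ _ (fun x => cmap f (ez x w)) (fun=> 0) _ _ _ sx).
- exact: (@lin_comp _ _ _ _ _ (fun x => ez x w) lf (bl _)).
- exact: lin_zero.
move=> c cn; move: w; apply: chains_ext => [||m G].
- exact: (@lin_comp _ _ _ _ _ _ lf (br _)).
- exact: lin_zero.
rewrite cell_cc ez_cc cmap_cc; apply: (@cc_degenerate _ _ _ _ 0); first by rewrite cn.
move=> s t st; set F := (_ \o _ : icube X).
rewrite -[LHS]/(f (F (truncI _ s), G (dropI (cell_dim c) s))).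
rewrite -[RHS]/(f (F (truncI _ t), G (dropI (cell_dim c) t))).
have -> : dropI (cell_dim c) s = dropI (cell_dim c) t.
  by apply/funext => j; apply: st; rewrite cn.
exact: fE.
Qed.
End Cross.

Lemma ezA (X Y Z : topologicalType) (x : chains k R X) (y : chains k R Y) (z : chains k R Z) :
  cmap (assocmap X Y Z) (ez (ez x y) z) = ez x (ez y z).
Proof.
have [bxl bxr] := @bilin_ez k R X Y; have [byl byr] := @bilin_ez k R Y Z.
have [b1l b1r] := @bilin_ez k R (X * Y)%type Z.
have [b2l b2r] := @bilin_ez k R X (Y * Z)%type.
have lf : linear (@cmap k R _ _ (assocmap X Y Z)) by lin.
move: x; apply: chains_ext => [||m F].
- apply: (@lin_comp _ _ _ _ _ (fun x => ez (ez x y) z) lf).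
  exact: (@lin_comp _ _ _ _ (fun u => ez u z) (fun x => ez x y) (b1l _) (bxl _)).
- exact: b2l.
move: y; apply: chains_ext => [||n G].
- apply: (@lin_comp _ _ _ _ _ (fun y => ez (ez (cc k m F) y) z) lf).
  exact: (@lin_comp _ _ _ _ (fun u => ez u z) _ (b1l _) (bxr _)).
- exact: (@lin_comp _ _ _ _ _ (fun y => ez y z) (b2r _) (byl _)).
move: z; apply: chains_ext => [||l H].
- exact: (@lin_comp _ _ _ _ _ _ lf (b1r _)).
- exact: (@lin_comp _ _ _ _ _ _ (b2r _) (byr _)).
rewrite !ez_cc cmap_cc; apply: cc_eq; first by rewrite addnA.
move=> t.
rewrite -[LHS]/(F (truncI m (truncI (m + n) t)), (G (dropI m (truncI (m + n) t)), H (dropI (m + n) t))).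
rewrite -[RHS]/(F (truncI m t), (G (truncI n (dropI m t)), H (dropI n (dropI m t)))).
congr (F _, (G _, H _)); apply/funext => j.
- by rewrite !truncE; case: ltnP => // jm; rewrite ltn_addr.
- by rewrite /dropI !truncE ltn_add2l.
- by rewrite /dropI addnA.
Qed.

End ConeAndPoints.

(** * The coalgebra axioms in terms of tensor squares instead of words *)

Section CoalgebraCriterion.
Variables (k : comPzRingType) (C : precoalg k).
Notation A := (cgen C).
Notation d := (cdiff C).
Notation com := (ccomul C).

Lemma lin_word1 : linear (@word1 k C).
Proof. by move=> a x y; rewrite /word1 linearP. Qed.
Lemma lin_word2 : linear (@word2 k C).
Proof. by move=> a x y; rewrite /word2 linearP. Qed.
Lemma bilin_fcat : bilin (@fcat k C).
Proof. exact: bilin_flift2. Qed.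

Lemma word2_basis (a b : A) : word2 (fbasis k (a, b)) = fbasis k ([:: a; b] : word C).
Proof. by rewrite /word2 flift_fbasis. Qed.

Lemma fcat_word1 x y : fcat (word1 x) (word1 y) = word2 (tns x y) :> freemod k (word C).
Proof.
have [fl fr] := bilin_fcat; have [tl tr] := @bilin_tns k A A.
have l1 := lin_word1; have l2 := lin_word2.
move: x; apply: flin_ext => [||a].
- exact: (@lin_comp _ _ _ _ (fun u => fcat u (word1 y)) _ (fl _) l1).
- exact: (@lin_comp _ _ _ _ _ (fun x => tns x y) l2 (tl _)).
move: y; apply: flin_ext => [||b].
- exact: (@lin_comp _ _ _ _ _ _ (fr _) l1).
- exact: (@lin_comp _ _ _ _ _ _ l2 (tr _)).
by rewrite !word1_basis fcat_basis tns_basis word2_basis.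
Qed.

Lemma fcat_nil (x : freemod k (word C)) : fcat x (fbasis k ([::] : word C)) = x.
Proof.
move: x; apply: flin_ext => [||w]; [exact: bilin_fcat.1|exact: lin_id|].
by rewrite fcat_basis cats0.
Qed.

Lemma tdiff_word2 z :
  tdiff (word2 z) = word2 (tmap d (fun x => x) z + tmap (nu (@cdeg k C)) d z) :> freemod k (word C).
Proof.
have [fl fr] := bilin_fcat; have l1 := lin_word1; have l2 := lin_word2.
have ld : linear (@tdiff k C) by move=> a x y; rewrite /tdiff linearP.
move: z; apply: flin_ext => [||[a b]].
- exact: (@lin_comp _ _ _ _ _ _ ld l2).
- by apply: (@lin_comp _ _ _ _ _ _ l2); lin.
rewrite word2_basis /tdiff flift_fbasis /= fcat0 scaler0 addr0 fcat_nil.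
rewrite !tmapE !tlift_basis (linD _ _ l2) -word1_basis !fcat_word1 nu_basis.
by rewrite tensZl (linZ _ _ l2).
Qed.

Definition word3 : freemod k (A * (A * A))%type -> freemod k (word C) :=
  flift (fun p => fbasis k ([:: p.1; p.2.1; p.2.2] : word C)).

Lemma lin_word3 : linear word3.
Proof. by move=> a x y; rewrite /word3 linearP. Qed.

Lemma fcat_word12 x z : fcat (word1 x) (word2 z) = word3 (tns x z).
Proof.
have [fl fr] := bilin_fcat; have [tl tr] := @bilin_tns k A (A * A)%type.
have l1 := lin_word1; have l2 := lin_word2; have l3 := lin_word3.
move: x; apply: flin_ext => [||a].
- exact: (@lin_comp _ _ _ _ (fun u => fcat u (word2 z)) _ (fl _) l1).
- exact: (@lin_comp _ _ _ _ _ (fun x => tns x z) l3 (tl _)).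
move: z; apply: flin_ext => [||[b c]].
- exact: (@lin_comp _ _ _ _ _ _ (fr _) l2).
- exact: (@lin_comp _ _ _ _ _ _ l3 (tr _)).
by rewrite word1_basis word2_basis fcat_basis tns_basis /word3 flift_fbasis.
Qed.

Lemma fcat_word21 z x : fcat (word2 z) (word1 x) = word3 (asl (tns z x)).
Proof.
have [fl fr] := bilin_fcat; have [tl tr] := @bilin_tns k (A * A)%type A.
have l1 := lin_word1; have l2 := lin_word2; have l3 := lin_word3; have la := @lin_asl k A A A.
have l3a : linear (fun u => word3 (asl u)) by exact: lin_comp.
move: x; apply: flin_ext => [||a].
- exact: (@lin_comp _ _ _ _ _ _ (fr _) l1).
- exact: (@lin_comp _ _ _ _ _ _ l3a (tr _)).
move: z; apply: flin_ext => [||[b c]].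
- exact: (@lin_comp _ _ _ _ (fun u => fcat u (word1 (fbasis k a))) _ (fl _) l2).
- exact: (@lin_comp _ _ _ _ _ (fun z => tns z (fbasis k a)) l3a (tl _)).
by rewrite word1_basis word2_basis fcat_basis tns_basis asl.unlock flift_fbasis /word3 flift_fbasis.
Qed.

Lemma lin_tcomul i : linear (@tcomul k C i).
Proof. by move=> a x y; rewrite /tcomul linearP. Qed.

Lemma tcomul0_word2 z : tcomul 0 (word2 z) = word3 (asl (tmap com (fun x => x) z)).
Proof.
have lt := lin_tcomul; have l2 := lin_word2; have l3 := lin_word3; have la := @lin_asl k A A A.
move: z; apply: flin_ext => [||[a b]].
- exact: (@lin_comp _ _ _ _ _ _ (lt _) l2).
- by apply: (@lin_comp _ _ _ _ _ _ l3); lin.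
rewrite word2_basis /tcomul flift_fbasis /= tmapE tlift_basis -fcat_word21.
by rewrite word1_basis.
Qed.

Lemma tcomul1_word2 z : tcomul 1 (word2 z) = word3 (tmap (fun x => x) com z).
Proof.
have lt := lin_tcomul; have l2 := lin_word2; have l3 := lin_word3.
move: z; apply: flin_ext => [||[a b]].
- exact: (@lin_comp _ _ _ _ _ _ (lt _) l2).
- by apply: (@lin_comp _ _ _ _ _ _ l3); lin.
by rewrite word2_basis /tcomul flift_fbasis /= fcat_nil tmapE tlift_basis fcat_word12.
Qed.

Lemma chain_coalgebra_criterion :
  (forall b : A, supp (fun c => (cdeg c).+1 = cdeg b) (d (fbasis k b))) ->
  (forall b : A, supp (fun p => (cdeg p.1 + cdeg p.2)%N = cdeg b) (com (fbasis k b))) ->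
  (forall b : A, ccounit C (fbasis k b) != 0 -> cdeg b = 0%N) ->
  (forall x, d (d x) = 0) ->
  (forall x, com (d x) = tmap d (fun y => y) (com x) + tmap (nu (@cdeg k C)) d (com x)) ->
  (forall x, ccounit C (d x) = 0) ->
  (forall x, tmap (fun y => y) com (com x) = asl (tmap com (fun y => y) (com x))) ->
  (forall x, tlift (fun a b => (ccounit C a : k) *: b) (com x) = x) ->
  (forall x, tlift (fun a b => (ccounit C b : k) *: a) (com x) = x) ->
  chain_coalgebra C.
Proof.
move=> ddeg cdeg edeg dd cd ed cA el er; split=> // [x|x|x|x].
- by rewrite tdiff_word2 cd.
- by rewrite tcomul0_word2 tcomul1_word2 cA.
- by have := el x; rewrite tlift.unlock.
- by have := er x; rewrite tlift.unlock.
Qed.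

End CoalgebraCriterion.

Section CubicalCoalgebra.
Variables (k : comPzRingType) (R : realType) (X : topologicalType).

Lemma eps_bd (x : chains k R X) : eps (bd x) = 0.
Proof.
have le : linear (@eps k R X) by lin.
have lb : linear (@bd k R X) by lin.
move: x; apply: (@chains_ext k R X k^o) => [||n F]; [lin|exact: lin_zero|].
have lev : linear (@ev k R X F) by lin.
case: n => [|[|n]]; rewrite bd_cc dW_basis.
- by rewrite (lin0 lev) (lin0 le).
- rewrite /= (lin0 (@lin_consw k _)) subr0 (linD _ _ lev) (linN _ lev).
  by rewrite (linD _ _ le) (linN _ le) !ev_basis !eps_cc subrr.
have sx : supp (fun w : wd => stars w = n.+1) (dWb k (nseq n.+2 None)).
  apply: suppW (@supp_stars_dWb k _) => w; rewrite /stars count_nseq mul1n => -[].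
  by [].
apply: (@lin_supp_ext k wd k^o _ (fun u => eps (ev F u)) (fun=> 0) _ _ _ sx) => [| |w wn].
- lin.
- exact: lin_zero.
by rewrite ev_basis eps_cc wn.
Qed.

Lemma chain_coalgebra_CU : chain_coalgebra (CU k R X).
Proof.
have dE x : cdiff (CU k R X) x = bd x by rewrite bd.unlock.
have cE x : ccomul (CU k R X) x = cm x by rewrite cm.unlock.
have eE x : ccounit (CU k R X) x = eps x by rewrite eps.unlock.
apply: chain_coalgebra_criterion => [b|b|b|x|x|x|x|x|x].
- by rewrite dE; apply: supp_bd; exact: supp_basis.
- by rewrite cE; apply: supp_cm; exact: supp_basis.
- rewrite eE cell_cc eps_cc => nz.
  by apply/eqP; apply: contraNT nz => /negbTE ->; rewrite eqxx.
- by rewrite !dE bdK.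
- rewrite dE !cE cm_bd; congr (_ + _); apply: tmap_ext => y //; by rewrite dE.
- by rewrite eE dE eps_bd.
- rewrite !cE [LHS](_ : _ = tmap (fun y => y) cm (cm x)); last by apply: tmap_ext => y; rewrite ?cE.
  by rewrite cmA; congr asl; apply: tmap_ext => y; rewrite ?cE.
- rewrite cE -[RHS]cm_epsl; apply: tlift_ext => a b; by rewrite eE.
- rewrite cE -[RHS]cm_epsr; apply: tlift_ext => a b; by rewrite eE.
Qed.

End CubicalCoalgebra.

(** * The circle and the chains T_n *)

Section CircleTopology.
Variable R : realType.

Lemma S1_continuous (X : topologicalType) (f : X -> S1 R) :
  continuous (fun x => (val (f x)).1) -> continuous (fun x => (val (f x)).2) ->
  continuous f.
Proof.
move=> c1 c2; apply: (@continuous_comp_initial _ _ _ set_val).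
rewrite (_ : set_val \o f = fun x => ((val (f x)).1, (val (f x)).2)).
  exact: pair_continuous.
by apply/funext => x /=; rewrite -surjective_pairing.
Qed.

Lemma S1_val_continuous : continuous (fun x : S1 R => val x).
Proof. exact: initial_continuous. Qed.

Lemma S1_fst_continuous : continuous (fun x : S1 R => (val x).1).
Proof.
by apply: (@continuous_comp_all _ _ _ (fun x : S1 R => val x) fst);
  [exact: S1_val_continuous|exact: fst_cts].
Qed.

Lemma S1_snd_continuous : continuous (fun x : S1 R => (val x).2).
Proof.
by apply: (@continuous_comp_all _ _ _ (fun x : S1 R => val x) snd);
  [exact: S1_val_continuous|exact: snd_cts].
Qed.

Lemma mulS1_continuous (X : topologicalType) (f g : X -> S1 R) :
  continuous f -> continuous g -> continuous (fun x => mulS1 (f x) (g x)).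
Proof.
move=> cf cg.
have c1 (h : X -> S1 R) : continuous h -> continuous (fun x => (val (h x)).1).
  by move=> ch; apply: (@continuous_comp_all _ _ _ h (fun x : S1 R => (val x).1)); [|exact: S1_fst_continuous].
have c2 (h : X -> S1 R) : continuous h -> continuous (fun x => (val (h x)).2).
  by move=> ch; apply: (@continuous_comp_all _ _ _ h (fun x : S1 R => (val x).2)); [|exact: S1_snd_continuous].
apply: S1_continuous => x /=.
  by apply: cvgB; apply: cvgM; [apply: c1|apply: c1|apply: c2|apply: c2].
by apply: cvgD; apply: cvgM; [apply: c1|apply: c2|apply: c2|apply: c1].
Qed.

Lemma invS1_continuous (X : topologicalType) (f : X -> S1 R) :
  continuous f -> continuous (fun x => invS1 (f x)).
Proof.
move=> cf; apply: S1_continuous => x /=.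
  by apply: (@continuous_comp_all _ _ _ f (fun x : S1 R => (val x).1)); [|exact: S1_fst_continuous].
apply: cvgN.
by apply: (@continuous_comp_all _ _ _ f (fun x : S1 R => (val x).2)); [|exact: S1_snd_continuous].
Qed.

Lemma mulS1p_continuous : continuous (fun p : S1 R * S1 R => mulS1 p.1 p.2).
Proof. by apply: mulS1_continuous; [exact: fst_cts|exact: snd_cts]. Qed.
Definition mulS1c : continuousType (S1 R * S1 R)%type (S1 R) := mkcts mulS1p_continuous.

Lemma mulS1C : commutative (@mulS1 R).
Proof. by move=> x y; apply: S1_eq => /=; ring. Qed.

Lemma expiD x y : expi R (x + y) = mulS1 (expi R x) (expi R y).
Proof. by apply: S1_eq => /=; rewrite mulrDr ?cosD ?sinD //; ring. Qed.

Lemma expi0 : expi R 0 = oneS1 R.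
Proof. by apply: S1_eq => /=; rewrite mulr0 ?cos0 ?sin0. Qed.

Lemma expi1 : expi R 1 = oneS1 R.
Proof. by apply: S1_eq => /=; rewrite mulr1 mulr_natl ?cos2pi ?sin2pi. Qed.

Lemma mulI_continuous : continuous (fun p : I01 R * R => set_val p.1 * p.2 : R).
Proof.
move=> p; apply: cvgM.
  apply: (@continuous_comp_all _ _ _ fst (set_val : I01 R -> R)); first exact: fst_cts.
  exact: initial_continuous.
exact: snd_cts.
Qed.
Definition mulI : continuousType (I01 R * R)%type R := mkcts mulI_continuous.

End CircleTopology.

(** * Products of chains induced by continuous pairings *)

Section Pairing.
Variables (k : comPzRingType) (R : realType).
Notation nuC := (@nu k _ (@cell_dim R _)).

Section Pair.
Variables (X Y Z : topologicalType) (a : continuousType (X * Y)%type Z).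
Implicit Types (x : chains k R X) (y : chains k R Y).

Definition pr x y : chains k R Z := cmap a (ez x y).

Lemma bilin_pr : bilin pr.
Proof. by apply: bilin_app; [exact: bilin_ez|lin]. Qed.

Lemma bd_pr x y : bd (pr x y) = pr (bd x) y + pr (nuC x) (bd y).
Proof.
have la : linear (@cmap k R _ _ a) by lin.
by rewrite /pr -cmap_bd bd_ez (linD _ _ la).
Qed.

Lemma supp_pr m n x y : supp (fun c => cell_dim c = m) x ->
  supp (fun c => cell_dim c = n) y -> supp (fun c => cell_dim c = (m + n)%N) (pr x y).
Proof. by move=> sx sy; apply: supp_cmap; exact: supp_ez. Qed.

End Pair.

Lemma mul2_app (A A' B B' D D' E E' : choiceType) (dA : A' -> nat) (dB : B -> nat)
    (m : freemod k A -> freemod k B -> freemod k D)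
    (m' : freemod k A' -> freemod k B' -> freemod k D')
    (f : freemod k D -> freemod k E) (f' : freemod k D' -> freemod k E') z z' :
  bilin m -> bilin m' -> linear f -> linear f' ->
  tmap f f' (mul2 dA dB m m' z z') =
  mul2 dA dB (fun x y => f (m x y)) (fun x y => f' (m' x y)) z z'.
Proof.
move=> bm bm' lf lf'; have [ml mr] := bilin_mul2 dA dB m m'.
have [nl nr] := bilin_mul2 dA dB (fun x y => f (m x y)) (fun x y => f' (m' x y)).
have lt := @lin_tmap _ _ _ _ _ f f'.
move: z; apply: flin_ext => [||[a a']]; [exact: (@lin_comp _ _ _ _ _ _ lt (ml _))|exact: nl|].
move: z'; apply: flin_ext => [||[b b']]; [exact: (@lin_comp _ _ _ _ _ _ lt (mr _))|exact: nr|].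
by rewrite !mul2_basis (linZ _ _ lt) tmap_tens.
Qed.

Lemma cm_pr (X Y Z : topologicalType) (a : continuousType (X * Y)%type Z) x y :
  cm (pr a x y) = mul2 (@cell_dim R X) (@cell_dim R Y) (pr a) (pr a) (cm x) (cm y).
Proof.
have la : linear (@cmap k R _ _ a) by lin.
have be := @bilin_ez k R X Y.
by rewrite /pr cm_cmap cm_ez mul2_app.
Qed.

Lemma pr_cmap (X Y X' Y' Z : topologicalType) (a : continuousType (X * Y)%type Z)
    (a' : continuousType (X' * Y')%type Z) (f : continuousType X' X) (g : continuousType Y' Y)
    (x : chains k R X') (y : chains k R Y') :
  (forall u v, a (f u, g v) = a' (u, v)) -> pr a (cmap f x) (cmap g y) = pr a' x y.
Proof.
by move=> aa; rewrite /pr cmap_ez cmap_comp; apply: cmap_ext => -[u v]; rewrite -aa.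
Qed.

Lemma cmap_pr (X Y Z Z' : topologicalType) (a : continuousType (X * Y)%type Z)
    (a' : continuousType (X * Y)%type Z') (h : continuousType Z Z')
    (x : chains k R X) (y : chains k R Y) :
  (forall p, h (a p) = a' p) -> cmap h (pr a x y) = pr a' x y.
Proof. by move=> ha; rewrite /pr cmap_comp; apply: cmap_ext => p /=; rewrite ha. Qed.

Lemma pr_assoc (X Y Z XY YZ W : topologicalType) (a : continuousType (X * Y)%type XY)
    (b : continuousType (XY * Z)%type W) (c : continuousType (Y * Z)%type YZ)
    (e : continuousType (X * YZ)%type W) (x : chains k R X) (y : chains k R Y) (z : chains k R Z) :
  (forall u v w, b (a (u, v), w) = e (u, c (v, w))) ->
  pr b (pr a x y) z = pr e x (pr c y z).
Proof.
move=> abce; rewrite /pr.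
rewrite -[z in LHS](@cmap_id _ _ _ idfun)// cmap_ez cmap_comp.
rewrite -[x in RHS](@cmap_id _ _ _ idfun)// cmap_ez cmap_comp -ezA cmap_comp.
by apply: cmap_ext => -[[u v] w] /=; exact: abce.
Qed.

Lemma pr_ptl (X Y Z : topologicalType) (a : continuousType (X * Y)%type Z)
    (f : continuousType Y Z) p (y : chains k R Y) :
  (forall v, a (p, v) = f v) -> pr a (ptc k R p) y = cmap f y.
Proof. by move=> af; rewrite /pr ez_ptl cmap_comp; apply: cmap_ext => v /=; rewrite -af. Qed.

Lemma inpairr_continuous (X Y : topologicalType) (p : Y) : continuous (fun x : X => (x, p)).
Proof. by apply: pair_continuous; [move=> y; exact: cvg_id|exact: cst_continuous]. Qed.

Lemma pr_ptr (X Y Z : topologicalType) (a : continuousType (X * Y)%type Z)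
    (f : continuousType X Z) p (x : chains k R X) :
  (forall u, a (u, p) = f u) -> pr a x (ptc k R p) = cmap f x.
Proof.
move=> af; pose h : continuousType X (X * Y)%type := mkcts (@inpairr_continuous X Y p).
by rewrite /pr (@ez_ptr _ _ _ _ _ _ h)// cmap_comp; apply: cmap_ext => v /=; rewrite -af.
Qed.

Lemma cmap_cst_eps (X W : topologicalType) (f : continuousType X W) (w : W) (x : chains k R X) :
  (forall y, f y = w) -> cmap f x = (eps x : k) *: ptc k R w.
Proof.
move=> fw; have le : linear (@eps k R X) by lin.
move: x; apply: chains_ext => [||n F]; [lin| |].
  exact: (@lin_bilinl _ _ _ _ _ _ _ (ptc k R w) (@bilin_scalel k _ _ _ le) (@lin_id _ _)).
rewrite cmap_cc eps_cc; case: n => [|n]; last first.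
  rewrite scale0r; apply: (@cc_degenerate _ _ _ _ 0) => // s t _.
  by rewrite /= !fw.
by rewrite scale1r; apply: ptc_eq => t /=; rewrite fw.
Qed.

Lemma eps_nu (X : topologicalType) (x : chains k R X) : eps (nuC x) = eps x.
Proof.
have le : linear (@eps k R X) by lin.
move: x; apply: (@chains_ext k R X k^o) => [||n F]; [lin|lin|].
by rewrite nu_cc (linZ _ _ le) eps_cc; case: n => [|n]; rewrite ?expr0 ?scale1r ?scaler0.
Qed.

End Pairing.

Section Convolution.
Variables (V : nmodType).

(** Both sides run over the triples with sum [n], grouped by the last or by the first entry.
    Cancellations of triple products below have this form. *)
Lemma conv3 (F : nat -> nat -> nat -> V) n :
  \sum_(i < n.+1) \sum_(j < i.+1) F j (i - j)%N (n - i)%N =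
  \sum_(i < n.+1) \sum_(j < (n - i).+1) F i j (n - i - j)%N.
Proof.
have E (G : nat -> nat -> V) m : \sum_(i < m.+1) \sum_(j < i.+1) G i j =
    \sum_(i < m.+1) \sum_(j < m.+1 | (j <= i)%N) G i j.
  by apply: eq_bigr => i _; rewrite (big_ord_widen_cond m.+1 xpredT (G i)) ?ltn_ord.
rewrite (E (fun i j => F j (i - j)%N (n - i)%N)) (exchange_big_dep xpredT) //=.
apply: eq_bigr => j _.
rewrite -(big_mkord (fun i => j <= i)%N (fun i => F j (i - j)%N (n - i)%N)).
rewrite (big_cat_nat (n := j)) //=; last exact: ltnW.
rewrite big_nat_cond big1 ?add0r => [|i /andP[/andP[_ ij]]]; last by rewrite leqNgt ij.
rewrite -{1}[nat_of_ord j]add0n big_addn big_mkord subSn ?leq_ord//.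
rewrite big_mkcond /=; apply: eq_bigr => i _; rewrite leq_addl addnK.
by rewrite subnDA subnAC.
Qed.

Lemma conv_rev (F : nat -> nat -> V) n :
  \sum_(i < n.+1) F i (n - i)%N = \sum_(i < n.+1) F (n - i)%N i.
Proof.
rewrite (reindex_inj rev_ord_inj) /=; apply: eq_bigr => i _.
by rewrite subSS subKn// -ltnS.
Qed.

End Convolution.

Section CircleChains.
Variables (k : comPzRingType) (R : realType).
Notation nuC := (@nu k _ (@cell_dim R _)).

(* The index is shifted by one: |tR n| = |sC n| = 2 n - 1, and the            *)
(* zero terms at n = 0 let all sums over i + j = n start at 0.                *)
Definition tR (n : nat) : chains k R R := if n is m.+1 then Ttilde k R m else 0.
Definition sC (n : nat) : chains k R (S1 R) := cmap (expi R) (tR n).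

Lemma sC_Tchain n : sC n.+1 = Tchain k R n.
Proof. by rewrite /sC cmap.unlock. Qed.

Lemma sC0 : sC 0 = 0.
Proof.
have lf : linear (@cmap k R _ _ (expi R)) by lin.
by rewrite /sC /tR (lin0 lf).
Qed.

Notation pR := (pr (k := k) (R := R) (addc R)).
Notation pS := (pr (k := k) (R := R) (mulS1c R)).

Lemma chains_mulE (x y : chains k R R) : chains_mul x y = pR x y.
Proof. by rewrite /pr /chains_mul ez.unlock cmap.unlock. Qed.

Lemma sigmaE (x : chains k R R) : sigma x = cone (mulI R) x.
Proof.
rewrite cone.unlock; apply: (congr1 (fun f => flift f x)); apply/funext => c.
rewrite chain_of_cc; apply: cc_ext => t; set u := truncI _ t.
rewrite -[LHS]/(set_val (u 0%N) * cell_cube c (fun i => u (lift ord0 i))).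
rewrite -[RHS]/(set_val (u 0%N) * cell_cube c (fun i => u i.+1)).
by congr (_ * cell_cube c _).
Qed.

(** The base over which [tR n] is a cone with apex 0 ([tR_cone]). The point 1 for [n = 1] makes the
    cone the path t |-> t, so that the first chain fits the same recursion. *)
Definition bR (n : nat) : chains k R R :=
  (if n == 1%N then ptc k R (1 : R) else 0) + \sum_(i < n.+1) pR (tR i) (tR (n - i)).

Lemma tR_cone n : tR n = cone (mulI R) (bR n).
Proof.
have lc : linear (@cone k R _ _ (mulI R)) by lin.
have [pl p_r] := @bilin_pr k R _ _ _ (addc R).
case: n => [|[|n]].
- rewrite /bR big_ord1 /= (lin0 (p_r _)) addr0 (lin0 lc).
  by [].
- rewrite /bR eqxx big1 ?addr0; last first.
    by case=> [[|[|//]] ?] _ /=; rewrite ?subnn ?(lin0 (pl _)) ?(lin0 (p_r _)).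
  rewrite /tR.
  rewrite Ttilde0 chain_of_cc /ptc cone_cc; apply: cc_eq => // t.
  by rewrite -[RHS]/(_ * 1) mulr1.
rewrite /bR /= add0r TtildeS// sigmaE; congr cone.
rewrite big_ord_recl big_ord_recr /= (lin0 (pl _)) /bump /= !add1n subSS subnn.
rewrite (lin0 (p_r _)) add0r addr0 big_add1 big_mkord; apply: eq_bigr => i _ /=.
by rewrite chains_mulE /bump /= !add1n subSS subSn//= -ltnS.
Qed.

Lemma supp_tR n : supp (fun c => (cell_dim c).+1 = n.*2) (tR n).
Proof.
elim/ltn_ind: n => n IH; rewrite tR_cone.
case: n IH => [|n] IH.
  rewrite -tR_cone; exact: supp0.
apply: (@suppW _ _ (fun c => cell_dim c = n.*2.+1)) => [c ->|]; first by rewrite doubleS.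
apply: supp_cone; apply: suppD.
  by case: eqP => [[->]|_]; [exact: supp_ptc|exact: supp0].
apply: supp_sum => i _; have [pl p_r] := @bilin_pr k R _ _ _ (addc R).
have [ltin|lein] := ltnP i n.+1; last first.
  have -> : nat_of_ord i = n.+1 by apply/eqP; rewrite eqn_leq lein -ltnS ltn_ord.
  by rewrite subnn (lin0 (p_r _)); exact: supp0.
case: (nat_of_ord i) ltin => [_|j ltjn]; first by rewrite (lin0 (pl _)); exact: supp0.
have s1 := IH j.+1 ltjn; have s2 := IH (n.+1 - j.+1)%N (leq_ltn_trans (leq_subr j n) (leqnn _)).
rewrite subSS in s2 *.
have [m nE] : exists m, n = (j + m.+1)%N.
  by exists (n - j.+1)%N; rewrite -subSn ?subSS ?subnKC// ltnW.
rewrite nE addKn in s2 *.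
apply: (@suppW _ _ (fun c => cell_dim c = (j.*2.+1 + m.*2.+1)%N)) => [c ->|]; first by lia.
by apply: supp_pr; [apply: suppW s1|apply: suppW s2] => c; rewrite doubleS => -[].
Qed.

Lemma nu_tR n : nuC (tR n) = - tR n.
Proof.
case: n => [|n]; first by rewrite (lin0 (@lin_nu _ _ _)) oppr0.
rewrite (@nu_supp _ _ _ n.*2.+1).
  by rewrite -signr_odd /= odd_double /= expr1 scaleN1r.
by apply: suppW (@supp_tR n.+1) => c; rewrite doubleS => -[].
Qed.

Lemma supp_sC n : supp (fun c => (cell_dim c).+1 = n.*2) (sC n).
Proof.
case: n => [|n]; first by rewrite sC0; exact: supp0.
apply: (@suppW _ _ (fun c => cell_dim c = n.*2.+1)) => [c ->|]; first by rewrite doubleS.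
by apply: supp_cmap; apply: suppW (@supp_tR n.+1) => c; rewrite doubleS => -[].
Qed.

Lemma nu_sC n : nuC (sC n) = - sC n.
Proof.
have lf : linear (@cmap k R _ _ (expi R)) by lin.
by rewrite /sC nu_cmap nu_tR (linN _ lf).
Qed.

Lemma bR_eps n : eps (bR n) = (n == 1%N)%:R.
Proof.
have le : linear (@eps k R R) by lin.
rewrite /bR (linD _ _ le) (linsum _ _ _ le) big1 ?addr0 => [|i _].
  by case: eqP => _; rewrite ?eps_ptc ?(lin0 le).
have [pl p_r] := @bilin_pr k R _ _ _ (addc R).
case: (nat_of_ord i) => [|j]; first by rewrite (lin0 (pl _)) (lin0 le).
rewrite /pr eps_cmap; have [bl br] := @bilin_ez k R R R.
apply: (@lin_supp_ext k _ k^o _ (fun u => eps (ez u _)) (fun=> 0) _ _ _ (@supp_tR j.+1)) => [| |c].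
- lin.
- exact: lin_zero.
rewrite doubleS => -[cE]; move: (tR _) => y.
move: y; apply: (@chains_ext k R R k^o) => [||m F].
- lin.
- exact: lin_zero.
by rewrite cell_cc ez_cc eps_cc cE.
Qed.

(** The boundary of a cone over a cycle is the cycle minus its augmentation times the apex, and by
    [bR_eps] the augmentation contributes for [n = 1] only. *)
Lemma bd_tR n : bd (tR n) = (if n == 1%N then ptc k R (1 : R) - ptc k R 0 else 0) +
  \sum_(i < n.+1) pR (tR i) (tR (n - i)).
Proof.
have [pl p_r] := @bilin_pr k R _ _ _ (addc R).
have lb : linear (@bd k R R) by lin.
have lc : linear (@cone k R _ _ (mulI R)) by lin.
elim/ltn_ind: n => n IH.
(* The base is a cycle: the triple products from the two factors cancel by associativity, and the
   end points from index 1 cancel because multiplication by a point of the line is the same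
   translation on either side. *)
have dB : bd (bR n) = 0.
  rewrite /bR (linD _ _ lb) (linsum _ _ _ lb).
  rewrite [X in X + _](_ : _ = 0) ?add0r; last by case: ifP; rewrite ?bd_ptc ?(lin0 lb).
  pose e i : chains k R R := if i == 1%N then ptc k R (1 : R) - ptc k R 0 else 0.
  pose F i j l := pR (pR (tR i) (tR j)) (tR l).
  have stepl (i : 'I_n.+1) : pR (bd (tR i)) (tR (n - i)) =
      pR (e i) (tR (n - i)) + \sum_(j < i.+1) F j (i - j)%N (n - i)%N.
    have [lein|] := ltnP i n.
      by rewrite IH// (linD _ _ (pl _)) (linsum _ _ _ (pl _)).
    rewrite -subn_eq0 => /eqP ->; rewrite !(lin0 (p_r _)) add0r big1// => j _.
    by rewrite /F (lin0 (p_r _)).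
  have stepr (i : 'I_n.+1) : pR (tR i) (bd (tR (n - i))) =
      pR (tR i) (e (n - i)%N) + \sum_(j < (n - i).+1) F i j (n - i - j)%N.
    have asc u v w : pR u (pR v w) = pR (pR u v) w.
      by apply/esym/pr_assoc => x y z; exact: esym (addrA x y z).
    case: i => -[|i] lein /=.
      by rewrite !(lin0 (pl _)) add0r big1// => j _; rewrite /F !(lin0 (pl _)).
    rewrite IH; last by rewrite subnS prednK ?leq_subr// subn_gt0.
    rewrite (linD _ _ (p_r _)) (linsum _ _ _ (p_r _)); congr (_ + _).
    by apply: eq_bigr => j _; rewrite asc.
  under eq_bigr => i _ do rewrite bd_pr nu_tR (linN _ (pl _)) stepl stepr.
  rewrite sumrB !big_split /= (conv3 F) opprD addrACA subrr addr0.
  rewrite [X in _ - X](_ : _ = \sum_(i < n.+1) pR (e i) (tR (n - i))) ?subrr//.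
  rewrite (conv_rev (fun i j => pR (tR i) (e j))) /=; apply: eq_bigr => i _.
  rewrite /e; case: ifP => _; last by rewrite (lin0 (pl _)) (lin0 (p_r _)).
  rewrite !(linD _ _ (p_r _)) !(linD _ _ (pl _)) !(linN _ (p_r _)) !(linN _ (pl _)).
  have cE c : exists f : continuousType R R, forall u, f u = c + u.
    by exists (addc R \o inpair R c : continuousType R R).
  have comm c x : pR x (ptc k R (c : R)) = pR (ptc k R c) x.
    have [f fE] := cE c; transitivity (cmap f x).
      by apply: pr_ptr => u; rewrite fE; exact: addrC.
    by apply/esym; apply: pr_ptl => u; rewrite fE.
  by rewrite !comm.
rewrite tR_cone bd_cone dB (lin0 lc) subr0 cmap_id => [|x]; last first.
  by rewrite -[LHS]/(1 * x) mul1r.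
rewrite (@cmap_cst_eps _ _ _ _ _ (0 : R)) => [|y]; last by rewrite -[LHS]/(0 * y) mul0r.
rewrite bR_eps /bR; case: eqP => _; rewrite ?scale1r ?scale0r ?subr0//.
by rewrite addrAC.
Qed.

Lemma cmap_expi_pr x y : cmap (expi R) (pR x y) = pS (cmap (expi R) x) (cmap (expi R) y).
Proof.
pose h : continuousType (R * R)%type (S1 R) := expi R \o addc R.
rewrite (@cmap_pr _ _ _ _ _ _ _ h)//; apply/esym; apply: (@pr_cmap _ _ _ _ _ _ _ _ h) => u v.
exact: esym (expiD u v).
Qed.

(** The points 0 and 1 of the line become equal on the circle, which removes the extra term of
    [bd_tR]. What remains is a Maurer-Cartan equation for the family. *)
Lemma bd_sC n : bd (sC n) = \sum_(i < n.+1) pS (sC i) (sC (n - i)).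
Proof.
have lf : linear (@cmap k R _ _ (expi R)) by lin.
rewrite /sC -cmap_bd bd_tR (linD _ _ lf) (linsum _ _ _ lf).
rewrite [X in X + _](_ : _ = 0) ?add0r.
  by apply: eq_bigr => i _; rewrite cmap_expi_pr.
case: eqP => _; last by rewrite (lin0 lf).
by rewrite (linD _ _ lf) (linN _ lf) !cmap_ptc expi0 expi1 subrr.
Qed.

Notation one := (ptc k R (oneS1 R)).

Lemma pS1l x : pS one x = x.
Proof.
rewrite (@pr_ptl _ _ _ _ _ _ idfun) ?cmap_id// => v /=; exact: mul1S1.
Qed.
Lemma pS1r x : pS x one = x.
Proof.
rewrite (@pr_ptr _ _ _ _ _ _ idfun) ?cmap_id// => v /=; exact: mulS11.
Qed.

(** On the line these chains are not primitive, their end points being distinct. Projecting the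
    second factor alone to the circle repairs this and keeps the first factor on the line, where
    [cm_cone] still applies and the induction can go on. *)
Lemma cm_tR n : tmap (fun x => x) (cmap (expi R)) (cm (tR n)) =
  tns (tR n) one + tns (ptc k R (0 : R)) (sC n).
Proof.
have [pl p_r] := @bilin_pr k R _ _ _ (addc R).
have [ql qr] := @bilin_pr k R _ _ _ (mulS1c R).
have bpR := @bilin_pr k R _ _ _ (addc R); have bpS := @bilin_pr k R _ _ _ (mulS1c R).
have lf : linear (@cmap k R _ _ (expi R)) by lin.
have lcm : linear (@cm k R R) by lin.
have lid := @lin_id k (chains k R R).
have lt := @lin_tmap _ _ _ _ _ (fun x : chains k R R => x) (@cmap k R _ _ (expi R)).
have ls : linear (@cone k R _ _ (mulI R)) by lin.
elim/ltn_ind: n => n IH.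
have cB : tmap (fun x => x) (cmap (expi R)) (cm (bR n)) =
    tns (bR n) one + tns (ptc k R (0 : R)) (\sum_(i < n.+1) pS (sC i) (sC (n - i))).
  have [tl tr] := @bilin_tns k (cell R R) (cell R (S1 R)).
  rewrite /bR !(linD _ _ lcm) (linD _ _ lt) !(linsum _ _ _ lcm) (linsum _ _ _ lt).
  rewrite (linD _ _ (tl _)) -addrA; congr (_ + _).
    case: eqP => _; last by rewrite (lin0 lcm) (lin0 lt) (lin0 (tl _)).
    by rewrite cm_ptc tmap_tens// cmap_ptc expi1.
  rewrite (linsum _ _ _ (tl _)) (linsum _ _ _ (tr _)).
  pose G i j := tmap (fun x => x) (cmap (expi R)) (cm (pR (tR i) (tR j))) =
      tns (pR (tR i) (tR j)) one + tns (tR i) (sC j) -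
      tns (tR j) (sC i) + tns (ptc k R (0 : R)) (pS (sC i) (sC j)).
  have nil i j : tR i = 0 \/ tR j = 0 -> G i j.
    rewrite /G /sC => -[] ->.
      by rewrite !(lin0 (pl _)) (lin0 lcm) (lin0 lt) (lin0 lf) !(lin0 (ql _)) !(lin0 (tr _)) !(lin0 (tl _)) subr0 !addr0.
    by rewrite !(lin0 (p_r _)) (lin0 lcm) (lin0 lt) (lin0 lf) !(lin0 (qr _)) !(lin0 (tr _)) !(lin0 (tl _)) subr0 !addr0.
  have term i j : (i + j)%N = n -> G i j.
    case: i => [_|i']; first by apply: nil; left.
    case: j => [_|j' ij]; first by apply: nil; right.
    have IHi : tmap (fun x => x) (cmap (expi R)) (cm (tR i'.+1)) = tns (tR i'.+1) one + tns (ptc k R (0 : R)) (sC i'.+1).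
      by apply: IH; rewrite -ij addnS ltnS leq_addr.
    have IHj : tmap (fun x => x) (cmap (expi R)) (cm (tR j'.+1)) = tns (tR j'.+1) one + tns (ptc k R (0 : R)) (sC j'.+1).
      by apply: IH; rewrite -ij addSn ltnS leq_addl.
    rewrite /G.
    move: (tR i'.+1) (tR j'.+1) IHi IHj (@nu_tR j'.+1) (@supp_sC i'.+1) => x y IHx IHy ny ssi.
    rewrite cm_pr mul2_app//.
    have -> : mul2 (@cell_dim R R) (@cell_dim R R) pR (fun x y => cmap (expi R) (pR x y)) (cm x) (cm y) =
      mul2 (@cell_dim R (S1 R)) (@cell_dim R R) pR pS (tmap (fun x => x) (cmap (expi R)) (cm x)) (tmap (fun x => x) (cmap (expi R)) (cm y)).
      rewrite (@mul2_tmap k _ _ _ _ _ _ _ _ _ _ bpR bpS _ _ _ _ (@cell_dim R R) (@cell_dim R R))//.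
        by congr (mul2 _ _ _ _ _ _); apply/funext => u; apply/funext => v; rewrite cmap_expi_pr.
      by move=> c; apply: supp_cmap; exact: supp_basis.
    have [ml mr] := bilin_mul2 (@cell_dim R (S1 R)) (@cell_dim R R) pR pS.
    rewrite IHx IHy (linD _ _ (ml _)).
    rewrite (@mul2_tns k _ _ _ _ _ _ _ _ _ _ bpR bpS 0%N _ _ _ (@supp_ptc k R _ _)).
    rewrite (@mul2_tns k _ _ _ _ _ _ _ _ _ _ bpR bpS i'.*2.+1); last first.
      by apply: suppW ssi => c; rewrite doubleS => -[].
    rewrite /= odd_double /= !(linD _ _ (@lin_tmap _ _ _ _ _ _ _)).
    rewrite !tmap_tens; [|first [exact: p_r|exact: qr|
      exact: (@lin_comp _ _ _ _ _ _ (p_r _) (@lin_nu _ _ _))]..].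
    rewrite ny nu_ptc !pS1l !pS1r (linN _ (p_r _)) (linN _ (tl _)).
    have [f0 f0E] : exists f : continuousType R R, forall u, f u = u by exists idfun.
    have zl u : pR (ptc k R (0 : R)) u = u.
      by rewrite (@pr_ptl _ _ _ _ _ _ f0) ?cmap_id// => v; rewrite f0E -[LHS]/(0 + v) add0r.
    have zr u : pR u (ptc k R (0 : R)) = u.
      by rewrite (@pr_ptr _ _ _ _ _ _ f0) ?cmap_id// => v; rewrite f0E -[LHS]/(v + 0) addr0.
    by rewrite !zl !zr !addrA.
  under eq_bigr => i _ do rewrite (term i (n - i)%N) ?subnKC -1?ltnS//.
  (* The mixed terms cancel after reversing one sum; their opposite signs come from the odd degree
     of the chains. *)
  rewrite !big_split /= -!addrA; congr (_ + _); rewrite addrA sumrN.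
  by rewrite (conv_rev (fun i j => tns (tR i) (sC j))) subrr add0r.
rewrite {1}tR_cone cm_cone (linD _ _ lt) !tmapM; [|lin..].
rewrite [X in X + _](_ : _ = tns (tR n) one).
  congr (_ + _); rewrite /sC tR_cone.
  have [tl tr] := @bilin_tns k (cell R R) (cell R (S1 R)).
  have lg : linear (fun y => tns (ptc k R (0 : R)) (cmap (expi R) (cone (mulI R) y))).
    by apply: (@lin_comp _ _ _ _ _ _ (tr _)); lin.
  rewrite -[in RHS](cm_epsl (bR n)) (tlift_app _ _ lg) tmapE; apply: tlift_ext => u v.
  rewrite (@cmap_cst_eps _ _ _ _ _ (0 : R)) => [|y]; last by rewrite -[LHS]/(0 * y) mul0r.
  by rewrite eps_nu tensZl (linZ _ _ lg).
have -> : tmap (fun x => cone (mulI R) x) (fun y => cmap (expi R) (cmap (cone_end (mulI R) true) y)) (cm (bR n)) =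
   tmap (cone (mulI R)) (fun y => y) (tmap (fun x => x) (cmap (expi R)) (cm (bR n))).
  rewrite tmapM; [|lin..]; apply: tmap_ext => u //; congr cmap; apply: cmap_id => x.
  by rewrite -[LHS]/(1 * x) mul1r.
rewrite cB (linD _ _ (@lin_tmap _ _ _ _ _ _ _)) !tmap_tens; [|lin..].
rewrite -tR_cone [cone _ (ptc _ _ _)](_ : _ = 0) ?tens0l ?addr0//.
rewrite /ptc cone_cc; apply: (@cc_degenerate _ _ _ _ 0) => // s t _.
by rewrite -[LHS]/(_ * 0) -[RHS]/(_ * 0) !mulr0.
Qed.

(** Primitivity follows by projecting the first factor to the circle as well. *)
Lemma cm_sC n : cm (sC n) = tns (sC n) one + tns one (sC n).
Proof.
have lf : linear (@cmap k R _ _ (expi R)) by lin.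
rewrite {1}/sC cm_cmap.
have -> : tmap (cmap (expi R)) (cmap (expi R)) (cm (tR n)) =
  tmap (cmap (expi R)) (fun y => y) (tmap (fun x => x) (cmap (expi R)) (cm (tR n))).
  by rewrite tmapM; [|lin..].
rewrite cm_tR (linD _ _ (@lin_tmap _ _ _ _ _ _ _)) !tmap_tens; [|lin..].
by rewrite cmap_ptc expi0.
Qed.

End CircleChains.

HB.lock Definition twg (k : comPzRingType) (R : realType) (Y : topologicalType)
  (n : nat) (x : chains k R Y) : freemod k (tw_cell R Y) := tw_gen n x.
HB.lock Definition twd (k : comPzRingType) (R : realType) (Y : topologicalType)
  (g : circle_action R Y) (z : freemod k (tw_cell R Y)) : freemod k (tw_cell R Y) :=
  tw_diff g z.
HB.lock Definition twc (k : comPzRingType) (R : realType) (Y : topologicalType)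
  (z : freemod k (tw_cell R Y)) : freemod k (tw_cell R Y * tw_cell R Y)%type :=
  tw_comul z.
HB.lock Definition twe (k : comPzRingType) (R : realType) (Y : topologicalType)
  (z : freemod k (tw_cell R Y)) : k^o := tw_counit z.
Arguments twg.body {k R Y} n x.
Arguments twc.body {k R Y} z.
Arguments twe.body {k R Y} z.

#[local] Hint Extern 0 (GRing.linear_for _ (pr _ _)) => exact: (bilin_pr _).2 : linear_maps.
#[local] Hint Extern 0 (GRing.linear_for _ (twg _)) => (rewrite twg.unlock; exact: linearP) : linear_maps.
#[local] Hint Extern 0 (GRing.linear_for _ (twd _)) => (rewrite twd.unlock; exact: linearP) : linear_maps.
#[local] Hint Extern 0 (GRing.linear_for _ (@twc _ _ _)) => (rewrite twc.unlock; exact: linearP) : linear_maps.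
#[local] Hint Extern 0 (GRing.linear_for _ (@twe _ _ _)) => (rewrite twe.unlock; exact: linearP) : linear_maps.
#[local] Hint Extern 0 (bilin (pr _)) => exact: bilin_pr : bilinear_maps.

(** * The twisted tensor product as a chain coalgebra *)

Section Twisted.
Variables (k : comPzRingType) (R : realType).
Notation nuC := (@nu k _ (@cell_dim R _)).
Notation one := (ptc k R (oneS1 R)).

Lemma cm_pr_sC (X Z : topologicalType) (a : continuousType (S1 R * X)%type Z) n
    (x : chains k R X) :
  cm (pr a (sC k R n) x) = tmap (pr a (sC k R n)) (pr a one) (cm x) +
    tmap (fun u => pr a one (nuC u)) (pr a (sC k R n)) (cm x).
Proof.
have ba := @bilin_pr k R _ _ _ a; have [pl p_r] := ba.
have lcm : linear (@cm k R Z) by lin.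
case: n => [|n].
  have z0 (X' Z' : choiceType) (f : freemod k X' -> freemod k Z') (z : freemod k (X' * X')%type) :
      tmap (fun=> 0) f z = 0 :> freemod k (Z' * Z')%type.
    by rewrite tmapE (@tlift_ext _ _ _ _ _ (fun _ _ => 0)) ?tlift0// => u v; rewrite tens0l.
  have z1 (X' Z' : choiceType) (f : freemod k X' -> freemod k Z') (z : freemod k (X' * X')%type) :
      tmap f (fun=> 0) z = 0 :> freemod k (Z' * Z')%type.
    by rewrite tmapE (@tlift_ext _ _ _ _ _ (fun _ _ => 0)) ?tlift0// => u v; rewrite tens0r.
  rewrite sC0 (lin0 (pl _)) (lin0 lcm).
  have p0 : pr a (0 : chains k R (S1 R)) =1 fun=> 0 by move=> u; exact: (lin0 (pl _)).
  by rewrite (tmap_ext _ p0 (frefl _)) z0 add0r (tmap_ext _ (frefl _) p0) z1.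
have [ml mr] := bilin_mul2 (@cell_dim R (S1 R)) (@cell_dim R X) (@pr k R _ _ _ a) (@pr k R _ _ _ a).
rewrite cm_pr cm_sC (linD _ _ (ml _)).
rewrite (@mul2_tns k _ _ _ _ _ _ _ _ _ _ ba ba 0%N _ _ _ (@supp_ptc k R _ _)).
rewrite (@mul2_tns k _ _ _ _ _ _ _ _ _ _ ba ba n.*2.+1) /= ?odd_double//.
by apply: suppW (@supp_sC k R n.+1) => c; rewrite doubleS => -[].
Qed.

Variable Y : topologicalType.
Notation tw := (freemod k (tw_cell R Y)).
Notation nuT := (@nu k _ (@tw_deg R Y)).

Lemma tw_ext (V : lmodType k) (f h : tw -> V) : linear f -> linear h ->
  (forall n x, f (twg n x) = h (twg n x)) -> forall z, f z = h z.
Proof.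
move=> lf lh fh; apply: flin_ext => // -[n c].
by have := fh n (fbasis k c); rewrite twg.unlock /tw_gen flift_fbasis.
Qed.

Lemma twg_basis n c : twg n (fbasis k c) = fbasis k ((n, c) : tw_cell R Y).
Proof. by rewrite twg.unlock /tw_gen flift_fbasis. Qed.

Lemma lin_twg n : linear (@twg k R Y n).
Proof. by lin. Qed.

Lemma nu_twg n (x : chains k R Y) : nuT (twg n x) = twg n (nuC x).
Proof.
have lg := @lin_twg n; move: x; apply: flin_ext => [||c]; [lin|lin|].
rewrite twg_basis !nu_basis (linZ _ _ lg) twg_basis /tw_deg /= exprD.
by rewrite -mul2n exprM expr2 mulrNN mulr1 expr1n mul1r.
Qed.

Lemma supp_twg n m (x : chains k R Y) : supp (fun c => cell_dim c = m) x ->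
  supp (fun b => @tw_deg R Y b = (n.*2 + m)%N) (twg n x).
Proof.
apply: supp_lin => [|c <-]; first by lin.
by rewrite twg_basis; exact: supp_basis.
Qed.

Lemma twc_twg n (x : chains k R Y) : twc (twg n x) =
  \sum_(j < n.+1) tmap (twg j) (twg (n - j)) (cm x) :> freemod k (_ * _)%type.
Proof.
have lg := @lin_twg; move: x; apply: flin_ext => [||c]; [lin| |].
  by apply: lin_sum => j; lin.
rewrite twg_basis twc.unlock /tw_comul flift_fbasis; apply: eq_bigr => j _.
rewrite cm.unlock; move: (CU_comul _) => z; move: z.
apply: flin_ext => [||[a b]]; [exact: linearP|lin|].
by rewrite flift_fbasis tmapE tlift_basis !twg_basis tns_basis.
Qed.

Lemma twe_twg n (x : chains k R Y) : twe (twg n x) = if n is 0%N then eps x else 0.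
Proof.
have le : linear (@twe k R Y) by lin.
move: x; apply: (@flin_ext k _ k^o) => [||c]; [lin|by case: n => [|n] /=; lin|].
by rewrite twg_basis twe.unlock /tw_counit flift_fbasis; case: n => [|n]; rewrite ?eps.unlock.
Qed.

Variable g : circle_action R Y.
Notation pA := (pr (k := k) (actc g)).
Notation sC := (@sC k R).

(** The sum may include [j = n] because [sC 0] is zero; in this range the double sums are instances
    of [conv3]. *)
Lemma twd_twg n (x : chains k R Y) : twd g (twg n x) =
  twg n (bd x) - \sum_(j < n.+1) twg j (pA (sC (n - j)) x).
Proof.
have [pl p_r] := @bilin_pr k R _ _ _ (actc g); have lg := @lin_twg.
move: x; apply: flin_ext => [||c]; [lin| |].
  by apply: lin_add; [lin|apply: lin_opp; apply: lin_sum => j; exact: (@lin_comp _ _ _ _ _ _ (lg _) (p_r _))].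
rewrite twg_basis twd.unlock /tw_diff flift_fbasis big_ord_recr /= subnn sC0.
rewrite (lin0 (pl _)) (lin0 (lg _)) addr0 bd.unlock; congr (_ - _); first by rewrite twg.unlock.
apply: eq_bigr => j _; rewrite -[(n - j)%N in RHS]prednK ?subn_gt0// sC_Tchain.
by rewrite twg.unlock /pr ez.unlock cmap.unlock.
Qed.

Lemma pA_assoc (a b : chains k R (S1 R)) (x : chains k R Y) : pA (pr (mulS1c R) a b) x = pA a (pA b x).
Proof. by apply: pr_assoc => u v w; exact: actM. Qed.

Lemma pA_one (x : chains k R Y) : pA one x = x.
Proof. by rewrite (@pr_ptl _ _ _ _ _ _ idfun) ?cmap_id// => v; exact: act1. Qed.

Lemma bd_pA n (x : chains k R Y) : bd (pA (sC n) x) =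
  \sum_(i < n.+1) pA (sC i) (pA (sC (n - i)) x) - pA (sC n) (bd x).
Proof.
have [pl p_r] := @bilin_pr k R _ _ _ (actc g).
rewrite bd_pr nu_sC bd_sC (linsum _ _ _ (pl _)) (linN _ (pl _)).
by congr (_ - _); apply: eq_bigr => i _; rewrite pA_assoc.
Qed.

Lemma cm_pA n (x : chains k R Y) : cm (pA (sC n) x) =
  tmap (pA (sC n)) (fun u => u) (cm x) + tmap nuC (pA (sC n)) (cm x).
Proof. by rewrite cm_pr_sC; congr (_ + _); apply: tmap_ext => u //; rewrite pA_one. Qed.

(** By [bd_sC] the boundary of a circle chain is a sum of products, and the action is associative;
    this cancels the square of the twisting term. *)
Lemma twdK (z : tw) : twd g (twd g z) = 0.
Proof.
have [pl p_r] := @bilin_pr k R _ _ _ (actc g); have lg := @lin_twg.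
have ld : linear (@twd k R Y g) by lin.
move: z; apply: tw_ext => [||n x]; [lin|exact: lin_zero|].
rewrite twd_twg (linD _ _ ld) (linN _ ld) (linsum _ _ _ ld) twd_twg bdK.
rewrite (lin0 (lg _)) add0r.
under [X in _ - X]eq_bigr => j _.
  rewrite twd_twg bd_pA (linD _ _ (lg _)) (linN _ (lg _)) (linsum _ _ _ (lg _)).
  over.
rewrite !sumrB /= (conv3 (fun l a b => twg l (pA (sC a) (pA (sC b) x)))) opprB.
by rewrite opprB addrCA addKr subrr.
Qed.

(** Since [sC] is primitive, multiplication by it is a coderivation ([cm_pA]). [F1] and [F2] are its
    effects on the left and on the right factor. *)
Lemma twc_twd (z : tw) : twc (twd g z) =
  tmap (twd g) (fun u => u) (twc z) + tmap nuT (twd g) (twc z).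
Proof.
have [pl p_r] := @bilin_pr k R _ _ _ (actc g); have lg := @lin_twg.
have lc : linear (@twc k R Y) by lin.
have ld : linear (@twd k R Y g) by lin.
have [tl tr] := @bilin_tns k (tw_cell R Y) (tw_cell R Y).
move: z; apply: tw_ext => [||n x]; [lin|lin|].
pose F1 l a b : freemod k (tw_cell R Y * tw_cell R Y)%type :=
  tmap (fun u => twg l (pA (sC a) u)) (twg b) (cm x).
pose F2 l b a : freemod k (tw_cell R Y * tw_cell R Y)%type :=
  tmap (fun u => twg l (nuC u)) (fun u => twg b (pA (sC a) u)) (cm x).
have lgp i a : linear (fun u => twg i (pA (sC a) u)).
  by exact: (@lin_comp _ _ _ _ _ _ (lg _) (p_r _)).
rewrite twd_twg (linD _ _ lc) (linN _ lc) (linsum _ _ _ lc) twc_twg.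
have lhs : \sum_(j < n.+1) twc (twg j (pA (sC (n - j)) x)) =
   \sum_(j < n.+1) \sum_(l < (n - j).+1) F1 j l (n - j - l)%N +
   \sum_(j < n.+1) \sum_(l < (n - j).+1) F2 j l (n - j - l)%N.
  have -> : \sum_(j < n.+1) \sum_(l < (n - j).+1) F1 j l (n - j - l)%N =
      \sum_(j < n.+1) \sum_(l < j.+1) F1 l (n - j)%N (j - l)%N.
    rewrite (conv3 (fun l b a => F1 l a b)).
    by apply: eq_bigr => j _; rewrite (conv_rev (F1 j)).
  rewrite -(conv3 F2) -big_split; apply: eq_bigr => j _; rewrite twc_twg -big_split; apply: eq_bigr => l _.
  rewrite cm_pA (linD _ _ (@lin_tmap _ _ _ _ _ _ _)) !tmapM; [|lin..].
  by congr (_ + _).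
have rhs1 : tmap (twd g) (fun u => u) (twc (twg n x)) =
    \sum_(j < n.+1) tmap (fun u => twg j (bd u)) (twg (n - j)) (cm x) -
    \sum_(j < n.+1) \sum_(l < (n - j).+1) F1 j l (n - j - l)%N.
  rewrite -(conv3 F1) twc_twg (linsum _ _ _ (@lin_tmap _ _ _ _ _ _ _)) -sumrB; apply: eq_bigr => j _.
  rewrite tmapM; [|lin..]; under [in RHS]eq_bigr => l _ do rewrite /F1 tmapE.
  rewrite !tmapE -tlift_sum -tliftN -tliftD; apply: tlift_ext => u v.
  by rewrite twd_twg tensDl tensNl (linsum _ _ _ (tl _)).
have rhs2 : tmap nuT (twd g) (twc (twg n x)) =
    \sum_(j < n.+1) tmap (fun u => twg j (nuC u)) (fun v => twg (n - j) (bd v)) (cm x) -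
    \sum_(j < n.+1) \sum_(l < (n - j).+1) F2 j l (n - j - l)%N.
  rewrite twc_twg (linsum _ _ _ (@lin_tmap _ _ _ _ _ _ _)) -sumrB; apply: eq_bigr => j _.
  rewrite tmapM; [|lin..]; under [in RHS]eq_bigr => l _ do rewrite /F2 tmapE.
  rewrite !tmapE -tlift_sum -tliftN -tliftD; apply: tlift_ext => u v.
  by rewrite nu_twg twd_twg tensDr tensNr (linsum _ _ _ (tr _)).
have hb : \sum_(j < n.+1) tmap (twg j) (twg (n - j)) (cm (bd x)) =
    \sum_(j < n.+1) tmap (fun u => twg j (bd u)) (twg (n - j)) (cm x) +
    \sum_(j < n.+1) tmap (fun u => twg j (nuC u)) (fun v => twg (n - j) (bd v)) (cm x).
  rewrite -big_split; apply: eq_bigr => j _.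
  by rewrite cm_bd (linD _ _ (@lin_tmap _ _ _ _ _ _ _)) !tmapM; [|lin..].
by rewrite lhs rhs1 rhs2 hb opprD addrACA.
Qed.

Lemma twcA (z : tw) : tmap (fun y => y) twc (twc z) = asl (tmap twc (fun y => y) (twc z)) :> freemod k (tw_cell R Y * _)%type.
Proof.
have lg := @lin_twg; have lc : linear (@twc k R Y) by lin.
have lcm : linear (@cm k R Y) by lin.
have [tl tr] := @bilin_tns k (tw_cell R Y) (tw_cell R Y).
move: z; apply: tw_ext => [||n x]; [lin|lin|].
pose G a b c : freemod k (tw_cell R Y * (tw_cell R Y * tw_cell R Y))%type :=
  tmap (twg a) (tmap (twg b) (twg c)) (tmap (fun y => y) cm (cm x)).
transitivity (\sum_(j < n.+1) \sum_(l < (n - j).+1) G j l (n - j - l)%N).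
  rewrite twc_twg (linsum _ _ _ (@lin_tmap _ _ _ _ _ _ _)); apply: eq_bigr => j _.
  rewrite tmapM; [|lin..].
  rewrite (@tmap_ext _ _ _ _ _ _ _ _ (fun v => \sum_(l < (n - j).+1) tmap (twg l) (twg (n - j - l)) (cm v)) _ (frefl _)); last first.
    by move=> v; rewrite twc_twg.
  rewrite tmapE; under tlift_ext => u v do rewrite (linsum _ _ _ ((bilin_tns _ _ _).2 _)).
  rewrite tlift_sum; apply: eq_bigr => l _; rewrite /G tmapM; [|lin..].
  by rewrite tmapE.
rewrite -(conv3 G) twc_twg (linsum _ _ _ (@lin_tmap _ _ _ _ _ _ _)) (linsum _ _ _ (@lin_asl _ _ _ _)).
apply: eq_bigr => j _; rewrite tmapM; [|lin..].
rewrite (@tmap_ext _ _ _ _ _ _ (fun v => \sum_(l < j.+1) tmap (twg l) (twg (j - l)) (cm v)) _ _ _ _ (frefl _)); last first.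
  by move=> v; rewrite twc_twg.
rewrite tmapE; under tlift_ext => u v do rewrite (linsum _ _ _ ((bilin_tns _ _ _).1 _)).
rewrite tlift_sum (linsum _ _ _ (@lin_asl _ _ _ _)); apply: eq_bigr => l _.
rewrite /G cmA -asl_tmap; [|lin..]; rewrite tmapM; [|lin..].
by rewrite tmapE.
Qed.

Lemma twc_twel (z : tw) : tlift (fun a b => (twe a : k) *: b) (twc z) = z :> tw.
Proof.
have lg := @lin_twg; have lc : linear (@twc k R Y) by lin.
have le : linear (@twe k R Y) by lin.
have bs := @bilin_scalel k _ _ (@twe k R Y) le.
move: z; apply: tw_ext => [||n x]; [lin|lin|].
rewrite twc_twg (linsum _ _ _ (@lin_tlift _ _ _ _ _)) big_ord_recl big1 => [|i _]; last first.
  rewrite tlift_tmap //; under tlift_ext => u v do rewrite twe_twg /= scale0r.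
  by rewrite tlift0.
rewrite addr0 tlift_tmap // subn0 -[in RHS](cm_epsl x) (tlift_app _ _ (lg n)).
by apply: tlift_ext => u v; rewrite twe_twg (linZ _ _ (lg n)).
Qed.

Lemma twc_twer (z : tw) : tlift (fun a b => (twe b : k) *: a) (twc z) = z :> tw.
Proof.
have lg := @lin_twg; have lc : linear (@twc k R Y) by lin.
have le : linear (@twe k R Y) by lin.
have bs := @bilin_scaler k _ _ (@twe k R Y) le.
move: z; apply: tw_ext => [||n x]; [lin|lin|].
rewrite twc_twg (linsum _ _ _ (@lin_tlift _ _ _ _ _)) big_ord_recr big1 => [|i _]; last first.
  rewrite tlift_tmap //; under tlift_ext => u v do rewrite twe_twg.
  rewrite -[(n - i)%N in X in tlift X]prednK ?subn_gt0 //.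
  by under tlift_ext => u v do rewrite scale0r; rewrite tlift0.
rewrite /= add0r tlift_tmap // subnn -[in RHS](cm_epsr x) (tlift_app _ _ (lg n)).
by apply: tlift_ext => u v; rewrite twe_twg (linZ _ _ (lg n)).
Qed.

Lemma eps_supp n (x : chains k R Y) : supp (fun c => cell_dim c = n.+1) x -> eps x = 0.
Proof.
move=> sx; have le : linear (@eps k R Y) by lin.
apply: (@lin_supp_ext k _ k^o _ (@eps k R Y) (fun=> 0) _ le _ sx) => [|c cn]; first exact: lin_zero.
by rewrite cell_cc eps_cc cn.
Qed.

Lemma eps_pA n (x : chains k R Y) : eps (pA (sC n) x) = 0.
Proof.
have [pl p_r] := @bilin_pr k R _ _ _ (actc g).
have le : linear (@eps k R Y) by lin.
case: n => [|n]; first by rewrite sC0 (lin0 (pl _)) (lin0 le).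
have lp : linear (pA (sC n.+1)) by exact: p_r.
move: x; apply: (@flin_ext k _ k^o) => [||c]; [lin|exact: lin_zero|].
apply: (@eps_supp (n.*2 + cell_dim c)); rewrite -addSn; apply: supp_pr; last exact: supp_basis.
by apply: suppW (@supp_sC k R n.+1) => e; rewrite doubleS => -[].
Qed.

Lemma twe_twd (z : tw) : twe (twd g z) = 0.
Proof.
have le : linear (@twe k R Y) by lin.
have ld : linear (@twd k R Y g) by lin.
move: z; apply: (@flin_ext k _ k^o) => [||[n c]]; [lin|exact: lin_zero|].
rewrite -twg_basis twd_twg (linD _ _ le) (linN _ le) (linsum _ _ _ le).
rewrite big_ord_recl big1 => [|i _]; last by rewrite twe_twg.
by rewrite !twe_twg eps_pA addr0 subr0; case: n => // ; rewrite eps_bd.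
Qed.

Lemma supp_twd n (z : tw) : supp (fun b => @tw_deg R Y b = n) z ->
  supp (fun b => (@tw_deg R Y b).+1 = n) (twd g z).
Proof.
apply: supp_lin => [|[m c] <-]; first by lin.
have sc := @supp_basis k _ (fun e : cell R Y => cell_dim e = cell_dim c) c erefl.
rewrite -twg_basis twd_twg; apply: suppD; last apply: suppN; last first.
  apply: supp_sum => j _; case nj: (m - j)%N => [|i].
    have [pl p_r] := @bilin_pr k R _ _ _ (actc g); have lg := @lin_twg.
    by rewrite sC0 (lin0 (pl _)) (lin0 (lg _)); exact: supp0.
  apply: (@suppW _ _ (fun b => tw_deg b = (j.*2 + (i.*2.+1 + cell_dim c))%N)).
    by move=> b ->; rewrite /tw_deg /=; have := ltn_ord j; lia.
  apply: supp_twg; apply: supp_pr => //.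
  by apply: suppW (@supp_sC k R i.+1) => e; rewrite doubleS => -[].
case dc: (cell_dim c) => [|d].
  have := supp_bd sc; rewrite dc => s0.
  rewrite (_ : bd _ = 0); last by apply/val_inj/funext => b; apply/eqP; apply/negPn/negP => /s0.
  by rewrite (lin0 (@lin_twg _)); exact: supp0.
apply: (@suppW _ _ (fun b => tw_deg b = (m.*2 + d)%N)).
  by move=> b ->; rewrite /tw_deg /= dc addnS.
by apply: supp_twg; apply: suppW (supp_bd sc) => e; rewrite dc => -[].
Qed.

Lemma chain_coalgebra_twisted : chain_coalgebra (twisted_tensor k g).
Proof.
have dE x : cdiff (twisted_tensor k g) x = twd g x by rewrite twd.unlock.
have cE x : ccomul (twisted_tensor k g) x = twc x by rewrite twc.unlock.
have eE x : ccounit (twisted_tensor k g) x = twe x by rewrite twe.unlock.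
apply: chain_coalgebra_criterion => [b|b|b|x|x|x|x|x|x].
- by rewrite dE; apply: supp_twd; exact: supp_basis.
- rewrite cE; case: b => n c; rewrite -twg_basis twc_twg; apply: supp_sum => j _.
  have sc := supp_cm (@supp_basis k _ (fun e : cell R Y => cell_dim e = cell_dim c) c erefl).
  apply: supp_lin sc => [|[a e] /= ae]; first by lin.
  rewrite tmapE tlift_basis !twg_basis tns_basis; apply: supp_basis.
  by rewrite /= /tw_deg /= -ae; have := ltn_ord j; lia.
- rewrite eE; case: b => n c; rewrite -twg_basis twe_twg; case: n => [|n] nz; last by rewrite eqxx in nz.
  change (cell_dim c = 0%N); apply/eqP; apply: contraNT nz => /negbTE nz.
  by rewrite cell_cc eps_cc nz.
- by rewrite !dE twdK.
- rewrite dE !cE twc_twd; congr (_ + _); apply: tmap_ext => y //; by rewrite dE.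
- by rewrite eE dE twe_twd.
- rewrite !cE [LHS](_ : _ = tmap (fun y => y) twc (twc x)); last by apply: tmap_ext => y; rewrite ?cE.
  by rewrite twcA; congr asl; apply: tmap_ext => y; rewrite ?cE.
- rewrite cE -[RHS]twc_twel; apply: tlift_ext => a b; by rewrite eE.
- rewrite cE -[RHS]twc_twer; apply: tlift_ext => a b; by rewrite eE.
Qed.

End Twisted.

(** * The cobar construction *)

HB.lock Definition catA (k : comPzRingType) (B : choiceType)
    (x y : freemod k (seq B)) : freemod k (seq B) :=
  flift2 (fun s t : seq B => fbasis k (s ++ t : seq B)) x y.
HB.lock Definition ltr (k : comPzRingType) (B : choiceType) (x : freemod k B) :
  freemod k (seq B) := flift (fun b => fbasis k ([:: b] : seq B)) x.
HB.lock Definition mapA (k : comPzRingType) (B B' : choiceType)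
    (f : freemod k B -> freemod k B') (x : freemod k (seq B)) : freemod k (seq B') :=
  flift (fun w : seq B => foldr (fun b u => catA (ltr (f (fbasis k b))) u)
    (fbasis k ([::] : seq B')) w) x.

(* Letters of the cobar construction are desuspended: [b] has degree |b| - 1. *)
Definition cobdeg (B : choiceType) (deg : B -> nat) (w : seq B) : nat :=
  (\sum_(b <- w) (deg b).+1)%N.

(** On a letter: the signed diagonal minus the desuspended boundary; on words: the Leibniz rule. The
    degree |b| + 1 that governs the signs has the parity of |b| - 1 and avoids integers. *)
Fixpoint cobw (k : comPzRingType) (B : choiceType) (deg : B -> nat)
    (d : freemod k B -> freemod k B) (com : freemod k B -> freemod k (B * B)%type)
    (w : seq B) : freemod k (seq B) :=
  if w is b :: w' then
    catA (tlift (fun x y => catA (ltr (nu deg x)) (ltr y)) (com (fbasis k b))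
          - ltr (d (fbasis k b))) (fbasis k (w' : seq B))
    + catA (- ltr (nu deg (fbasis k b))) (cobw deg d com w')
  else 0.
HB.lock Definition dA (k : comPzRingType) (B : choiceType) (deg : B -> nat)
    (d : freemod k B -> freemod k B) (com : freemod k B -> freemod k (B * B)%type)
    (x : freemod k (seq B)) : freemod k (seq B) := flift (cobw deg d com) x.

(** The homotopy on words induced by a homotopy [s] from the identity to [p]: [s] acts on one
    letter, [p] with a sign on the letters before it, and the letters after it stay. *)
Fixpoint derw (k : comPzRingType) (B : choiceType) (deg : B -> nat)
    (s p : freemod k B -> freemod k B) (w : seq B) : freemod k (seq B) :=
  if w is b :: w' then
    catA (- ltr (s (fbasis k b))) (fbasis k (w' : seq B))
    + catA (- ltr (nu deg (p (fbasis k b)))) (derw deg s p w')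
  else 0.
HB.lock Definition SA (k : comPzRingType) (B : choiceType) (deg : B -> nat)
    (s p : freemod k B -> freemod k B) (x : freemod k (seq B)) : freemod k (seq B) :=
  flift (derw deg s p) x.
Arguments ltr.body {k B} x.

#[local] Hint Extern 0 (GRing.linear_for _ (@ltr _ _)) => (rewrite ltr.unlock; exact: linearP) : linear_maps.
#[local] Hint Extern 0 (GRing.linear_for _ (mapA _)) => (rewrite mapA.unlock; exact: linearP) : linear_maps.
#[local] Hint Extern 0 (GRing.linear_for _ (dA _ _ _)) => (rewrite dA.unlock; exact: linearP) : linear_maps.
#[local] Hint Extern 0 (GRing.linear_for _ (SA _ _ _)) => (rewrite SA.unlock; exact: linearP) : linear_maps.
#[local] Hint Extern 0 (GRing.linear_for _ (catA _)) => (rewrite catA.unlock; exact: (bilin_flift2 _).2) : linear_maps.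
#[local] Hint Extern 0 (bilin (@catA _ _)) => (rewrite catA.unlock; exact: bilin_flift2) : bilinear_maps.

Section TensorAlgebra.
Variables (k : comPzRingType) (B : choiceType).
Notation A := (freemod k (seq B)).
Notation oneA := (fbasis k ([::] : seq B)).

Lemma bilin_catA : bilin (@catA k B).
Proof. by rewrite catA.unlock; exact: bilin_flift2. Qed.

Lemma catA_basis (u v : seq B) : catA (fbasis k u) (fbasis k v) = fbasis k (u ++ v : seq B).
Proof. by rewrite catA.unlock /flift2 !flift_fbasis. Qed.

Lemma ltr_basis (b : B) : ltr (fbasis k b) = fbasis k ([:: b] : seq B).
Proof. by rewrite ltr.unlock flift_fbasis. Qed.

Lemma lin_ltr : linear (@ltr k B). Proof. by lin. Qed.

Lemma cat1A (x : A) : catA oneA x = x.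
Proof.
have [bl br] := bilin_catA; move: x; apply: flin_ext => [||u]; [exact: br|exact: lin_id|].
by rewrite catA_basis.
Qed.

Lemma catA1 (x : A) : catA x oneA = x.
Proof.
have [bl br] := bilin_catA; move: x; apply: flin_ext => [||u]; [exact: bl|exact: lin_id|].
by rewrite catA_basis cats0.
Qed.

Lemma catAA (x y z : A) : catA x (catA y z) = catA (catA x y) z.
Proof.
have [bl br] := bilin_catA.
move: x; apply: flin_ext => [||u]; [exact: bl|exact: (@lin_comp _ _ _ _ _ _ (bl _) (bl _))|].
move: y; apply: flin_ext => [||v].
- exact: (@lin_comp _ _ _ _ _ _ (br _) (bl _)).
- exact: (@lin_comp _ _ _ _ _ _ (bl _) (br _)).
move: z; apply: flin_ext => [||w]; [exact: (@lin_comp _ _ _ _ _ _ (br _) (br _))|exact: br|].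
by rewrite !catA_basis seq.catA.
Qed.

Lemma alg_ext (V : lmodType k) (f g : A -> V) : linear f -> linear g ->
  f oneA = g oneA ->
  (forall x y, f y = g y -> f (catA (ltr x) y) = g (catA (ltr x) y)) ->
  forall x, f x = g x.
Proof.
move=> lf lg fg1 fgS; apply: flin_ext => // w; elim: w => [//|b w IH].
by have := fgS (fbasis k b) _ IH; rewrite ltr_basis catA_basis.
Qed.

Lemma alg_mul_ext (V : lmodType k) (f g : A -> A -> V) : bilin f -> bilin g ->
  (forall y, f oneA y = g oneA y) ->
  (forall x x' y, f x' y = g x' y -> f (catA (ltr x) x') y = g (catA (ltr x) x') y) ->
  forall x y, f x y = g x y.
Proof. by move=> [fl fr] [gl gr] fg1 fgS x y; move: x; apply: alg_ext => // x x'; exact: fgS. Qed.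
End TensorAlgebra.

Section AlgebraMaps.
Variables (k : comPzRingType) (B B' : choiceType).
Variables (f : freemod k B -> freemod k B').
Hypothesis lf : linear f.

Lemma mapA_one : mapA f (fbasis k ([::] : seq B)) = fbasis k ([::] : seq B').
Proof. by rewrite mapA.unlock flift_fbasis. Qed.

Lemma mapA_ltrM x y : mapA f (catA (ltr x) y) = catA (ltr (f x)) (mapA f y).
Proof.
have [bl br] := @bilin_catA k B; have [bl' br'] := @bilin_catA k B'.
have lm : linear (mapA f) by lin.
have ll := @lin_ltr k B; have ll' := @lin_ltr k B'.
move: x; apply: flin_ext => [||b].
- apply: (@lin_comp _ _ _ _ (mapA f) (fun x => catA (ltr x) y) lm); exact: (@lin_comp _ _ _ _ _ _ (bl y) ll).
- apply: (@lin_comp _ _ _ _ (fun z => catA z _) _ (bl' _)); by lin.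
move: y; apply: flin_ext => [||w].
- exact: (@lin_comp _ _ _ _ _ _ lm (br _)).
- exact: (@lin_comp _ _ _ _ _ _ (br' _) lm).
by rewrite ltr_basis catA_basis mapA.unlock !flift_fbasis.
Qed.

Lemma mapAM x y : mapA f (catA x y) = catA (mapA f x) (mapA f y).
Proof.
have lm : linear (mapA f) by lin.
move: x y; apply: alg_mul_ext => [||y|x x' y IH].
- by apply: bilin_app => //; exact: bilin_catA.
- by apply: bilin_comp => //; exact: bilin_catA.
- by rewrite cat1A mapA_one cat1A.
by rewrite -catAA !mapA_ltrM IH catAA.
Qed.

Lemma mapA_ltr x : mapA f (ltr x) = ltr (f x).
Proof. by rewrite -[ltr x]catA1 mapA_ltrM mapA_one catA1. Qed.
End AlgebraMaps.

Lemma mapA_ext (k : comPzRingType) (B B' : choiceType) (f g : freemod k B -> freemod k B') x :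
  linear f -> linear g -> f =1 g -> mapA f x = mapA g x.
Proof.
move=> lf lg fg; move: x; apply: alg_ext => [||| x y IH]; [lin|lin|by rewrite !mapA_one|].
by rewrite !mapA_ltrM// IH fg.
Qed.

Lemma mapA_comp (k : comPzRingType) (B B' B'' : choiceType)
    (f : freemod k B' -> freemod k B'') (g : freemod k B -> freemod k B') x :
  linear f -> linear g -> mapA f (mapA g x) = mapA (fun u => f (g u)) x.
Proof.
move=> lf lg; have lfg : linear (fun u => f (g u)) by exact: (@lin_comp _ _ _ _ _ _ lf lg).
move: x; apply: alg_ext => [||| x y IH]; [lin|lin|by rewrite !mapA_one|].
by rewrite !mapA_ltrM// IH.
Qed.

Lemma mapA_id (k : comPzRingType) (B : choiceType) (f : freemod k B -> freemod k B) x :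
  linear f -> f =1 id -> mapA f x = x.
Proof.
move=> lf fi; move: x; apply: alg_ext => [||| x y IH]; [lin|exact: lin_id|by rewrite !mapA_one|].
by rewrite !mapA_ltrM// IH fi.
Qed.

Section Cobar.
Variables (k : comPzRingType) (B : choiceType) (deg : B -> nat).
Variables (d : freemod k B -> freemod k B) (com : freemod k B -> freemod k (B * B)%type).
Hypotheses (ld : linear d) (lcom : linear com).
Notation nuB := (nu (k := k) deg).
Notation nuA := (nu (k := k) (cobdeg deg)).
Notation dA := (dA deg d com).
Notation oneA := (fbasis k ([::] : seq B)).

Lemma nuA_one : nuA oneA = oneA.
Proof. by rewrite nu_basis /cobdeg big_nil expr0 scale1r. Qed.

Lemma nuA_M x y : nuA (catA x y) = catA (nuA x) (nuA y).
Proof.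
have ln : linear nuA by lin.
have [bl br] := @bilin_catA k B.
move: x; apply: flin_ext => [||u].
- exact: (@lin_comp _ _ _ _ _ _ ln (bl _)).
- exact: (@lin_comp _ _ _ _ _ _ (bl _) ln).
move: y; apply: flin_ext => [||v].
- exact: (@lin_comp _ _ _ _ _ _ ln (br _)).
- exact: (@lin_comp _ _ _ _ _ _ (br _) ln).
rewrite catA_basis !nu_basis (linZ _ _ (bl _)) (linZ _ _ (br _)) catA_basis scalerA.
by rewrite /cobdeg big_cat -exprD.
Qed.

Lemma nuA_ltr x : nuA (ltr x) = - ltr (nuB x).
Proof.
have ln : linear nuA by lin.
move: x; apply: flin_ext => [||b]; [lin|lin|].
rewrite ltr_basis !nu_basis (linZ _ _ (@lin_ltr k B)) ltr_basis /cobdeg big_seq1.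
by rewrite exprS mulN1r scaleNr.
Qed.

Lemma dA_one : dA oneA = 0. Proof. by rewrite dA.unlock flift_fbasis. Qed.

Definition dA1 (x : freemod k B) : freemod k (seq B) :=
  tlift (fun x y => catA (ltr (nuB x)) (ltr y)) (com x) - ltr (d x).

Lemma lin_dA1 : linear dA1. Proof. by rewrite /dA1; lin. Qed.

Lemma dA_ltrM x y :
  dA (catA (ltr x) y) = catA (dA1 x) y + catA (nuA (ltr x)) (dA y).
Proof.
have [bl br] := @bilin_catA k B; have lm : linear dA by lin.
have ln : linear nuA by lin.
have ll := @lin_ltr k B; have l1 := lin_dA1.
move: x; apply: flin_ext => [||b].
- apply: (@lin_comp _ _ _ _ dA (fun x => catA (ltr x) y) lm); exact: (@lin_comp _ _ _ _ _ _ (bl y) ll).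
- apply: lin_add; first exact: (@lin_comp _ _ _ _ _ _ (bl y) l1).
  by apply: (@lin_comp _ _ _ _ (fun z => catA z _) (fun x => nuA (ltr x)) (bl _)); lin.
move: y; apply: flin_ext => [||w].
- exact: (@lin_comp _ _ _ _ _ _ lm (br _)).
- by apply: lin_add; [exact: br|exact: (@lin_comp _ _ _ _ _ _ (br _) lm)].
by rewrite {1}ltr_basis catA_basis dA.unlock !flift_fbasis nuA_ltr.
Qed.

Lemma dA_ltr x : dA (ltr x) = dA1 x.
Proof.
have [bl br] := @bilin_catA k B.
by rewrite -[ltr x]catA1 dA_ltrM dA_one (lin0 (br _)) addr0 catA1.
Qed.

Lemma dAM x y : dA (catA x y) = catA (dA x) y + catA (nuA x) (dA y).
Proof.
have [bl br] := @bilin_catA k B; have lm : linear dA by lin.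
have ln : linear nuA by lin.
have bc := @bilin_catA k B.
move: x y; apply: alg_mul_ext => [|||x x' y IH].
- exact: bilin_app.
- split=> [y|x]; apply: lin_add.
  + exact: (@lin_comp _ _ _ _ _ _ (bl y) lm).
  + exact: (@lin_comp _ _ _ _ _ _ (bl (dA y)) ln).
  + exact: br.
  + exact: (@lin_comp _ _ _ _ _ _ (br _) lm).
- by move=> y; rewrite dA_one (lin0 (bl _)) add0r nuA_one !cat1A.
rewrite -catAA !dA_ltrM IH; move: (dA1 x) => D1; rewrite (linD _ _ (br _)) (linD _ _ (bl _)) nuA_M.
by rewrite !catAA addrA.
Qed.

Section Contraction.
Variables s p : freemod k B -> freemod k B.
Hypotheses (ls : linear s) (lp : linear p).
Notation S := (SA deg s p).
Notation P := (mapA p).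

Lemma SA_one : S oneA = 0. Proof. by rewrite SA.unlock flift_fbasis. Qed.

Lemma SA_ltrM x y : S (catA (ltr x) y) =
  catA (- ltr (s x)) y + catA (nuA (P (ltr x))) (S y).
Proof.
have [bl br] := @bilin_catA k B; have lm : linear S by lin.
have ln : linear nuA by lin.
have lP : linear P by lin.
have ll := @lin_ltr k B.
move: x; apply: flin_ext => [||b].
- apply: (@lin_comp _ _ _ _ S (fun x => catA (ltr x) y) lm); exact: (@lin_comp _ _ _ _ _ _ (bl y) ll).
- apply: lin_add; apply: (@lin_comp _ _ _ _ (fun z => catA z _) _ (bl _)); by lin.
move: y; apply: flin_ext => [||w].
- exact: (@lin_comp _ _ _ _ _ _ lm (br _)).
- by apply: lin_add; [exact: br|exact: (@lin_comp _ _ _ _ _ _ (br _) lm)].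
by rewrite {1}ltr_basis catA_basis SA.unlock !flift_fbasis mapA_ltr// nuA_ltr.
Qed.

Lemma SA_ltr x : S (ltr x) = - ltr (s x).
Proof.
have [bl br] := @bilin_catA k B.
by rewrite -[ltr x]catA1 SA_ltrM SA_one (lin0 (br _)) addr0 catA1.
Qed.

Lemma SAM x y : S (catA x y) = catA (S x) y + catA (nuA (P x)) (S y).
Proof.
have [bl br] := @bilin_catA k B; have lm : linear S by lin.
have ln : linear nuA by lin.
have lP : linear P by lin.
have bc := @bilin_catA k B.
move: x y; apply: alg_mul_ext => [|||x x' y IH].
- exact: bilin_app.
- split=> [y|x]; apply: lin_add.
  + exact: (@lin_comp _ _ _ _ _ _ (bl y) lm).
  + apply: (@lin_comp _ _ _ _ (fun z => catA z _) _ (bl _)); by lin.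
  + exact: br.
  + exact: (@lin_comp _ _ _ _ _ _ (br _) lm).
- by move=> y; rewrite SA_one (lin0 (bl _)) add0r mapA_one nuA_one !cat1A.
rewrite -catAA !SA_ltrM IH (linD _ _ (br _)) (linD _ _ (bl _)) mapAM// nuA_M.
by rewrite !catAA addrA.
Qed.

Hypothesis nup : forall x, nuB (p x) = p (nuB x).
Lemma nuA_P x : nuA (P x) = P (nuA x).
Proof.
have ln : linear nuA by lin.
have lP : linear P by lin.
move: x; apply: alg_ext => [|||x y IH]; [lin|lin|by rewrite mapA_one !nuA_one mapA_one|].
have lN : forall z, P (- z) = - P z by move=> z; rewrite (linN _ lP).
by rewrite !(mapAM, nuA_M)// !(nuA_ltr, mapA_ltr, lN)// IH nup.
Qed.

Hypothesis nus : forall x, nuB (s x) = - s (nuB x).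
Lemma nuA_SA x : nuA (S x) = - S (nuA x).
Proof.
have [bl br] := @bilin_catA k B; have lm : linear S by lin.
have ln : linear nuA by lin.
have lP : linear P by lin.
have ll := @lin_ltr k B.
move: x; apply: alg_ext => [|||x y IH]; [lin|lin|by rewrite nuA_one SA_one (lin0 ln) oppr0|].
rewrite SA_ltrM (linD _ _ ln) !nuA_M SAM opprD nuA_P IH nuA_ltr.
rewrite (linN _ lm) SA_ltr (linN _ ln) nuA_ltr nus (linN _ ll) !opprK.
by rewrite (linN _ (br _)) (linN _ (bl _)).
Qed.

Lemma mapA_SA0 (B' : choiceType) (f : freemod k B -> freemod k B') : linear f ->
  (forall x, f (s x) = 0) -> forall x, mapA f (S x) = 0.
Proof.
move=> lf fs; have lm : linear (mapA f) by lin.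
have ll := @lin_ltr k B'; have [bl br] := @bilin_catA k B'.
apply: alg_ext => [||| x y IH]; [lin|exact: lin_zero|by rewrite SA_one (lin0 lm)|].
rewrite SA_ltrM (linD _ _ lm) !mapAM// IH (lin0 (br _)) addr0.
by rewrite (linN _ lm) mapA_ltr// fs (lin0 ll) oppr0 (lin0 (bl _)).
Qed.

Hypothesis nud : forall x, nuB (d x) = - d (nuB x).
Hypothesis nucom : forall x, com (nuB x) = tmap nuB nuB (com x).

Lemma nuA_dA x : nuA (dA x) = - dA (nuA x).
Proof.
have ln : linear nuA by lin.
have ld' : linear dA by lin.
have ll := @lin_ltr k B; have [bl br] := @bilin_catA k B.
have bc := @bilin_catA k B.
have n1 y : nuA (dA1 y) = dA1 (nuB y).
  rewrite /dA1 (linD _ _ ln) (linN _ ln) nuA_ltr nud (linN _ ll) opprK.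
  rewrite nucom; congr (_ - _); rewrite (tlift_app _ _ ln) tlift_tmap; last first.
    by apply: bilin_comp => //; lin.
  apply: tlift_ext => u v; rewrite nuA_M !nuA_ltr (linN _ (bl _)) (linN _ (br _)) opprK.
  by [].
move: x; apply: alg_ext => [|||x y IH]; [lin|lin|by rewrite nuA_one dA_one (lin0 ln) oppr0|].
rewrite dA_ltrM (linD _ _ ln) !nuA_M IH n1 dAM opprD nuA_ltr (linN _ ld') dA_ltr.
rewrite (linN _ (bl _)) opprK; congr (_ + _).
by rewrite (linN _ (br _)).
Qed.

Hypothesis dp : forall x, d (p x) = p (d x).
Hypothesis comp : forall x, com (p x) = tmap p p (com x).
Hypothesis ds : forall x, d (s x) = x - p x - s (d x).
Hypothesis coms : forall x, com (s x) =
  tmap s (fun y => y) (com x) + tmap (fun y => p (nuB y)) s (com x).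

Lemma mapA_dA x : P (dA x) = dA (P x).
Proof.
have lP : linear P by lin.
have ld' : linear dA by lin.
have ll := @lin_ltr k B.
have bc := @bilin_catA k B.
have n1 y : P (dA1 y) = dA1 (p y).
  rewrite /dA1 (linD _ _ lP) (linN _ lP) mapA_ltr// dp comp.
  congr (_ - _); rewrite (tlift_app _ _ lP) tlift_tmap//; last first.
    by apply: bilin_comp => //; lin.
  by apply: tlift_ext => u v; rewrite mapAM// !mapA_ltr// nup.
move: x; apply: alg_ext => [|||x y IH]; [lin|lin|by rewrite mapA_one !dA_one (lin0 lP)|].
by rewrite dA_ltrM (linD _ _ lP) !mapAM// IH n1 dAM nuA_P !mapA_ltr// dA_ltr.
Qed.

(** Both sides satisfy the same twisted product rule, so the case of a letter suffices. There the
    linear part is [ds] and the quadratic part is [coms], the compatibility of the homotopy with the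
    diagonal. *)
Lemma dA_SA x : dA (S x) = x - P x - S (dA x).
Proof.
have lP : linear P by lin.
have ld' : linear dA by lin.
have lS : linear S by lin.
have ln : linear nuA by lin.
have ll := @lin_ltr k B; have [bl br] := @bilin_catA k B.
have bc := @bilin_catA k B.
have n1 y : dA (S (ltr y)) = ltr y - P (ltr y) - S (dA1 y).
  rewrite SA_ltr (linN _ ld') dA_ltr /dA1 ds !coms.
  rewrite (linD _ _ lS) (linN _ lS) SA_ltr opprK (linD _ _ (@lin_tlift _ _ _ _ _)).
  rewrite !tlift_tmap//; try (by lin); try by apply: bilin_comp => //; lin.
  rewrite (tlift_app _ _ lS) !(linD _ _ ll) !(linN _ ll) mapA_ltr//.
  set t1 := tlift _ _; set t2 := tlift _ _; set t3 := tlift _ _.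
  have -> : t3 = t1 + t2.
    rewrite -tliftD; apply: tlift_ext => u v.
    rewrite SAM !SA_ltr (linN _ (br _)) mapA_ltr// nuA_ltr nus !nup.
    by rewrite (linN _ ll) !(linN _ (bl _)) opprK.
  move: (t1 + t2) (ltr y) (ltr (p y)) (ltr _) => t a b c.
  by rewrite opprB opprD [RHS]addrC -addrA addrC; congr (_ + _); rewrite addrC.
move: x; apply: alg_ext => [|||x y IH].
- by lin.
- by apply: lin_add; [apply: lin_add; [exact: lin_id|lin]|lin].
- by rewrite SA_one dA_one (lin0 ld') (lin0 lS) mapA_one subrr subr0.
have Nr a b : catA a (- b) = - catA a b :> freemod k (seq B) by rewrite (linN _ (br _)).
have Nl a b : catA (- a) b = - catA a b :> freemod k (seq B) by rewrite (linN _ (bl _)).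
have Dr a b c : catA a (b + c) = catA a b + catA a c :> freemod k (seq B) by rewrite (linD _ _ (br _)).
have Dl a b c : catA (a + b) c = catA a c + catA b c :> freemod k (seq B) by rewrite (linD _ _ (bl _)).
have h1 := nuA_SA (ltr x).
have h2 : dA (nuA (P (ltr x))) = - nuA (P (dA1 x)) by rewrite -dA_ltr mapA_dA nuA_dA opprK.
have h3 : nuA (P (nuA (ltr x))) = P (ltr x) by rewrite nuA_P nuK.
rewrite dA_ltrM (linD _ _ lS) (SAM (ltr x)) (SAM (nuA _)) (SAM (dA1 x)) (linD _ _ ld').
rewrite (dAM (S _)) (dAM (nuA _)) n1 IH h1 h2 h3 nuK mapAM//.
rewrite !(Dl, Dr) !(Nl, Nr).
zring.
Qed.

End Contraction.
End Cobar.

(** * Naturality and degrees of the operations on the cobar construction *)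

Section Naturality.
Variables (k : comPzRingType) (B : choiceType) (deg : B -> nat).
Variables (d : freemod k B -> freemod k B) (com : freemod k B -> freemod k (B * B)%type).
Hypotheses (ld : linear d) (lcom : linear com).
Variables (B' : choiceType) (deg' : B' -> nat).
Variables (d' : freemod k B' -> freemod k B') (com' : freemod k B' -> freemod k (B' * B')%type).
Hypotheses (ld' : linear d') (lcom' : linear com').
Variables (s p : freemod k B -> freemod k B) (s' p' : freemod k B' -> freemod k B').
Hypotheses (ls : linear s) (lp : linear p) (ls' : linear s') (lp' : linear p').
Variable f : freemod k B -> freemod k B'.
Hypothesis lf : linear f.
Hypothesis nuf : forall x, nu deg' (f x) = f (nu deg x).

Lemma mapA_nu x : mapA f (nu (cobdeg deg) x) = nu (cobdeg deg') (mapA f x).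
Proof.
have lF : linear (mapA f) by lin.
move: x; apply: alg_ext => [|||x y IH]; [lin|lin|by rewrite nuA_one mapA_one nuA_one|].
by rewrite nuA_M !mapAM// nuA_M IH nuA_ltr (linN _ lF) !mapA_ltr// nuA_ltr nuf.
Qed.

Lemma mapA_cobar x : (forall x, f (d x) = d' (f x)) ->
  (forall x, com' (f x) = tmap f f (com x)) -> mapA f (dA deg d com x) = dA deg' d' com' (mapA f x).
Proof.
move=> fd fc; have lF : linear (mapA f) by lin.
have ldA : linear (dA deg d com) by lin.
have ll := @lin_ltr k B'; have bc := @bilin_catA k B'.
move: x; apply: alg_ext => [|||x y IH]; [lin|lin|by rewrite dA_one mapA_one dA_one (lin0 lF)|].
rewrite dA_ltrM// (linD _ _ lF) !mapAM// IH mapA_nu !mapA_ltr// dA_ltrM//.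
congr (catA _ _ + _); rewrite /dA1 (linD _ _ lF) (linN _ lF) mapA_ltr// fd fc.
congr (_ - _); rewrite (tlift_app _ _ lF) tlift_tmap//; last by apply: bilin_comp => //; lin.
by apply: tlift_ext => u v; rewrite mapAM// !mapA_ltr// nuf.
Qed.

Lemma mapA_SA x : (forall x, f (s x) = s' (f x)) -> (forall x, f (p x) = p' (f x)) ->
  mapA f (SA deg s p x) = SA deg' s' p' (mapA f x).
Proof.
move=> fs fp; have lF : linear (mapA f) by lin.
have lS : linear (SA deg s p) by lin.
have ll := @lin_ltr k B'; have [bl br] := @bilin_catA k B'.
move: x; apply: alg_ext => [|||x y IH]; [lin|lin|by rewrite SA_one mapA_one SA_one (lin0 lF)|].
rewrite SA_ltrM// (linD _ _ lF) !mapAM// IH mapA_nu !mapA_ltr// SA_ltrM//.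
by rewrite (linN _ lF) !mapA_ltr// fs fp.
Qed.

End Naturality.

(* The degree in the cobar construction, in which [b] has degree |b| - 1. *)
Definition sdeg (B : choiceType) (deg : B -> nat) (w : seq B) : int :=
  \sum_(b <- w) ((deg b)%:Z - 1).

Section Degrees.
Variables (k : comPzRingType) (B : choiceType) (deg : B -> nat).

Lemma supp_catA m n (x y : freemod k (seq B)) :
  supp (fun w => sdeg deg w = m) x -> supp (fun w => sdeg deg w = n) y ->
  supp (fun w => sdeg deg w = m + n) (catA x y).
Proof.
move=> sx sy; have [bl br] := @bilin_catA k B.
apply: (@supp_lin k _ _ (fun w => sdeg deg w = m) _ (fun x => catA x y) _ (bl y)) sx => u um.
apply: (@supp_lin k _ _ (fun w => sdeg deg w = n) _ (catA (fbasis k u)) _ (br _)) sy => v vn.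
by rewrite catA_basis; apply: supp_basis; rewrite /sdeg big_cat -um -vn.
Qed.

Lemma supp_ltr n (x : freemod k B) : supp (fun b => deg b = n) x ->
  supp (fun w => sdeg deg w = n%:Z - 1) (ltr x).
Proof.
apply: supp_lin => [|b <-]; first by lin.
by rewrite ltr_basis; apply: supp_basis; rewrite /sdeg big_seq1.
Qed.

Lemma supp_SA s p n (x : freemod k (seq B)) : linear s -> linear p ->
  (forall n x, supp (fun b => deg b = n) x -> supp (fun b => deg b = n.+1) (s x)) ->
  (forall n x, supp (fun b => deg b = n) x -> supp (fun b => deg b = n) (p x)) ->
  supp (fun w => sdeg deg w = n) x -> supp (fun w => sdeg deg w = n + 1) (SA deg s p x).
Proof.
move=> ls lp ss sp; apply: supp_lin => [|w <-]; first by lin.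
elim: w => [|b w IH]; first by rewrite SA_one; exact: supp0.
have sb := @supp_basis k B (fun c => deg c = deg b) b erefl.
rewrite -[b :: w]/([:: b] ++ w) -catA_basis -ltr_basis SA_ltrM//.
have -> : sdeg deg ([:: b] ++ w) + 1 = (deg b).+1%:Z - 1 + sdeg deg w.
  by rewrite /sdeg big_cat /= big_seq1; move: (\sum_(_ <- w) _) => z; lia.
apply: suppD.
  by apply: supp_catA; [apply: suppN; apply: supp_ltr; exact: ss|exact: supp_basis].
have -> : (deg b).+1%:Z - 1 + sdeg deg w = (deg b)%:Z - 1 + (sdeg deg w + 1) by lia.
apply: supp_catA => //; rewrite mapA_ltr// nuA_ltr; apply: suppN; apply: supp_ltr.
apply: (supp_lin (Q := fun c => deg c = deg b)) (sp _ _ sb) => [|c cb]; first by lin.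
by rewrite nu_basis; apply: suppZ; exact: supp_basis.
Qed.

End Degrees.

Lemma supp_mapA (k : comPzRingType) (B B' : choiceType) (deg : B -> nat)
    (deg' : B' -> nat) (f : freemod k B -> freemod k B') n x :
  linear f -> (forall b, supp (fun c => deg' c = deg b) (f (fbasis k b))) ->
  supp (fun w => sdeg deg w = n) x -> supp (fun w => sdeg deg' w = n) (mapA f x).
Proof.
move=> lf sf; apply: supp_lin => [|w <-]; first by lin.
elim: w => [|b w IH]; first by rewrite mapA_one; apply: supp_basis; rewrite /sdeg !big_nil.
have -> : sdeg deg (b :: w) = (deg b)%:Z - 1 + sdeg deg w by rewrite /sdeg big_cons.
rewrite -[b :: w]/([:: b] ++ w) -catA_basis -ltr_basis mapA_ltrM//.
by apply: supp_catA => //; apply: supp_ltr; exact: sf.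
Qed.

(** Convolution without signs, which makes it strictly associative ([stA]). The Koszul sign for a
    second factor of odd degree is added in [star]. *)
HB.lock Definition st (k : comPzRingType) (R : realType) (Y : topologicalType)
    (B : choiceType) (f g : chains k R Y -> freemod k (seq B)) (U : chains k R Y) :
    freemod k (seq B) :=
  tlift (fun x y => catA (f x) (g y)) (cm U).
Arguments st.body {k R Y B} f g U.

Section StarProduct.
Variables (k : comPzRingType) (R : realType) (Y : topologicalType) (B : choiceType).
Notation C := (chains k R Y).
Notation A := (freemod k (seq B)).
Notation nuC := (nu (k := k) (@cell_dim R Y)).
Implicit Types f g h : C -> A.

Lemma lin_st f g : linear (st f g).
Proof.
have lc : linear (@cm k R Y) by lin.
by rewrite st.unlock; apply: (@lin_comp _ _ _ _ _ _ (@lin_tlift _ _ _ _ _) lc).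
Qed.

Lemma st_ext f f' g g' U : f =1 f' -> g =1 g' -> st f g U = st f' g' U.
Proof. by move=> ff gg; rewrite st.unlock; apply: tlift_ext => x y; rewrite ff gg. Qed.

Lemma st_extl f f' g U : f =1 f' -> st f g U = st f' g U.
Proof. by move=> ff; exact: st_ext. Qed.

Lemma st_extr f g g' U : g =1 g' -> st f g U = st f g' U.
Proof. by move=> gg; exact: st_ext. Qed.

Lemma st0l g U : st (fun=> 0) g U = 0.
Proof.
have [bl br] := @bilin_catA k B.
by rewrite st.unlock -[RHS](tlift0 _ (cm U)); apply: tlift_ext => x y; rewrite (lin0 (bl _)).
Qed.

Lemma st0r f U : st f (fun=> 0) U = 0.
Proof.
have [bl br] := @bilin_catA k B.
by rewrite st.unlock -[RHS](tlift0 _ (cm U)); apply: tlift_ext => x y; rewrite (lin0 (br _)).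
Qed.

Lemma stDl f f' g U : st (fun u => f u + f' u) g U = st f g U + st f' g U.
Proof.
have [bl br] := @bilin_catA k B.
by rewrite st.unlock -tliftD; apply: tlift_ext => x y; rewrite (linD _ _ (bl _)).
Qed.

Lemma stDr f g g' U : st f (fun u => g u + g' u) U = st f g U + st f g' U.
Proof.
have [bl br] := @bilin_catA k B.
by rewrite st.unlock -tliftD; apply: tlift_ext => x y; rewrite (linD _ _ (br _)).
Qed.

Lemma st_suml n (f : 'I_n -> C -> A) g U : st (fun u => \sum_(i < n) f i u) g U = \sum_(i < n) st (f i) g U.
Proof.
have [bl br] := @bilin_catA k B.
by rewrite st.unlock -tlift_sum; apply: tlift_ext => x y; rewrite (linsum _ _ _ (bl _)).
Qed.

Lemma st_sumr n f (g : 'I_n -> C -> A) U : st f (fun u => \sum_(i < n) g i u) U = \sum_(i < n) st f (g i) U.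
Proof.
have [bl br] := @bilin_catA k B.
by rewrite st.unlock -tlift_sum; apply: tlift_ext => x y; rewrite (linsum _ _ _ (br _)).
Qed.

Lemma st_nu f g U : linear f -> linear g ->
  st f g (nuC U) = st (fun u => f (nuC u)) (fun u => g (nuC u)) U.
Proof.
move=> lf lg; rewrite st.unlock cm_nu tlift_tmap//; try by lin.
by apply: bilin_comp => //; exact: bilin_catA.
Qed.

Lemma stA f g h U : linear f -> linear g -> linear h ->
  st (fun u => st f g u) h U = st f (fun u => st g h u) U.
Proof.
move=> lf lg lh; have bc := @bilin_catA k B; have [bl br] := bc.
have lcm : linear (@cm k R Y) by lin.
pose F x (z : freemod k (cell R Y * cell R Y)%type) : A :=
  catA (f x) (tlift (fun y z => catA (g y) (h z)) z).
have bF : bilin F.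
  split=> [z|x]; rewrite /F.
    by apply: (@lin_comp _ _ _ _ (fun u => catA u _) _ (bl _)).
  by apply: (@lin_comp _ _ _ _ _ _ (br _)); lin.
have b2 : bilin (fun y z => catA (g y) (h z)) by apply: bilin_comp.
have b1 : bilin (fun y z => catA (f y) (g z)) by apply: bilin_comp.
transitivity (tlift F (tmap (fun y => y) cm (cm U))); last first.
  by rewrite tlift_tmap// ; rewrite ?st.unlock//; lin.
rewrite cmA st.unlock.
move: (cm U) => z; move: z; apply: tens_ext => [||x y].
- by lin.
- apply: (@lin_comp _ _ _ _ _ _ (@lin_tlift _ _ _ _ _)); apply: (@lin_comp _ _ _ _ _ _ (@lin_asl _ _ _ _)).
  exact: lin_tmap.
have la := @lin_asl k (cell R Y) (cell R Y) (cell R Y).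
have bL : bilin (fun x y => catA (tlift (fun x0 y0 => catA (f x0) (g y0)) (cm x)) (h y)).
  by apply: bilin_comp => //; lin.
rewrite tmap_tens; [|lin|lin]; rewrite tlift_tens//.
move: (cm x) => w; move: w; apply: tens_ext => [||u v].
- by apply: (@lin_comp _ _ _ _ (fun w => catA w _) _ (bl _)); lin.
- apply: (@lin_comp _ _ _ _ _ _ (@lin_tlift _ _ _ _ _)); apply: (@lin_comp _ _ _ _ _ _ la).
  exact: ((@bilin_tns k (cell R Y * cell R Y)%type (cell R Y)).1 _).
by rewrite asl_tens !tlift_tens// /F tlift_tens// catAA.
Qed.

Definition star f g := st (fun u => f (nuC u)) g.

Lemma star_nu f g U : linear f -> linear g ->
  star f g (nuC U) = st f (fun u => g (nuC u)) U.
Proof.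
move=> lf lg; rewrite /star st_nu//; last by lin.
by apply: st_ext => // u; rewrite nuK.
Qed.
End StarProduct.

Section StarLeibniz.
Variables (k : comPzRingType) (R : realType) (Y X : topologicalType).
Notation C := (chains k R Y).
Notation A := (freemod k (seq (cell R X))).
Notation nuC := (nu (k := k) (@cell_dim R _)).
Notation nuA := (nu (k := k) (cobdeg (@cell_dim R X))).
Notation dA := (dA (@cell_dim R X) (@bd k R X) (@cm k R X)).

(** The last two terms measure how far [f] and [g] are from anticommuting with the differentials;
    the remainder of the Leibniz rule is absorbed by [cm_bd] into the value on [bd U]. *)
Lemma dA_star (f g : C -> A) U : linear f -> linear g ->
  (forall u, nuA (f u) = - f (nuC u)) ->
  dA (star f g U) = star f g (bd U)
    + st (fun u => dA (f (nuC u)) + f (bd (nuC u))) g U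
    - st f (fun u => dA (g u) + g (bd u)) U.
Proof.
move=> lf lg nf; have bc := @bilin_catA k (cell R X); have [bl br] := bc.
have lbd : linear (@bd k R X) by lin.
have lbY : linear (@bd k R Y) by lin.
have lcm : linear (@cm k R X) by lin.
have ld : linear dA by lin.
have b1 : bilin (fun x y => catA (f (nuC x)) (g y)) by apply: bilin_comp => //; lin.
rewrite stDl stDr /star st.unlock cm_bd (linD _ _ (@lin_tlift _ _ _ _ _)).
rewrite !tlift_tmap//; [|lin..].
rewrite (tlift_app _ _ ld) -!tliftD -tliftN -tliftD; apply: tlift_ext => x y.
rewrite (@dAM k _ (@cell_dim R X) _ _ lbd lcm) nf nuK (linN _ (bl _)) nu_bd (linN _ lf) (linN _ (bl _)).
zring.
Qed.

Lemma nuA_star (f g : C -> A) U : linear f -> linear g ->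
  (forall u, nuA (f u) = - f (nuC u)) -> (forall u, nuA (g u) = - g (nuC u)) ->
  nuA (star f g U) = star f g (nuC U).
Proof.
move=> lf lg nf ng; have bc := @bilin_catA k (cell R X); have [bl br] := bc.
have ln : linear nuA by lin.
rewrite star_nu// /star st.unlock (tlift_app _ _ ln); apply: tlift_ext => x y.
by rewrite nuA_M nf ng nuK (linN _ (bl _)) (linN _ (br _)) opprK.
Qed.

Lemma supp_star (f g : C -> A) a b n U : linear f -> linear g ->
  (forall n u, supp (fun c => cell_dim c = n) u -> supp (fun w => sdeg (@cell_dim R X) w = n%:Z + a) (f u)) ->
  (forall n u, supp (fun c => cell_dim c = n) u -> supp (fun w => sdeg (@cell_dim R X) w = n%:Z + b) (g u)) ->
  supp (fun c => cell_dim c = n) U -> supp (fun w => sdeg (@cell_dim R X) w = n%:Z + a + b) (star f g U).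
Proof.
move=> lf lg sf sg sU; rewrite /star st.unlock.
apply: (@supp_lin _ _ _ _ _ (tlift _) _ _ _ (supp_cm sU)) => [|[c e] /= cen]; first by lin.
rewrite tlift_basis; have -> : n%:Z + a + b = ((cell_dim c)%:Z + a) + ((cell_dim e)%:Z + b).
  by rewrite -cen; lia.
apply: supp_catA; last by apply: sg; exact: supp_basis.
apply: sf; apply: (supp_lin (Q := fun b => cell_dim b = cell_dim c)) => [|b' bc|].
- by lin.
- by rewrite nu_basis; apply: suppZ; exact: supp_basis.
exact: supp_basis.
Qed.

Lemma mapA_star (X' : topologicalType) (F : chains k R X -> chains k R X') (f g : C -> A) U : linear F ->
  linear f -> linear g ->
  mapA F (star f g U) = star (fun u => mapA F (f u)) (fun u => mapA F (g u)) U.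
Proof.
move=> lF lf lg; have lm : linear (mapA F) by lin.
by rewrite /star st.unlock (tlift_app _ _ lm); apply: tlift_ext => x y; rewrite mapAM.
Qed.

Lemma star_cmap (Y' : topologicalType) (phi : continuousType Y' Y) (f g : C -> A) U : linear f -> linear g ->
  star f g (cmap phi U) = star (fun u => f (cmap phi u)) (fun u => g (cmap phi u)) U.
Proof.
move=> lf lg; rewrite /star st.unlock cm_cmap.
rewrite tlift_tmap; try (by lin); last first.
  by apply: bilin_comp => //; [exact: bilin_catA|lin].
by apply: tlift_ext => x y; rewrite nu_cmap.
Qed.
End StarLeibniz.

#[local] Hint Extern 0 (GRing.linear_for _ (st _ _)) => exact: lin_st : linear_maps.
#[local] Hint Extern 0 (GRing.linear_for _ (star _ _)) => exact: lin_st : linear_maps.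

(** * The twisting cochain over a contractible space with a right circle action *)

Section Contractible.
Variables (R : realType) (E : topologicalType) (h : continuousType (I01 R * E)%type E).
Variables (e0 : E) (ea : continuousType (E * S1 R)%type E).
Hypotheses (h0 : forall e, h (endpt R false, e) = e0) (h1 : forall e, h (endpt R true, e) = e).
Hypothesis he0 : forall t, h (t, e0) = e0.

Lemma slide_continuous (Y : topologicalType) :
  continuous (fun p : I01 R * (E * Y) => (h (p.1, p.2.1), p.2.2)).
Proof.
apply: pair_continuous; last first.
  by apply: (continuous_comp_all (f := snd)); exact: snd_cts.
apply: continuous_comp_all; last exact: cts_fun.
apply: pair_continuous; first exact: fst_cts.
by apply: (continuous_comp_all (f := snd)); [exact: snd_cts|exact: fst_cts].
Qed.
Definition slide (Y : topologicalType) : continuousType (I01 R * (E * Y))%type (E * Y)%type :=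
  mkcts (@slide_continuous Y).

Lemma collapse_continuous (Y : topologicalType) : continuous (fun p : E * Y => (e0, p.2)).
Proof. by apply: pair_continuous; [exact: cst_continuous|exact: snd_cts]. Qed.
Definition collapse (Y : topologicalType) : continuousType (E * Y)%type (E * Y)%type :=
  mkcts (@collapse_continuous Y).

Lemma transfer_continuous (Y : topologicalType) :
  continuous (fun p : E * (S1 R * Y) => (ea (p.1, p.2.1), p.2.2)).
Proof.
apply: pair_continuous; last first.
  by apply: (continuous_comp_all (f := snd)); exact: snd_cts.
apply: continuous_comp_all; last exact: cts_fun.
apply: pair_continuous; first exact: fst_cts.
by apply: (continuous_comp_all (f := snd)); [exact: snd_cts|exact: fst_cts].
Qed.
(** Lets the circle coordinate act on [E]. In the orbit space this has the same effect as letting it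
    act on [Y], although no action on [Y] is present yet. *)
Definition transfer (Y : topologicalType) : continuousType (E * (S1 R * Y))%type (E * Y)%type :=
  mkcts (@transfer_continuous Y).

Lemma overmap_continuous (Y Y' : topologicalType) (f : continuousType Y Y') :
  continuous (fun p : E * Y => (p.1, f p.2)).
Proof.
apply: pair_continuous; first exact: fst_cts.
by apply: (continuous_comp_all (f := snd)); [exact: snd_cts|exact: cts_fun].
Qed.
Definition overmap (Y Y' : topologicalType) (f : continuousType Y Y') :
  continuousType (E * Y)%type (E * Y')%type := mkcts (@overmap_continuous Y Y' f).

Variable k : comPzRingType.
Notation nuC := (nu (k := k) (@cell_dim R _)).
Notation nuA := (nu (k := k) (cobdeg (@cell_dim R _))).
Notation dX := (dA (@cell_dim R _) (@bd k R _) (@cm k R _)).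
Notation Aof X := (freemod k (seq (cell R X))).
Notation sC := (sC k R).

Definition iota (Y : topologicalType) (U : chains k R Y) : chains k R (E * Y)%type :=
  cmap (inpair Y e0) U.
Definition contr (Y : topologicalType) (x : Aof (E * Y)%type) : Aof (E * Y)%type :=
  SA (@cell_dim R _) (cone (slide Y)) (cmap (collapse Y)) x.
Definition collA (Y : topologicalType) (x : Aof (E * Y)%type) : Aof (E * Y)%type :=
  mapA (cmap (collapse Y)) x.

Section Basics.
Variable Y : topologicalType.
Notation s := (cone (k := k) (slide Y)).
Notation p := (cmap (k := k) (R := R) (collapse Y)).

Lemma lin_contr : linear (@contr Y).
Proof. by rewrite /contr; lin. Qed.
Lemma lin_collA : linear (@collA Y).
Proof. by rewrite /collA; lin. Qed.

Lemma slide_end1 x : cmap (cone_end (slide Y) true) x = x :> chains k R _.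
Proof. by apply: cmap_id => -[e y]; exact: (congr1 (fun z => (z, y)) (h1 e)). Qed.
Lemma slide_end0 x : cmap (cone_end (slide Y) false) x = p x.
Proof. by apply: cmap_ext => -[e y]; exact: (congr1 (fun z => (z, y)) (h0 e)). Qed.
Lemma bd_slide x : bd (s x) = x - p x - s (bd x).
Proof. by rewrite bd_cone slide_end0 slide_end1. Qed.
Lemma cm_slide x : cm (s x) = tmap s (fun y => y) (cm x) + tmap (fun y => p (nuC y)) s (cm x).
Proof.
rewrite cm_cone; congr (_ + _); apply: tmap_ext => // u; [exact: slide_end1|exact: slide_end0].
Qed.
Lemma collapse_slide x : p (s x) = 0.
Proof. by rewrite cmap_cone; apply: cone_const. Qed.
Lemma slide_iota (U : chains k R Y) : s (iota U) = 0.
Proof.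
pose H : continuousType (I01 R * Y)%type (E * Y)%type := inpair Y e0 \o mkcts (@snd_cts (I01 R) Y).
rewrite /iota (@cone_cmap _ _ _ _ _ _ _ H); first exact: cone_const.
by move=> t v; exact: (congr1 (fun z => (z, v)) (esym (he0 t))).
Qed.
Lemma collapse_iota (U : chains k R Y) : p (iota U) = iota U.
Proof. by rewrite /iota cmap_comp; apply: cmap_ext. Qed.
Lemma lin_slide : linear s. Proof. by lin. Qed.
Lemma lin_collapse : linear p. Proof. by lin. Qed.

Lemma contr_M (x y : Aof (E * Y)%type) : contr (catA x y) = catA (contr x) y + catA (nuA (collA x)) (contr y).
Proof. exact: (SAM _ lin_slide lin_collapse). Qed.
Lemma contr_ltr (x : chains k R (E * Y)%type) : contr (ltr x) = - ltr (s x).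
Proof. exact: (SA_ltr _ lin_slide lin_collapse). Qed.
Lemma nuA_contr (x : Aof (E * Y)%type) : nuA (contr x) = - contr (nuA x).
Proof. apply: (nuA_SA lin_slide lin_collapse) => u; [exact: nu_cmap|exact: nu_cone]. Qed.
Lemma dA_contr (x : Aof (E * Y)%type) : dX (contr x) = x - collA x - contr (dX x).
Proof.
have lb : linear (@bd k R (E * Y)%type) by lin.
have lc : linear (@cm k R (E * Y)%type) by lin.
apply: (dA_SA lb lc lin_slide lin_collapse) => u.
- exact: nu_cmap.
- exact: nu_cone.
- by rewrite nu_bd opprK.
- exact: cm_nu.
- by rewrite cmap_bd.
- exact: cm_cmap.
- exact: bd_slide.
- exact: cm_slide.
Qed.
Lemma collA_contr (x : Aof (E * Y)%type) : collA (contr x) = 0.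
Proof. exact: (mapA_SA0 _ lin_slide lin_collapse lin_collapse collapse_slide). Qed.
End Basics.

Lemma contr_nat (Y Y' : topologicalType) (f : continuousType Y Y') (x : Aof (E * Y)%type) :
  mapA (cmap (overmap f)) (contr x) = contr (mapA (cmap (overmap f)) x).
Proof.
have lf : linear (cmap (k := k) (R := R) (overmap f)) by lin.
rewrite /contr; apply: (mapA_SA (@lin_slide Y) (@lin_collapse Y) (@lin_slide Y') (@lin_collapse Y') lf) => u.
- exact: nu_cmap.
- by rewrite cmap_cone; symmetry; apply: cone_cmap.
- by rewrite !cmap_comp; apply: cmap_ext.
Qed.

(** The term of index [n] needs all smaller ones, over [Y] and over the product of the circle with
    [Y]; so the recursion carries the whole family up to [n], with value 0 beyond. The tests for 0
    leave Phi_0 out of the products, and the last summand of the second sum falls in the range where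
    the value is 0. *)
Fixpoint Phi_upto (n i : nat) (Y : topologicalType) (U : chains k R Y) :
    Aof (E * Y)%type :=
  if n is m.+1 then
    if i == n then
      contr (\sum_(j < m.+2)
          star (if nat_of_ord j is 0%N then fun=> 0 else @Phi_upto m j Y)
            (if (m.+1 - j)%N is 0%N then fun=> 0 else @Phi_upto m (m.+1 - j) Y) U
        + \sum_(j < m.+2) mapA (cmap (transfer Y))
            (@Phi_upto m j (S1 R * Y)%type (ez (sC (m.+1 - j)) U)))
    else @Phi_upto m i Y U
  else if i is 0%N then ltr (iota U) else 0.

Definition Phi (n : nat) (Y : topologicalType) (U : chains k R Y) := Phi_upto n n U.
(** The equation of index [n] contains Phi_n itself in its products with Phi_0. Dropping Phi_0
    leaves terms of lower index, from which Phi_n can be defined. *)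
Definition Phip (n : nat) (Y : topologicalType) (U : chains k R Y) : Aof (E * Y)%type :=
  if n is 0%N then 0 else Phi n U.
Definition Theta (n : nat) (Y : topologicalType) (U : chains k R Y) : Aof (E * Y)%type :=
  \sum_(j < n.+1) mapA (cmap (transfer Y)) (@Phi j (S1 R * Y)%type (ez (sC (n - j)) U)).
Definition Rhs (n : nat) (Y : topologicalType) (U : chains k R Y) : Aof (E * Y)%type :=
  \sum_(j < n.+1) star (@Phip j Y) (@Phip (n - j) Y) U + Theta n U.

Lemma Phi_upto_gt n i (Y : topologicalType) (U : chains k R Y) : (n < i)%N -> Phi_upto n i U = 0.
Proof.
elim: n i => [|n IH] [|i]//= ni; rewrite gtn_eqF ?IH//; exact: ltnW.
Qed.

Lemma Phi_uptoE n i (Y : topologicalType) (U : chains k R Y) : (i <= n)%N -> Phi_upto n i U = Phi i U.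
Proof.
rewrite /Phi; elim: n => [|n IH]; first by rewrite leqn0 => /eqP ->.
by rewrite leq_eqVlt => /orP[/eqP->//|ni]; rewrite -IH//= ltn_eqF.
Qed.

Lemma lin_Phi_upto n i (Y : topologicalType) : linear (@Phi_upto n i Y).
Proof.
elim: n i Y => [|n IH] i Y.
  by case: i => [|i] /=; [rewrite /iota; lin|exact: lin_zero].
rewrite /=; case: (i == n.+1); last exact: IH.
have lc := @lin_contr Y; have [el er] := @bilin_ez k R (S1 R) Y.
apply: (@lin_comp _ _ _ _ (@contr Y) _ lc); apply: lin_add; apply: lin_sum => j.
  exact: lin_st.
apply: (@lin_comp _ _ _ _ (mapA _) _); first by lin.
by apply: (@lin_comp _ _ _ _ _ _ (IH _ _)); exact: er.
Qed.

Lemma lin_Phi n (Y : topologicalType) : linear (@Phi n Y).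
Proof. exact: lin_Phi_upto. Qed.
Lemma lin_Phip n (Y : topologicalType) : linear (@Phip n Y).
Proof. by case: n => [|n]; [exact: lin_zero|exact: lin_Phi]. Qed.
Lemma lin_Theta n (Y : topologicalType) : linear (@Theta n Y).
Proof.
have [el er] := @bilin_ez k R (S1 R) Y.
apply: lin_sum => j; apply: (@lin_comp _ _ _ _ (mapA _) _); first by lin.
by apply: (@lin_comp _ _ _ _ _ _ (@lin_Phi _ _)); exact: er.
Qed.

Lemma Phi0 (Y : topologicalType) (U : chains k R Y) : Phi 0 U = ltr (iota U).
Proof. by []. Qed.

Lemma PhiS n (Y : topologicalType) (U : chains k R Y) : Phi n.+1 U = contr (Rhs n.+1 U).
Proof.
have [el er] := @bilin_ez k R (S1 R) Y.
rewrite /Phi /= eqxx /Rhs; congr (contr (_ + _)); apply: eq_bigr => j _.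
  case: (posnP j) => [->|j0]; first by rewrite /star !st0l.
  case nj: (n.+1 - j)%N => [|i]; first by rewrite /star !st0r.
  have jn : (j <= n)%N by rewrite -ltnS -subn_gt0 nj.
  have ni : (i < n)%N by rewrite -ltnS -nj; lia.
  rewrite /star; apply: st_ext => u; last by rewrite Phi_uptoE.
  by case: (nat_of_ord j) j0 jn => // m _ mn; rewrite Phi_uptoE.
have [jn|jn] := leqP j n; first by rewrite Phi_uptoE.
have -> : (n.+1 - j = 0)%N by have := ltn_ord j; lia.
rewrite sC0 (lin0 (el _)) Phi_upto_gt//.
by rewrite (lin0 (@lin_Phi _ _)).
Qed.

(** Every ingredient of the recursion is natural and none uses an action on [Y], so all continuous
    maps are allowed. The maps of interest are the multiplication of the circle ([Phi_mulS1]) and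
    the action map ([porb_Theta]). *)
Lemma Phi_nat n (Y Y' : topologicalType) (f : continuousType Y Y') (U : chains k R Y) :
  mapA (cmap (overmap f)) (Phi n U) = Phi n (cmap f U).
Proof.
elim/ltn_ind: n Y Y' f U => -[|n] IH Y Y' f U.
  rewrite !Phi0 mapA_ltr; last by lin.
  by congr ltr; rewrite /iota !cmap_comp; apply: cmap_ext.
have lm : linear (mapA (cmap (k := k) (R := R) (overmap f))) by lin.
have lF : linear (cmap (k := k) (R := R) (overmap f)) by lin.
have lP := @lin_Phi; have lPp := @lin_Phip.
rewrite !PhiS contr_nat; congr contr; rewrite /Rhs (linD _ _ lm) !(linsum _ _ _ lm).
congr (_ + _).
  apply: eq_bigr => j _; rewrite (mapA_star _ lF (lPp _ _) (lPp _ _)) (star_cmap _ _ (lPp _ _) (lPp _ _)).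
  have Pp m u : (m <= n.+1)%N -> ((0 < n.+1 - m) || (m == 0))%N -> mapA (cmap (overmap f)) (Phip m u) = Phip m (cmap f u).
    case: m => [|m] mn; first by rewrite /Phip (lin0 lm).
    by rewrite orbF subn_gt0 => mn'; exact: IH.
  case: (posnP j) => [->|j0]; first by rewrite /star !st0l ?(lin0 lm)// /Phip; under st_extl => u do rewrite (lin0 lm); rewrite st0l.
  have jn := ltn_ord j.
  have [->|jn1] := eqVneq (nat_of_ord j) n.+1.
    rewrite subnn /star [LHS](_ : _ = 0) ?[RHS](_ : _ = 0)//.
      by rewrite (st_extr _ _ (g' := fun=> 0)) ?st0r.
    by rewrite (st_extr _ _ (g' := fun=> 0)) ?st0r// => u; rewrite /Phip (lin0 lm).
  by rewrite /star; apply: st_ext => u; apply: Pp; lia.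
apply: eq_bigr => j _.
case nj: (n.+1 - j)%N => [|i].
  have [el er] := @bilin_ez k R (S1 R) Y; have [el' er'] := @bilin_ez k R (S1 R) Y'.
  have lt : linear (mapA (cmap (k := k) (R := R) (transfer Y))) by lin.
  have lt' : linear (mapA (cmap (k := k) (R := R) (transfer Y'))) by lin.
  rewrite sC0 (lin0 (el _)) (lin0 (el' _)) !(lin0 (lP _ _)).
  by rewrite (lin0 lt) (lin0 lt') (lin0 lm).
rewrite mapA_comp; [|lin|lin].
pose f1 := prodmap (idfun : continuousType (S1 R) (S1 R)) f.
have <- : mapA (cmap (overmap f1)) (Phi j (ez (sC i.+1) U)) = Phi j (ez (sC i.+1) (cmap f U)).
  rewrite IH; last by lia.
  by rewrite -cmap_ez (@cmap_id _ _ _ idfun).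
rewrite mapA_comp; [|lin|lin]; apply: mapA_ext => [||u].
- by apply: (@lin_comp _ _ _ _ (cmap _) (cmap _)); lin.
- by apply: (@lin_comp _ _ _ _ (cmap _) (cmap _)); lin.
by rewrite !cmap_comp; apply: cmap_ext.
Qed.

Lemma nuA_Phi n (Y : topologicalType) (U : chains k R Y) : nuA (Phi n U) = - Phi n (nuC U).
Proof.
elim/ltn_ind: n Y U => -[|n] IH Y U.
  by rewrite !Phi0 nuA_ltr /iota nu_cmap.
have ln : linear (nu (k := k) (cobdeg (@cell_dim R (E * Y)%type))) by lin.
have lP := @lin_Phi; have lPp := @lin_Phip.
rewrite !PhiS nuA_contr; congr (- contr _); rewrite /Rhs (linD _ _ ln) !(linsum _ _ _ ln).
have N0 m V : (m < n.+1)%N -> nuA (@Phip m Y V) = - Phip m (nuC V).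
  by case: m => [|m] mn; [rewrite /= (lin0 ln) oppr0|exact: IH].
congr (_ + _); apply: eq_bigr => j _.
  case: (posnP j) => [->|j0]; first by rewrite /star !st0l (lin0 ln).
  have jn := ltn_ord j.
  have [->|jn1] := eqVneq (nat_of_ord j) n.+1.
    by rewrite subnn /star !st0r (lin0 ln).
  by rewrite nuA_star//; (try exact: lPp) => u; apply: N0; lia.
have [el er] := @bilin_ez k R (S1 R) Y.
have lt : linear (mapA (cmap (k := k) (R := R) (transfer Y))) by lin.
case nj: (n.+1 - j)%N => [|i].
  by rewrite sC0 !(lin0 (el _)) !(lin0 (lP _ _)) (lin0 lt) (lin0 ln).
rewrite -(@mapA_nu _ _ (@cell_dim R _) _ (@cell_dim R _)); [|lin|by move=> u; exact: nu_cmap].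
rewrite IH; last by lia.
by rewrite nu_ez nu_sC (linN _ (el _)) (linN _ (lP _ _)) opprK.
Qed.

Lemma supp_Phi n m (Y : topologicalType) (U : chains k R Y) :
  supp (fun c => cell_dim c = m) U ->
  supp (fun w => sdeg (@cell_dim R (E * Y)%type) w = m%:Z + (n.*2%:Z - 1)) (Phi n U).
Proof.
elim/ltn_ind: n m Y U => -[|n] IH m Y U sU.
  by rewrite Phi0 add0r; apply: supp_ltr; rewrite /iota; exact: supp_cmap.
rewrite PhiS.
have -> : m%:Z + ((n.+1).*2%:Z - 1) = m%:Z + (n.+1.*2%:Z - 2) + 1 by lia.
apply: supp_SA; [lin|lin|by move=> *; exact: supp_cone|by move=> *; exact: supp_cmap|].
have lPp := @lin_Phip.
apply: suppD; apply: supp_sum => j _.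
  case: (posnP j) => [->|j0]; first by rewrite /star !st0l; exact: supp0.
  have jn := ltn_ord j.
  have [->|jn1] := eqVneq (nat_of_ord j) n.+1.
    by rewrite subnn /star !st0r; exact: supp0.
  have -> : m%:Z + (n.+1.*2%:Z - 2) = m%:Z + (j.*2%:Z - 1) + ((n.+1 - j).*2%:Z - 1) by lia.
  apply: supp_star => // m' u su.
    by case: (nat_of_ord j) j0 jn jn1 => // l _ ln ln1; apply: IH => //; lia.
  case nj: (n.+1 - j)%N => [|l]; first by lia.
  by apply: IH => //; lia.
case nj: (n.+1 - j)%N => [|i].
  have [el er] := @bilin_ez k R (S1 R) Y.
  have lt : linear (mapA (cmap (k := k) (R := R) (transfer Y))) by lin.
  by rewrite sC0 (lin0 (el _)) (lin0 (@lin_Phi _ _)) (lin0 lt); exact: supp0.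
apply: (supp_mapA (deg := @cell_dim R _)) => [|b|]; first by lin.
  by apply: supp_cmap; exact: supp_basis.
apply: (suppW (P := fun w => sdeg (@cell_dim R _) w = (i.*2.+1 + m)%:Z + (j.*2%:Z - 1))).
  by move=> w ->; have := ltn_ord j; lia.
apply: IH; first by have := ltn_ord j; lia.
by apply: supp_ez => //; apply: suppW (@supp_sC k R i.+1) => c; rewrite doubleS => -[].
Qed.

(** Terms of positive index lie in the image of [contr], which the collapse kills. The remaining
    term, with Phi_0, becomes degenerate: after the collapse the circle coordinate is forgotten, and
    the circle chain has positive dimension. *)
Lemma collA_Rhs n (Y : topologicalType) (U : chains k R Y) : collA (Rhs n.+1 U) = 0.
Proof.
have lc := @lin_collA Y; have [el er] := @bilin_ez k R (S1 R) Y.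
have lPp := @lin_Phip.
have cPp m (Z : topologicalType) (V : chains k R Z) : collA (Phip m V) = 0.
  by case: m => [|m]; [rewrite (lin0 (@lin_collA Z))|rewrite /Phip PhiS collA_contr].
rewrite /Rhs (linD _ _ lc) !(linsum _ _ _ lc) !big1 ?addr0// => j _; last first.
  rewrite /collA mapA_star//; [|lin].
  rewrite /star (st_extl (f' := fun=> 0)) ?st0l// => u; exact: cPp.
pose psi' : continuousType (E * (S1 R * Y))%type (E * Y)%type := overmap (mkcts (@snd_cts (S1 R) Y)).
have e1 : collA (mapA (cmap (transfer Y)) (Phi j (ez (sC (n.+1 - j)) U))) =
  mapA (cmap psi') (collA (Phi j (ez (sC (n.+1 - j)) U))).
  rewrite /collA mapA_comp; [|lin|lin]; rewrite mapA_comp; [|lin|lin].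
  apply: mapA_ext => [||u].
  - by apply: (@lin_comp _ _ _ _ (cmap _) (cmap _)); lin.
  - by apply: (@lin_comp _ _ _ _ (cmap _) (cmap _)); lin.
  by rewrite !cmap_comp; apply: cmap_ext.
rewrite e1.
have lp' : linear (mapA (cmap (k := k) (R := R) psi')) by lin.
case jE: (nat_of_ord j) => [|i]; last first.
  by rewrite PhiS collA_contr (lin0 lp').
rewrite subn0 Phi0 /collA mapA_ltr; last by lin.
rewrite collapse_iota mapA_ltr; last by lin.
rewrite /iota cmap_comp (@cmap_ez_degenerate _ _ _ _ _ _ n.*2) ?(lin0 (@lin_ltr _ _))//.
by apply: suppW (@supp_sC k R n.+1) => e; rewrite doubleS => -[].
Qed.

Hypotheses (ea1 : forall e, ea (e, oneS1 R) = e).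
Hypothesis eaM : forall e a b, ea (e, mulS1 a b) = ea (ea (e, a), b).
Notation one := (ptc k R (oneS1 R)).
Notation psiA Y := (mapA (cmap (k := k) (R := R) (transfer Y))).

Lemma lin_psiA Y : linear (psiA Y). Proof. by lin. Qed.

Lemma Phi_one n (Y : topologicalType) (U : chains k R Y) : psiA Y (Phi n (ez one U)) = Phi n U.
Proof.
rewrite ez_ptl -Phi_nat mapA_comp; [|lin|lin]; apply: mapA_id => [|u].
  by apply: (@lin_comp _ _ _ _ (cmap _) (cmap _)); lin.
by rewrite cmap_comp; apply: cmap_id => -[e y]; exact: (congr1 (fun z => (z, y)) (ea1 e)).
Qed.

(** Transferring a product of circle elements in one step or in two gives the same result, by
    associativity of the right action. *)
Lemma Phi_mulS1 n (Y : topologicalType) x y (U : chains k R Y) :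
  psiA Y (Phi n (ez (pr (mulS1c R) x y) U)) = psiA Y (psiA (S1 R * Y)%type (Phi n (ez x (ez y U)))).
Proof.
have mc : continuous (fun p : S1 R * (S1 R * Y) => (mulS1 p.1 p.2.1, p.2.2)).
  apply: pair_continuous; last by apply: (continuous_comp_all (f := snd)); exact: snd_cts.
  apply: mulS1_continuous; first exact: fst_cts.
  by apply: (continuous_comp_all (f := snd)); [exact: snd_cts|exact: fst_cts].
have -> : ez (pr (mulS1c R) x y) U = cmap (mkcts mc) (ez x (ez y U)).
  rewrite -ezA cmap_comp -[U in LHS](@cmap_id _ _ _ idfun)// /pr cmap_ez.
  by apply: cmap_ext => -[[a b] c].
rewrite -Phi_nat !mapA_comp; [|lin..].
apply: mapA_ext => [||u].
- by apply: (@lin_comp _ _ _ _ (cmap _) (cmap _)); lin.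
- by apply: (@lin_comp _ _ _ _ (cmap _) (cmap _)); lin.
rewrite !cmap_comp; apply: cmap_ext => -[e [a [b z]]].
exact: (congr1 (fun v => (v, z)) (eaM e a b)).
Qed.

(** Because [sC j] is primitive, it meets only one of the two factors; the other one receives the
    unit, which [Phi_one] removes. *)
Lemma Phi_star_ez a b j (Y : topologicalType) (U : chains k R Y) :
  psiA Y (star (@Phi a _) (@Phi b _) (ez (sC j) U)) =
  st (@Phi a Y) (fun v => psiA Y (Phi b (ez (sC j) v))) U -
  st (fun u => psiA Y (Phi a (ez (sC j) (nuC u)))) (@Phi b Y) U.
Proof.
have lP := @lin_Phi; have bc := @bilin_catA k (cell R (E * Y)%type); have [bl br] := bc.
have lps := @lin_psiA Y.
have [el er] := @bilin_ez k R (S1 R) Y.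
have lpc : linear (cmap (k := k) (R := R) (transfer Y)) by lin.
rewrite mapA_star// /star.
have -> : ez (sC j) U = pr (idfun : continuousType (S1 R * Y)%type (S1 R * Y)%type) (sC j) U.
  by rewrite /pr cmap_id.
have pE x v : pr (idfun : continuousType (S1 R * Y)%type (S1 R * Y)%type) x v = ez x v :> chains k R _.
  by rewrite /pr cmap_id.
have l1 m : linear (fun u => psiA Y (@Phi m (S1 R * Y)%type u)).
  exact: (@lin_comp _ _ _ _ _ _ lps (lP _ _)).
have l2 m : linear (fun u => psiA Y (@Phi m (S1 R * Y)%type (nuC u))).
  by apply: (@lin_comp _ _ _ _ (fun u => psiA Y (Phi m u)) _ (l1 m)); lin.
have b1 : bilin (fun x y => catA (psiA Y (@Phi a (S1 R * Y)%type (nuC x))) (psiA Y (@Phi b (S1 R * Y)%type y))).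
  exact: (bilin_comp bc (l2 a) (l1 b)).
have [_ lp1] := @bilin_pr k R _ _ _ (idfun : continuousType (S1 R * Y)%type (S1 R * Y)%type).
have ln : linear (fun u => pr (idfun : continuousType (S1 R * Y)%type (S1 R * Y)%type) one (nu (k := k) (@cell_dim R Y) u)).
  exact: (@lin_comp _ _ _ _ _ _ (lp1 one) (@lin_nu _ _ _)).
rewrite st.unlock cm_pr_sC (linD _ _ (@lin_tlift _ _ _ _ _)) !tlift_tmap//.
rewrite addrC -tliftN; congr (_ + _); apply: tlift_ext => u v; rewrite !pE.
  by rewrite nu_ez nuK nu_ptc !Phi_one.
by rewrite nu_ez nu_sC (linN _ (el _)) (linN _ (lP _ _)) (linN _ lps) (linN _ (bl _)) Phi_one.
Qed.

(** * The inductive step of the twisting equation *)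

Section Step.
Variables (n : nat).
Hypothesis IH : forall m, (m < n.+1)%N -> forall (Y : topologicalType) (U : chains k R Y),
  dX (Phi m U) = \sum_(i < m.+1) star (@Phi i Y) (@Phi (m - i) Y) U + Theta m U - Phi m (bd U).
Variable Y : topologicalType.
Notation N := n.+1.
Implicit Type U : chains k R Y.

Lemma Theta0 (Z : topologicalType) (U : chains k R Z) : Theta 0 U = 0.
Proof.
have [el er] := @bilin_ez k R (S1 R) Z; have lt := @lin_psiA Z.
by rewrite /Theta big_ord1 sC0 (lin0 (el _)) (lin0 (@lin_Phi _ _)) (lin0 lt).
Qed.

Lemma st_Phi_splitr m (F : nat -> chains k R Y -> Aof (E * Y)%type) U :
  \sum_(i < m.+1) st (F i) (@Phi (m - i) Y) U =
  \sum_(i < m.+1) st (F i) (@Phip (m - i) Y) U + st (F m) (@Phi 0 Y) U.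
Proof.
rewrite !big_ord_recr /= subnn st0r addr0; congr (_ + _); apply: eq_bigr => i _.
by apply: st_extr => u; case mi: (m - i)%N => //; have := ltn_ord i; lia.
Qed.

Lemma st_Phi_splitl m (F : nat -> chains k R Y -> Aof (E * Y)%type) U :
  \sum_(i < m.+1) st (@Phi i Y) (F (m - i)%N) U =
  \sum_(i < m.+1) st (@Phip i Y) (F (m - i)%N) U + st (@Phi 0 Y) (F m) U.
Proof. by rewrite !big_ord_recl /= subn0 st0l add0r addrC; congr (_ + _); apply: eq_bigr. Qed.

Lemma star_Phi_split m (Z : topologicalType) (U : chains k R Z) :
  \sum_(i < m.+2) star (@Phi i Z) (@Phi (m.+1 - i) Z) U =
  \sum_(i < m.+2) star (@Phip i Z) (@Phip (m.+1 - i) Z) U +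
    star (@Phi 0 Z) (@Phi m.+1 Z) U + star (@Phi m.+1 Z) (@Phi 0 Z) U.
Proof.
rewrite big_ord_recl big_ord_recr /= [in RHS]big_ord_recl [in RHS]big_ord_recr /=.
rewrite /bump /= add1n subnn subn0 /star st0l st0r add0r addr0 addrCA addrA.
congr (_ + _ + _); apply: eq_bigr => i _; apply: st_ext => // u.
by rewrite add1n subSS; case mi: (m - i)%N => //; have := ltn_ord i; lia.
Qed.

Let Rp (u : chains k R Y) := \sum_(j < N.+1) star (@Phip j Y) (@Phip (N - j) Y) u.
Let Do m (u : chains k R Y) := Theta m u + \sum_(j < m.+1) star (@Phip j Y) (@Phip (m - j) Y) u
  + star (@Phi 0 Y) (@Phip m Y) u + star (@Phip m Y) (@Phi 0 Y) u.

Lemma DoE m (u : chains k R Y) : (m <= n)%N -> dX (Phip m u) + Phip m (bd u) = Do m u.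
Proof.
have ld : linear (dA (@cell_dim R (E * Y)%type) (@bd k R (E * Y)%type) (@cm k R (E * Y)%type)) by lin.
case: m => [|m] mn.
  by rewrite /Do Theta0 big_ord1 /star !st0l st0r (lin0 ld) !addr0.
by rewrite /Do {1 2}/Phip IH// subrK star_Phi_split [RHS](ACl ((2*3*4)*1)).
Qed.

(** Triple products of positive index cancel by associativity, and so do those with Phi_0 in the
    middle. The outer products with Phi_0 survive, and the products of Theta with terms of positive
    index. *)
Lemma dA_Rp U : dX (Rp U) = Rp (bd U)
  + \sum_(i < N.+1) (st (fun u => Theta i (nuC u)) (@Phip (N - i) Y) U
      - st (@Phip i Y) (@Theta (N - i) Y) U)
  + st (@Phi 0 Y) Rp U - st (fun u => Rp (nuC u)) (@Phi 0 Y) U.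
Proof.
have ld : linear (dA (@cell_dim R (E * Y)%type) (@bd k R (E * Y)%type) (@cm k R (E * Y)%type)) by lin.
have lPp := @lin_Phip; have lP := @lin_Phi; have lT := @lin_Theta.
have lnp m : linear (fun u => @Phip m Y (nuC u)).
  by apply: (@lin_comp _ _ _ _ _ _ (lPp _ _)); lin.
have lst := @lin_st.
pose F a b c := st (@Phip a Y) (fun u => star (@Phip b Y) (@Phip c Y) u) U.
rewrite {1}/Rp (linsum _ _ _ ld).
have e1 (i : 'I_N.+1) : dX (star (@Phip i Y) (@Phip (N - i) Y) U) =
    star (@Phip i Y) (@Phip (N - i) Y) (bd U) +
    (st (fun u => Theta i (nuC u)) (@Phip (N - i) Y) U - st (@Phip i Y) (@Theta (N - i) Y) U)
    + st (@Phi 0 Y) (star (@Phip i Y) (@Phip (N - i) Y)) U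
    - st (fun u => star (@Phip i Y) (@Phip (N - i) Y) (nuC u)) (@Phi 0 Y) U
    + (\sum_(l < i.+1) F l (i - l)%N (N - i)%N - \sum_(l < (N - i).+1) F i l (N - i - l)%N).
  rewrite dA_star//; last first.
    move=> u; case: (nat_of_ord i) => [|m]; last exact: nuA_Phi.
    by rewrite /= oppr0 (lin0 (@lin_nu _ _ _)).
  have i1 : st (fun u => dX (Phip i (nuC u)) + Phip i (bd (nuC u))) (@Phip (N - i) Y) U =
      st (fun u => Do i (nuC u)) (@Phip (N - i) Y) U.
    case Ni: (N - i)%N => [|l]; first by rewrite !st0r.
    by apply: st_extl => u; rewrite DoE//; lia.
  have i2 : st (@Phip i Y) (fun u => dX (Phip (N - i) u) + Phip (N - i) (bd u)) U =
      st (@Phip i Y) (Do (N - i)) U.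
    case: (posnP i) => [->|i0]; first by rewrite !st0l.
    by apply: st_extr => u; rewrite DoE//; lia.
  rewrite i1 i2 /Do !stDl !stDr (st_suml (fun (l : 'I_i.+1) u => star (@Phip l Y) (@Phip (i - l) Y) (nuC u))) st_sumr.
  have a1 (l : nat) : st (fun u => star (@Phip l Y) (@Phip (i - l) Y) (nuC u)) (@Phip (N - i) Y) U = F l (i - l)%N (N - i)%N.
    rewrite /F -stA//; apply: st_extl => u; by rewrite star_nu.
  have a2 : st (fun u => star (@Phi 0 Y) (@Phip i Y) (nuC u)) (@Phip (N - i) Y) U =
      st (@Phi 0 Y) (star (@Phip i Y) (@Phip (N - i) Y)) U.
    by rewrite -stA//; apply: st_extl => u; rewrite star_nu.
  have l0 : linear (fun u => @Phi 0 Y (nuC u)) by apply: (@lin_comp _ _ _ _ _ _ (lP _ _)); lin.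
  have a3 : st (fun u => star (@Phip i Y) (@Phi 0 Y) (nuC u)) (@Phip (N - i) Y) U =
      st (@Phip i Y) (star (@Phi 0 Y) (@Phip (N - i) Y)) U.
    by rewrite -stA//; apply: st_extl => u; rewrite star_nu.
  have a4 : st (@Phip i Y) (star (@Phip (N - i) Y) (@Phi 0 Y)) U =
      st (fun u => star (@Phip i Y) (@Phip (N - i) Y) (nuC u)) (@Phi 0 Y) U.
    by rewrite -stA//; apply: st_extl => u; rewrite star_nu.
  under eq_bigr => l _ do rewrite a1.
  rewrite a2 a3 a4 /F; zring.
under eq_bigr => i _ do rewrite e1.
rewrite !big_split /= !sumrN (conv3 F) subrr addr0.
have -> : \sum_(i < N.+1) st (@Phi 0 Y) (star (@Phip i Y) (@Phip (N - i) Y)) U = st (@Phi 0 Y) Rp U.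
  by rewrite -st_sumr.
by rewrite -st_suml.
Qed.

(** [G] collects the terms with two circle chains; they occur once through the equation of lower
    index and once through the boundary of the circle chain, and cancel. [F] and [F'] are the two
    halves of [Phi_star_ez]. *)
Lemma dA_Theta U : dX (Theta N U) = Theta N (bd U)
  + \sum_(i < N.+1) (st (@Phi i Y) (@Theta (N - i) Y) U - st (fun u => Theta i (nuC u)) (@Phi (N - i) Y) U).
Proof.
have ld : linear (dA (@cell_dim R (E * Y)%type) (@bd k R (E * Y)%type) (@cm k R (E * Y)%type)) by lin.
have ldS (Z : topologicalType) : linear (dA (@cell_dim R Z) (@bd k R Z) (@cm k R Z)) by lin.
have lps := @lin_psiA Y; have lps' := @lin_psiA (S1 R * Y)%type; have lP := @lin_Phi.
have [el er] := @bilin_ez k R (S1 R) Y.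
have lb Z : linear (@bd k R Z) by lin.
have lc Z : linear (@cm k R Z) by lin.
have lpc : linear (cmap (k := k) (R := R) (transfer Y)) by lin.
rewrite {1}/Theta (linsum _ _ _ ld).
pose G a b c := psiA Y (psiA (S1 R * Y)%type (@Phi a (S1 R * (S1 R * Y))%type (ez (sC b) (ez (sC c) U)))).
pose F a b c := st (@Phi a Y) (fun v => psiA Y (Phi b (ez (sC c) v))) U.
pose F' a c b := st (fun u => psiA Y (Phi a (ez (sC c) (nuC u)))) (@Phi b Y) U.
have e1 (j : 'I_N.+1) : dX (psiA Y (Phi j (ez (sC (N - j)) U))) =
    psiA Y (Phi j (ez (sC (N - j)) (bd U))) +
    (\sum_(i < j.+1) F i (j - i)%N (N - j)%N - \sum_(i < j.+1) F' i (N - j)%N (j - i)%N)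
    + (\sum_(i < j.+1) G i (j - i)%N (N - j)%N - \sum_(i < (N - j).+1) G j i (N - j - i)%N).
  rewrite -(@mapA_cobar _ _ (@cell_dim R _) _ _ (lb _) (lc _) _ (@cell_dim R _) _ _ (lb _) (lc _) _ lpc); first last.
  - by move=> u; exact: cm_cmap.
  - by move=> u; rewrite cmap_bd.
  - by move=> u; exact: nu_cmap.
  have -> : dA (@cell_dim R _) (@bd k R _) (@cm k R _) (Phi j (ez (sC (N - j)) U)) =
     \sum_(i < j.+1) star (@Phi i _) (@Phi (j - i) _) (ez (sC (N - j)) U) +
     Theta j (ez (sC (N - j)) U) - Phi j (bd (ez (sC (N - j)) U)).
    have [jn|jn] := ltnP j N; first exact: IH.
    have -> : (N - j = 0)%N by lia.
    rewrite sC0 (lin0 (el _)) (lin0 (lb _)) (lin0 (lP _ _)) (lin0 (ldS _)).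
    rewrite (lin0 (@lin_Theta _ _)) big1 ?addr0 ?subr0// => i _.
    exact: (lin0 (@lin_st _ _ _ _ _ _)).
  rewrite bd_ez nu_sC (linN _ (el _)) bd_sC (linsum _ _ _ (el _)).
  rewrite (linD _ _ (lP _ _)) (linN _ (lP _ _)) (linsum _ _ _ (lP _ _)).
  rewrite (linD _ _ lps) (linD _ _ lps) (linN _ lps) (linD _ _ lps) (linN _ lps).
  rewrite /Theta !(linsum _ _ _ lps).
  under eq_bigr => i _ do rewrite Phi_star_ez.
  under [in X in _ - X]eq_bigr => i _ do rewrite Phi_mulS1.
  rewrite sumrB /F /F' /G; zring.
under eq_bigr => i _ do rewrite e1.
rewrite !big_split /= !sumrN (conv3 G) subrr addr0 -/(Theta N (bd U)); congr (_ + _).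
rewrite (conv3 F) (conv3 (fun a b c => F' a c b)); congr (_ - _).
  by apply: eq_bigr => i _; rewrite /Theta st_sumr.
have -> : \sum_(i < N.+1) st (fun u => Theta i (nuC u)) (@Phi (N - i) Y) U =
    \sum_(i < N.+1) \sum_(j < i.+1) F' j (i - j)%N (N - i)%N.
  by apply: eq_bigr => i _; rewrite /Theta st_suml.
rewrite (conv3 F'); apply: eq_bigr => i _.
by rewrite (conv_rev (F' i)).
Qed.

(** Products of Theta with terms of positive index cancel between [dA_Rp] and [dA_Theta]; its
    products with Phi_0 complete [Rp] to [Rhs]. *)
Lemma dA_Rhs U : dX (Rhs N U) = Rhs N (bd U) + st (@Phi 0 Y) (@Rhs N Y) U
  - st (fun u => Rhs N (nuC u)) (@Phi 0 Y) U.
Proof.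
have ld : linear (dA (@cell_dim R (E * Y)%type) (@bd k R (E * Y)%type) (@cm k R (E * Y)%type)) by lin.
rewrite /Rhs (linD _ _ ld) -/(Rp U) -/(Rp (bd U)) dA_Rp dA_Theta !sumrB.
rewrite stDl stDr -/Rp (st_Phi_splitr _ (fun i u => Theta i (nuC u))) (st_Phi_splitl _ (fun i => @Theta i Y)).
rewrite -/(Rp _); zring.
Qed.

(** [dA_contr] applies with vanishing collapse ([collA_Rhs]). Under [contr] the two products with
    Phi_0 in [dA_Rhs] become exactly the products that [Rhs] leaves out. *)
Lemma dA_PhiS U : dX (Phi N U) =
  \sum_(i < N.+1) star (@Phi i Y) (@Phi (N - i) Y) U + Theta N U - Phi N (bd U).
Proof.
have lS := @lin_contr Y; have [bl br] := @bilin_catA k (cell R (E * Y)%type).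
have ll := @lin_ltr k (cell R (E * Y)%type).
rewrite {1}PhiS dA_contr collA_Rhs subr0 dA_Rhs (linD _ _ lS) (linD _ _ lS) (linN _ lS).
(* The contraction fixes [e0], so [contr] vanishes on the letter of Phi_0 and moves past it with a
   sign. *)
have -> : contr (st (@Phi 0 Y) (@Rhs N Y) U) = - star (@Phi 0 Y) (@Phi N Y) U.
  rewrite /star st.unlock (tlift_app _ _ lS) -tliftN; apply: tlift_ext => u v.
  rewrite contr_M !Phi0 contr_ltr slide_iota (lin0 ll) oppr0 (lin0 (bl _)) add0r.
  rewrite PhiS /collA mapA_ltr; last by lin.
  by rewrite collapse_iota nuA_ltr (linN _ (bl _)) /iota nu_cmap.
(* Here only the left factor is affected, since the other term contains the collapse of [Rhs]. *)
have -> : contr (st (fun u => Rhs N (nuC u)) (@Phi 0 Y) U) = star (@Phi N Y) (@Phi 0 Y) U.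
  rewrite /star st.unlock (tlift_app _ _ lS); apply: tlift_ext => u v.
  by rewrite contr_M collA_Rhs (lin0 (@lin_nu _ _ _)) (lin0 (bl _)) addr0 PhiS.
rewrite -PhiS star_Phi_split /Rhs; zring.
Qed.
End Step.

Theorem Phi_twisting n (Y : topologicalType) (U : chains k R Y) :
  dX (Phi n U) = \sum_(i < n.+1) star (@Phi i Y) (@Phi (n - i) Y) U + Theta n U - Phi n (bd U).
Proof.
elim/ltn_ind: n Y U => -[|n] IH Y U; last exact: dA_PhiS.
have lb Z : linear (@bd k R Z) by lin.
have lc Z : linear (@cm k R Z) by lin.
have bc := @bilin_catA k (cell R (E * Y)%type).
rewrite Theta0 big_ord1 addr0 !Phi0 (@dA_ltr _ _ _ _ _ (lb _) (lc _)) /dA1; congr (_ - _); last by rewrite /iota cmap_bd.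
rewrite /iota cm_cmap.
rewrite tlift_tmap; try (by lin); last by apply: bilin_comp => //; lin.
by rewrite /star st.unlock; apply: tlift_ext => u v; rewrite !Phi0 /iota nu_cmap.
Qed.
End Contractible.

(** * Milnor's space *)

Section MilnorCoordinates.
Variable R : realType.
Notation E := (milnorE R).

Definition jw (e : E) (i : nat) : R := join_weight e i.
(** With [jy], the complex number t_i x_i, extended by 0. These numbers are continuous, determine
    the point ([milnorE_coord_eq]), and detect continuity of maps into [E] ([milnor_continuous]). *)
Definition jx (e : E) (i : nat) : R := if e i is Some (t, x) then t * (val x).1 else 0.
Definition jy (e : E) (i : nat) : R := if e i is Some (t, x) then t * (val x).2 else 0.
Definition modulus (a b : R) : R := Num.sqrt (a ^+ 2 + b ^+ 2).

Lemma modulus_scale (t a b : R) : 0 <= t -> modulus (t * a) (t * b) = t * modulus a b.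
Proof.
by move=> t0; rewrite /modulus !exprMn -mulrDr sqrtrM ?sqr_ge0// sqrtr_sqr ger0_norm.
Qed.

Lemma modulus_ge0 a b : 0 <= modulus a b. Proof. exact: sqrtr_ge0. Qed.

Lemma modulus_eq0 a b : (modulus a b == 0) = (a == 0) && (b == 0).
Proof.
rewrite /modulus sqrtr_eq0 le_eqVlt [X in _ || X]ltNge addr_ge0 ?sqr_ge0// orbF.
by rewrite paddr_eq0 ?sqr_ge0// !sqrf_eq0.
Qed.

Lemma norm_le_modulus a b : `|a| <= modulus a b /\ `|b| <= modulus a b.
Proof.
by rewrite /modulus -!sqrtr_sqr !ler_sqrt ?addr_ge0 ?sqr_ge0// lerDl lerDr !sqr_ge0.
Qed.

Lemma modulusD a b c d : modulus (a + c) (b + d) <= modulus a b + modulus c d.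
Proof.
have h := modulus_ge0; rewrite -[leRHS]ger0_norm ?addr_ge0// -sqrtr_sqr {1}/modulus.
rewrite ler_sqrt ?sqr_ge0// [leRHS]sqrrD {1 3}/modulus !sqr_sqrtr ?addr_ge0 ?sqr_ge0//.
have cs : a * c + b * d <= modulus a b * modulus c d.
  rewrite /modulus -sqrtrM ?addr_ge0 ?sqr_ge0//; apply: le_trans (ler_norm _) _.
  rewrite -sqrtr_sqr ler_sqrt ?mulr_ge0 ?addr_ge0 ?sqr_ge0// -subr_ge0.
  have -> : (a ^+ 2 + b ^+ 2) * (c ^+ 2 + d ^+ 2) - (a * c + b * d) ^+ 2 = (a * d - b * c) ^+ 2 by ring.
  exact: sqr_ge0.
by move: cs; move: (modulus a b * modulus c d) => z; lra.
Qed.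

Lemma modulus_continuous (T : topologicalType) (f g : T -> R) t :
  {for t, continuous f} -> {for t, continuous g} -> {for t, continuous (fun s => modulus (f s) (g s))}.
Proof.
move=> cf cg; apply: (@continuous_comp _ _ _ (fun s => f s ^+ 2 + g s ^+ 2) Num.sqrt); last exact: sqrt_continuous.
by apply: cvgD; rewrite /= ?expr2; under eq_fun do rewrite expr2; apply: cvgM.
Qed.

Lemma jwE e i : jw e i = modulus (jx e i) (jy e i).
Proof.
rewrite /jw /join_weight /jx /jy; case ei: (e i) => [[t x]|].
  rewrite modulus_scale ?(ltW (jcoord_gt0 ei))// /modulus.
  by rewrite (S1P x) sqrtr1 mulr1.
by rewrite /modulus !expr0n /= addr0 sqrtr0.
Qed.

Lemma jw_ge0 e i : 0 <= jw e i. Proof. by rewrite jwE modulus_ge0. Qed.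

Lemma milnorE_coord_eq (e e' : E) : jx e =1 jx e' -> jy e =1 jy e' -> e = e'.
Proof.
move=> xx yy; apply: milnorE_eq => i.
have ww : jw e i = jw e' i by rewrite !jwE xx yy.
have := xx i; have := yy i; rewrite /jx /jy; move: ww; rewrite /jw /join_weight.
case ei: (e i) => [[t x]|]; case ei': (e' i) => [[t' x']|]// tt; last 2 first.
- by have := jcoord_gt0 ei; rewrite tt ltxx.
- by have := jcoord_gt0 ei'; rewrite -tt ltxx.
have t0 : t != 0 by rewrite gt_eqF// (jcoord_gt0 ei).
rewrite -tt => /(mulfI t0) y2 /(mulfI t0) y1; congr (Some (_, _)); exact: S1_eq.
Qed.

Lemma jcoord_bound (e : E) : exists N, (forall i, (N <= i)%N -> e i = None) /\
  forall K, (N <= K)%N -> \sum_(i < K) jw e i = 1.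
Proof.
have [N eN e1] := jcoord_sum e; exists N; split=> // K NK.
rewrite -(subnKC NK) big_split_ord /= -[RHS]addr0; congr (_ + _); first exact: e1.
by apply: big1 => i _; rewrite /jw /join_weight eN// leq_addr.
Qed.

Lemma milnor_exists (px py : nat -> R) N :
  (forall i, (N <= i)%N -> px i = 0 /\ py i = 0) -> \sum_(i < N) modulus (px i) (py i) = 1 ->
  exists e : E, jx e =1 px /\ jy e =1 py.
Proof.
move=> pN p1.
have D a b : exists x : S1 R, a = modulus a b * (val x).1 /\ b = modulus a b * (val x).2.
  have [/eqP|nz] := eqVneq (modulus a b) 0.
    by rewrite modulus_eq0 => /andP[/eqP -> /eqP ->]; exists (oneS1 R); rewrite /modulus !expr0n addr0 sqrtr0 !mul0r.
  have h : (a / modulus a b) ^+ 2 + (b / modulus a b) ^+ 2 = 1.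
    rewrite !exprMn -mulrDl exprVn /modulus sqr_sqrtr ?addr_ge0 ?sqr_ge0// divff//.
    by move: nz; rewrite -sqrf_eq0 /modulus sqr_sqrtr ?addr_ge0 ?sqr_ge0.
  by exists (@mkS1 R (_, _) h) => /=; rewrite ![_ * (_ / _)]mulrC !divfK.
pose dir a b := projT1 (cid (D a b)).
have dirE a b : a = modulus a b * (val (dir a b)).1 /\ b = modulus a b * (val (dir a b)).2.
  exact: (projT2 (cid (D a b))).
pose f i : option (R * S1 R) :=
  if modulus (px i) (py i) == 0 then None else Some (modulus (px i) (py i), dir (px i) (py i)).
have wf i : join_weight f i = modulus (px i) (py i).
  by rewrite /join_weight /f; case: eqP.
have f0 i t x : f i = Some (t, x) -> 0 < t.
  by rewrite /f; case: eqP => // /eqP nz [<- _]; rewrite lt_neqAle eq_sym nz modulus_ge0.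
have fs : exists2 N : nat, (forall i, (N <= i)%N -> f i = None) &
    \sum_(i < N) join_weight f i = 1.
  exists N => [i /pN [x0 y0]|]; last by under eq_bigr do rewrite wf.
  by rewrite /f x0 y0 modulus_eq0 eqxx.
exists (MilnorE f0 fs); split=> i; rewrite /jx /jy /= /f; case: eqP => [/eqP|_].
- by rewrite modulus_eq0 => /andP[/eqP -> _].
- by rewrite -(dirE _ _).1.
- by rewrite modulus_eq0 => /andP[_ /eqP ->].
- by rewrite -(dirE _ _).2.
Qed.

Lemma milnor_open (A : set E) : milnor_subbase A -> open A.
Proof.
move=> bA; exists [set A]; last first.
  by rewrite predeqE => ?; split=> [[_ ->]|] //; exists A.
move=> _ ->; exists [fset A]%fset.
  by move=> ?; rewrite inE inE => /eqP->.
by rewrite predeqE=> ?; split=> [|??]; [apply|]; rewrite /= inE // =>/eqP->.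
Qed.

Lemma S1_open_preimage (V : set (S1 R)) : open V ->
  exists2 W : set (R * R), open W & forall x : S1 R, V x <-> W (val x).
Proof. by case=> W oW <-; exists W. Qed.

Lemma jw_continuous i : continuous (fun e : E => jw e i).
Proof.
apply/continuousP => U oU; apply: milnor_open; left; exists i, U; split=> //.
Qed.

Lemma sum_continuous (T : topologicalType) (f : nat -> T -> R) m :
  (forall i, continuous (f i)) -> continuous (fun t => \sum_(i < m) f i t).
Proof.
move=> cf; elim: m => [|m IH].
  rewrite (_ : (fun t => _) = fun=> 0); last by apply/funext => t; rewrite big_ord0.
  exact: cst_continuous.
rewrite (_ : (fun t => _) = fun t => \sum_(i < m) f i t + f m t); last first.
  by apply/funext => t; rewrite big_ord_recr.
by move=> t; apply: cvgD; [exact: IH|exact: cf].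
Qed.

Lemma squeeze_continuous_at (T : topologicalType) (f w : T -> R) t :
  {for t, continuous w} -> w t = 0 -> (forall s, `|f s| <= w s) -> {for t, continuous f}.
Proof.
move=> cw w0 fw; have f0 : f t = 0 by apply/eqP; rewrite -normr_le0 -w0.
have h : f s @[s --> t] --> (0 : R).
  apply: (@squeeze_cvgr _ _ _ _ (fun s => - w s) w).
  - by apply: nearW => s; rewrite -ler_norml.
  - by rewrite -[0]oppr0 -w0; apply: cvgN; exact: cw.
  - by rewrite -[0]w0; exact: cw.
by rewrite -[0]f0 in h.
Qed.

(** Where t_i > 0 this is a product of continuous functions. Where t_i = 0 the phase has no value,
    but [g] is bounded and the weight tends to 0. *)
Lemma jcoord_continuous_at (g : S1 R -> R) i (e0 : E) : continuous g -> (forall x, `|g x| <= 1) ->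
  {for e0, continuous (fun e : E => if e i is Some (t, x) then t * g x else 0)}.
Proof.
move=> cg g1; have cw := @jw_continuous i e0.
case ei: (e0 i) => [[t x]|].
  pose G (e : E) := if e i is Some (_, y) then g y else 0.
  have cG : G e @[e --> e0] --> g x.
    move=> P; rewrite nbhsE => -[U [oU Ux] UP].
    have oV : open (g @^-1` U) by move/continuousP: cg; apply.
    have oA : open [set e : E | exists t y, e i = Some (t, y) /\ (g @^-1` U) y].
      by apply: milnor_open; right; exists i, (g @^-1` U).
    have := open_nbhs_nbhs (conj oA _) => /(_ e0); apply: filterS_imp || idtac.
    move=> /(_ (ex_intro _ t (ex_intro _ x (conj ei Ux)))).
    by apply: filterS => e [t' [y [eiy Uy]]]; rewrite /= /G eiy; exact: UP.
  have -> : (fun e : E => if e i is Some (t, x) then t * g x else 0) = (fun e => jw e i * G e).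
    by apply/funext => e; rewrite /jw /join_weight /G; case: (e i) => [[]|]//; rewrite mulr0.
  have cG' : G e @[e --> e0] --> G e0 by rewrite {2}/G ei.
  exact: (cvgM cw cG').
apply: (@squeeze_continuous_at E _ (fun e => jw e i)) => //.
  by rewrite /jw /join_weight ei.
move=> e; rewrite /jw /join_weight; case ej: (e i) => [[t x]|]; last by rewrite normr0.
by rewrite normrM ger0_norm ?(ltW (jcoord_gt0 ej))// ler_piMr// (ltW (jcoord_gt0 ej)).
Qed.

Lemma S1_coord_le1 (x : S1 R) : `|(val x).1| <= 1 /\ `|(val x).2| <= 1.
Proof. by have := norm_le_modulus (val x).1 (val x).2; rewrite /modulus (S1P x) sqrtr1. Qed.

Lemma jx_continuous i : continuous (fun e : E => jx e i).
Proof.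
move=> e0; apply: (@jcoord_continuous_at (fun x => (val x).1)); first exact: S1_fst_continuous.
by move=> x; exact: (S1_coord_le1 x).1.
Qed.

Lemma jy_continuous i : continuous (fun e : E => jy e i).
Proof.
move=> e0; apply: (@jcoord_continuous_at (fun x => (val x).2)); first exact: S1_snd_continuous.
by move=> x; exact: (S1_coord_le1 x).2.
Qed.

(* The phase x_i, with a junk value where t_i = 0.                            *)
Definition phase (i : nat) (e : E) : S1 R := if e i is Some (_, x) then x else oneS1 R.

Lemma phase_continuous i (e0 : E) : e0 i <> None -> {for e0, continuous (phase i)}.
Proof.
move=> e0i A; rewrite nbhsE => -[V [oV V0] VA].
have oA : open [set e : E | exists t y, e i = Some (t, y) /\ V y].
  by apply: milnor_open; right; exists i, V.
have : [set e : E | exists t y, e i = Some (t, y) /\ V y] e0.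
  by move: V0; rewrite /phase; case ei: (e0 i) e0i => [[t x]|]// _ Vx; exists t, x.
move=> Ae0; have := open_nbhs_nbhs (conj oA Ae0).
by apply: filterS => e [t [y [ey Vy]]]; rewrite /= /phase ey; exact: VA.
Qed.

(** The weight is the modulus of the complex coordinate and, where it is positive, the phase is the
    quotient by it; so the sets of the subbase have open preimages. *)
Lemma milnor_continuous (T : topologicalType) (f : T -> E) :
  (forall i, continuous (fun t => jx (f t) i)) -> (forall i, continuous (fun t => jy (f t) i)) ->
  continuous f.
Proof.
move=> cx cy t.
have cw i : {for t, continuous (fun s => jw (f s) i)}.
  rewrite (_ : (fun s => _) = fun s => modulus (jx (f s) i) (jy (f s) i)); last by apply/funext => s; exact: jwE.
  by apply: modulus_continuous; [exact: cx|exact: cy].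
have sub (S : set E) : milnor_subbase S -> S (f t) -> \forall s \near t, S (f s).
  move=> [[i [U [oU ->]]] /= Uw|[i [V [oV ->]]] /= [w [x [fx Vx]]]].
    by apply: (cw i); exact: open_nbhs_nbhs.
  have w0 := jcoord_gt0 fx.
  have jwt : jw (f t) i = w by rewrite /jw /join_weight fx.
  have [W oW VW] := S1_open_preimage oV.
  have near0 : \forall s \near t, jw (f s) i != 0.
    have : \forall s \near t, 0 < jw (f s) i by apply: (cvgr_gt _ (cw i)); rewrite jwt.
    by apply: filterS => s; rewrite lt_neqAle eq_sym => /andP[].
  have c1 : (jx (f s) i / jw (f s) i) @[s --> t] --> (val x).1.
    rewrite (_ : (val x).1 = jx (f t) i / jw (f t) i); last by rewrite jwt /jx fx mulrC mulKf// gt_eqF.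
    by apply: cvgM; [exact: cx|apply: cvgV; [rewrite jwt gt_eqF|exact: cw]].
  have c2 : (jy (f s) i / jw (f s) i) @[s --> t] --> (val x).2.
    rewrite (_ : (val x).2 = jy (f t) i / jw (f t) i); last by rewrite jwt /jy fx mulrC mulKf// gt_eqF.
    by apply: cvgM; [exact: cy|apply: cvgV; [rewrite jwt gt_eqF|exact: cw]].
  have cc : (jx (f s) i / jw (f s) i, jy (f s) i / jw (f s) i) @[s --> t] --> ((val x).1, (val x).2).
    exact: (cvg_pair c1 c2).
  have Wx : nbhs ((val x).1, (val x).2) W.
    by apply: open_nbhs_nbhs; split=> //; rewrite -surjective_pairing; apply/VW.
  near=> s.
  have s0 : jw (f s) i != 0 by near: s.
  have Ws : W (jx (f s) i / jw (f s) i, jy (f s) i / jw (f s) i) by near: s; exact: cc.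
  move: s0 Ws; rewrite {1}/jw /jx /jy /jw /join_weight; case fs: (f s i) => [[v y]|]; last by rewrite eqxx.
  move=> v0; rewrite ![v * _]mulrC !mulfK// -surjective_pairing => /VW Vy.
  by exists v, y.
move=> A; rewrite (@nbhsE E) => -[_ [[B sB <-] [C BC Ct] sUBA]].
rewrite nbhs_filterE; apply: filterS sUBA _; apply: (@filterS _ _ _ (f @^-1` C)).
  by move=> ? ?; exists C.
have /sB [D sD IDeC] := BC; rewrite -IDeC; apply: filterS; last first.
  apply: (filter_bigI (f := fun S : set E => f @^-1` S) (D := D)) => S SD.
  have /sD := SD; rewrite inE => bS; apply: sub => //.
  by move: Ct; rewrite -IDeC => /(_ _ SD).
by move=> s h S SD; exact: h.
Unshelve. all: by end_near.
Qed.

(** * Normalizing complex coordinates to a point of the infinite join *)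

Section Normalize.
Variables (T : topologicalType) (px py : nat -> T -> R) (r : nat -> T -> R).
Hypotheses (cpx : forall i, continuous (px i)) (cpy : forall i, continuous (py i)).
Hypothesis fin : forall t, exists N, forall i, (N <= i)%N -> px i t = 0 /\ py i t = 0.
Hypothesis nz : forall t, exists i, modulus (px i t) (py i t) != 0.
Hypothesis cr : forall K, continuous (r K).
Hypothesis tail : forall K N t,
  \sum_(K.+2 <= i < N) modulus (px i t) (py i t) <= r K t.
Hypothesis r0 : forall t, exists K, r K t = 0.

Let mass t := let N := projT1 (cid (fin t)) in \sum_(i < N) modulus (px i t) (py i t).

Lemma massE t : exists N, forall K, (N <= K)%N -> \sum_(i < K) modulus (px i t) (py i t) = mass t.
Proof.
rewrite /mass; case: (cid (fin t)) => N tN /=; exists N => K NK.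
rewrite -(subnKC NK) big_split_ord /= -[RHS]addr0; congr (_ + _).
by apply: big1 => i _; have [-> ->] := tN _ (leq_addr i N); apply/eqP; rewrite modulus_eq0 eqxx.
Qed.

Lemma mass_gt0 t : 0 < mass t.
Proof.
have [N tN] := massE t; have [i ni] := nz t.
rewrite -(tN (maxn N i.+1)) ?leq_maxl//.
have lt : (i < maxn N i.+1)%N by rewrite leq_maxr.
rewrite (bigD1 (Ordinal lt))//= ltr_pwDl//; first by rewrite lt_neqAle eq_sym ni modulus_ge0.
by apply: sumr_ge0 => j _; exact: modulus_ge0.
Qed.

(** At each point finitely many coordinates are nonzero, but their number need not be locally
    bounded. The tail estimate squeezes the mass between two continuous functions that agree at
    [t]. *)
Lemma mass_continuous : continuous mass.
Proof.
move=> t; have [K rK] := r0 t.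
pose S s := \sum_(i < K.+2) modulus (px i s) (py i s).
have bound s : S s <= mass s <= S s + r K s.
  have [N sN] := massE s; rewrite -(sN (maxn N K.+2)) ?leq_maxl//.
  rewrite -(big_mkord xpredT (fun i => modulus (px i s) (py i s))).
  rewrite (@big_cat_nat _ _ _ K.+2) ?leq_maxr//= big_mkord lerD2l tail andbT lerDl.
  by apply: sumr_ge0 => j _; exact: modulus_ge0.
have St : S t = mass t by apply/eqP; rewrite eq_le; have := bound t; rewrite rK addr0 andbC.
have cS : S s @[s --> t] --> mass t.
  rewrite -St; apply: (@sum_continuous T (fun i s => modulus (px i s) (py i s)) K.+2) => i s.
  by apply: modulus_continuous; [exact: cpx|exact: cpy].
apply: (@squeeze_cvgr _ _ _ _ S (fun s => S s + r K s)) => //; first exact: nearW.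
by rewrite -[mass t]addr0 -rK; apply: cvgD => //; exact: cr.
Qed.

Lemma normalize : exists2 f : T -> E, continuous f & forall t, exists2 M, 0 < M &
  (exists N, forall K, (N <= K)%N -> \sum_(i < K) modulus (px i t) (py i t) = M) /\
  forall i, jx (f t) i = px i t / M /\ jy (f t) i = py i t / M.
Proof.
have D t : exists e : E, jx e =1 (fun i => px i t / mass t) /\ jy e =1 (fun i => py i t / mass t).
  have m0 := mass_gt0 t.
  have [N tN] := massE t; have [N' tN'] := fin t.
  apply: (@milnor_exists _ _ (maxn N N')) => [i|].
    by rewrite geq_max => /andP[_ /tN' [-> ->]]; rewrite !mul0r.
  have -> : \sum_(i < maxn N N') modulus (px i t / mass t) (py i t / mass t) =
     (mass t)^-1 * \sum_(i < maxn N N') modulus (px i t) (py i t).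
    rewrite mulr_sumr; apply: eq_bigr => i _; rewrite -modulus_scale ?invr_ge0 ?ltW//.
    by rewrite ![_ / _]mulrC.
  by rewrite tN ?leq_maxl// mulVf// gt_eqF.
pose f t := projT1 (cid (D t)).
have fE t : jx (f t) =1 (fun i => px i t / mass t) /\ jy (f t) =1 (fun i => py i t / mass t).
  exact: (projT2 (cid (D t))).
exists f => [|t]; last first.
  exists (mass t); first exact: mass_gt0.
  by split=> [|i]; [exact: massE|rewrite (fE t).1 (fE t).2].
apply: milnor_continuous => i.
  rewrite (_ : (fun t => _) = fun t => px i t / mass t); last by apply/funext => t; rewrite (fE t).1.
  by move=> t; apply: cvgM; [exact: cpx|apply: cvgV; [rewrite gt_eqF ?mass_gt0|exact: mass_continuous]].
rewrite (_ : (fun t => _) = fun t => py i t / mass t); last by apply/funext => t; rewrite (fE t).2.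
by move=> t; apply: cvgM; [exact: cpy|apply: cvgV; [rewrite gt_eqF ?mass_gt0|exact: mass_continuous]].
Qed.
End Normalize.

Lemma jw_tail (e : E) K N : \sum_(K <= i < N) jw e i <= 1 - \sum_(i < K) jw e i.
Proof.
have [m [_ em]] := jcoord_bound e.
have [NK|KN] := leqP N K.
  rewrite big_geq// subr_ge0 -(em (maxn m K)) ?leq_maxl//.
  rewrite -!(big_mkord xpredT (fun i => jw e i)) (@big_cat_nat _ _ _ K _ (maxn m K)) ?leq_maxr//= lerDl.
  by apply: sumr_ge0 => j _; exact: jw_ge0.
rewrite lerBrDl -(em (maxn m N)) ?leq_maxl// -!(big_mkord xpredT (fun i => jw e i)).
rewrite -big_cat_nat ?(ltnW KN)//= (@big_cat_nat _ _ _ N _ (maxn m N)) ?leq_maxr//= lerDl.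
by apply: sumr_ge0 => j _; exact: jw_ge0.
Qed.

Lemma basepoint_exists : exists e : E, jx e =1 (fun i => (i == 0%N)%:R) /\ jy e =1 (fun=> 0).
Proof.
apply: (@milnor_exists _ _ 1) => [[|i]//|].
by rewrite big_ord1 /modulus expr1n expr0n addr0 sqrtr1.
Qed.
Definition basepoint : E := projT1 (cid basepoint_exists).

Lemma basepointE i : jx basepoint i = (i == 0%N)%:R /\ jy basepoint i = 0.
Proof. by have [-> ->] := projT2 (cid basepoint_exists). Qed.

(** With z the sequence of complex coordinates of the point, the homotopy is (1 - s) e_0 + s z + s
    (1 - s) (shift z - e_1), before normalization. It goes from e_0 to z; the shift keeps it away
    from 0, and subtracting e_1 makes it constant for z = e_0. *)
Let cx (i : nat) (p : I01 R * E) : R := let s : R := set_val p.1 in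
  (1 - s) * (i == 0%N)%:R + s * jx p.2 i
  + s * (1 - s) * ((if i is j.+1 then jx p.2 j else 0) - (i == 1%N)%:R).
Let cy (i : nat) (p : I01 R * E) : R := let s : R := set_val p.1 in
  s * jy p.2 i + s * (1 - s) * (if i is j.+1 then jy p.2 j else 0).

Lemma contraction_exists : exists h : continuousType (I01 R * E)%type E,
  [/\ forall e, h (endpt R false, e) = basepoint, forall e, h (endpt R true, e) = e &
      forall t, h (t, basepoint) = basepoint].
Proof.
have I0 (t : I01 R) : 0 <= (set_val t : R) <= 1.
  by case: t => t tI; have := set_mem tI; rewrite /= in_itv.
have cs : continuous (fun p : I01 R * E => set_val p.1 : R).
  by apply: (@continuous_comp_all _ _ _ fst); [exact: fst_cts|exact: initial_continuous].
have cjx i : continuous (fun p : I01 R * E => jx p.2 i).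
  by apply: (@continuous_comp_all _ _ _ snd (fun e => jx e i)); [exact: snd_cts|exact: jx_continuous].
have cjy i : continuous (fun p : I01 R * E => jy p.2 i).
  by apply: (@continuous_comp_all _ _ _ snd (fun e => jy e i)); [exact: snd_cts|exact: jy_continuous].
have cjw i : continuous (fun p : I01 R * E => jw p.2 i).
  by apply: (@continuous_comp_all _ _ _ snd (fun e => jw e i)); [exact: snd_cts|exact: jw_continuous].
have cM (f g : I01 R * E -> R) : continuous f -> continuous g -> continuous (fun p => f p * g p).
  by move=> cf cg p; apply: cvgM; [exact: cf|exact: cg].
have cD (f g : I01 R * E -> R) : continuous f -> continuous g -> continuous (fun p => f p + g p).
  by move=> cf cg p; apply: cvgD; [exact: cf|exact: cg].
have cC (c : R) : continuous (fun p : I01 R * E => c) by move=> p; exact: cvg_cst.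
have c1s : continuous (fun p : I01 R * E => 1 - set_val p.1 : R).
  by apply: (cD _ _) => // p; apply: cvgN; exact: cs.
have ccx i : continuous (cx i).
  apply: (cD (fun p => (1 - set_val p.1) * (i == 0%N)%:R + set_val p.1 * jx p.2 i)).
    by apply: (cD _ _); apply: (cM _ _).
  by apply: (cM _ _); [exact: (cM _ _)|case: i => [|i]; apply: (cD _ _); first [exact: cC | exact: cjx]].
have ccy i : continuous (cy i).
  by apply: (cD _ _); apply: (cM _ _) => //; [exact: (cM _ _)|case: i => [|i]; first [exact: cC | exact: cjy]].
(* Twice the mass of the point beyond index [K]: for i >= 2 the i-th coordinate of the homotopy is
   bounded by the weights at i and at i - 1. *)
pose r K (p : I01 R * E) : R := 2 * (1 - \sum_(i < K.+1) jw p.2 i).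
have [||K|||f cf fE] := @normalize _ cx cy r ccx ccy.
- move=> [t e]; have [N [eN _]] := jcoord_bound e; exists N.+2 => -[|i] // iN.
  rewrite /cx /cy /= /jx /jy !eN ?eqSS; try lia.
  have -> : (i == 0%N) = false by lia.
  by rewrite !(mulr0, addr0, subr0).
(* If all coordinates vanish with 0 < s < 1, then z_0 = - (1 - s) / s, hence z_1 = (1 - s) / s, and
   z_(i+1) = - (1 - s) z_i from then on. So no z_i with i > 0 vanishes, against finiteness of the
   support; s = 0 and s = 1 are excluded directly. *)
- move=> [t e]; apply: contrapT => /forallNP z.
  have {}z i : cx i (t, e) = 0 /\ cy i (t, e) = 0.
    by have /negP := z i; rewrite negbK modulus_eq0 => /andP[/eqP -> /eqP ->].
  have /andP[s0 s1] := I0 t; move: z s0 s1; rewrite /cx /cy /=; move: (set_val t : R) => s z s0 s1.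
  have [N [eN eS]] := jcoord_bound e.
  have jN i : (N <= i)%N -> jx e i = 0 by move=> iN; rewrite /jx eN.
  have [s_1|s_1] := eqVneq s 1.
    have : (1 : R) = 0; last by move/eqP; rewrite oner_eq0.
    rewrite -(eS N)// big1// => i _; apply/eqP; rewrite jwE modulus_eq0.
    have [zx zy] := z i; move: zx zy; rewrite s_1 subrr !mul1r !mul0r !addr0 add0r => -> ->.
    by rewrite eqxx.
  have ss : 0 < 1 - s by rewrite subr_gt0 lt_neqAle s_1.
  have [z0 _] := z 0%N; move: z0; rewrite eqxx /= mulr1 subrr mulr0 addr0 => z0.
  have sp : 0 < s.
    rewrite lt_neqAle s0 andbT; apply/eqP => sE; move: z0; rewrite -sE subr0 mul0r addr0.
    by move/eqP; rewrite oner_eq0.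
  have [z1 _] := z 1%N; move: z1; rewrite /= mulr0 add0r => z1.
  have u1 : jx e 1 = (1 - s) / s.
    apply: (mulfI (lt0r_neq0 sp)); rewrite mulrCA divff ?lt0r_neq0// mulr1.
    apply: (@mulfI _ s); first exact: lt0r_neq0.
    move: z1 z0; move: (jx e 1) (jx e 0) => a b h1 h2.
    have hb : s * b = s - 1 by lra.
    have h3 : s * (s * a) + (1 - s) * (s * (s * b) - s * s) = 0 by rewrite -[RHS](mulr0 s) -h1; ring.
    rewrite hb in h3; have : s * (s * a) = (1 - s) * (s * s - s * (s - 1)) by lra.
    by move=> ->; ring.
  have un i : jx e i.+1 != 0.
    elim: i => [|i IH]; first by rewrite u1 mulf_neq0 ?invr_eq0 ?lt0r_neq0.
    have [zi _] := z i.+2; move: zi; rewrite /= !mulr0 add0r subr0 => zi.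
    apply/eqP => u0; move: zi; rewrite u0 mulr0 add0r => /eqP.
    by rewrite !mulf_eq0 (negbTE IH) (gt_eqF sp) (gt_eqF ss).
  by have := un N; rewrite jN ?eqxx// leqW.
- apply: (cM _ _) => //; apply: (cD _ _) => // p; apply: cvgN.
  exact: (@sum_continuous _ (fun i p => jw p.2 i) K.+1 cjw p).
- move=> K N [t e]; have /andP[s0 s1] := I0 t.
  apply: (@le_trans _ _ (\sum_(K.+2 <= i < N) (jw e i + jw e i.-1))).
    rewrite !big_nat; apply: ler_sum => i /andP[Ki _].
    case: i Ki => [|[|i]]// _; rewrite /cx /cy /= !mulr0 add0r subr0.
    move: s0 s1; move: (set_val t : R) => s s0 s1.
    apply: le_trans (modulusD _ _ _ _) _; rewrite !modulus_scale ?mulr_ge0 ?subr_ge0// -!jwE.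
    rewrite lerD// ler_piMl ?jw_ge0// mulr_ile1// ?subr_ge0//; lra.
  rewrite big_split /= /r /=.
  have -> : \sum_(K.+2 <= i < N) jw e i.-1 = \sum_(K.+1 <= i < N.-1) jw e i.
    by case: N => [|N]; [rewrite !big_geq|rewrite big_add1 /=].
  have t1 := jw_tail e K.+1 N.-1.
  have t2 : \sum_(K.+2 <= i < N) jw e i <= 1 - \sum_(i < K.+1) jw e i.
    apply: le_trans (jw_tail _ _ _) _; rewrite big_ord_recr /= opprD addrA gerDl oppr_le0.
    exact: jw_ge0.
  by move: t1 t2; move: (\sum_(i < K.+1) _) (\sum_(_ <= _ < _) jw e _) (\sum_(_ <= _ < _) jw e _) => a b c; lra.
- move=> [t e]; have [N [_ eS]] := jcoord_bound e; exists N.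
  by rewrite /r /= eS// subrr mulr0.
exists (mkcts cf).
(* Coordinates that already come from a point have mass 1, so the normalization leaves them alone.
   This gives both ends and the fixed base point. *)
have endE (t : I01 R) (e e' : E) : (forall i, cx i (t, e) = jx e' i) -> (forall i, cy i (t, e) = jy e' i) ->
    f (t, e) = e'.
  move=> hx hy; have [M M0 [[N MN] fM]] := fE (t, e).
  have [N' [_ eS]] := jcoord_bound e'.
  have M1 : M = 1.
    rewrite -(MN (maxn N N')) ?leq_maxl// -(eS (maxn N N')) ?leq_maxr//.
    by apply: eq_bigr => i _; rewrite jwE hx hy.
  by apply: milnorE_coord_eq => i; have [fx fy] := fM i; rewrite ?fx ?fy M1 divr1.
split=> [e|e|t] /=; apply: endE => i; rewrite /cx /cy /= ?(basepointE i).1 ?(basepointE i).2.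
- by rewrite subr0 !mul0r mul1r !addr0.
- by rewrite !mul0r addr0.
- by rewrite subrr mulr0 !mul0r mul1r addr0 add0r.
- by rewrite subrr mulr0 mul0r mul1r addr0.
- by case: i => [|[|i]] /=; rewrite ?(basepointE _).1 ?(basepointE _).2 /=; ring.
- by case: i => [|i] /=; rewrite ?(basepointE _).1 ?(basepointE _).2; ring.
Qed.

Lemma milnor_act_continuous : continuous (fun p : E * S1 R => milnor_act p.1 p.2).
Proof.
have ax p i : jx (milnor_act p.1 p.2) i = jx p.1 i * (val p.2).1 - jy p.1 i * (val p.2).2.
  by rewrite /jx /jy /=; case: (p.1 i) => [[t x]|] /=; ring.
have ay p i : jy (milnor_act p.1 p.2) i = jx p.1 i * (val p.2).2 + jy p.1 i * (val p.2).1.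
  by rewrite /jx /jy /=; case: (p.1 i) => [[t x]|] /=; ring.
have c1 i : continuous (fun p : E * S1 R => jx p.1 i).
  by apply: (@continuous_comp_all _ _ _ fst (fun e => jx e i)); [exact: fst_cts|exact: jx_continuous].
have c2 i : continuous (fun p : E * S1 R => jy p.1 i).
  by apply: (@continuous_comp_all _ _ _ fst (fun e => jy e i)); [exact: fst_cts|exact: jy_continuous].
have c3 : continuous (fun p : E * S1 R => (val p.2).1).
  by apply: (@continuous_comp_all _ _ _ snd (fun x : S1 R => (val x).1)); [exact: snd_cts|exact: S1_fst_continuous].
have c4 : continuous (fun p : E * S1 R => (val p.2).2).
  by apply: (@continuous_comp_all _ _ _ snd (fun x : S1 R => (val x).2)); [exact: snd_cts|exact: S1_snd_continuous].
apply: milnor_continuous => i.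
  rewrite (_ : (fun p : E * S1 R => _) = fun p => jx p.1 i * (val p.2).1 - jy p.1 i * (val p.2).2).
    by move=> p; apply: cvgB; apply: cvgM; [exact: c1|exact: c3|exact: c2|exact: c4].
  by apply/funext => p; rewrite ax.
rewrite (_ : (fun p : E * S1 R => _) = fun p => jx p.1 i * (val p.2).2 + jy p.1 i * (val p.2).1).
  by move=> p; apply: cvgD; apply: cvgM; [exact: c1|exact: c4|exact: c2|exact: c3].
by apply/funext => p; rewrite ay.
Qed.
Definition milnor_actc : continuousType (E * S1 R)%type E := mkcts milnor_act_continuous.
End MilnorCoordinates.

(** * From twisting cochains to DCSH maps *)

Section Linearize.
Variables (k : comPzRingType) (V W : lmodType k) (f : V -> W).
Hypothesis lf : linear f.
Definition linpack : {linear V -> W} :=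
  HB.pack f (GRing.isLinear.Build k V W *:%R f lf).
Lemma linpackE x : linpack x = f x. Proof. by []. Qed.
End Linearize.

(* The sign of the isomorphism between the m-fold tensor power of the         *)
(* suspension and the suspension of the m-fold tensor power.                  *)
Fixpoint susp_sign (B : choiceType) (deg : B -> nat) (w : seq B) : nat :=
  if w is b :: w' then (size w' * deg b + susp_sign deg w')%N else 0%N.

HB.lock Definition unsusp (k : comPzRingType) (B : choiceType) (deg : B -> nat)
    (m : nat) (x : freemod k (seq B)) : freemod k (seq B) :=
  flift (fun w : seq B => if size w == m then (-1) ^+ susp_sign deg w *: fbasis k w else 0) x.

HB.lock Definition letter (k : comPzRingType) (B : choiceType)
    (x : freemod k (seq B)) : freemod k B :=
  flift (fun w : seq B => if w is [:: b] then fbasis k b else 0) x.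
Arguments letter.body {k B} x.

HB.lock Definition aug (k : comPzRingType) (B : choiceType)
    (x : freemod k (seq B)) : k^o := flift (fun w : seq B => (size w == 0%N)%:R : k^o) x.
Arguments aug.body {k B} x.

Section Suspension.
Variables (k : comPzRingType) (B : choiceType) (deg : B -> nat).
Notation A := (freemod k (seq B)).
Notation J := (unsusp (k := k) deg).
Notation nuB := (nu (k := k) deg).
Definition nupow (m : nat) (x : freemod k B) := if odd m then nuB x else x.

Lemma lin_J m : linear (J m). Proof. by rewrite unsusp.unlock; exact: linearP. Qed.
Lemma lin_nupow m : linear (nupow m).
Proof. by rewrite /nupow; case: (odd m); [exact: lin_nu|exact: lin_id]. Qed.
Lemma lin_letter : linear (@letter k B). Proof. by rewrite letter.unlock; exact: linearP. Qed.
Lemma lin_aug : linear (@aug k B). Proof. by rewrite aug.unlock; exact: linearP. Qed.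

Lemma nupowS m x : nupow m.+1 x = nuB (nupow m x).
Proof. by rewrite /nupow /=; case: (odd m) => //=; rewrite nuK. Qed.

Lemma nupow_basis m b : nupow m (fbasis k b) = (-1) ^+ (m * deg b) *: fbasis k b.
Proof.
rewrite /nupow exprM -signr_odd; case: (odd m); last by rewrite expr0 expr1n scale1r.
by rewrite nu_basis expr1.
Qed.

Lemma J_basis m (w : seq B) : J m (fbasis k w) =
  if size w == m then (-1) ^+ susp_sign deg w *: fbasis k w else 0.
Proof. by rewrite unsusp.unlock flift_fbasis. Qed.

(** The first letter b of a word of length m + 1 contributes m |b| to [susp_sign]; [nupow m] is that
    sign. *)
Lemma J_ltrM m x (y : A) : J m.+1 (catA (ltr x) y) = catA (ltr (nupow m x)) (J m y).
Proof.
have [bl br] := @bilin_catA k B; have lJ := lin_J; have ln := lin_nupow m.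
have ll := @lin_ltr k B.
move: x; apply: flin_ext => [||b].
- apply: (@lin_comp _ _ _ _ (J m.+1) (fun x => catA (ltr x) y) (lJ _)).
  exact: (@lin_comp _ _ _ _ _ _ (bl _) ll).
- apply: (@lin_comp _ _ _ _ (fun x => catA (ltr x) (J m y)) (nupow m) _ ln).
  exact: (@lin_comp _ _ _ _ _ _ (bl _) ll).
move: y; apply: flin_ext => [||w].
- exact: (@lin_comp _ _ _ _ _ _ (lJ _) (br _)).
- exact: (@lin_comp _ _ _ _ _ _ (br _) (lJ _)).
rewrite nupow_basis (linZ _ _ ll) (linZ _ _ (bl _)) !ltr_basis catA_basis !J_basis /= eqSS.
case: eqP => [<-|_]; last by rewrite (lin0 (br _)) scaler0.
by rewrite (linZ _ _ (br _)) catA_basis scalerA exprD.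
Qed.

Lemma J0_ltrM x (y : A) : J 0 (catA (ltr x) y) = 0.
Proof.
have [bl br] := @bilin_catA k B; have lJ := lin_J; have ll := @lin_ltr k B.
move: x; apply: flin_ext => [||b]; [|exact: lin_zero|].
  apply: (@lin_comp _ _ _ _ (J 0) (fun x => catA (ltr x) y) (lJ _)).
  exact: (@lin_comp _ _ _ _ _ _ (bl _) ll).
move: y; apply: flin_ext => [||w]; [|exact: lin_zero|].
  exact: (@lin_comp _ _ _ _ _ _ (lJ _) (br _)).
by rewrite ltr_basis catA_basis J_basis.
Qed.

Lemma J_one m : J m (fbasis k ([::] : seq B)) = if m is 0%N then fbasis k ([::] : seq B) else 0.
Proof. by rewrite J_basis; case: m => // ; rewrite scale1r. Qed.

Lemma augE (x : A) : J 0 x = (aug x : k) *: fbasis k ([::] : seq B).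
Proof.
move: x; apply: flin_ext => [||w]; [exact: lin_J| |].
  by move=> a x y; rewrite lin_aug scalerDl -scalerA.
rewrite J_basis aug.unlock flift_fbasis; case: w => [|b w] /=; first by rewrite expr0.
by rewrite scale0r.
Qed.

Lemma aug_basis (w : seq B) : aug (fbasis k w) = (size w == 0%N)%:R.
Proof. by rewrite aug.unlock flift_fbasis. Qed.

Lemma aug_ltrM x (y : A) : aug (catA (ltr x) y) = 0.
Proof.
have [bl br] := @bilin_catA k B; have la := lin_aug; have ll := @lin_ltr k B.
move: x; apply: (@flin_ext k _ k^o) => [||b]; [|exact: lin_zero|].
  apply: (@lin_comp _ _ _ _ (@aug k B) (fun x => catA (ltr x) y) la).
  exact: (@lin_comp _ _ _ _ _ _ (bl _) ll).
move: y; apply: (@flin_ext k _ k^o) => [||w]; [|exact: lin_zero|].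
  exact: (@lin_comp _ _ _ _ _ _ la (br _)).
by rewrite ltr_basis catA_basis aug_basis.
Qed.

Lemma letter_ltrM x (y : A) : letter (catA (ltr x) y) = (aug y : k) *: x.
Proof.
have [bl br] := @bilin_catA k B; have lJ := lin_letter; have ll := @lin_ltr k B.
have la := lin_aug.
move: x; apply: flin_ext => [||b].
- apply: (@lin_comp _ _ _ _ _ (fun x => catA (ltr x) y) lJ).
  exact: (@lin_comp _ _ _ _ _ _ (bl _) ll).
- exact: (@lin_scale k _ _ (aug y) (fun x => x) (@lin_id _ _)).
move: y; apply: flin_ext => [||w].
- exact: (@lin_comp _ _ _ _ _ _ lJ (br _)).
- by move=> a x y; rewrite lin_aug scalerDl -scalerA.
rewrite ltr_basis catA_basis aug_basis letter.unlock flift_fbasis.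
by case: w => [|c w] /=; rewrite ?scale1r ?scale0r.
Qed.

Lemma letter_one : letter (fbasis k ([::] : seq B)) = 0.
Proof. by rewrite letter.unlock flift_fbasis. Qed.

Lemma aug_one : aug (fbasis k ([::] : seq B)) = 1.
Proof. by rewrite aug_basis. Qed.

Lemma letter_ltr (x : freemod k B) : letter (ltr x) = x.
Proof. by rewrite -[ltr x]catA1 letter_ltrM aug_one scale1r. Qed.

Lemma J1E (x : A) : J 1 x = ltr (letter x).
Proof.
have ll := @lin_ltr k B; have lJ := lin_letter.
move: x; apply: alg_ext => [|||x y _]; [exact: lin_J|exact: (@lin_comp _ _ _ _ _ _ ll lJ)| |].
  by rewrite J_one letter_one (lin0 ll).
rewrite J_ltrM letter_ltrM augE (linZ _ _ ll).
by have [bl br] := @bilin_catA k B; rewrite (linZ _ _ (br _)) catA1.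
Qed.
End Suspension.

Section SuspensionMaps.
Variables (k : comPzRingType) (B : choiceType) (deg : B -> nat).
Notation A := (freemod k (seq B)).

Lemma aug_mapA (B' : choiceType) (f : freemod k B -> freemod k B') (x : A) : linear f ->
  aug (mapA f x) = aug x.
Proof.
move=> lf; have la := @lin_aug k B'; have la' := @lin_aug k B.
have lm : linear (mapA f) by lin.
move: x; apply: (@alg_ext k B k^o) => [|||x y _].
- exact: (@lin_comp _ _ _ _ _ _ la lm).
- exact: la'.
- by rewrite mapA_one !aug_one.
- by rewrite mapA_ltrM// !aug_ltrM.
Qed.

Lemma letter_mapA (B' : choiceType) (f : freemod k B -> freemod k B') (x : A) : linear f ->
  letter (mapA f x) = f (letter x).
Proof.
move=> lf; have la := @lin_letter k B'; have la' := @lin_letter k B.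
have lm : linear (mapA f) by lin.
move: x; apply: alg_ext => [|||x y _].
- exact: (@lin_comp _ _ _ _ _ _ la lm).
- exact: (@lin_comp _ _ _ _ _ _ lf la').
- by rewrite mapA_one !letter_one (lin0 lf).
- by rewrite mapA_ltrM// !letter_ltrM aug_mapA// (linZ _ _ lf).
Qed.

Lemma aug_SA s p (x : A) : linear s -> linear p -> aug (SA deg s p x) = 0.
Proof.
move=> ls lp; have la := @lin_aug k B; have lS : linear (SA deg s p) by lin.
have ll := @lin_ltr k B.
move: x; apply: (@alg_ext k B k^o) => [|||x y _].
- exact: (@lin_comp _ _ _ _ _ _ la lS).
- exact: lin_zero.
- by rewrite SA_one (lin0 la).
rewrite SA_ltrM// mapA_ltr// nuA_ltr -!(linN _ ll) (linD _ _ la).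
by rewrite !aug_ltrM addr0.
Qed.

End SuspensionMaps.

Section CobarToDCSH.
Variables (k : comPzRingType) (C : precoalg k).
Notation B := (cgen C).
Notation deg := (@cdeg k C).
Notation A := (freemod k (seq B)).
Notation nuB := (nu (k := k) deg).
Notation d := (cdiff C).
Notation com := (ccomul C).
Notation J := (unsusp (k := k) deg).
Hypothesis nud : forall x, nuB (d x) = - d (nuB x).
Hypothesis nucom : forall x, com (nuB x) = tmap nuB nuB (com x).
Notation dAC := (dA deg d com).

Lemma fcat_catA (x y : A) : @fcat k C x y = catA x y.
Proof. by rewrite catA.unlock. Qed.
Lemma word1_ltr x : @word1 k C x = ltr x. Proof. by rewrite ltr.unlock. Qed.
Lemma lin_tdiff : linear (@tdiff k C). Proof. by rewrite /tdiff; lin. Qed.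

Lemma tdiff_ltrM x (y : A) : @tdiff k C (catA (ltr x) y) = catA (ltr (d x)) y + catA (ltr (nuB x)) (tdiff y).
Proof.
have [bl br] := @bilin_catA k B; have lt := lin_tdiff; have ll := @lin_ltr k B.
have ld : linear d by lin.
move: x; apply: flin_ext => [||b].
- apply: (@lin_comp _ _ _ _ _ (fun x => catA (ltr x) y) lt).
  exact: (@lin_comp _ _ _ _ _ _ (bl _) ll).
- by apply: lin_add; apply: (@lin_comp _ _ _ _ (fun z => catA z _) _ (bl _)); lin.
move: y; apply: flin_ext => [||w].
- exact: (@lin_comp _ _ _ _ _ _ lt (br _)).
- by apply: lin_add; [exact: br|exact: (@lin_comp _ _ _ _ _ _ (br _) lt)].
rewrite nu_basis (linZ _ _ ll) (linZ _ _ (bl _)) ltr_basis catA_basis /tdiff !flift_fbasis /=.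
by rewrite !fcat_catA !word1_ltr ltr_basis.
Qed.

Definition tcsum (m : nat) (y : A) : A := \sum_(0 <= i < m) (-1) ^+ i *: @tcomul k C i y.

Lemma lin_tcsum m : linear (tcsum m).
Proof. by apply: lin_sum => i; apply: lin_scale; rewrite /tcomul; exact: linearP. Qed.

Lemma tcsum_ltrM m x (y : A) : tcsum m.+1 (catA (ltr x) y) =
  catA (tlift (fun a b => catA (ltr a) (ltr b)) (com x)) y - catA (ltr x) (tcsum m y).
Proof.
have [bl br] := @bilin_catA k B; have lt := lin_tcsum; have ll := @lin_ltr k B.
have lc : linear com by lin.
move: x; apply: flin_ext => [||b].
- apply: (@lin_comp _ _ _ _ _ (fun x => catA (ltr x) y) (lt _)).
  exact: (@lin_comp _ _ _ _ _ _ (bl _) ll).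
- apply: lin_add; last apply: lin_opp; apply: (@lin_comp _ _ _ _ (fun z => catA z _) _ (bl _)); lin.
move: y; apply: flin_ext => [||w].
- exact: (@lin_comp _ _ _ _ _ _ (lt _) (br _)).
- by apply: lin_add; [exact: br|apply: lin_opp; exact: (@lin_comp _ _ _ _ _ _ (br _) (lt _))].
rewrite {1}ltr_basis catA_basis /tcsum big_nat_recl// (linsum _ _ _ (br _)) -sumrN; congr (_ + _).
  rewrite expr0 scale1r /tcomul flift_fbasis /= fcat_catA; congr (catA _ _).
  move: (com _) => z; move: z; rewrite /word2; apply: flin_ext => [||[a c]]; [lin|lin|].
  by rewrite flift_fbasis tlift_basis !ltr_basis catA_basis.
apply: eq_bigr => i _; rewrite (linZ _ _ (br _)) exprS mulN1r scaleNr; congr (- (_ *: _)).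
by rewrite /tcomul !flift_fbasis /= fcat_catA word1_ltr.
Qed.

(** The part of the cobar differential that preserves length becomes the tensor differential up to
    the sign of n desuspensions, and the part that raises length becomes the alternating sum of the
    diagonals. *)
Lemma unsusp_dA n (y : A) : J n (dAC y) = (-1) ^+ n *: tdiff (J n y)
  + (if n is m.+1 then tcsum m (J m y) else 0).
Proof.
have [bl br] := @bilin_catA k B; have lt := lin_tdiff; have ll := @lin_ltr k B.
have lts := lin_tcsum; have lJ := @lin_J k B deg; have lcm : linear com by lin.
have ld : linear d by lin.
have ldA : linear dAC by lin.
have lif m : linear (fun y => if m is m'.+1 then tcsum m' (J m' y) else 0).
  by case: m => [|m]; [exact: lin_zero|exact: (@lin_comp _ _ _ _ _ _ (lts _) (lJ _))].
move: y; apply: flin_ext => [||w].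
- exact: (@lin_comp _ _ _ _ _ _ (lJ _) ldA).
- apply: lin_add; last exact: lif.
  by apply: lin_scale; exact: (@lin_comp _ _ _ _ _ _ lt (lJ _)).
have dnu m x : d (nupow deg m x) = (-1) ^+ m *: nupow deg m (d x).
  rewrite /nupow -signr_odd; case: (odd m); last by rewrite expr0 scale1r.
  by rewrite expr1 scaleN1r nud opprK.
elim: w n => [|b w IH] n.
  rewrite dA_one (lin0 (lJ _)) J_one; case: n => [|n].
    by rewrite /tdiff flift_fbasis /= scaler0 addr0.
  rewrite (lin0 lt) scaler0 add0r J_one; case: n => [|n]; last by rewrite (lin0 (lts _)).
  by rewrite /tcsum big_nil.
rewrite -[b :: w]/([:: b] ++ w) -catA_basis -ltr_basis; move: (fbasis k b) (fbasis k w) IH => x y IH.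
have Nl u v : catA (- u) v = - catA u v :> A by rewrite (linN _ (bl _)).
have Nr u v : catA u (- v) = - catA u v :> A by rewrite (linN _ (br _)).
have Zr c u v : catA u (c *: v) = c *: catA u v :> A by rewrite (linZ _ _ (br _)).
have tl x' m : catA (tlift (fun a b => catA (ltr (nuB a)) (ltr b)) (com x')) m =
    tlift (fun a b => catA (ltr (nuB a)) (catA (ltr b) m)) (com x').
  rewrite (tlift_app (f := fun z => catA z m)); last exact: bl.
  by apply: tlift_ext => u v; rewrite catAA.
rewrite dA_ltrM// (linD _ _ (lJ _)) nuA_ltr Nl (linN _ (lJ _)).
rewrite /dA1 (linD _ _ (bl _)) Nl (linD _ _ (lJ _)) (linN _ (lJ _)) tl.
rewrite (tlift_app _ _ (lJ _)).
case: n => [|n].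
  rewrite !J0_ltrM (lin0 lt) scaler0 !subr0 addr0.
  by under tlift_ext => u v do rewrite J0_ltrM; rewrite tlift0.
rewrite !J_ltrM tdiff_ltrM IH (linD _ _ (br _)) Zr dnu.
rewrite (linZ _ _ (@lin_ltr k B)) (linZ _ _ (bl _)) scalerDr scalerA.
rewrite exprS mulN1r mulNr -expr2 sqrr_sign scaleN1r !scaleNr.
have -> : nupow deg n (nuB x) = nuB (nupow deg n x).
  by rewrite /nupow; case: (odd n).
case: n => [|n].
  under tlift_ext => u v do rewrite J_ltrM J0_ltrM (lin0 (br _)).
  by rewrite tlift0 add0r (lin0 (br _)) /tcsum big_nil !addr0.
under tlift_ext => u v do rewrite J_ltrM.
rewrite J_ltrM tcsum_ltrM.
have -> : catA (tlift (fun a b => catA (ltr a) (ltr b)) (com (nupow deg n x))) (J n y) =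
   tlift (fun x0 y0 => catA (ltr (nupow deg n.+1 (nuB x0))) (J n.+1 (catA (ltr y0) y))) (com x).
  have -> : com (nupow deg n x) = tmap (nupow deg n) (nupow deg n) (com x).
    by rewrite /nupow; case: (odd n); [exact: nucom|rewrite tmap_id].
  have lnp := @lin_nupow k B deg n.
  rewrite tlift_tmap//; last first.
    by apply: bilin_comp => //; exact: bilin_catA.
  rewrite (tlift_app (f := fun z => catA z _)); last exact: bl.
  apply: tlift_ext => u v; rewrite J_ltrM catAA; congr (catA (catA (ltr _) _) _).
  by rewrite nupowS /nupow; case: (odd n); rewrite !nuK.
rewrite !nupowS !nuK; zring.
Qed.

(** The power of [nu] is the sign of moving the m - i desuspensions of the right factor past the
    left factor. *)
Lemma unsusp_catA m (u v : A) : J m (catA u v) =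
  \sum_(i < m.+1) catA (nupow (@wdeg k C) (m - i) (J i u)) (J (m - i) v).
Proof.
have [bl br] := @bilin_catA k B; have lJ := @lin_J k B deg.
have ln i : linear (@nupow k (seq B) (@wdeg k C) i) by exact: lin_nupow.
have lnJ n i : linear (fun u => @nupow k (seq B) (@wdeg k C) n (J i u)).
  exact: (@lin_comp _ _ _ _ _ _ (ln _) (lJ _)).
move: u; apply: flin_ext => [||s].
- exact: (@lin_comp _ _ _ _ _ _ (lJ _) (bl _)).
- by apply: lin_sum => i; exact: (@lin_comp _ _ _ _ _ _ (bl _) (lnJ _ _)).
move: v; apply: flin_ext => [||t].
- exact: (@lin_comp _ _ _ _ _ _ (lJ _) (br _)).
- by apply: lin_sum => i; exact: (@lin_comp _ _ _ _ _ _ (br _) (lJ _)).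
have susp_cat : susp_sign deg (s ++ t) = (size t * wdeg s + susp_sign deg s + susp_sign deg t)%N.
  elim: s => [|b s IH]; first by rewrite /wdeg big_nil muln0.
  by rewrite /= IH size_cat /wdeg big_cons mulnDl mulnDr; lia.
rewrite catA_basis J_basis size_cat.
have z i : (i < m.+1)%N -> i != size s ->
    catA (nupow (@wdeg k C) (m - i) (J i (fbasis k s))) (J (m - i) (fbasis k t)) = 0.
  by move=> _ /negbTE si; rewrite J_basis eq_sym si (lin0 (ln _)) (lin0 (bl _)).
have [ms|ms] := ltnP m (size s).
  have -> : (size s + size t == m) = false by lia.
  by rewrite big1// => i _; apply: z => //; have := ltn_ord i; lia.
rewrite (bigD1 (Ordinal (n := m.+1) (m := size s) ms))//= big1 ?addr0; last first.
  by move=> i ii; apply: z => //; apply: contraNneq ii => e; apply/eqP/val_inj.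
rewrite !J_basis eqxx (linZ _ _ (ln _)) nupow_basis.
have -> : (size t == m - size s)%N = (size s + size t == m)%N by lia.
case: eqP => [<-|_]; last by rewrite (lin0 (br _)).
rewrite !(linZ _ _ (br _)) !(linZ _ _ (bl _)) catA_basis !scalerA -!exprD susp_cat.
by congr (_ ^+ _ *: _); rewrite addKn; lia.
Qed.
End CobarToDCSH.

(* The sign c_m relating the m-letter part of a twisting cochain to the m-th  *)
(* map of a DCSH family.                                                      *)
Fixpoint dcsh_sign (m : nat) : nat := if m is n.+1 then (dcsh_sign n + m)%N else 1%N.

(** In closed form c_m = 1 + m (m + 1) / 2; as c_1 is even, the first map of the family carries no
    sign. *)
Lemma dcsh_signD a b : (dcsh_sign (a + b)).+1 = (dcsh_sign a + dcsh_sign b + a * b)%N.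
Proof. by elim: a => [|a IH]; [rewrite mul0n addn0|rewrite addSn /=; nia]. Qed.

(** * The DCSH family of a twisting cochain *)

Section DCSHOfTwisting.
Variables (k : comPzRingType) (D C : precoalg k).
Notation B := (cgen C).
Notation A := (freemod k (seq B)).
Notation degC := (@cdeg k C).
Notation nuC := (nu (k := k) degC).
Notation nuD := (nu (k := k) (@cdeg k D)).
Notation J := (unsusp (k := k) degC).
Hypothesis nud : forall x, nuC (cdiff C x) = - cdiff C (nuC x).
Hypothesis nucom : forall x, ccomul C (nuC x) = tmap nuC nuC (ccomul C x).
Variable F : freemod k (cgen D) -> A.
Hypothesis lF : linear F.
Hypothesis augF : forall z, aug (F z) = 0.
Hypothesis degF : forall b, supp (fun w => sdeg degC w = (cdeg b)%:Z - 1) (F (fbasis k b)).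
Hypothesis twF : forall z, dA degC (cdiff C) (ccomul C) (F z) =
  tlift (fun a b => catA (F (nuD a)) (F b)) (ccomul D z) - F (cdiff D z).

Definition dcsh_fun (m : nat) (z : freemod k (cgen D)) : freemod k (word C) :=
  (-1) ^+ dcsh_sign m *: J m (F z).

Lemma lin_dcsh_fun m : linear (dcsh_fun m).
Proof. by apply: lin_scale; apply: (@lin_comp _ _ _ _ _ _ (@lin_J k B degC m) lF). Qed.

Lemma supp_J m n (x : A) : supp (fun w => sdeg degC w = n) x ->
  supp (fun w => sdeg degC w = n /\ size w = m) (J m x).
Proof.
apply: supp_lin => [|w wn]; first exact: lin_J.
rewrite J_basis; case: eqP => [wm|_]; last exact: supp0.
by apply: suppZ; exact: supp_basis.
Qed.

Lemma sdegE (w : seq B) : sdeg degC w = (@wdeg k C w)%:Z - (size w)%:Z.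
Proof.
rewrite /sdeg /wdeg; elim: w => [|b w IH]; first by rewrite !big_nil.
by rewrite !big_cons IH /=; lia.
Qed.

(** The equations are the parts of given word length of the twisting equation. The products in which
    one factor has length 0 vanish because [F] has no constant part; what remains is a comparison of
    signs. *)
Lemma dcsh_family_of_twisting :
  dcsh_family (fun m => linpack (lin_dcsh_fun m)).
Proof.
have lJ := @lin_J k B degC; have [bl br] := @bilin_catA k B.
have lts := @lin_tcsum k C; have lt := @lin_tdiff k C.
have J0 z : J 0 (F z) = 0 by rewrite augE augF scale0r.
move=> m m0; split=> [b w|z].
  rewrite linpackE /dcsh_fun => nz.
  have [] := @suppZ k _ _ _ _ (@supp_J m _ _ (@degF b)) w nz.
  by rewrite sdegE => dw sw; split=> //; lia.
rewrite linpackE /dcsh_fun (linZ _ _ lt).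
have := congr1 (J m) (twF z); rewrite (unsusp_dA nud nucom) (linD _ _ (lJ _)) (linN _ (lJ _)).
case: m m0 => // m _ E.
rewrite linpackE /dcsh_fun.
have sE : (-1) ^+ dcsh_sign m.+1 = (-1) ^+ m.+1 * (-1) ^+ dcsh_sign m :> k by rewrite /= exprD mulrC.
have -> : \sum_(0 <= i < m) (-1) ^+ i *: @tcomul k C i (linpack (lin_dcsh_fun m) z) =
    (-1) ^+ dcsh_sign m *: tcsum m (J m (F z)).
  by rewrite -(linZ _ _ (lts m)).
have -> : \sum_(1 <= i < m.+1) (-1) ^+ i.+1 *: tens_map (m.+1 - i).-1
      (linpack (lin_dcsh_fun i)) (linpack (lin_dcsh_fun (m.+1 - i))) (ccomul D z) =
    (-1) ^+ dcsh_sign m *: J m.+1 (tlift (fun a b => catA (F (nuD a)) (F b)) (ccomul D z)).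
  move: (ccomul D z) => y; rewrite (tlift_app _ _ (lJ _)).
  move: y; apply: flin_ext => [||[a b]].
  - by apply: lin_sum => i; apply: lin_scale; rewrite /tens_map; exact: linearP.
  - by apply: lin_scale; exact: lin_tlift.
  rewrite tlift_basis nu_basis (linZ _ _ lF) (linZ _ _ (bl _)) (linZ _ _ (lJ _)).
  rewrite unsusp_catA big_ord_recl J0 (lin0 (@lin_nupow _ _ _ _)) (lin0 (bl _)) add0r.
  rewrite big_ord_recr /= /bump /= add1n subnn J0 (lin0 (br _)) addr0.
  rewrite big_add1 big_mkord !scaler_sumr; apply: eq_bigr => i _; rewrite add1n.
  rewrite /tens_map flift_fbasis /= /dcsh_fun fcat_catA.
  rewrite (linZ _ _ (br _)) (linZ _ _ (bl _)).
  have -> : nupow (@wdeg k C) (m.+1 - i.+1) (J i.+1 (F (fbasis k a))) =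
      (-1) ^+ ((m - i) * (cdeg a + i)) *: J i.+1 (F (fbasis k a)).
    have := @supp_J i.+1 _ _ (@degF a); move: (J i.+1 _) => x sx.
    apply: (lin_supp_ext _ _ sx) => [||w [wd ws]].
    - exact: lin_nupow.
    - by apply: lin_scale; exact: lin_id.
    by rewrite nupow_basis subSS; congr ((-1) ^+ (_ * _) *: _); move: wd; rewrite sdegE ws; lia.
  rewrite (linZ _ _ (bl _)) !scalerA -!exprD; congr (_ *: _).
  have im := ltn_ord i.
  have eqs := dcsh_signD i.+1 (m - i); have eqm : (i.+1 + (m - i) = m.+1)%N by lia.
  rewrite eqm /= in eqs; rewrite subSS; rewrite -[LHS]signr_odd -[RHS]signr_odd; congr (_ ^+ nat_of_bool _).
  move: eqs; have [l ml] : exists l, (m - i = l.+1)%N by exists (m - i).-1; lia.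
  move: ml {im eqm}; move: (nat_of_ord i) (cdeg a) => j p ml eqs.
  have mj : m = (j + l.+1)%N by lia.
  clear E sE; rewrite ml in eqs *; subst m; rewrite /= in eqs *.
  (* The signs depend on six parities only, subject to the relation from [dcsh_signD]. *)
  have := congr1 odd eqs; rewrite /= !(oddD, oddM, oddS) /=.
  move: (odd (dcsh_sign (j + l.+1))) (odd (dcsh_sign j)) (odd (dcsh_sign l)) (odd p) (odd j) (odd l).
  by do 6!case.
have {E} -> : J m.+1 (F (cdiff D z)) = J m.+1 (tlift (fun a b => catA (F (nuD a)) (F b)) (ccomul D z)) -
   ((-1) ^+ m.+1 *: tdiff (J m.+1 (F z)) + tcsum m (J m (F z))) by rewrite E opprB addrC subrK.
have aa : (-1) ^+ m.+1 * (-1) ^+ m.+1 = 1 :> k by rewrite -expr2 sqrr_sign.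
rewrite {}sE; set T := tdiff _; set P := tcsum _ _; set Q := J m.+1 (tlift _ _).
move: T P Q aa => T P Q; move: ((-1) ^+ m.+1) ((-1) ^+ dcsh_sign m) => a c aa.
by rewrite scalerA mulrA aa mul1r; zring.
Qed.

Lemma lin_letterF : linear (fun z => letter (F z) : freemod k B).
Proof. exact: (@lin_comp _ _ _ _ _ _ (@lin_letter k B) lF). Qed.

(** For index 1 both sums of the family are empty, and its equation says that the one-letter part
    commutes with the differentials. *)
Lemma dcsh_map_of_twisting : chain_coalgebra D -> chain_coalgebra C ->
  dcsh_map (linpack lin_letterF).
Proof.
move=> cD cC; have fam := dcsh_family_of_twisting.
have p1 z : dcsh_fun 1 z = @word1 k C (letter (F z)).
  by rewrite /dcsh_fun /= expr2 mulrNN mulr1 scale1r J1E word1_ltr.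
split=> //; last by exists (fun m => linpack (lin_dcsh_fun m)).
split=> [b c|z].
  rewrite linpackE => nz; have := degF; have [_ _] := fam 1%N isT.
  have sl : supp (fun c => (cdeg c)%:Z - 1 = (cdeg b)%:Z - 1) (letter (F (fbasis k b))).
    apply: supp_lin (@lin_letter k B) _ (@degF b) => w wb.
    rewrite letter.unlock flift_fbasis; case: w wb => [|e [|e' w]] wb; try exact: supp0.
    by apply: supp_basis; rewrite -wb /sdeg big_seq1.
  by move=> _; have := sl c nz; lia.
have [_ /(_ z)] := fam 1%N isT.
rewrite !big_geq// subr0 expr1 scaleN1r !linpackE !p1 !word1_ltr => /eqP.
rewrite subr_eq0 => /eqP e; have := congr1 (@letter k B) e.
rewrite letter_ltr => <-; have := @tdiff_ltrM k C (letter (F z)) (fbasis k ([::] : seq B)).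
rewrite catA1 => ->; rewrite catA1 /tdiff flift_fbasis /=.
have [bl br] := @bilin_catA k B.
by rewrite (lin0 (br _)) addr0 letter_ltr.
Qed.
End DCSHOfTwisting.

(** * The Borel construction as a quotient *)

Section Borel.
Variables (R : realType) (Y : topologicalType) (g : circle_action R Y).
Notation E := (milnorE R).
Notation Yh := (homotopy_orbits g).

Lemma orb_continuous : continuous (fun p : E * Y => \pi_Yh p : Yh)%qT.
Proof. exact: pi_continuous. Qed.
Definition orb : continuousType (E * Y)%type Yh := mkcts orb_continuous.

Lemma orbK (z : Yh) : orb (repr z) = z.
Proof. exact: (@reprK _ Yh z). Qed.

Lemma orb_repr (z : Yh) : exists p, z = orb p.
Proof. by exists (repr z); rewrite orbK. Qed.

Lemma orb_eq p q : orb p = orb q <-> exists a : S1 R, p.1 = milnor_act q.1 a /\ q.2 = g (a, p.2).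
Proof.
split=> [/eqquotP/asboolP//|h].
by apply/eqquotP/asboolP.
Qed.

Lemma orb_act e a y : orb (milnor_act e a, y) = orb (e, g (a, y)).
Proof. by apply/orb_eq; exists a. Qed.

Lemma orb_descent (W : topologicalType) (f : E * Y -> W) : continuous f ->
  (forall e a y, f (milnor_act e a, y) = f (e, g (a, y))) ->
  exists2 F : continuousType Yh W, True & forall p, F (orb p) = f p.
Proof.
move=> cf fa; pose F (z : Yh) := f (repr z).
have Fo p : F (orb p) = f p.
  have /orb_eq[a [p1 p2]] : orb (repr (orb p)) = orb p by rewrite orbK.
  by rewrite /F [repr _]surjective_pairing p1 fa -p2 -surjective_pairing.
have cF : continuous F.
  apply/quotient_continuous; rewrite (_ : F \o _ = f)//.
  by apply/funext => p; exact: Fo.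
by exists (mkcts cF).
Qed.
End Borel.

Section BorelMaps.
Variables (R : realType) (Y Y' : topologicalType) (g : circle_action R Y) (g' : circle_action R Y').
Variable f : continuousType Y Y'.
Hypothesis fg : forall a y, f (g (a, y)) = g' (a, f y).

Lemma orbmap_exists : exists2 F : continuousType (homotopy_orbits g) (homotopy_orbits g'), True &
  forall p, F (orb g p) = orb g' (p.1, f p.2).
Proof.
have c : continuous (fun p : milnorE R * Y => orb g' (p.1, f p.2)).
  apply: (@continuous_comp_all _ _ _ (overmap (milnorE R) f) (orb g')); exact: cts_fun.
by apply: orb_descent c _ => e a y /=; rewrite fg orb_act.
Qed.
Definition orbmap := s2val (cid2 orbmap_exists).
Lemma orbmapE p : orbmap (orb g p) = orb g' (p.1, f p.2).
Proof. exact: (s2valP' (cid2 orbmap_exists)). Qed.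
End BorelMaps.

(** * The DCSH map to the Borel construction *)

Section TheMap.
Variables (k : comPzRingType) (R : realType).
Notation E := (milnorE R).
Definition hE : continuousType (I01 R * E)%type E := projT1 (cid (contraction_exists R)).
Notation e0 := (basepoint R).
Notation ea := (milnor_actc R).
Lemma hE0 e : hE (endpt R false, e) = e0. Proof. by have [] := projT2 (cid (contraction_exists R)). Qed.
Lemma hE1 e : hE (endpt R true, e) = e. Proof. by have [] := projT2 (cid (contraction_exists R)). Qed.
Lemma hEe0 t : hE (t, e0) = e0. Proof. by have [] := projT2 (cid (contraction_exists R)). Qed.
Lemma eaM e a b : ea (e, mulS1 a b) = ea (ea (e, a), b). Proof. exact: milnor_actM. Qed.
Lemma ea1 e : ea (e, oneS1 R) = e. Proof. exact: milnor_act1. Qed.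
Notation PhiE := (@Phi R E hE e0 ea k).

Lemma aug_Phi n (Z : topologicalType) (U : chains k R Z) : aug (PhiE n U) = 0.
Proof.
case: n => [|n]; first by rewrite Phi0 -[ltr _]catA1 aug_ltrM.
by rewrite PhiS aug_SA//; lin.
Qed.

Section Map.
Variables (Y : topologicalType) (g : circle_action R Y).
Notation Yh := (homotopy_orbits g).
Notation tw := (freemod k (tw_cell R Y)).
Notation porb := (mapA (cmap (k := k) (R := R) (orb g))).

Definition twist (z : tw) : freemod k (seq (cell R Yh)) :=
  flift (fun b : tw_cell R Y => porb (PhiE b.1 (fbasis k b.2))) z.

Lemma lin_twist : linear twist. Proof. by rewrite /twist; lin. Qed.

Lemma twist_twg n (x : chains k R Y) : twist (twg n x) = porb (PhiE n x).
Proof.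
have lt := lin_twist; have lg := @lin_twg k R Y; have lP := @lin_Phi R E hE e0 ea k.
have lp : linear porb by lin.
move: x; apply: flin_ext => [||c].
- exact: (@lin_comp _ _ _ _ _ _ lt (lg _)).
- exact: (@lin_comp _ _ _ _ _ _ lp (lP _ _)).
by rewrite twg_basis /twist flift_fbasis.
Qed.

(** As (e a, y) and (e, a y) have the same orbit, transferring a to E can be replaced by acting on
    Y, and naturality of Phi for the action map does the rest. *)
Lemma porb_Theta n (x : chains k R Y) : porb (Theta hE e0 ea n x) =
  \sum_(j < n.+1) twist (twg j (pr (actc g) (sC k R (n - j)) x)).
Proof.
have lp : linear porb by lin.
rewrite /Theta (linsum _ _ _ lp); apply: eq_bigr => j _.
rewrite twist_twg /pr -Phi_nat !mapA_comp; [|lin..].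
apply: mapA_ext => [||u].
- by apply: (@lin_comp _ _ _ _ (cmap _) (cmap _)); lin.
- by apply: (@lin_comp _ _ _ _ (cmap _) (cmap _)); lin.
by rewrite !cmap_comp; apply: cmap_ext => -[e [a y]]; exact: orb_act.
Qed.

Lemma twist_twisting z : dA (@cell_dim R Yh) (@bd k R Yh) (@cm k R Yh) (twist z) =
  tlift (fun a b => catA (twist (nu (@tw_deg R Y) a)) (twist b)) (twc z) - twist (twd g z).
Proof.
have lt := lin_twist; have lg := @lin_twg k R Y; have lP := @lin_Phi R E hE e0 ea k.
have lp : linear porb by lin.
have lb Z : linear (@bd k R Z) by lin.
have lc Z : linear (@cm k R Z) by lin.
have ltc : linear (@twc k R Y) by lin.
have ltd : linear (@twd k R Y g) by lin.
have bc := @bilin_catA k (cell R Yh).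
have ld : linear (dA (@cell_dim R Yh) (@bd k R Yh) (@cm k R Yh)) by lin.
move: z; apply: tw_ext => [||n x].
- exact: (@lin_comp _ _ _ _ _ _ ld lt).
- apply: lin_add; last by apply: lin_opp; exact: (@lin_comp _ _ _ _ _ _ lt ltd).
  exact: (@lin_comp _ _ _ _ _ _ (@lin_tlift _ _ _ _ _) ltc).
have lpc : linear (cmap (k := k) (R := R) (orb g)) by lin.
rewrite twist_twg.
rewrite -(@mapA_cobar _ _ (@cell_dim R _) _ _ (lb _) (lc _) _ (@cell_dim R _) _ _ (lb _) (lc _) _ lpc); first last.
- by move=> u; exact: cm_cmap.
- by move=> u; rewrite cmap_bd.
- by move=> u; exact: nu_cmap.
rewrite (Phi_twisting hE0 hE1 hEe0 ea1 eaM) (linD _ _ lp) (linN _ lp) (linD _ _ lp).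
rewrite porb_Theta twd_twg (linD _ _ lt) (linN _ lt) (linsum _ _ _ lt) -twist_twg opprD opprK.
rewrite addrAC -addrA; congr (_ + _); rewrite ?[RHS]addrC //.
rewrite twc_twg (linsum _ _ _ (@lin_tlift _ _ _ _ _)) (linsum _ _ _ lp).
apply: eq_bigr => i _; rewrite mapA_star//.
have lnu : linear (nu (k := k) (@tw_deg R Y)) by lin.
have ltn : linear (fun a => twist (nu (@tw_deg R Y) a)) by exact: (@lin_comp _ _ _ _ _ _ lt lnu).
rewrite tlift_tmap//; last exact: bilin_comp.
rewrite /star st.unlock; apply: tlift_ext => u v.
by rewrite nu_twg !twist_twg.
Qed.

Lemma aug_twist z : aug (twist z) = 0.
Proof.
have lt := lin_twist; have la := @lin_aug k (cell R Yh).
move: z; apply: (@flin_ext k _ k^o) => [||b].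
- exact: (@lin_comp _ _ _ _ _ _ la lt).
- exact: lin_zero.
by rewrite /twist flift_fbasis aug_mapA ?aug_Phi//; lin.
Qed.

Lemma supp_twist b : supp (fun w => sdeg (@cell_dim R Yh) w = (tw_deg b)%:Z - 1) (twist (fbasis k b)).
Proof.
rewrite /twist flift_fbasis.
apply: (supp_mapA (deg := @cell_dim R _)) => [|c|]; first by lin.
  by apply: supp_cmap; exact: supp_basis.
have := @supp_Phi R E hE e0 ea k b.1 (cell_dim b.2) Y (fbasis k b.2) (@supp_basis _ _ _ _ erefl).
by apply: suppW => w ->; rewrite /tw_deg; lia.
Qed.

Definition borel_fun (z : tw) : chains k R Yh := letter (twist z).

Lemma lin_borel_fun : linear borel_fun.
Proof. exact: (@lin_comp _ _ _ _ _ _ (@lin_letter _ _) lin_twist). Qed.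

Definition borel_map := linpack (@lin_letterF k (twisted_tensor k g) (CU k R Yh) twist lin_twist).

Lemma borel_dcsh : dcsh_map borel_map.
Proof.
apply: (@dcsh_map_of_twisting k (twisted_tensor k g) (CU k R Yh) _ _ twist lin_twist).
- move=> x; have := congr1 (fun z => - z) (@nu_bd k R Yh x).
  by rewrite opprK bd.unlock => h; exact: (esym h).
- by move=> x; have := @cm_nu k R Yh x; rewrite cm.unlock.
- exact: aug_twist.
- exact: supp_twist.
- move=> z; have := twist_twisting z.
  by rewrite bd.unlock cm.unlock twc.unlock twd.unlock.
- exact: chain_coalgebra_twisted.
- exact: chain_coalgebra_CU.
Qed.

Lemma borel_twg n (x : chains k R Y) : borel_fun (twg n x) = cmap (orb g) (letter (PhiE n x)).
Proof. by rewrite /borel_fun twist_twg letter_mapA//; lin. Qed.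

Lemma borel_bd z : borel_fun (twd g z) = bd (borel_fun z).
Proof.
have [_ _ [_ h] _] := borel_dcsh.
by have := h z; rewrite twd.unlock bd.unlock.
Qed.

Lemma supp_borel n (z : tw) : supp (fun b => tw_deg b = n) z ->
  supp (fun c => cell_dim c = n) (borel_fun z).
Proof.
apply: supp_lin => [|b <-]; first exact: lin_borel_fun.
by have [_ _ [h _] _] := borel_dcsh => c; exact: h.
Qed.
End Map.

Section MapNat.
Variables (Y Y' : topologicalType) (g : circle_action R Y) (g' : circle_action R Y').
Variable f : continuousType Y Y'.
Hypothesis fg : forall a y, f (g (a, y)) = g' (a, f y).

Definition twmap (z : freemod k (tw_cell R Y)) : freemod k (tw_cell R Y') :=
  flift (fun b : tw_cell R Y => twg b.1 (cmap f (fbasis k b.2))) z.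
Lemma lin_twmap : linear twmap. Proof. by rewrite /twmap; lin. Qed.

Lemma twmap_twg n (x : chains k R Y) : twmap (twg n x) = twg n (cmap f x).
Proof.
have lg := @lin_twg k R Y; have lg' := @lin_twg k R Y'; have lt := lin_twmap.
have lc : linear (cmap (k := k) (R := R) f) by lin.
move: x; apply: flin_ext => [||c].
- exact: (@lin_comp _ _ _ _ _ _ lt (lg _)).
- exact: (@lin_comp _ _ _ _ _ _ (lg' _) lc).
by rewrite twg_basis /twmap flift_fbasis.
Qed.

Lemma twmap_twd z : twmap (twd g z) = twd g' (twmap z).
Proof.
have lt := lin_twmap.
have ltd : linear (@twd k R Y g) by lin.
have ltd' : linear (@twd k R Y' g') by lin.
move: z; apply: tw_ext => [||n x].
- exact: (@lin_comp _ _ _ _ _ _ lt ltd).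
- exact: (@lin_comp _ _ _ _ _ _ ltd' lt).
rewrite twmap_twg !twd_twg (linD _ _ lt) (linN _ lt) (linsum _ _ _ lt) twmap_twg cmap_bd.
congr (_ - _); apply: eq_bigr => j _; rewrite twmap_twg; congr twg.
rewrite /pr cmap_comp -[sC k R (n - j) in RHS](@cmap_id _ _ _ idfun)// cmap_ez cmap_comp.
by apply: cmap_ext => -[a y]; exact: fg.
Qed.

Lemma borel_nat z : borel_fun g' (twmap z) = cmap (orbmap fg) (borel_fun g z).
Proof.
have lt := lin_twmap; have lb := @lin_borel_fun Y g; have lb' := @lin_borel_fun Y' g'.
have lc : linear (cmap (k := k) (R := R) (orbmap fg)) by lin.
move: z; apply: tw_ext => [||n x].
- exact: (@lin_comp _ _ _ _ _ _ lb' lt).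
- exact: (@lin_comp _ _ _ _ _ _ lc lb).
rewrite twmap_twg !borel_twg -Phi_nat letter_mapA ?cmap_comp; last by lin.
by apply: cmap_ext => p; rewrite /= orbmapE.
Qed.
End MapNat.
End TheMap.

(** * Lifting cubes to the Borel construction *)

Section UnitCoordinates.
Variable R : realType.
Notation T := (Iinf R).

Lemma unitI_subproof (x : R) : `[0, 1]%classic (Num.max 0 (Num.min 1 x)).
Proof. by rewrite /= in_itv /= le_max lexx /= ge_max ler01 ge_min lexx. Qed.
Definition unitI (x : R) : I01 R := exist _ (Num.max 0 (Num.min 1 x)) (mem_set (unitI_subproof x)).

Lemma I01_ge0le1 (t : I01 R) : 0 <= (set_val t : R) <= 1.
Proof. by case: t => t tI; have := set_mem tI; rewrite /= in_itv. Qed.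

Lemma set_valK (x : R) : 0 <= x <= 1 -> set_val (unitI x) = x.
Proof.
move=> /andP[x0 x1]; change (Num.max 0 (Num.min 1 x) = x).
by rewrite min_r// max_r.
Qed.

Lemma unitI_val (t : I01 R) : unitI (set_val t) = t.
Proof. by apply: val_inj; rewrite -[LHS]/(set_val (unitI (set_val t))) set_valK ?I01_ge0le1. Qed.

Lemma maxmin_continuous (S : topologicalType) (f g : S -> R) : continuous f -> continuous g ->
  continuous (fun s => Num.max (f s) (g s)) /\ continuous (fun s => Num.min (f s) (g s)).
Proof.
by move=> cf cg; split=> s; [apply: continuous_max|apply: continuous_min]; [exact: cf|exact: cg|exact: cf|exact: cg].
Qed.

Lemma unitI_continuous (S : topologicalType) (f : S -> R) : continuous f -> continuous (fun s => unitI (f s)).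
Proof.
move=> cf; apply: (@continuous_comp_initial _ _ _ set_val).
have c0 : continuous (fun _ : S => 0 : R) by move=> ?; exact: cvg_cst.
have c1 : continuous (fun _ : S => 1 : R) by move=> ?; exact: cvg_cst.
exact: (maxmin_continuous c0 (maxmin_continuous c1 cf).2).1.
Qed.

Lemma I01_compact : compact [set: I01 R].
Proof.
have -> : [set: I01 R] = unitI @` `[0, 1]%classic.
  apply/seteqP; split=> // t _; exists (set_val t); last exact: unitI_val.
  by rewrite /= in_itv /= I01_ge0le1.
apply: continuous_compact; last exact: segment_compact.
by apply: continuous_subspaceT; apply: unitI_continuous => x; exact: cvg_id.
Qed.

Lemma Iinf_compact : compact [set: T].
Proof.
have := @tychonoff nat (fun=> I01 R) (fun=> [set: I01 R]) (fun=> I01_compact).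
by congr compact; apply/seteqP; split.
Qed.

(** For a box inside the cube, the retraction onto it; [unitI] keeps the values in the interval in
    all other cases. *)
Definition clip (a b : nat -> R) (t : T) : T :=
  fun i => unitI (Num.max (a i) (Num.min (b i) (set_val (t i)))).

Lemma val_continuous i : continuous (fun t : T => set_val (t i) : R).
Proof. by apply: (@continuous_comp_all _ _ _ (fun t : T => t i)); [exact: coord_continuous|exact: initial_continuous]. Qed.

Lemma clip_continuous (S : topologicalType) (a b : nat -> S -> R) (t : S -> T) :
  (forall i, continuous (a i)) -> (forall i, continuous (b i)) -> continuous t ->
  continuous (fun s => clip (a^~ s) (b^~ s) (t s)).
Proof.
move=> ca cb ct; apply: Iinf_continuous => i; apply: unitI_continuous.
have cv : continuous (fun s => set_val (t s i) : R).
  by apply: (@continuous_comp_all _ _ _ t (fun u : T => set_val (u i))); [exact: ct|exact: val_continuous].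
exact: (maxmin_continuous (ca i) (maxmin_continuous (cb i) cv).2).1.
Qed.

Lemma clip_id a b (t : T) : (forall i, a i <= set_val (t i) <= b i) -> clip a b t = t.
Proof.
move=> ab; apply/funext => i; rewrite /clip; have /andP[ha hb] := ab i.
by rewrite min_r// max_r// unitI_val.
Qed.

Lemma clip_val a b (t : T) i : 0 <= a i -> a i <= b i -> b i <= 1 ->
  set_val (clip a b t i) = Num.max (a i) (Num.min (b i) (set_val (t i))) /\
  a i <= set_val (clip a b t i) <= b i.
Proof.
move=> a0 ab b1; have h : a i <= Num.max (a i) (Num.min (b i) (set_val (t i))) <= b i.
  by rewrite le_max lexx /= ge_max ab ge_min lexx.
have /andP[h1 h2] := h.
by rewrite /clip set_valK// (le_trans a0)// (le_trans h2).
Qed.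

Definition upd (a : nat -> R) j c i := if i == j then c else a i.
Lemma updK a j c c' : upd (upd a j c) j c' = upd a j c'.
Proof. by apply/funext => i; rewrite /upd; case: eqP. Qed.
Lemma upd_same a j : upd a j (a j) = a.
Proof. by apply/funext => i; rewrite /upd; case: eqP => // ->. Qed.

Definition boxed (a b : nat -> R) := forall i, [/\ 0 <= a i, a i <= b i & b i <= 1].

(** * Lifting cubes through a map with local sections *)

Section Lifting.
Variables (P B : topologicalType) (q : P -> B).
Hypothesis sections : forall b, exists V : set B, [/\ open V, V b &
  exists s : B -> P, forall x, V x -> {for x, continuous s} /\ q (s x) = x].
(** The use made of a principal bundle: over the image of a retraction [r] a lift can be altered,
    with the same projection, to agree with another one. For the orbit map this is a translation by
    circle elements, for the exponential a translation by reals. *)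
Hypothesis regauge : forall (r : T -> T) (l m : T -> P),
  continuous r -> continuous l -> continuous m -> (forall t, r (r t) = r t) ->
  (forall t, q (l (r t)) = q (m (r t))) ->
  exists2 m' : T -> P, continuous m' &
    (forall t, q (m' t) = q (m t)) /\ (forall t, m' (r t) = l (r t)).
Variable f : T -> B.
Hypothesis cf : continuous f.

(** The lift is that of [f] composed with the retraction onto the box, which avoids maps defined on
    subspaces. *)
Definition liftable a b := exists2 l : T -> P, continuous l & forall t, q (l t) = f (clip a b t).

Lemma cst_fam_continuous (c : nat -> R) i : continuous (fun _ : T => c i).
Proof. by move=> ?; exact: cst_continuous. Qed.

Lemma clipc a b : continuous (clip a b).
Proof.
apply: (@clip_continuous T (fun i _ => a i) (fun i _ => b i) idfun); try exact: cst_fam_continuous.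
by move=> t; exact: cvg_id.
Qed.

Lemma liftable_sub a b a' b' : boxed a' b' -> (forall i, a i <= a' i) -> (forall i, b' i <= b i) ->
  liftable a b -> liftable a' b'.
Proof.
move=> box aa bb [l cl ql]; exists (fun t => l (clip a' b' t)).
  by apply: (@continuous_comp_all _ _ _ (clip a' b') l); [exact: clipc|].
move=> t; rewrite ql (@clip_id a b)// => i.
have [h1 h2 h3] := box i; have [_ /andP[u v]] := clip_val t h1 h2 h3.
by rewrite (le_trans (aa i))//= (le_trans v).
Qed.

(** A Lebesgue number for the open sets with sections. Compactness of the cube is used twice, for
    the center [x] of a box and for the point [t] that is clipped to it. *)
Lemma liftable_small : exists N : nat, forall a b, boxed a b ->
  (forall i, b i - a i <= N.+1%:R^-1) -> liftable a b.
Proof.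
pose C (x : T) (d : R) := clip (fun i => set_val (x i) - d) (fun i => set_val (x i) + d).
pose Q (d : R) (x : T) := exists V, (forall t, V (f (C x d t))) /\
  exists s : B -> P, forall x, V x -> {for x, continuous s} /\ q (s x) = x.
have cov := (compact_near_coveringP [set: T]).1 Iinf_compact.
have : \forall d \near nbhs (0 : R), [set: T] `<=` Q d.
  apply: (cov _ _ _ _) => x _; have [V [oV Vx sV]] := sections (f x).
  have cj : continuous (fun p : (T * R) * T => f (C p.1.1 p.1.2 p.2)).
    apply: (@continuous_comp_all _ _ _ (fun p : (T * R) * T => C p.1.1 p.1.2 p.2) f) => //.
    have c1 i : continuous (fun p : (T * R) * T => set_val (p.1.1 i) : R).
      apply: (@continuous_comp_all _ _ _ fst (fun p : T * R => set_val (p.1 i) : R)); first exact: fst_cts.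
      by apply: (@continuous_comp_all _ _ _ fst (fun t : T => set_val (t i) : R)); [exact: fst_cts|exact: val_continuous].
    have c2 : continuous (fun p : (T * R) * T => p.1.2).
      by apply: (@continuous_comp_all _ _ _ fst snd); [exact: fst_cts|exact: snd_cts].
    apply: (@clip_continuous ((T * R) * T)%type (fun i p => set_val (p.1.1 i) - p.1.2) (fun i p => set_val (p.1.1 i) + p.1.2) snd).
    - by move=> i p; apply: cvgB; [exact: c1|exact: c2].
    - by move=> i p; apply: cvgD; [exact: c1|exact: c2].
    - exact: snd_cts.
  have C0 t : C x 0 t = x.
    apply/funext => i; rewrite /C /clip subr0 addr0.
    by rewrite max_l ?ge_min ?lexx// unitI_val.
  have near_t : \forall p \near nbhs (x, (0 : R)), [set: T] `<=` (fun t => V (f (C p.1 p.2 t))).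
    apply: (cov _ _ (fun p t => V (f (C p.1 p.2 t)))) => t _.
    have : \forall p \near nbhs ((x, (0 : R)), t), V (f (C p.1.1 p.1.2 p.2)).
      apply: (cj ((x, 0), t)); apply: open_nbhs_nbhs; split=> //=.
      by rewrite C0.
    move=> [[U W] /= [xU tW] UW]; exists (W, U) => //= -[t' p] /= [Wt Up].
    exact: (UW (p, t')).
  move: near_t => [[U W] /= [xU tW] UW]; exists (U, W) => //= -[x' d] /= [Ux Wd].
  by exists V; split=> // t; exact: (UW (x', d) (conj Ux Wd)).
move=> /nbhs_ballP[e /= e0 be].
have [N Ne] : exists N : nat, N.+1%:R^-1 < e.
  exists (Num.truncn e^-1).
  rewrite -[ltRHS]invrK ltf_pV2 ?posrE ?invr_gt0//.
  by apply: truncnS_gt.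
exists N => a b box ab; pose x : T := fun i => unitI (a i).
have xa i : set_val (x i) = a i.
  have [a0 ab1 b1] := box i; rewrite set_valK// a0/=; exact: le_trans b1.
have dN : ball 0 e (N.+1%:R^-1 : R) by rewrite /ball /= sub0r normrN ger0_norm// invr_ge0.
have [V [VC [s sV]]] := be _ dN x I.
apply: (@liftable_sub (fun i => set_val (x i) - N.+1%:R^-1) (fun i => set_val (x i) + N.+1%:R^-1)) => //.
- by move=> i; rewrite xa gerBl invr_ge0.
- by move=> i; rewrite xa -lerBlDl.
exists (fun t => s (f (C x N.+1%:R^-1 t))) => [t|t]; last by rewrite (sV _ (VC t)).2.
apply: (@continuous_comp _ _ _ (fun t => f (C x N.+1%:R^-1 t)) s); last exact: (sV _ (VC t)).1.
by apply: (@continuous_comp_all _ _ _ (C x N.+1%:R^-1) f) => //; exact: clipc.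
Qed.

(** With [r] the projection onto the wall t_j = c, [regauge] makes the second lift agree with the
    first on the wall; then they are pasted. *)
Lemma liftable_glue a b j c : boxed a b -> a j <= c <= b j ->
  liftable a (upd b j c) -> liftable (upd a j c) b -> liftable a b.
Proof.
move=> box /andP[ac cb] [l cl ql] [m cm qm].
have [aj0 abj bj1] := box j.
pose r (t : T) : T := fun i => if i == j then unitI c else t i.
have cr : continuous r.
  apply: Iinf_continuous => i; rewrite /r; case: (i == j); last exact: coord_continuous.
  by move=> ?; exact: cst_continuous.
have c01 : set_val (unitI c) = c by rewrite set_valK// (le_trans aj0)//= (le_trans cb).
have rr t : r (r t) = r t by apply/funext => i; rewrite /r; case: eqP.
have qlm t : q (l (r t)) = q (m (r t)).
  rewrite ql qm; congr f; apply/funext => i; rewrite /clip /upd /r; case: eqP => // ->.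
  by rewrite c01 minxx max_r// min_r// maxxx.
have [m' cm' [qm' mr]] := regauge cr cl cm rr qlm.
pose G t := if set_val (t j) <= c then l t else m' t.
have fixr t : set_val (t j) = c -> r t = t.
  by move=> tc; apply/funext => i; rewrite /r; case: eqP => // ->; rewrite -tc unitI_val.
exists G => t.
  have cv := @val_continuous j t.
  have [tc|tc|tc] := ltgtP (set_val (t j)) c.
  - have nt : \forall s \near t, set_val (s j) < c by apply: (cvgr_lt _ cv).
    move=> A; rewrite {1}/G (ltW tc) => /(cl t) lA; change (\forall s \near t, A (G s)); near=> s.
    have sc : set_val (s j) < c by near: s.
    by rewrite /= /G (ltW sc); near: s.
  - have nt : \forall s \near t, c < set_val (s j) by apply: (cvgr_gt _ cv).
    move=> A; rewrite {1}/G leNgt tc /= => /(cm' t) lA; change (\forall s \near t, A (G s)); near=> s.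
    have sc : c < set_val (s j) by near: s.
    by rewrite /= /G leNgt sc; near: s.
  - move=> A GA; have lA : nbhs (l t) A by move: GA; rewrite /G tc lexx.
    have mA : nbhs (m' t) A by rewrite -(fixr _ tc) mr fixr.
    have l2 := cl t A lA; have m2 := cm' t A mA.
    by change (\forall s \near t, A (G s)); near=> s; rewrite /= /G; case: ifP => _; near: s.
rewrite /G; case: leP => tc.
  rewrite ql; congr f; apply/funext => i; rewrite /clip /upd; case: eqP => // ->.
  by congr (unitI (Num.max _ _)); rewrite !min_r// (le_trans tc).
rewrite qm' qm; congr f; apply/funext => i; rewrite /clip /upd; case: eqP => // ->.
congr unitI; have cm2 : c <= Num.min (b j) (set_val (t j)) by rewrite le_min cb ltW.
by rewrite !max_r// (le_trans ac).
Unshelve. all: by end_near.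
Qed.

Lemma liftable_stack N a b j : boxed a b ->
  (forall m, (m <= N)%N -> liftable (upd a j (m%:R / N.+1%:R)) (upd b j (m.+1%:R / N.+1%:R))) ->
  liftable (upd a j 0) (upd b j 1).
Proof.
move=> box small.
have Np : 0 < N.+1%:R :> R by rewrite ltr0n.
suff H m : (m <= N)%N -> liftable (upd a j 0) (upd b j (m.+1%:R / N.+1%:R)).
  by have := H N (leqnn N); rewrite divff// gt_eqF.
elim: m => [|m IH] mN; first by have := small 0%N isT; rewrite mul0r.
apply: (@liftable_glue _ _ j (m.+1%:R / N.+1%:R)).
- move=> i; rewrite /upd; case: eqP => // _; split; [by []|by rewrite divr_ge0|].
  by rewrite ler_pdivrMr// mul1r ler_nat.
- rewrite /upd eqxx divr_ge0//= ler_pM2r ?invr_gt0// ler_nat.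
  by [].
- by rewrite updK; apply: IH; exact: ltnW.
- by rewrite updK; exact: small.
Qed.

(** The cube is cut into pieces of side 1 / (N + 1), glued one coordinate at a time. Coordinates
    from [n] on are held at 0, so only finitely many directions have to be cut. *)
Lemma liftable_cube n : (forall t, f (truncI n t) = f t) -> exists2 l : T -> P, continuous l & forall t, q (l t) = f t.
Proof.
move=> fn; have [N small] := liftable_small.
have Np : 0 < N.+1%:R :> R by rewrite ltr0n.
have H m a b : boxed a b -> (forall i, (i < m)%N -> a i = 0 /\ b i = 1) ->
    (forall i, (m <= i)%N -> b i - a i <= N.+1%:R^-1) -> liftable a b.
  elim: m a b => [|m IH] a b box full sm; first by apply: small => // i; exact: sm.
  have [am bm] := full m (ltnSn m).
  rewrite -(upd_same a m) -(upd_same b m) am bm.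
  apply: (@liftable_stack N) => // l lN; apply: IH => i.
  - rewrite /upd; case: eqP => // _; split; first by rewrite divr_ge0.
      by rewrite ler_pM2r ?invr_gt0// ler_nat.
    by rewrite ler_pdivrMr// mul1r ler_nat.
  - by move=> im; rewrite /upd ltn_eqF//; apply: full; exact: ltnW.
  - rewrite /upd; case: eqP => [_ _|ne mi]; last by apply: sm; rewrite ltn_neqAle mi eq_sym andbT; exact/eqP.
    by rewrite -mulrBl -natrB// subSnn mul1r.
have [|i ni|i ni|l cl ql] := H n (fun=> 0) (fun i => (i < n)%N%:R).
- by move=> i; case: (i < n)%N; rewrite /= ?lexx ?ler01.
- by rewrite ni.
- by rewrite ltnNge ni /= subr0 invr_ge0.
exists l => // t; rewrite ql -fn -[RHS]fn; congr f; apply/funext => i.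
rewrite !truncE; case: ltnP => // ni; rewrite /clip ni.
have /andP[h0 h1] := I01_ge0le1 (t i).
by rewrite min_r// max_r// unitI_val.
Qed.
End Lifting.
End UnitCoordinates.

HB.lock Definition cwise (k : comPzRingType) (R : realType) (X W : topologicalType)
    (phi : continuousType (Iinf R) X -> continuousType (Iinf R) W)
    (x : chains k R X) : chains k R W :=
  flift (fun c : cell R X => cc k (cell_dim c) (phi (cell_cube c \o resc _))) x.

(** * Operations on chains defined cube by cube *)

Section Cubewise.
Variables (k : comPzRingType) (R : realType).
Notation T := (Iinf R).
Notation icube X := (continuousType (Iinf R) X).

Definition tinv (X : Type) n (F : T -> X) := forall t, F (truncI n t) = F t.

Lemma trunc_idem n (t : T) : truncI n (truncI n t) = truncI n t.
Proof. by apply/funext => j; rewrite !truncE; case: ltnP. Qed.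

Lemma tinv_trunc (X : topologicalType) n (F : icube X) : tinv n (F \o truncc R n).
Proof. by move=> t; rewrite -[LHS]/(F (truncI n (truncI n t))) trunc_idem. Qed.

Lemma cc_trunc (X : topologicalType) n (F : icube X) : cc k n F = cc k n (F \o truncc R n).
Proof. by apply: cc_ext => t; rewrite -[RHS]/(F (truncI n (truncI n t))) trunc_idem. Qed.

Lemma tinv_res (X : topologicalType) n (C : cube R n X) : tinv n (C \o resc n : icube X).
Proof. by move=> t; rewrite -[LHS]/(C (res n (pad (res n t)))) padK. Qed.

Variables X W : topologicalType.
Variable phi : icube X -> icube W.

Lemma lin_cwise : linear (@cwise k R X W phi).
Proof. by move=> a x y; rewrite cwise.unlock linearP. Qed.

Hypothesis phi_indep : forall n i (F : icube X), tinv n F -> indep i F -> indep i (phi F).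

(** Preserving independence of a coordinate makes [phi] send degenerate cubes to degenerate ones.
    Compatibility with faces is not asked, so [cwise phi] is in general no chain map. *)
Lemma cwise_cc n (F : icube X) : tinv n F -> cwise phi (cc k n F) = cc k n (phi F).
Proof.
move=> tF; pose gg n (C : cube R n X) := cc k n (phi (C \o resc n)).
have gd m C : degenerate C -> gg m C = 0.
  move=> /indep_degenerate[i im iC]; apply: (@cc_degenerate _ _ _ _ i) => //.
  by apply: phi_indep iC; exact: tinv_res.
have -> : cwise phi (cc k n F) =
    flift (fun c => gg (cell_dim c) (cell_cube c)) (chain_of k (F \o padc R n)).
  by rewrite cwise.unlock /gg cc.unlock.
rewrite (flift_chain_of gd) /gg; congr (cc k n (phi _)).
by apply/continuousEP => t; exact: tF.
Qed.

Lemma supp_cwise n (x : chains k R X) : supp (fun c => cell_dim c = n) x ->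
  supp (fun c => cell_dim c = n) (cwise phi x).
Proof.
apply: supp_lin => [|c <-]; first exact: lin_cwise.
by rewrite cwise.unlock flift_fbasis; exact: supp_cc.
Qed.
End Cubewise.

(** * The orbit map as a principal bundle *)

Section OrbitLifting.
Variables (R : realType) (Y : topologicalType) (g : circle_action R Y).
Notation E := (milnorE R).
Notation T := (Iinf R).
Notation Yh := (homotopy_orbits g).

Lemma phase_act i (e : E) a : e i <> None -> phase i (milnor_act e a) = mulS1 (phase i e) a.
Proof. by rewrite /phase /=; case: (jcoord e i) => [[]|]. Qed.

Lemma milnor_nonempty (e : E) : exists i, e i <> None.
Proof.
have [N [eN e1]] := jcoord_bound e.
apply: contrapT => /forallNP z; have : (1 : R) = 0; last by move/eqP; rewrite oner_eq0.
rewrite -(e1 N)// big1// => i _; rewrite /jw /join_weight.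
by case ei: (e i) (z i) => [[]|]// [].
Qed.

Lemma milnor_act_free (e : E) a b : milnor_act e a = milnor_act e b -> a = b.
Proof.
move=> ab; have [i ei] := milnor_nonempty e.
have := congr1 (phase i) ab; rewrite !phase_act// => h.
by rewrite -[a]mul1S1 -[b]mul1S1 -(mulVS1 (phase i e)) -!mulS1A h.
Qed.

Lemma jw_neq0 (e : E) i : (jw e i != 0) = (e i != None :> option _).
Proof.
rewrite /jw /join_weight; case ei: (e i) => [[t x]|]; last by rewrite eqxx.
by rewrite gt_eqF ?(jcoord_gt0 ei).
Qed.

(** Near a point with t_i > 0 the translating element is the quotient of the two i-th phases, hence
    continuous. *)
Lemma orb_translation (S : topologicalType) (l m : S -> E * Y) : continuous l -> continuous m ->
  (forall s, orb g (l s) = orb g (m s)) ->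
  exists2 a : S -> S1 R, continuous a & forall s, (l s).1 = milnor_act (m s).1 (a s) /\ (m s).2 = g (a s, (l s).2).
Proof.
move=> cl cm lm.
have D s : exists a : S1 R, (l s).1 = milnor_act (m s).1 a /\ (m s).2 = g (a, (l s).2).
  by apply/orb_eq.
pose a s := projT1 (cid (D s)).
have aE s : (l s).1 = milnor_act (m s).1 (a s) /\ (m s).2 = g (a s, (l s).2).
  exact: (projT2 (cid (D s))).
exists a => // s0.
have [i ei] := milnor_nonempty (m s0).1.
have c1 : continuous (fun s => (m s).1) by apply: (@continuous_comp_all _ _ _ m fst) => //; exact: fst_cts.
have c2 : continuous (fun s => (l s).1) by apply: (@continuous_comp_all _ _ _ l fst) => //; exact: fst_cts.
have li : (l s0).1 i <> None by rewrite (aE s0).1 /=; case: ((m s0).1 i) ei.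
have near_i : \forall s \near s0, (m s).1 i <> None.
  have : \forall s \near s0, jw (m s).1 i != 0.
    have cw : {for s0, continuous (fun s => jw (m s).1 i)}.
      by apply: (@continuous_comp_all _ _ _ (fun s => (m s).1) (fun e => jw e i)) => //; exact: jw_continuous.
    have w0 : 0 < jw (m s0).1 i.
      by rewrite lt_neqAle jw_ge0 andbT eq_sym jw_neq0; apply/eqP.
    have : \forall s \near s0, 0 < jw (m s).1 i by apply: (cvgr_gt _ cw).
    by apply: filterS => s /lt0r_neq0.
  by apply: filterS => s; rewrite jw_neq0 => /eqP.
have aP s : (m s).1 i <> None -> a s = mulS1 (invS1 (phase i (m s).1)) (phase i (l s).1).
  by move=> mi; rewrite (aE s).1 phase_act// mulS1A mulVS1 mul1S1.
have cp1 : {for s0, continuous (fun s => phase i (m s).1)}.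
  by apply: (@continuous_comp _ _ _ (fun s => (m s).1) (phase i)); [exact: c1|exact: phase_continuous].
have cp2 : {for s0, continuous (fun s => phase i (l s).1)}.
  by apply: (@continuous_comp _ _ _ (fun s => (l s).1) (phase i)); [exact: c2|exact: phase_continuous].
have cq : {for s0, continuous (fun s => mulS1 (invS1 (phase i (m s).1)) (phase i (l s).1))}.
  pose F (p : S1 R * S1 R) := mulS1 (invS1 p.1) p.2.
  have cF : continuous F.
    apply: mulS1_continuous; last exact: snd_cts.
    by apply: invS1_continuous; exact: fst_cts.
  apply: (@continuous_comp _ _ _ (fun s => (phase i (m s).1, phase i (l s).1)) F); last exact: cF.
  exact: (cvg_pair cp1 cp2).
move=> A; rewrite (aP _ ei) => /cq qA; change (\forall s \near s0, A (a s)).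
near=> s; have mi : (m s).1 i <> None by near: s.
by rewrite aP//; near: s.
Unshelve. all: by end_near.
Qed.

Lemma invS1M (a b : S1 R) : invS1 (mulS1 a b) = mulS1 (invS1 b) (invS1 a).
Proof. by apply: S1_eq => /=; ring. Qed.

(** The representative of an orbit whose i-th phase is 1. It depends on the orbit only, and so gives
    a section over the open set t_i > 0. *)
Let slice i (p : E * Y) : E * Y :=
  (milnor_act p.1 (invS1 (phase i p.1)), g (phase i p.1, p.2)).

Lemma slice_continuous i (q : E * Y) : q.1 i <> None -> {for q, continuous (slice i)}.
Proof.
move=> qi.
have c1 : {for q, continuous (fun p : E * Y => phase i p.1)}.
  by apply: (@continuous_comp _ _ _ fst (phase i)); [exact: fst_cts|exact: phase_continuous].
have c2 : {for q, continuous (fun p : E * Y => invS1 (phase i p.1))}.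
  apply: (@continuous_comp _ _ _ (fun p : E * Y => phase i p.1) (@invS1 R)) => //.
  by apply: (@invS1_continuous _ _ id) => x; exact: cvg_id.
have c3 : {for q, continuous (fun p : E * Y => milnor_act p.1 (invS1 (phase i p.1)))}.
  apply: (@continuous_comp _ _ _ (fun p : E * Y => (p.1, invS1 (phase i p.1))) (fun p => milnor_act p.1 p.2)).
    exact: (cvg_pair (@fst_cts _ _ _) c2).
  exact: milnor_act_continuous.
have c4 : {for q, continuous (fun p : E * Y => g (phase i p.1, p.2))}.
  apply: (@continuous_comp _ _ _ (fun p : E * Y => (phase i p.1, p.2)) g).
    exact: (cvg_pair c1 (@snd_cts _ _ _)).
  exact: act_continuous.
exact: (cvg_pair c3 c4).
Qed.

Lemma orb_sections (b : Yh) : exists V : set Yh, [/\ open V, V b &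
  exists s : Yh -> E * Y, forall x, V x -> {for x, continuous s} /\ orb g (s x) = x].
Proof.
have [p ->] := orb_repr b; have [i pi_] := milnor_nonempty p.1.
have cw : continuous (fun p : E * Y => jw p.1 i).
  by apply: (@continuous_comp_all _ _ _ fst (fun e => jw e i)); [exact: fst_cts|exact: jw_continuous].
have jwa (e : E) a : jw (milnor_act e a) i = jw e i.
  by rewrite /jw /join_weight /=; case: (jcoord e i) => [[]|].
have [w _ wE] := @orb_descent R Y g _ (fun p : E * Y => jw p.1 i) cw (fun e a y => jwa e a).
pose s (z : Yh) := slice i (repr z).
have so (q : E * Y) : q.1 i <> None -> s (orb g q) = slice i q.
  move=> qi; have /orb_eq[a [r1 r2]] : orb g (repr (orb g q)) = orb g q by rewrite orbK.
  rewrite /s /slice r1 phase_act// -milnor_actM; congr (_, _).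
    by rewrite invS1M mulS1A mulS1V mul1S1.
  by rewrite actM -r2.
have oV : open [set z | 0 < w z].
  by have /continuousP := @cts_fun _ _ w; move=> /(_ [set x | 0 < x]); apply; exact: open_gt.
exists [set z | 0 < w z]; split => //.
  by rewrite /= wE lt_neqAle jw_ge0 andbT eq_sym jw_neq0; apply/eqP.
exists s => z; have [q ->] := orb_repr z; rewrite /= wE => wq.
have qiP (q' : E * Y) : 0 < jw q'.1 i -> q'.1 i <> None.
  by move=> /lt0r_neq0; rewrite jw_neq0 => /eqP.
have qi := qiP _ wq.
split; last first.
  by rewrite so// /slice orb_act -actM mulVS1 act1 -surjective_pairing.
move=> A; rewrite (so q qi) => sA.
have [U [oU Us] UA] : exists2 U, open_nbhs (slice i q) U & U `<=` A by move: sA; rewrite nbhsE.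
have oW : open (((orb g : E * Y -> Yh) @^-1` ([set z | 0 < w z] `&` s @^-1` U))).
  rewrite openE => q' /= [wq' sq']; rewrite wE in wq'; have qi' := qiP _ wq'.
  have c := slice_continuous qi'.
  rewrite so// in sq'.
  have n1 : \forall u \near q', U (slice i u) by apply: c; exact: open_nbhs_nbhs.
  have n2 : \forall u \near q', 0 < jw u.1 i by apply: (cvgr_gt _ (cw q')).
  change (\forall u \near q', 0 < w (orb g u) /\ U (s (orb g u))).
  near=> u; have u1 : 0 < jw u.1 i by near: u.
  rewrite wE so; last exact: qiP.
  by split=> //; near: u.
change (\forall u \near orb g q, A (s u)).
apply: (@filterS _ _ _ ([set z | 0 < w z] `&` s @^-1` U)) => [u [_ /UA]//|].
apply: open_nbhs_nbhs; split; first exact: oW.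
by split; [rewrite /= wE|rewrite /= so].
Unshelve. all: by end_near.
Qed.

(** The translation that carries [m] to [l] on the image of [r] extends to the whole cube by
    composition with [r]. *)
Lemma orb_regauge (r : T -> T) (l m : T -> E * Y) :
  continuous r -> continuous l -> continuous m -> (forall t, r (r t) = r t) ->
  (forall t, orb g (l (r t)) = orb g (m (r t))) ->
  exists2 m' : T -> E * Y, continuous m' &
    (forall t, orb g (m' t) = orb g (m t)) /\ (forall t, m' (r t) = l (r t)).
Proof.
move=> cr cl cm rr lm.
have clr : continuous (fun t => l (r t)) by apply: (@continuous_comp_all _ _ _ r l).
have cmr : continuous (fun t => m (r t)) by apply: (@continuous_comp_all _ _ _ r m).
have [a ca aE] := orb_translation clr cmr lm.
exists (fun t => (milnor_act (m t).1 (a t), g (invS1 (a t), (m t).2))).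
  have c1 : continuous (fun t => (m t).1) by apply: (@continuous_comp_all _ _ _ m fst) => //; exact: fst_cts.
  have c2 : continuous (fun t => (m t).2) by apply: (@continuous_comp_all _ _ _ m snd) => //; exact: snd_cts.
  have c3 : continuous (fun t => invS1 (a t)) by exact: invS1_continuous.
  apply: (@pair_continuous _ _ _ (fun t => milnor_act (m t).1 (a t)) (fun t => g (invS1 (a t), (m t).2))).
    apply: (@continuous_comp_all _ _ _ (fun t => ((m t).1, a t)) (fun p => milnor_act p.1 p.2)).
      exact: (@pair_continuous _ _ _ (fun t => (m t).1) a).
    exact: milnor_act_continuous.
  apply: (@continuous_comp_all _ _ _ (fun t => (invS1 (a t), (m t).2)) g).
    exact: (@pair_continuous _ _ _ (fun t => invS1 (a t)) (fun t => (m t).2)).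
  exact: act_continuous.
split=> t; first by rewrite orb_act -actM mulS1V act1 -surjective_pairing.
have [h1 h2] := aE (r t); rewrite rr in h1 h2.
by rewrite -h1 h2 -actM mulVS1 act1 -surjective_pairing.
Qed.

Lemma orb_lift n (f : continuousType T Yh) : tinv n f ->
  exists2 l : T -> E * Y, continuous l & forall t, orb g (l t) = f t.
Proof.
move=> fn; apply: (liftable_cube _ _ (@cts_fun _ _ f) fn).
  exact: orb_sections.
exact: orb_regauge.
Qed.
End OrbitLifting.

(** * Functoriality of cubes of the Borel construction in all continuous maps *)

Section Sections.
Variable R : realType.
Notation E := (milnorE R).
Notation T := (Iinf R).
Notation icube X := (continuousType (Iinf R) X).

Definition point_act : circle_action R (Icube R 0).
Proof. by exists snd => //; exact: snd_cts. Defined.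
Notation pt := ((fun i : 'I_0 => endpt R false) : Icube R 0).
Notation B := (homotopy_orbits point_act).

Lemma pt_eq (x y : Icube R 0) : x = y.
Proof. by apply/funext => -[]. Qed.

(** Precomposing a lift of [F] with this map makes the lift independent of the same coordinates as
    [F], so that degenerate cubes have degenerate lifts. *)
Definition deps (X : Type) (F : T -> X) (t : T) : T :=
  fun j => if `[< indep j F >] then endpt R false else t j.

Lemma deps_continuous (X : Type) (F : T -> X) : continuous (deps F).
Proof.
apply: Iinf_continuous => j; rewrite /deps; case: asboolP => _; last exact: coord_continuous.
by move=> ?; exact: cst_continuous.
Qed.

Lemma tinv_indep (X : Type) n (F : T -> X) j : tinv n F -> (n <= j)%N -> indep j F.
Proof.
move=> tF nj s t st; rewrite -tF -[RHS]tF; congr F; apply/funext => i; rewrite !truncE.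
by case: ltnP => // ni; apply: st; rewrite ltn_eqF// (leq_trans ni).
Qed.

Lemma deps_trunc (X : Type) n (F : T -> X) t : tinv n F -> deps F (truncI n t) = deps F t.
Proof.
move=> tF; apply/funext => j; rewrite /deps truncE; case: asboolP => // dj.
by case: ltnP => // /(tinv_indep tF).
Qed.

Lemma deps_id (X : Type) n (F : T -> X) t : tinv n F -> F (deps F t) = F t.
Proof.
move=> tF; rewrite -tF -[RHS]tF.
(* The coordinates are replaced one at a time; [n] steps are enough, as [F] sees no others. *)
pose u m : T := fun j => if ((j < m)%N && `[< indep j F >]) then endpt R false else truncI n t j.
have H m : F (u m) = F (truncI n t).
  elim: m => [|m <-]; first by congr F; apply/funext.
  case: (asboolP (indep m F)) => im.
    apply: im => j jm; rewrite /u ltnS leq_eqVlt.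
    by have /negbTE -> : j != m := jm.
  congr F; apply/funext => j; rewrite /u ltnS leq_eqVlt; case: eqP => //= ->.
  by rewrite ltnn /=; case: asboolP.
rewrite -(H n); congr F; apply/funext => j; rewrite /u /deps !truncE.
by case: ltnP => //= jn; case: asboolP.
Qed.

Lemma deps_indep (X : Type) (F : T -> X) i s t : indep i F -> (forall j, j != i -> s j = t j) -> deps F s = deps F t.
Proof.
move=> iF st; apply/funext => j; rewrite /deps; case: asboolP => // dj.
by apply: st; apply/eqP => ji; apply: dj; rewrite ji.
Qed.

Lemma gsec_exists (F : icube B) : exists l : icube E, (exists n, tinv n F) -> forall t, orb point_act (l t, pt) = F t.
Proof.
have [[n tF]|nF] := pselect (exists n, tinv n F); last first.
  by exists (mkcts (@cst_continuous T E (basepoint R))) => /nF.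
have [l cl lF] := orb_lift tF.
have cl1 : continuous (fun t => (l t).1) by apply: (@continuous_comp_all _ _ _ l fst) => //; exact: fst_cts.
exists (mkcts cl1) => _ t /=; rewrite -lF; congr (orb _ _).
by rewrite [RHS]surjective_pairing; congr (_, _); exact: pt_eq.
Qed.
(** One lift is chosen for each cube of the base, independently of the space over it. This is what
    makes [gcube] strictly functorial. *)
Definition gsec (F : icube B) : icube E := projT1 (cid (gsec_exists F)) \o mkcts (@deps_continuous _ F).

Lemma gsecE n (F : icube B) t : tinv n F -> orb point_act (gsec F t, pt) = F t.
Proof.
move=> tF; rewrite -(deps_id t tF) -[gsec F t]/(projT1 (cid (gsec_exists F)) (deps F t)).
by apply: (projT2 (cid (gsec_exists F))); exists n.
Qed.

Lemma gsec_tinv n (F : icube B) : tinv n F -> tinv n (gsec F).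
Proof.
by move=> tF t; rewrite -[LHS]/(projT1 (cid (gsec_exists F)) (deps F (truncI n t))) (deps_trunc t tF).
Qed.

Lemma gsec_indep i (F : icube B) : indep i F -> indep i (gsec F).
Proof.
move=> iF s t st; rewrite -[LHS]/(projT1 (cid (gsec_exists F)) (deps F s)).
by rewrite (deps_indep iF st).
Qed.

Section Fibre.
Variables (Z : topologicalType) (g : circle_action R Z).
Notation Zh := (homotopy_orbits g).

Lemma base_equiv a y : mkcts (@cst_continuous Z (Icube R 0) pt) (g (a, y)) = point_act (a, mkcts (@cst_continuous Z (Icube R 0) pt) y).
Proof. exact: pt_eq. Qed.
Definition base : continuousType Zh B := orbmap base_equiv.
Lemma baseE e z : base (orb g (e, z)) = orb point_act (e, pt).
Proof. by rewrite /base orbmapE. Qed.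

Lemma orb_inj e z z' : orb g (e, z) = orb g (e, z') -> z = z'.
Proof.
move=> /orb_eq[a [/= ea ->]].
by rewrite -(milnor_act_free (etrans (milnor_act1 e) ea)) act1.
Qed.

Lemma tinv_base n (F : icube Zh) : tinv n F -> tinv n (base \o F).
Proof. by move=> tF t; congr (base _); exact: tF. Qed.

Lemma indep_comp (X W : Type) i (f : X -> W) (F : T -> X) : indep i F -> indep i (f \o F).
Proof. by move=> iF s t st; congr f; exact: iF. Qed.

(** Any lift of [F] differs from the prescribed one in [E] by a continuous translation, read off
    over the point; the inverse translation moves the fibre component into place. *)
Lemma fib_exists (F : icube Zh) : exists z : icube Z, (exists n, tinv n F) ->
  forall t, orb g (gsec (base \o F) t, z t) = F t.
Proof.
have [[n tF]|nF] := pselect (exists n, tinv n F); last first.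
  have [_ z] : E * Z by exact: repr (F (fun=> endpt R false)).
  by exists (mkcts (@cst_continuous T Z z)) => /nF.
have [l cl lF] := orb_lift tF.
pose l' t : E * Icube R 0 := (gsec (base \o F) t, pt).
pose m' t : E * Icube R 0 := ((l t).1, pt).
have cl1 : continuous (fun t => (l t).1) by apply: (@continuous_comp_all _ _ _ l fst) => //; exact: fst_cts.
have cl2 : continuous (fun t => (l t).2) by apply: (@continuous_comp_all _ _ _ l snd) => //; exact: snd_cts.
have cpt : continuous (fun _ : T => pt) by move=> ?; exact: cst_continuous.
have [||t|a ca aE] := @orb_translation R _ point_act T l' m'.
- exact: (@pair_continuous _ _ _ (gsec (base \o F)) (fun=> pt) (@cts_fun _ _ _) cpt).
- exact: (@pair_continuous _ _ _ (fun t => (l t).1) (fun=> pt) cl1 cpt).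
- rewrite /l' /m' (gsecE t (tinv_base tF)) -[LHS]/(base (F t)) -lF.
  by rewrite [l t]surjective_pairing baseE.
have cz : continuous (fun t => g (invS1 (a t), (l t).2)).
  apply: (@continuous_comp_all _ _ _ (fun t => (invS1 (a t), (l t).2)) g); last exact: act_continuous.
  exact: (@pair_continuous _ _ _ (fun t => invS1 (a t)) (fun t => (l t).2) (invS1_continuous ca) cl2).
exists (mkcts cz) => _ t; have [/= -> _] := aE t.
by rewrite orb_act -actM mulS1V act1 -surjective_pairing lF.
Qed.
Definition fib (F : icube Zh) : icube Z := projT1 (cid (fib_exists F)).

Lemma fibE n (F : icube Zh) t : tinv n F -> orb g (gsec (base \o F) t, fib F t) = F t.
Proof. by move=> tF; apply: (projT2 (cid (fib_exists F))); exists n. Qed.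

Lemma fib_unique n (F : icube Zh) (z : T -> Z) : tinv n F ->
  (forall t, orb g (gsec (base \o F) t, z t) = F t) -> forall t, fib F t = z t.
Proof. by move=> tF zF t; apply: (@orb_inj (gsec (base \o F) t)); rewrite zF (fibE t tF). Qed.

Lemma fib_eq n (F : icube Zh) s t : tinv n F -> gsec (base \o F) s = gsec (base \o F) t ->
  F s = F t -> fib F s = fib F t.
Proof.
by move=> tF gst Fst; apply: (@orb_inj (gsec (base \o F) s)); rewrite (fibE s tF) {1}gst (fibE t tF).
Qed.
End Fibre.

Section Functor.
Variables (Z Z' : topologicalType) (g : circle_action R Z) (g' : circle_action R Z').
Variable f : continuousType Z Z'.
Notation Zh := (homotopy_orbits g).
Notation Zh' := (homotopy_orbits g').

Lemma gcube_continuous (F : icube Zh) : continuous (fun t => orb g' (gsec (base g \o F) t, f (fib F t))).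
Proof.
apply: (@continuous_comp_all _ _ _ (fun t => (gsec (base g \o F) t, f (fib F t))) (orb g')); last exact: cts_fun.
exact: (@pair_continuous _ _ _ (gsec (base g \o F)) (f \o fib F) (@cts_fun _ _ _) (@cts_fun _ _ (f \o fib F))).
Qed.
(** The map (e, z) |-> (e, f z), with e the chosen lift. As the lift chosen for a face need not be
    the face of the lift, it respects boundaries only under extra conditions on [f]; [gmap_orbmap]
    treats equivariant maps. *)
Definition gcube (F : icube Zh) : icube Zh' := mkcts (@gcube_continuous F).

Lemma gcube_indep n i (F : icube Zh) : tinv n F -> indep i F -> indep i (gcube F).
Proof.
move=> tF iF s t st; have gst := gsec_indep (indep_comp (base g) iF) st.
by rewrite -[LHS]/(orb g' (_, _)) gst (fib_eq tF gst (iF _ _ st)).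
Qed.

Lemma gcube_tinv n (F : icube Zh) : tinv n F -> tinv n (gcube F).
Proof.
move=> tF t; have gst := gsec_tinv (tinv_base tF) t.
by rewrite -[LHS]/(orb g' (_, _)) gst (fib_eq tF gst (tF t)).
Qed.

Lemma base_gcube n (F : icube Zh) : tinv n F -> base g' \o gcube F = base g \o F :> icube _.
Proof.
move=> tF; apply/continuousEP => t; rewrite -[LHS]/(base g' (orb g' (_, _))) baseE.
by rewrite (gsecE t (tinv_base tF)).
Qed.

Lemma fib_gcube n (F : icube Zh) : tinv n F -> fib (gcube F) =1 f \o fib F.
Proof. by move=> tF; apply: (fib_unique (gcube_tinv tF)) => t; rewrite (base_gcube tF). Qed.
End Functor.

Arguments gcube {Z Z'} g g' f F.
Lemma gcube_id Z (g : circle_action R Z) n (F : icube (homotopy_orbits g)) : tinv n F ->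
  gcube g g idfun F = F.
Proof. by move=> tF; apply/continuousEP => t; exact: fibE tF. Qed.

Lemma gcube_comp Z Z' Z'' (g : circle_action R Z) (g' : circle_action R Z') (g'' : circle_action R Z'')
    (f : continuousType Z Z') (f' : continuousType Z' Z'') n (F : icube (homotopy_orbits g)) : tinv n F ->
  gcube g' g'' f' (gcube g g' f F) = gcube g g'' (f' \o f) F.
Proof.
move=> tF; apply/continuousEP => t.
by rewrite -[LHS]/(orb g'' (_, _)) (base_gcube _ _ tF) (fib_gcube _ _ tF).
Qed.

Lemma gcube_orbmap Z Z' (g : circle_action R Z) (g' : circle_action R Z')
    (f : continuousType Z Z') (fg : forall a y, f (g (a, y)) = g' (a, f y)) n (F : icube (homotopy_orbits g)) :
  tinv n F -> gcube g g' f F = orbmap fg \o F.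
Proof.
move=> tF; apply/continuousEP => t.
by rewrite -[RHS]/(orbmap fg (F t)) -(fibE t tF) orbmapE.
Qed.
End Sections.
Arguments gcube {R Z Z'} g g' f F.

HB.lock Definition gmap (k : comPzRingType) (R : realType) (Z Z' : topologicalType)
    (g : circle_action R Z) (g' : circle_action R Z') (f : continuousType Z Z') :
    chains k R (homotopy_orbits g) -> chains k R (homotopy_orbits g') :=
  cwise (gcube g g' f).

Arguments gmap.body {k R Z Z'} g g' f x.
Section GMap.
Variables (k : comPzRingType) (R : realType).

Lemma lin_gmap Z Z' (g : circle_action R Z) (g' : circle_action R Z') f : linear (@gmap k R Z Z' g g' f).
Proof. by rewrite gmap.unlock; exact: lin_cwise. Qed.

Lemma gmap_cc Z Z' (g : circle_action R Z) (g' : circle_action R Z') f n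
    (F : continuousType (Iinf R) (homotopy_orbits g)) : tinv n F ->
  gmap g g' f (cc k n F) = cc k n (gcube g g' f F).
Proof. by rewrite gmap.unlock => tF; apply: cwise_cc => //; exact: gcube_indep. Qed.

Lemma tinv_ext (X : topologicalType) (V : lmodType k) (p q : chains k R X -> V) : linear p -> linear q ->
  (forall n (F : continuousType (Iinf R) X), tinv n F -> p (cc k n F) = q (cc k n F)) -> p =1 q.
Proof.
move=> lp lq pq; apply: chains_ext => // n F; rewrite cc_trunc.
by apply: pq; exact: tinv_trunc.
Qed.

Lemma gmap_id Z (g : circle_action R Z) x : @gmap k R Z Z g g idfun x = x.
Proof.
move: x; apply: (@tinv_ext _ _ (gmap g g idfun) id); [exact: lin_gmap|by move=> ? ? ?|].
by move=> n F tF; rewrite gmap_cc// (gcube_id tF).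
Qed.

Lemma gmap_comp Z Z' Z'' (g : circle_action R Z) (g' : circle_action R Z') (g'' : circle_action R Z'')
    (f : continuousType Z Z') (f' : continuousType Z' Z'') x :
  gmap g' g'' f' (@gmap k R Z Z' g g' f x) = gmap g g'' (f' \o f) x.
Proof.
move: x; apply: (@tinv_ext _ _ (fun x => gmap g' g'' f' (gmap g g' f x)) (gmap g g'' (f' \o f))).
- by move=> a x y; rewrite (@lin_gmap _ _ g g') (@lin_gmap _ _ g' g'').
- exact: lin_gmap.
move=> n F tF; have tG := gcube_tinv g' f tF.
by rewrite [gmap g g' f _]gmap_cc// gmap_cc// gmap_cc// (gcube_comp _ _ _ _ tF).
Qed.

Lemma gmap_orbmap Z Z' (g : circle_action R Z) (g' : circle_action R Z')
    (f : continuousType Z Z') (fg : forall a y, f (g (a, y)) = g' (a, f y)) x :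
  @gmap k R Z Z' g g' f x = cmap (orbmap fg) x.
Proof.
move: x; apply: (@tinv_ext _ _ (gmap g g' f) (cmap (orbmap fg))); [exact: lin_gmap|by lin|].
by move=> n F tF; rewrite gmap_cc// cmap_cc (gcube_orbmap fg tF).
Qed.

Lemma supp_gmap Z Z' (g : circle_action R Z) (g' : circle_action R Z') f n x :
  supp (fun c => cell_dim c = n) x -> supp (fun c => cell_dim c = n) (@gmap k R Z Z' g g' f x).
Proof. by rewrite gmap.unlock; exact: supp_cwise. Qed.
End GMap.

(** * Dimension shifting *)

Section BasedComplexes.
Variable k : comPzRingType.

Record bcx := BCx {
  bgen : choiceType;
  bdeg : bgen -> nat;
  bdif : freemod k bgen -> freemod k bgen;
  bdif_lin : linear bdif;
  bdif_supp : forall n x, supp (fun b => bdeg b = n) x -> supp (fun b => (bdeg b).+1 = n) (bdif x);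
  bdifK : forall x, bdif (bdif x) = 0
}.
Notation mod A := (freemod k (bgen A)).
Definition homogeneous (A : bcx) n (x : mod A) := supp (fun b => @bdeg A b = n) x.
Notation hom := homogeneous.

Lemma homD A n (x y : mod A) : hom n x -> hom n y -> hom n (x + y).
Proof. exact: suppD. Qed.
Lemma homN A n (x : mod A) : hom n x -> hom n (- x).
Proof. exact: suppN. Qed.
Lemma hom_dif A n (x : mod A) : hom n.+1 x -> hom n (bdif x).
Proof. by move=> /bdif_supp; apply: suppW => b []. Qed.
Lemma dif_hom0 A (x : mod A) : hom 0 x -> bdif x = 0.
Proof.
move=> /bdif_supp dx; apply: freemod_eqP => b; rewrite coef0.
by apply/eqP; apply: contraPT isT => /dx.
Qed.
Lemma difD A (x y : mod A) : bdif (x + y) = bdif x + bdif y.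
Proof. exact: linD (@bdif_lin A). Qed.
Lemma difN A (x : mod A) : bdif (- x) = - bdif x.
Proof. exact: linN (@bdif_lin A). Qed.
Lemma dif0 A : bdif (0 : mod A) = 0.
Proof. exact: lin0 (@bdif_lin A). Qed.

Record cmor (A B : bcx) (f : mod A -> mod B) : Prop := CMor {
  cmor_lin : linear f;
  cmor_hom : forall n x, hom n x -> hom n (f x);
  cmor_dif : forall x, f (bdif x) = bdif (f x)
}.

Definition homology_inj (A B : bcx) (f : mod A -> mod B) n := forall x, hom n x -> bdif x = 0 ->
  (exists2 y', hom n.+1 y' & f x = bdif y') -> exists2 y, hom n.+1 y & x = bdif y.
Definition homology_surj (A B : bcx) (f : mod A -> mod B) n := forall x', hom n x' -> bdif x' = 0 ->
  exists x y', [/\ hom n x, bdif x = 0, hom n.+1 y' & x' = f x + bdif y'].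

Definition total_iso (A B : bcx) (f : mod A -> mod B) :=
  (forall x, bdif x = 0 -> (exists y', f x = bdif y') -> exists y, x = bdif y) /\
  (forall x', bdif x' = 0 -> exists x y', bdif x = 0 /\ x' = f x + bdif y').

Definition part (A : bcx) n : mod A -> mod A :=
  flift (fun b => if @bdeg A b == n then fbasis k b else 0).

Lemma lin_part A n : linear (@part A n).
Proof. by move=> a x y; rewrite /part linearP. Qed.

Lemma part_basis A n b : @part A n (fbasis k b) = if bdeg b == n then fbasis k b else 0.
Proof. by rewrite /part flift_fbasis. Qed.

Lemma hom_part A n x : hom n (@part A n x).
Proof.
apply: (@supp_lin _ _ _ (fun=> True)) => [|b _|//]; first exact: lin_part.
by rewrite part_basis; case: eqP => [bn|_]; [exact: supp_basis|exact: supp0].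
Qed.

Lemma part_hom A n m (x : mod A) : hom m x -> part n x = if m == n then x else 0.
Proof.
move=> hx; apply: (lin_supp_ext (g := fun x => if m == n then x else 0) _ _ hx); first exact: lin_part.
  by case: (m == n); [exact: lin_id|exact: lin_zero].
by move=> b <-; rewrite part_basis.
Qed.

Lemma part_cmor A B (f : mod A -> mod B) n x : cmor f -> part n (f x) = f (part n x).
Proof.
move=> cf; have lf := cmor_lin cf; have lpA := @lin_part A n; have lpB := @lin_part B n.
move: x; apply: flin_ext => [||b].
- exact: (@lin_comp _ _ _ _ _ _ lpB lf).
- exact: (@lin_comp _ _ _ _ _ _ lf lpA).
rewrite part_basis (part_hom _ (cmor_hom cf (@supp_basis _ _ _ b (erefl (bdeg b))))).
by case: eqP => // _; rewrite (lin0 lf).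
Qed.

Lemma part_dif A n (x : mod A) : part n (bdif x) = bdif (part n.+1 x).
Proof.
have ld := @bdif_lin A; have lp := @lin_part A.
move: x; apply: flin_ext => [||b].
- exact: (@lin_comp _ _ _ _ _ _ (lp n) ld).
- exact: (@lin_comp _ _ _ _ _ _ ld (lp n.+1)).
rewrite part_basis; have hb := @supp_basis k _ (fun c => bdeg c = bdeg b) b erefl.
case bn: (bdeg b) hb => [|m] hb; first by rewrite eq_sym (dif_hom0 hb) dif0 (lin0 (lp n)).
by rewrite (part_hom _ (hom_dif hb)) eqSS; case: eqP => // _; rewrite dif0.
Qed.

(** A homogeneous part of an inhomogeneous solution solves the homogeneous problem. This allows the
    case of free orbits to be treated without degrees. *)
Lemma total_iso_graded A B (f : mod A -> mod B) : cmor f -> total_iso f ->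
  forall n, homology_inj f n /\ homology_surj f n.
Proof.
move=> cf [inj surj] n; split=> [x hx dx [y' hy' fx]|x' hx' dx'].
  have [|y xy] := inj x dx; first by exists y'.
  exists (part n.+1 y); first exact: hom_part.
  by rewrite -part_dif -xy (part_hom _ hx) eqxx.
have [x [y' [dx xE]]] := surj x' dx'; exists (part n x), (part n.+1 y').
split; [exact: hom_part| |exact: hom_part|].
  case: n hx' => [|n] hx'; first by apply: dif_hom0; exact: hom_part.
  by rewrite -part_dif dx (lin0 (@lin_part _ _)).
by rewrite -part_dif -(part_cmor _ _ cf) -(linD _ _ (@lin_part B n)) -xE (part_hom _ hx') eqxx.
Qed.

(** An exact sequence of modules in each degree, resolving the complex of index 0 augmented to zero;
    the complexes themselves may have homology. *)
Record resolution := Resolution {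
  rcx :> nat -> bcx;
  raug : forall r, mod (rcx r.+1) -> mod (rcx r);
  raug_mor : forall r, cmor (@raug r);
  raugK : forall r x, @raug r (@raug r.+1 x) = 0;
  raug_onto : forall n x, hom n x -> exists2 z, hom n z & x = @raug 0 z;
  raug_exact : forall r n x, hom n x -> @raug r x = 0 -> exists2 z, hom n z & x = @raug r.+1 z
}.

Arguments raug {r0} r x.
Definition rker (A : resolution) r : mod (A r) -> Prop :=
  match r with 0%N => fun=> True | r'.+1 => fun x => raug r' x = 0 end.

Lemma raugD (A : resolution) r (x y : mod (A r.+1)) : raug r (x + y) = raug r x + raug r y.
Proof. exact: linD (cmor_lin (@raug_mor A r)). Qed.
Lemma raugN (A : resolution) r (x : mod (A r.+1)) : raug r (- x) = - raug r x.
Proof. exact: linN (cmor_lin (@raug_mor A r)). Qed.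
Lemma raug_dif (A : resolution) r (x : mod (A r.+1)) : raug r (bdif x) = bdif (raug r x).
Proof. exact: cmor_dif (@raug_mor A r) x. Qed.
Lemma raug_hom (A : resolution) r n (x : mod (A r.+1)) : hom n x -> hom n (raug r x).
Proof. exact: cmor_hom (@raug_mor A r) n x. Qed.

Lemma rker_aug (A : resolution) r x : rker (@raug A r x).
Proof. by case: r x => [|r] x //=; exact: raugK. Qed.
Lemma rkerD (A : resolution) r (x y : mod (A r)) : rker x -> rker y -> rker (x + y).
Proof. by case: r x y => [|r] x y //=; rewrite raugD => -> ->; rewrite addr0. Qed.
Lemma rkerN (A : resolution) r (x : mod (A r)) : rker x -> rker (- x).
Proof. by case: r x => [|r] x //=; rewrite raugN => ->; rewrite oppr0. Qed.

Lemma rker_im (A : resolution) r n (x : mod (A r)) : hom n x -> rker x ->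
  exists2 z, hom n z & x = raug r z.
Proof. by case: r x => [|r] x hx kx; [exact: raug_onto|exact: raug_exact]. Qed.

(** * Comparison of two resolutions *)

Section Shift.
Variables (A B : resolution) (f : forall r, mod (A r) -> mod (B r)).
Arguments f {r}.
Hypothesis fmor : forall r, cmor (@f r).
Hypothesis faug : forall r x, f (raug r x) = raug r (f x).
Hypothesis finj : forall r n, homology_inj (@f r.+1) n.
Hypothesis fsurj : forall r n, homology_surj (@f r.+1) n.

Let fD r (x y : mod (A r)) : f (x + y) = f x + f y.
Proof. exact: linD (cmor_lin (fmor r)). Qed.
Let fN r (x : mod (A r)) : f (- x) = - f x.
Proof. exact: linN (cmor_lin (fmor r)). Qed.
Let f0 r : f (0 : mod (A r)) = 0.
Proof. exact: lin0 (cmor_lin (fmor r)). Qed.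
Let fd r (x : mod (A r)) : f (bdif x) = bdif (f x).
Proof. exact: cmor_dif (fmor r) x. Qed.
Let fhom r n (x : mod (A r)) : hom n x -> hom n (f x).
Proof. exact: cmor_hom (fmor r) n x. Qed.
Let fker r (x : mod (A r)) : rker x -> rker (f x).
Proof. by case: r x => [|r] x //=; rewrite -faug => ->; rewrite f0. Qed.

Definition ksurj n := forall r (x' : mod (B r)), hom n x' -> rker x' -> bdif x' = 0 ->
  exists x y', [/\ hom n x, rker x, bdif x = 0, hom n.+1 y' & rker y' /\ x' = f x + bdif y'].
Definition kinj n := forall r (x : mod (A r)), hom n x -> rker x -> bdif x = 0 ->
  (exists y', [/\ hom n.+1 y', rker y' & f x = bdif y']) -> exists y, [/\ hom n.+1 y, rker y & x = bdif y].

(* Lifting a cycle of a kernel along the augmentation and taking its boundary *)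
(* gives a cycle one degree lower in the next kernel: induct on the degree.   *)
Lemma ksurj_all n : ksurj n.
Proof.
elim: n => [|n IH] r x' hx' kx' dx'; have [z' hz' xz'] := rker_im hx' kx'.
  have [p [q' [hp dp hq' zE]]] := fsurj hz' (dif_hom0 hz').
  exists (raug r p), (raug r q'); rewrite -!raug_dif dp faug; split; try exact: raug_hom.
  - exact: rker_aug.
  - exact: lin0 (cmor_lin (@raug_mor A r)).
  - by split; [exact: rker_aug|rewrite -raugD -zE].
have kw : rker (bdif z') by rewrite /= raug_dif -xz'.
have [w [u' [hw kwA dw hu' [ku' wE]]]] := IH r.+1 _ (hom_dif hz') kw (bdifK _).
have [|v hv wv] := finj hw dw.
  exists (z' - u'); first by apply: homD => //; exact: homN.
  by rewrite difD difN wE addrK.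
have hzuv : hom n.+1 (z' - u' - f v) by apply: homD; [apply: homD => //|]; apply: homN => //; exact: fhom.
have [|p [q' [hp dp hq' zE]]] := fsurj hzuv.
  by rewrite !(difD, difN) -fd -wv wE addrK subrr.
exists (raug r (v + p)), (raug r q'); split.
- by apply: raug_hom; exact: homD.
- exact: rker_aug.
- by rewrite -raug_dif difD dp addr0 -wv.
- exact: raug_hom.
split; first exact: rker_aug.
rewrite -raug_dif faug -raugD xz' fD -addrA -zE [f v + _]addrC subrK raugD raugN.
by rewrite /= in ku'; rewrite ku' subr0.
Qed.

(** The cycle f (z - m) - [bdif t'] of a kernel comes, up to a boundary, from a cycle [p] there.
    Then z - m - p is a cycle whose image bounds, hence a boundary by the hypothesis in resolution
    degree r + 1, and its augmentation is [x]. *)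
Lemma kinj_step n r (x : mod (A r)) (z m : mod (A r.+1)) (t' : mod (B r.+1)) :
  hom n z -> hom n m -> hom n.+1 t' -> x = raug r z -> rker m -> rker (f z - bdif t') ->
  bdif (z - m) = 0 -> exists y, [/\ hom n.+1 y, rker y & x = bdif y].
Proof.
move=> hz hm ht' xz km kzt dzm.
have [|||p [q' [hp kp dp hq' [kq' pE]]]] := @ksurj_all n r.+1 (f (z - m) - bdif t').
- by apply: homD; [apply: fhom; apply: homD => //|]; apply: homN => //; exact: hom_dif.
- by rewrite fD fN addrAC; apply: rkerD => //; apply: rkerN; exact: fker.
- by rewrite difD difN bdifK subr0 -fd dzm f0.
have [|||s hs zE] := @finj r n (z - m - p).
- by apply: homD; [apply: homD => //|]; exact: homN.
- by rewrite difD difN dzm dp subr0.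
- exists (t' + q'); first exact: homD.
  rewrite fD fN difD -[f (z - m)](subrK (bdif t')) pE; zring.
exists (raug r s); split; [exact: raug_hom|exact: rker_aug|].
rewrite -raug_dif -zE !(raugD, raugN) -xz.
by rewrite /= in km kp; rewrite km kp !subr0.
Qed.

Lemma kinj_all n : kinj n.
Proof.
elim: n => [|n IH] r x hx kx dx [y' [hy' ky' fx]];
  have [z hz xz] := rker_im hx kx; have [t' ht' yt'] := rker_im hy' ky'.
all: have kzt : rker (f z - bdif t') by rewrite /= raugD raugN raug_dif -yt' -faug -xz fx subrr.
  apply: (kinj_step hz (@supp0 _ _ _) ht' xz _ kzt).
    exact: (lin0 (cmor_lin (@raug_mor A r))).
  by rewrite subr0 dif_hom0.
have [|||m [hm km zm]] := IH r.+1 (bdif z) (hom_dif hz).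
- by rewrite /= raug_dif -xz.
- exact: bdifK.
- exists (f z - bdif t'); split=> //; last by rewrite difD difN bdifK subr0 fd.
  by apply: homD; [exact: fhom|apply: homN; exact: hom_dif].
by apply: (kinj_step hz hm ht' xz km kzt); rewrite difD difN zm subrr.
Qed.

Lemma dimension_shift n : homology_inj (@f 0) n /\ homology_surj (@f 0) n.
Proof.
split=> [x hx dx [y' hy' fx]|x' hx' dx'].
  by have [|y [hy _ xy]] := @kinj_all n 0%N x hx I dx; [exists y'|exists y].
by have [x [y' [hx _ dx hy' [_ xE]]]] := @ksurj_all n 0%N x' hx' I dx'; exists x, y'.
Qed.
End Shift.
End BasedComplexes.

(** * Bar resolutions of functors on spaces with a circle action *)

Section ActionSpaces.
Variables (k : comPzRingType) (R : realType).
Local Notation S1 := (S1 R).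
Notation mod A := (freemod k (bgen A)).

Record aspace := ASpace { aspc :> topologicalType; aact : circle_action R aspc }.

Definition equivariant (P Q : aspace) (f : P -> Q) :=
  forall a y, f (aact P (a, y)) = aact Q (a, f y).

Lemma diag_continuous (P : aspace) :
  continuous (fun p : S1 * (S1 * P) => (mulS1 p.1 p.2.1, aact P (p.1, p.2.2))).
Proof.
have c1 : continuous (fun p : S1 * (S1 * P) => p.2.1).
  by apply: (@continuous_comp_all _ _ _ snd fst); [exact: snd_cts|exact: fst_cts].
have c2 : continuous (fun p : S1 * (S1 * P) => p.2.2).
  by apply: (@continuous_comp_all _ _ _ snd snd); [exact: snd_cts|exact: snd_cts].
have c3 : continuous (fun p : S1 * (S1 * P) => p.1) by exact: fst_cts.
apply: (@pair_continuous _ _ _ (fun p : S1 * (S1 * P) => mulS1 p.1 p.2.1) (fun p => aact P (p.1, p.2.2))).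
  exact: mulS1_continuous.
apply: (@continuous_comp_all _ _ _ (fun p : S1 * (S1 * P) => (p.1, p.2.2)) (aact P)); last exact: act_continuous.
exact: (@pair_continuous _ _ _ (fun p : S1 * (S1 * P) => p.1) (fun p => p.2.2)).
Qed.

Definition diag_act (P : aspace) : circle_action R (S1 * P)%type.
Proof.
exists (fun p : S1 * (S1 * P) => (mulS1 p.1 p.2.1, aact P (p.1, p.2.2))).
- exact: diag_continuous.
- by move=> [x y] /=; rewrite mul1S1 act1.
- by move=> a b [x y] /=; rewrite mulS1A actM.
Defined.
(** With the diagonal action the projection [counit] is equivariant, while its section [insert] is
    merely continuous. *)
Definition susp (P : aspace) : aspace := ASpace (diag_act P).
Definition counit (P : aspace) : continuousType (susp P) P := mkcts (@snd_cts S1 P).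

Lemma insert_continuous (P : aspace) : continuous (fun y : P => (oneS1 R, y)).
Proof.
apply: (@pair_continuous _ _ _ (fun=> oneS1 R) id) => y; first exact: cst_continuous.
exact: cvg_id.
Qed.
Definition insert (P : aspace) : continuousType P (susp P) := mkcts (@insert_continuous P).

Lemma smap_continuous (P Q : aspace) (f : continuousType P Q) : continuous (fun p : susp P => (p.1, f p.2) : susp Q).
Proof.
apply: (@pair_continuous _ _ _ (fun p : susp P => p.1) (fun p => f p.2)); first exact: fst_cts.
by apply: (@continuous_comp_all _ _ _ snd f); [exact: snd_cts|exact: cts_fun].
Qed.
Definition smap (P Q : aspace) (f : continuousType P Q) : continuousType (susp P) (susp Q) :=
  mkcts (@smap_continuous P Q f).

Fixpoint sp r (P : aspace) : aspace := if r is r'.+1 then sp r' (susp P) else P.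
Fixpoint spmap r (P Q : aspace) (f : continuousType P Q) : continuousType (sp r P) (sp r Q) :=
  match r with 0%N => f | r'.+1 => spmap r' (smap f) end.

Lemma counit_equiv P : equivariant (counit P).
Proof. by []. Qed.

Lemma spmap_equiv r (P Q : aspace) (f : continuousType P Q) : equivariant f -> equivariant (spmap r f).
Proof. by elim: r P Q f => //= r IH P Q f ef; apply: IH => a [x y]; rewrite -[LHS]/(mulS1 a x, f (aact P (a, y))) ef. Qed.

Lemma spmap_square r (P Q Q' W : aspace) (f : continuousType P Q) (h : continuousType Q W)
    (f' : continuousType P Q') (h' : continuousType Q' W) :
  (forall y, h (f y) = h' (f' y)) -> forall y, spmap r h (spmap r f y) = spmap r h' (spmap r f' y).
Proof.
elim: r P Q Q' W f h f' h' => [|r IH] P Q Q' W f h f' h' e //=.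
by apply: IH => -[x y]; rewrite -[LHS]/(x, h (f y)) e.
Qed.

Lemma spmap_id r (P : aspace) (f : continuousType P P) : (forall y, f y = y) -> forall y, spmap r f y = y.
Proof.
elim: r P f => [|r IH] P f fy //=; apply: IH => -[x y].
by rewrite -[LHS]/(x, f y) fy.
Qed.

(** All continuous maps act on the graded modules, and the equivariant ones commute with the
    differential. This matches the use: the bar differential involves equivariant maps, its
    contraction only [insert]. *)
Record gfun := GFun {
  fcx :> aspace -> bcx k;
  fmap : forall P Q : aspace, continuousType P Q -> mod (fcx P) -> mod (fcx Q);
  fmap_lin : forall (P Q : aspace) (f : continuousType P Q), linear (fmap f);
  fmap_hom : forall (P Q : aspace) (f : continuousType P Q) n x, homogeneous n x -> homogeneous n (fmap f x);
  fmap_dif : forall (P Q : aspace) (f : continuousType P Q), equivariant f ->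
    forall x, fmap f (bdif x) = bdif (fmap f x);
  fmap_id : forall (P : aspace) (f : continuousType P P), (forall y, f y = y) -> forall x, fmap f x = x;
  fmap_comp : forall (P Q W : aspace) (f : continuousType P Q) (h : continuousType Q W) x,
    fmap h (fmap f x) = fmap (h \o f : continuousType P W) x
}.
Arguments fmap F {P Q} f x : rename.

Section BarResolution.
Variable F : gfun.

Lemma fmap_ext (P Q : aspace) (f h : continuousType P Q) x : (forall y, f y = h y) -> fmap F f x = fmap F h x.
Proof. by move=> fh; congr fmap; apply/continuousEP. Qed.

Lemma fmap_square (P Q Q' W : aspace) (f : continuousType P Q) (h : continuousType Q W)
    (f' : continuousType P Q') (h' : continuousType Q' W) x :
  (forall y, h (f y) = h' (f' y)) -> fmap F h (fmap F f x) = fmap F h' (fmap F f' x).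
Proof. by move=> e; rewrite !fmap_comp; apply: fmap_ext. Qed.

Lemma fmap_mor (P Q : aspace) (f : continuousType P Q) : equivariant f -> cmor (fmap F f).
Proof. by move=> ef; split; [exact: fmap_lin|exact: fmap_hom|exact: fmap_dif]. Qed.

(** The alternating sum of the maps that delete one circle coordinate; the summand split off in the
    recursion deletes the circle next to [P]. *)
Fixpoint bar r (P : aspace) : mod (F (sp r.+1 P)) -> mod (F (sp r P)) :=
  match r with
  | 0%N => fmap F (counit P)
  | r'.+1 => fun x => @bar r' (susp P) x + (-1) ^+ r'.+1 *: fmap F (spmap r'.+1 (counit P)) x
  end.
Arguments bar r P x : clear implicits.

Lemma cmor_comb (A B : bcx k) (f h : mod A -> mod B) a : cmor f -> cmor h -> cmor (fun x => f x + a *: h x).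
Proof.
move=> [lf hf df] [lh hh dh]; split.
- by apply: lin_add => //; exact: lin_scale.
- by move=> n x hx; apply: homD; [exact: hf|apply: suppZ; exact: hh].
- by move=> x; rewrite df dh difD -(linZ _ _ (@bdif_lin _ B)).
Qed.

Lemma barS r P x : bar r.+1 P x = bar r (susp P) x + (-1) ^+ r.+1 *: fmap F (spmap r.+1 (counit P)) x.
Proof. by []. Qed.

Lemma spcounit_mor r P : @cmor k (F (sp r.+2 P)) (F (sp r.+1 P)) (fmap F (spmap r.+1 (counit P))).
Proof. exact: (fmap_mor (@spmap_equiv r.+1 _ _ _ (@counit_equiv P))). Qed.

Lemma bar_mor r P : cmor (bar r P).
Proof.
elim: r P => [|r IH] P; first exact: (fmap_mor (@counit_equiv P)).
exact: (cmor_comb _ (IH (susp P)) (spcounit_mor r P)).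
Qed.

Lemma bar_nat r (P Q : aspace) (f : continuousType P Q) x :
  bar r Q (fmap F (spmap r.+1 f) x) = fmap F (spmap r f) (bar r P x).
Proof.
elim: r P Q f x => [|r IH] P Q f x; first exact: fmap_square.
rewrite !barS (linD _ _ (fmap_lin _)) (linZ _ _ (fmap_lin _)).
congr (_ + _ *: _); first exact: (IH _ _ (smap f)).
by apply: (fmap_square x); exact: (@spmap_square r.+1).
Qed.

Lemma barK r P x : bar r P (bar r.+1 P x) = 0.
Proof.
elim: r P x => [|r IH] P x; have lb := cmor_lin (bar_mor _ P).
  rewrite barS (linD _ _ (lb _)) (linZ _ _ (lb _)) (bar_nat (counit P)).
  by rewrite expr1 scaleN1r subrr.
rewrite [bar r.+2 P x]barS (linD _ _ (lb _)) (linZ _ _ (lb _)) (bar_nat (counit P)).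
rewrite (barS (bar r.+1 (susp P) x)) IH add0r -scalerDl.
by rewrite [(-1) ^+ r.+2]exprS mulN1r subrr scale0r.
Qed.

Lemma bar_onto P (x : mod (F P)) : bar 0 P (fmap F (insert P) x) = x.
Proof. by rewrite /= fmap_comp fmap_id. Qed.

(** Inserting 1 next to [P] commutes with all deletions but the last one, which undoes it. *)
Lemma bar_homotopy r P x : bar r.+1 P (fmap F (spmap r.+1 (insert P)) x) =
  fmap F (spmap r (insert P)) (bar r P x) + (-1) ^+ r.+1 *: x.
Proof.
rewrite barS; congr (_ + _ *: _); first exact: (bar_nat (insert P)).
rewrite fmap_comp; apply: fmap_id => y.
rewrite -[LHS]/(spmap r.+1 (counit P) (spmap r.+1 (insert P) y)).
by rewrite (@spmap_square r.+1 P (susp P) P P (insert P) (counit P) idfun idfun)// !spmap_id.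
Qed.

Lemma bar_exact r P n (x : mod (F (sp r.+1 P))) : homogeneous n x -> bar r P x = 0 ->
  exists2 z, homogeneous n z & x = bar r.+1 P z.
Proof.
move=> hx bx; exists ((-1) ^+ r.+1 *: fmap F (spmap r.+1 (insert P)) x).
  by apply: suppZ; exact: fmap_hom.
rewrite (linZ _ _ (cmor_lin (bar_mor r.+1 P))) bar_homotopy bx.
by rewrite (lin0 (fmap_lin _)) add0r scalerA -expr2 sqrr_sign scale1r.
Qed.

Lemma bar_surj P n (x : mod (F P)) : homogeneous n x -> exists2 z, homogeneous n z & x = bar 0 P z.
Proof. by move=> hx; exists (fmap F (insert P) x); [exact: fmap_hom|rewrite bar_onto]. Qed.

Definition bar_resolution P : resolution k :=
  @Resolution k (fun r => F (sp r P)) (fun r => bar r P) (fun r => bar_mor r P)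
    (fun r => @barK r P) (@bar_surj P) (fun r => @bar_exact r P).
End BarResolution.

Section Comparison.
Variables (F G : gfun) (eta : forall P, mod (F P) -> mod (G P)).
Hypothesis eta_mor : forall P, cmor (@eta P).
Hypothesis eta_nat : forall (P Q : aspace) (f : continuousType P Q), equivariant f ->
  forall x, eta (fmap F f x) = fmap G f (eta x).
Hypothesis eta_susp : forall P, total_iso (@eta (susp P)).

Lemma eta_sp r P : total_iso (@eta (sp r.+1 P)).
Proof. by elim: r P => [|r IH] P; [exact: eta_susp|exact: IH]. Qed.

Lemma eta_bar r P x : eta (bar (F := F) (r := r) (P := P) x) = bar (eta x).
Proof.
elim: r P x => [|r IH] P x /=; first exact: eta_nat.
rewrite (linD _ _ (cmor_lin (@eta_mor _))) (linZ _ _ (cmor_lin (@eta_mor _))) IH.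
by congr (_ + _ *: _); exact: (eta_nat (@spmap_equiv r.+1 _ _ _ (@counit_equiv P))).
Qed.

Lemma comparison P n : homology_inj (@eta P) n /\ homology_surj (@eta P) n.
Proof.
apply: (@dimension_shift k (bar_resolution F P) (bar_resolution G P) (fun r => @eta (sp r P))).
- by move=> r; exact: eta_mor.
- by move=> r x; exact: eta_bar.
- by move=> r m; exact: (total_iso_graded (@eta_mor _) (@eta_sp r P) m).1.
- by move=> r m; exact: (total_iso_graded (@eta_mor _) (@eta_sp r P) m).2.
Qed.
End Comparison.
End ActionSpaces.

(** * Free orbits *)

Section ExponentialCover.
Variable R : realType.
Notation T := (Iinf R).

Lemma S1_bounds (x : S1 R) : -1 <= (val x).1 <= 1 /\ -1 <= (val x).2 <= 1.
Proof.
have := S1P x; move: (val x).1 (val x).2 => c s cs.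
by split; rewrite -ler_norml -(@ler_pXn2r _ 2) ?nnegrE// expr1n real_normK ?num_real//; nra.
Qed.

Lemma twopiK (x : R) : 2 * pi * (x / (2 * pi)) = x.
Proof. by rewrite mulrC divfK// mulf_neq0 ?pnatr_eq0// gt_eqF ?pi_gt0. Qed.

Lemma expi_surj (x : S1 R) : exists b : R, expi R b = x.
Proof.
have [c1 _] := S1_bounds x; have x1 := S1P x.
have sq : 1 - (val x).1 ^+ 2 = (val x).2 ^+ 2 by move: x1; move: (val x).1 (val x).2 => c s; lra.
have ca : cos (acos (val x).1) = (val x).1 by rewrite acosK// in_itv.
have sa : sin (acos (val x).1) = `|(val x).2| by rewrite sin_acos// sq sqrtr_sqr.
have [s0|s0] := leP 0 (val x).2.
  by exists (acos (val x).1 / (2 * pi)); apply: S1_eq; rewrite /= twopiK ?ca ?sa ?ger0_norm.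
exists (- (acos (val x).1 / (2 * pi))).
by apply: S1_eq; rewrite /= mulrN twopiK ?cosN ?sinN ?ca ?sa ?ltr0_norm ?opprK.
Qed.

Lemma expiN (x : R) : expi R (- x) = invS1 (expi R x).
Proof. by apply: S1_eq; rewrite /= mulrN ?cosN ?sinN. Qed.

Lemma expi_nat n : expi R n%:R = oneS1 R.
Proof. by elim: n => [|n IH]; rewrite ?expi0// [n.+1%:R]mulrS expiD IH expi1 mul1S1. Qed.

Lemma invS1_1 : invS1 (oneS1 R) = oneS1 R.
Proof. by rewrite -[LHS]mulS11 mulVS1. Qed.

Lemma expi_int (z : int) : expi R z%:~R = oneS1 R.
Proof. by case: z => n; rewrite ?NegzE ?mulrNz ?expiN expi_nat ?invS1_1. Qed.

(** After subtracting the integer part, 1 - cos (2 pi u) = 2 sin^2 (pi u) is positive unless u =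
    0. *)
Lemma expi_eq1 (u : R) : expi R u = oneS1 R -> exists z : int, u = z%:~R.
Proof.
move=> eu; exists (Num.floor u); set z := Num.floor u.
have /andP[zu uz] : z%:~R <= u < (z + 1)%:~R by exact: floor_itv.
have : expi R (u - z%:~R) = oneS1 R by rewrite expiD eu expiN expi_int invS1_1 mulS11.
move=> /(congr1 (fun x : S1 R => (val x).1)) /=; rewrite -mulrA.
have [u0|u0] := eqVneq u z%:~R; first by [].
have : 0 < sin (pi * (u - z%:~R)).
  apply: sin_gt0_pi; apply/andP; split.
    by rewrite mulr_gt0 ?pi_gt0// subr_gt0 lt_neqAle eq_sym u0.
  by rewrite -[ltRHS]mulr1 ltr_pM2l ?pi_gt0// ltrBlDl addrC; move: uz; rewrite intrD [1 + _]addrC.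
rewrite mulr_natl cos_mulr2n cos2sin2 => s0 h.
have : sin (pi * (u - z%:~R)) ^+ 2 = 0 by move: h; move: (sin _ ^+ 2) => y; lra.
by move=> /eqP; rewrite sqrf_eq0 gt_eqF.
Qed.

(** On the open half circle around [b], where x / b has positive real part, the arcsine of its
    imaginary part is a logarithm. *)
Lemma expi_sections (b : S1 R) : exists V : set (S1 R), [/\ open V, V b &
  exists s : S1 R -> R, forall x, V x -> {for x, continuous s} /\ expi R (s x) = x].
Proof.
have [be beE] := expi_surj b; pose y x := mulS1 x (invS1 b).
have cid' : continuous (fun x : S1 R => x) by move=> x; exact: cvg_id.
have cb : continuous (fun _ : S1 R => invS1 b) by move=> ?; exact: cst_continuous.
have cy : continuous y := mulS1_continuous cid' cb.
have cy1 : continuous (fun x => (val (y x)).1).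
  by apply: (@continuous_comp_all _ _ _ y (fun x : S1 R => (val x).1)); [exact: cy|exact: S1_fst_continuous].
have cy2 : continuous (fun x => (val (y x)).2).
  by apply: (@continuous_comp_all _ _ _ y (fun x : S1 R => (val x).2)); [exact: cy|exact: S1_snd_continuous].
exists [set x | 0 < (val (y x)).1]; split.
- by have /continuousP := cy1 => /(_ [set x | 0 < x]); apply; exact: open_gt.
- by change (0 < (val (y b)).1); rewrite /y mulS1V ltr01.
exists (fun x => be + asin (val (y x)).2 / (2 * pi)) => x x0; change (is_true (0 < (val (y x)).1)) in x0.
have y1 := S1P (y x); have [_ y2] := S1_bounds (y x).
have yy : -1 < (val (y x)).2 < 1.
  by move: y1 y2 x0; move: (val (y x)).1 (val (y x)).2 => p q pq /andP[q1 q2] p0; apply/andP; split; nra.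
split.
  pose ps (q : R) := be + asin q / (2 * pi).
  apply: (@continuous_comp _ _ _ (fun x => (val (y x)).2) ps); first exact: cy2.
  apply: cvgD; first exact: cvg_cst.
  by apply: cvgM; [exact: continuous_asin|exact: cvg_cst].
rewrite expiD beE.
have -> : expi R (asin (val (y x)).2 / (2 * pi)) = y x.
  have sq : 1 - (val (y x)).2 ^+ 2 = (val (y x)).1 ^+ 2.
    by move: y1; move: (val (y x)).1 (val (y x)).2 => c s; lra.
  apply: S1_eq; [change (cos (2 * pi * (asin (val (y x)).2 / (2 * pi))) = (val (y x)).1)|
    change (sin (2 * pi * (asin (val (y x)).2 / (2 * pi))) = (val (y x)).2)]; rewrite twopiK.
    by rewrite cos_asin// sq sqrtr_sqr gtr0_norm.
  by rewrite asinK// in_itv.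
by rewrite /y [mulS1 x _]mulS1C mulS1A mulS1V mul1S1.
Qed.

Lemma expi_lift n (f : continuousType T (S1 R)) : tinv n f ->
  exists2 l : T -> R, continuous l & forall t, expi R (l t) = f t.
Proof.
move=> fn; apply: (liftable_cube _ _ (@cts_fun _ _ f) fn); first exact: expi_sections.
move=> r l m cr cl cm rr lm; exists (fun t => m t + (l (r t) - m (r t))).
  have c1 : continuous (fun t => l (r t)) by apply: (@continuous_comp_all _ _ _ r l).
  have c2 : continuous (fun t => m (r t)) by apply: (@continuous_comp_all _ _ _ r m).
  by move=> t; exact: (cvgD (cm t) (cvgB (c1 t) (c2 t))).
split=> t; last by rewrite rr addrC subrK.
by rewrite !expiD lm expiN mulS1V mulS11.
Qed.

Definition origin : T := fun=> endpt R false.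

(** Otherwise the intermediate value theorem on the segment from the origin to [t] produces a value
    of the form a + 1/2. *)
Lemma integral_const (u : T -> R) : continuous u -> (forall t, exists z : int, u t = z%:~R) ->
  forall t, u t = u origin.
Proof.
move=> cu uz t.
pose ph (s : R) := u (fun i => unitI (s * set_val (t i))).
have cph : continuous ph.
  apply: (@continuous_comp_all _ _ _ (fun s : R => (fun i => unitI (s * set_val (t i))) : T) u) => //.
  apply: Iinf_continuous => i; apply: unitI_continuous => s.
  by apply: cvgM; [exact: cvg_id|exact: cvg_cst].
have ph0 : ph 0 = u origin.
  congr u; apply/funext => i; rewrite mul0r; apply: val_inj.
  by rewrite -[LHS]/(set_val (unitI 0)) set_valK ?lexx ?ler01.
have ph1 : ph 1 = u t by congr u; apply/funext => i; rewrite mul1r unitI_val.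
have cw : {within `[0, 1], continuous ph} by exact: continuous_subspaceT.
have gap (a b : int) : (a < b)%R -> Num.min (ph 0) (ph 1) = a%:~R -> Num.max (ph 0) (ph 1) = b%:~R -> False.
  move=> ab e1 e2; have [|c _ pc] := @IVT R ph 0 1 (a%:~R + 2^-1) ler01 cw.
    rewrite e1 e2 lerDl invr_ge0 ler0n /=.
    have : a%:~R + 1 <= b%:~R :> R by rewrite -[1]/(1%:~R) -intrD ler_int; lia.
    by move: (a%:~R) (b%:~R) => x y; lra.
  have [z zE] := uz (fun i => unitI (c * set_val (t i))).
  have : ph c = z%:~R by rewrite -zE.
  rewrite pc => h; have h1 : (a%:~R < z%:~R :> R) by rewrite -h; lra.
  have h2 : (z%:~R < (a + 1)%:~R :> R) by rewrite intrD -h; lra.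
  by move: h1 h2; rewrite !ltr_int; lia.
have [a aE] := uz origin; have [b bE] := uz t; rewrite -ph0 in aE; rewrite -ph1 in bE.
rewrite -ph1 -ph0 aE bE; have [ab|ab|->//] := ltgtP a b.
- by case: (gap a b) => //; rewrite aE bE ?min_l ?max_r// ler_int ltW.
- by case: (gap b a) => //; rewrite aE bE ?min_r ?max_l// ler_int ltW.
Qed.
End ExponentialCover.

(** * Chains of a product with the circle, from the covering by the line *)

Section Cover.
Variables (k : comPzRingType) (R : realType) (W : topologicalType).
Notation T := (Iinf R).
Notation icube X := (continuousType (Iinf R) X).
Notation X := (R * W)%type.
Notation C := (S1 R * W)%type.

Definition cover : continuousType X C := prodmap (expi R) idfun.

Lemma shift_continuous (z : int) : continuous (fun p : X => (p.1 + z%:~R, p.2)).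
Proof.
apply: (@pair_continuous _ _ _ (fun p : X => p.1 + z%:~R) (fun p => p.2)) => p; last exact: snd_cts.
exact: (cvgD (@fst_cts _ _ p) (@cvg_cst _ _ _ _ _)).
Qed.
Definition shift z : continuousType X X := mkcts (@shift_continuous z).

Lemma shiftD y z p : shift y (shift z p) = shift (z + y) p.
Proof. by rewrite -[LHS]/(p.1 + z%:~R + y%:~R, p.2) -addrA -intrD. Qed.

Lemma cover_shift z p : cover (shift z p) = cover p.
Proof. by rewrite -[LHS]/(expi R (p.1 + z%:~R), p.2) expiD expi_int mulS11. Qed.

(** Tells apart the lifts of one cube ([cover_unique]); the lift chosen in [clift] is the one of
    height 0. *)
Definition height (F : icube X) : int := Num.floor (F (origin R)).1.

Lemma height_shift z (F : icube X) : height (shift z \o F) = height F + z.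
Proof. by rewrite /height -[LHS]/(Num.floor (_ + z%:~R)) floorDrz ?intr_int// intrKfloor. Qed.

Lemma cover_unique (F G : icube X) : (forall t, cover (F t) = cover (G t)) -> height F = height G ->
  forall t, F t = G t.
Proof.
move=> FG hFG t.
have cF : continuous (fun t => (F t).1) by apply: (@continuous_comp_all _ _ _ F fst); [exact: cts_fun|exact: fst_cts].
have cG : continuous (fun t => (G t).1) by apply: (@continuous_comp_all _ _ _ G fst); [exact: cts_fun|exact: fst_cts].
have e1 s : expi R (F s).1 = expi R (G s).1 by have /(congr1 fst) := FG s.
have e2 s : (F s).2 = (G s).2 by have /(congr1 snd) := FG s.
have uz s : exists z : int, (F s).1 - (G s).1 = z%:~R.
  by apply: expi_eq1; rewrite expiD e1 expiN mulS1V.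
have cu : continuous (fun s => (F s).1 - (G s).1) by move=> s; exact: (cvgB (cF s) (cG s)).
have [z zE] := uz (origin R).
have z0 : z = 0.
  move: hFG; rewrite /height -[(F _).1](subrK (G (origin R)).1) zE addrC floorDrz ?intr_int// intrKfloor.
  by move/eqP; rewrite -subr_eq0 addrAC subrr add0r => /eqP.
have := integral_const cu uz t; rewrite zE z0 => /eqP; rewrite subr_eq0 => /eqP tE.
by rewrite [F t]surjective_pairing [G t]surjective_pairing tE e2.
Qed.

Lemma clift_exists (F : icube C) : exists L : icube X, (exists n, tinv n F) ->
  (forall t, cover (L t) = F t) /\ height L = 0.
Proof.
have [[n tF]|nF] := pselect (exists n, tinv n F); last first.
  by exists (mkcts (@cst_continuous T X (0, (F (origin R)).2))) => /nF.
have cF1 : continuous (fun t => (F t).1) by apply: (@continuous_comp_all _ _ _ F fst); [exact: cts_fun|exact: fst_cts].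
have cF2 : continuous (fun t => (F t).2) by apply: (@continuous_comp_all _ _ _ F snd); [exact: cts_fun|exact: snd_cts].
have [l cl lF] := @expi_lift R n (mkcts cF1) (fun t => congr1 fst (tF t)).
pose G : icube X := mkcts (@pair_continuous _ _ _ l (fun t => (F t).2) cl cF2).
exists (shift (- height G) \o G) => _; split=> [t|]; last by rewrite height_shift subrr.
rewrite -[LHS]/(cover (shift _ (G t))) cover_shift -[LHS]/(expi R (l t), (F t).2) lF.
by rewrite [RHS]surjective_pairing.
Qed.
Definition clift (F : icube C) : icube X := projT1 (cid (clift_exists F)).

Lemma cliftE n (F : icube C) : tinv n F -> (forall t, cover (clift F t) = F t) /\ height (clift F) = 0.
Proof. by move=> tF; apply: (projT2 (cid (clift_exists F))); exists n. Qed.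

Definition zeroat i (t : T) : T := fun j => if j == i then endpt R false else t j.
Lemma zeroat_continuous i : continuous (zeroat i).
Proof.
apply: Iinf_continuous => j; rewrite /zeroat; case: (j == i); last exact: coord_continuous.
by move=> ?; exact: cst_continuous.
Qed.

Lemma clift_indep n i (F : icube C) : tinv n F -> indep i F -> indep i (clift F).
Proof.
move=> tF iF; have [cF hF] := cliftE tF.
have H t : clift F (zeroat i t) = clift F t.
  apply: (@cover_unique (clift F \o mkcts (@zeroat_continuous i)) (clift F)) => [s|].
    rewrite -[LHS]/(cover (clift F (zeroat i s))) !cF; apply: iF => j ji.
    by rewrite /zeroat (negbTE ji).
  congr (Num.floor (clift F _).1); apply/funext => j; rewrite -[LHS]/(zeroat i _ j) /zeroat /origin.
  by case: (j == i).
move=> s t st; rewrite -H -[RHS]H; congr (clift F _); apply/funext => j; rewrite /zeroat.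
by case: eqP => // /eqP ji; exact: st.
Qed.

Definition chlift : chains k R C -> chains k R X := cwise clift.
Definition pushdown : chains k R X -> chains k R C := cmap cover.
Definition deck : chains k R X -> chains k R X := cmap (shift 1).

Lemma lin_chlift : linear chlift. Proof. exact: lin_cwise. Qed.
Lemma lin_pushdown : linear pushdown. Proof. by rewrite /pushdown; lin. Qed.
Lemma lin_deck : linear deck. Proof. by rewrite /deck; lin. Qed.

Lemma chlift_cc n (F : icube C) : tinv n F -> chlift (cc k n F) = cc k n (clift F).
Proof. by move=> tF; apply: cwise_cc => //; exact: clift_indep. Qed.

Lemma pushdown_chlift x : pushdown (chlift x) = x.
Proof.
move: x; apply: (@tinv_ext _ _ _ _ (fun x => pushdown (chlift x)) id).
- exact: (@lin_comp _ _ _ _ _ _ lin_pushdown lin_chlift).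
- by move=> ? ? ?.
move=> n F tF; rewrite chlift_cc// /pushdown cmap_cc; congr cc; apply/continuousEP => t.
exact: (cliftE tF).1.
Qed.

Lemma pushdown_deck x : pushdown (deck x) = pushdown x.
Proof. by rewrite /pushdown /deck cmap_comp; apply: cmap_ext => p; exact: cover_shift. Qed.

(** The sum over 0 <= z < N, continued to negative N so that [intsumS] holds for all integers. *)
Definition intsum (V : zmodType) (N : int) (a : int -> V) : V :=
  match N with Posz n => \sum_(i < n) a i | Negz n => - \sum_(i < n.+1) a (- (i.+1%:Z)) end.

Lemma intsumS (V : zmodType) N (a : int -> V) : intsum (N + 1) a = intsum N a + a N.
Proof.
case: N => [n|[|n]] /=.
- by rewrite addn1 big_ord_recr.
- by rewrite subnn big_ord0 big_ord1 addNr.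
by rewrite subn1 /= [in RHS]big_ord_recr /= opprD NegzE addrNK.
Qed.

Lemma intsum_eq0 (V : zmodType) N (a : int -> V) : (forall z, a z = 0) -> intsum N a = 0.
Proof. by move=> a0; case: N => n /=; rewrite big1 ?oppr0. Qed.

Lemma int_rec (P : int -> Prop) : P 0 -> (forall N, P N <-> P (N + 1)) -> forall N, P N.
Proof.
move=> P0 PS; case; elim=> [|n IH] //.
- by have := (PS n).1 IH; rewrite -PoszD addn1.
- by apply/(PS _); rewrite NegzE addNr.
- by apply/(PS _); have -> : Negz n.+1 + 1 = Negz n by rewrite !NegzE; lia.
Qed.

Lemma intsum_telescope (V : zmodType) N (a : int -> V) : intsum N (fun z => a (z + 1) - a z) = a N - a 0.
Proof.
move: N; apply: int_rec => [|N]; first by rewrite /= big_ord0 subrr.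
rewrite intsumS; split=> [->|]; first by rewrite addrC addrA subrK.
move/eqP; rewrite addrC addrAC -addrA => /eqP h.
by rewrite -[LHS](subrK (a N)) (@addrI _ _ _ _ h) addrC.
Qed.

(** The sum of the translates of [F] of heights 0, ..., N - 1 for a cube of height N: a discrete
    integral, inverting [deck] - 1. *)
Definition wind n (F : icube X) : chains k R X :=
  intsum (height F) (fun z => cc k n (shift (z - height F) \o F)).
Definition windH (x : chains k R X) : chains k R X :=
  flift (fun c => wind (cell_dim c) (cell_cube c \o resc _)) x.

Lemma lin_windH : linear windH. Proof. by move=> a x y; rewrite /windH linearP. Qed.

Lemma intsum_ext (V : zmodType) N (a b : int -> V) : a =1 b -> intsum N a = intsum N b.
Proof. by move=> ab; case: N => n /=; [|congr (- _)]; apply: eq_bigr => i _; rewrite ab. Qed.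

Lemma linear_intsum (V V' : lmodType k) (f : V -> V') N (a : int -> V) : linear f ->
  f (intsum N a) = intsum N (f \o a).
Proof.
move=> lf; case: N => n /=; first exact: (linsum _ _ _ lf).
by rewrite (linN _ lf) (linsum _ _ _ lf).
Qed.

Lemma windH_cc n (F : icube X) : tinv n F -> windH (cc k n F) = wind n F.
Proof.
move=> tF; pose gg n (c : cube R n X) := wind n (c \o resc n).
have gd m c : degenerate c -> gg m c = 0.
  move=> /indep_degenerate[i im ic]; apply: intsum_eq0 => z; apply: (@cc_degenerate _ _ _ _ i) => //.
  by move=> s t st; congr (shift _ _); exact: ic.
have -> : windH (cc k n F) = flift (fun c => gg (cell_dim c) (cell_cube c)) (chain_of k (F \o padc R n)).
  by rewrite /windH /gg cc.unlock.
rewrite (flift_chain_of gd) /gg; congr (wind n _).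
by apply/continuousEP => t; exact: tF.
Qed.

(** The sums for two consecutive heights differ by the last translate, which is the cube itself. It
    follows that [deck] - 1 is injective. *)
Lemma windH_deck x : windH (deck x) - windH x = x.
Proof.
have lw := lin_windH; have ld := lin_deck.
move: x; apply: (@tinv_ext _ _ _ _ (fun x => windH (deck x) - windH x) id).
- by apply: lin_add; [exact: (@lin_comp _ _ _ _ _ _ lw ld)|exact: lin_opp].
- by move=> ? ? ?.
move=> n F tF; rewrite /deck cmap_cc !windH_cc//; last by move=> t; congr (shift _ _); exact: tF.
rewrite /wind height_shift (@intsum_ext _ _ _ (fun z => cc k n (shift (z - height F) \o F))); last first.
  move=> z; congr cc; apply/continuousEP => t; rewrite -[LHS]/(shift _ (shift 1 (F t))) shiftD.
  by congr (shift _ _); ring.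
rewrite intsumS addrC addrA addNr add0r; congr cc; apply/continuousEP => t.
by rewrite subrr -[LHS]/((F t).1 + 0, (F t).2) addr0 -surjective_pairing.
Qed.

(** The telescoping sum of translates starts at the one of height 0, which is the chosen lift of the
    projected cube. This gives exactness in the middle of the sequence of the covering. *)
Lemma chlift_pushdown x : x = chlift (pushdown x) + (deck (windH x) - windH x).
Proof.
have lw := lin_windH; have ld := lin_deck; have lc := lin_chlift; have lp := lin_pushdown.
move: x; apply: (@tinv_ext _ _ _ _ id (fun x => chlift (pushdown x) + (deck (windH x) - windH x))).
- by move=> ? ? ?.
- apply: lin_add; first exact: (@lin_comp _ _ _ _ _ _ lc lp).
  by apply: lin_add; [exact: (@lin_comp _ _ _ _ _ _ ld lw)|exact: lin_opp].
move=> n F tF; have tG : tinv n (cover \o F) by move=> t; congr (cover _); exact: tF.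
rewrite windH_cc// /pushdown cmap_cc chlift_cc// /wind (linear_intsum _ _ ld).
pose b z : chains k R X := cc k n (shift (z - height F) \o F).
have -> : intsum (height F) (deck \o (fun z => cc k n (shift (z - height F) \o F))) =
  intsum (height F) (fun z => b (z + 1)).
  apply: intsum_ext => z; rewrite /= /deck cmap_cc; congr cc; apply/continuousEP => t.
  by rewrite -[LHS]/(shift 1 (shift _ (F t))) shiftD -addrAC.
have <- : forall N, intsum N (fun z => b (z + 1) - b z) = intsum N (fun z => b (z + 1)) - intsum N b.
  by case=> m; rewrite /= sumrB ?opprB ?opprK ?opprD ?opprK// addrC.
rewrite intsum_telescope.
have -> : b (height F) = cc k n F.
  congr cc; apply/continuousEP => t.
  by rewrite subrr -[LHS]/((F t).1 + 0, (F t).2) addr0 -surjective_pairing.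
suff -> : cc k n (clift (cover \o F)) = b 0 by rewrite addrC subrK.
congr cc; apply/continuousEP; have [cG hG] := cliftE tG; apply: cover_unique => [t|].
  by rewrite cG -[RHS]/(cover (shift _ (F t))) cover_shift.
by rewrite hG height_shift sub0r subrr.
Qed.

Lemma deck_inj x : deck x = x -> x = 0.
Proof. by move=> dx; rewrite -(windH_deck x) dx subrr. Qed.

Lemma pushdown_ker x : pushdown x = 0 -> exists e, x = deck e - e.
Proof.
move=> px; exists (windH x); rewrite {1}(chlift_pushdown x) px.
by rewrite (lin0 lin_chlift) add0r.
Qed.

Lemma scale_continuous : continuous (fun p : I01 R * X => (set_val p.1 * p.2.1, p.2.2) : X).
Proof.
have c1 : continuous (fun p : I01 R * X => (p.1, p.2.1)).
  apply: (@pair_continuous _ _ _ (fun p : I01 R * X => p.1) (fun p => p.2.1)); first exact: fst_cts.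
  by apply: (@continuous_comp_all _ _ _ snd fst); [exact: snd_cts|exact: fst_cts].
apply: (@pair_continuous _ _ _ (fun p : I01 R * X => set_val p.1 * p.2.1 : R) (fun p => p.2.2)).
  by apply: (@continuous_comp_all _ _ _ (fun p : I01 R * X => (p.1, p.2.1)) (fun p : I01 R * R => set_val p.1 * p.2 : R));
    [exact: c1|exact: mulI_continuous].
by apply: (@continuous_comp_all _ _ _ snd snd); [exact: snd_cts|exact: snd_cts].
Qed.
Definition scalec : continuousType (I01 R * X)%type X := mkcts scale_continuous.

Definition at0 : continuousType W X := inpair W 0.
Definition at1 : continuousType W C := inpair W (oneS1 R).
Definition sndX : continuousType X W := mkcts (@snd_cts R W).

Lemma path_continuous : continuous (fun p : I01 R * W => (set_val p.1, p.2) : X).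
Proof.
apply: (@pair_continuous _ _ _ (fun p : I01 R * W => set_val p.1 : R) (fun p => p.2)); last exact: snd_cts.
by apply: (@continuous_comp_all _ _ _ fst (set_val : I01 R -> R)); [exact: fst_cts|exact: initial_continuous].
Qed.
Definition pathX : continuousType (I01 R * W)%type X := mkcts path_continuous.
Definition pathC : continuousType (I01 R * W)%type C := cover \o pathX.

Lemma bd_scale x : bd (cone scalec x) = x - cmap at0 (cmap sndX x) - cone (k := k) scalec (bd x).
Proof.
rewrite bd_cone cmap_comp; congr (_ - _ - _).
  by apply: cmap_id => -[r w]; rewrite -[LHS]/(1 * r, w) mul1r.
by apply: cmap_ext => -[r w]; rewrite -[LHS]/(0 * r, w) mul0r.
Qed.

Lemma bd_pathX x : bd (cone pathX x) = deck (cmap at0 x) - cmap at0 x - cone (k := k) pathX (bd x).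
Proof.
rewrite bd_cone /deck cmap_comp; congr (_ - _ - _).
  by apply: cmap_ext => w; rewrite -[RHS]/(0 + 1, w) add0r.
exact: cmap_ext.
Qed.

Lemma pushdown_path x : pushdown (cone pathX x) = cone (k := k) pathC x.
Proof. exact: cmap_cone. Qed.

Lemma pushdown_at0 x : pushdown (cmap at0 x) = cmap (k := k) at1 x.
Proof.
rewrite /pushdown cmap_comp; apply: cmap_ext => w.
by rewrite -[LHS]/(expi R 0, w) expi0.
Qed.

Lemma cone0 (Z Z' : topologicalType) (H : continuousType (I01 R * Z)%type Z') : cone (k := k) H 0 = 0.
Proof. by apply: lin0; lin. Qed.
Lemma bdD (Z : topologicalType) (x y : chains k R Z) : bd (x + y) = bd x + bd y.
Proof. by apply: linD; lin. Qed.
Lemma bdN (Z : topologicalType) (x : chains k R Z) : bd (- x) = - bd x.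
Proof. by apply: linN; lin. Qed.

Lemma cycle_contract (e : chains k R X) : bd e = 0 ->
  e = cmap at0 (cmap sndX e) + bd (cone scalec e).
Proof.
by move=> de; rewrite bd_scale de cone0 subr0 addrC subrK.
Qed.

(** The boundary of the lift of [c] is (deck - 1) e with [e] a cycle, which the contraction of the
    line moves to a cycle c' over 0. Subtracting the path over c' corrects the lift to a cycle of R
    x W, again homologous to one over 0. *)
Lemma circle_cycle (c : chains k R C) : bd c = 0 -> exists a c' b,
  [/\ bd a = 0, bd c' = 0 & c = cmap at1 a + cone pathC c' + bd b].
Proof.
move=> dc; have ld := lin_deck; have lp := lin_pushdown.
have [e eE] : exists e, bd (chlift c) = deck e - e.
  by apply: pushdown_ker; rewrite /pushdown cmap_bd -/pushdown pushdown_chlift.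
have de : bd e = 0.
  apply: deck_inj; apply/eqP; rewrite -subr_eq0 /deck cmap_bd -bdN -bdD -/deck -eE.
  by rewrite bdK.
pose c' := cmap sndX e; pose u := cone scalec e.
have dc' : bd c' = 0 by rewrite /c' -cmap_bd de; apply: lin0; lin.
have eu : e = cmap at0 c' + bd u := cycle_contract de.
(* The path over c' has boundary (deck - 1) applied to c' over 0, and [e] differs from c' over 0 by
   the boundary of [u]. *)
pose v := chlift c - cone pathX c' - (deck u - u).
have dv : bd v = 0.
  rewrite /v !(bdD, bdN) eE bd_pathX dc' cone0 subr0.
  by rewrite {1 2}eu (linD _ _ ld) /deck cmap_bd; zring.
exists (cmap sndX v), c', (pushdown (cone scalec v)); split=> //.
  by rewrite -cmap_bd dv; apply: lin0; lin.
rewrite {1}/pushdown -cmap_bd -/pushdown -pushdown_at0 -pushdown_path.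
have -> : pushdown (cmap at0 (cmap sndX v)) + pushdown (cone pathX c') + pushdown (bd (cone scalec v)) =
  pushdown v + pushdown (cone pathX c').
  by rewrite addrAC [in RHS](congr1 pushdown (cycle_contract dv)) (linD _ _ lp).
rewrite /v !(linD _ _ lp, linN _ lp) pushdown_chlift pushdown_deck.
by rewrite subrr subr0 subrK.
Qed.

(** Lifting [b] gives (deck - 1) e, whose boundary is (deck - 1) applied to [a] over 0; as deck - 1
    is injective, [a] over 0 is the boundary of [e]. *)
Lemma circle_boundary (a : chains k R W) b : bd a = 0 -> cone pathC a = bd b -> exists a', a = bd a'.
Proof.
move=> da ab; have lp := lin_pushdown.
have [e eE] : exists e, cone pathX a - bd (chlift b) = deck e - e.
  apply: pushdown_ker; rewrite (linD _ _ lp) (linN _ lp) pushdown_path ab.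
  by rewrite /pushdown cmap_bd -/pushdown pushdown_chlift subrr.
have h : cmap at0 a = bd e.
  apply/eqP; rewrite -subr_eq0; apply/eqP; apply: deck_inj.
  have := congr1 (@bd k R _) eE; rewrite !(bdD, bdN) bdK subr0 bd_pathX da.
  rewrite cone0 subr0 (linD _ _ lin_deck) (linN _ lin_deck).
  have -> : bd (deck e) = deck (bd e) by rewrite /deck cmap_bd.
  by move=> h; rewrite -[deck (cmap at0 a)](subrK (cmap at0 a)) h; zring.
exists (cmap sndX e); rewrite -cmap_bd -h cmap_comp.
by rewrite (@cmap_id _ _ _ (sndX \o at0)).
Qed.
End Cover.

Section CirclePath.
Variables (k : comPzRingType) (R : realType).

Lemma pr_sC1 (Y Z : topologicalType) (a : continuousType (S1 R * Y)%type Z)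
    (H : continuousType (I01 R * Y)%type Z) (x : chains k R Y) :
  (forall t y, H (t, y) = a (expi R (set_val t), y)) -> pr a (sC k R 1) x = cone H x.
Proof.
move=> Ha; have [_ lp] := @bilin_pr k R _ _ _ a.
move: x; apply: chains_ext => [||n F]; [exact: lp|lin|].
rewrite /pr /sC /= Ttilde0 chain_of_cc cmap_cc ez_cc cmap_cc cone_cc.
apply: cc_eq => // t; rewrite -[RHS]/(H (t 0%N, F (tailI t))) Ha.
by rewrite -[LHS]/(a (expi R (set_val (truncI 1 t 0%N)), F (dropI 1 t))) truncE.
Qed.
End CirclePath.

(** * The twisted tensor product for a product with the circle *)

Section FreeSuspension.
Variables (k : comPzRingType) (R : realType) (P : aspace R).
Local Notation S1 := (S1 R).
Notation g := (aact P).
Notation SP := (S1 * P)%type.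
Notation C := (S1 * P)%type.
Notation gS := (diag_act P).
Notation ins := (cmap (k := k) (R := R) (insert P)).
Notation rot := (pr (k := k) (R := R) (actc gS) (sC k R 1)).

Lemma action_of_continuous (a : SP -> S1) : continuous a -> continuous (fun p : SP => g (a p, p.2)).
Proof.
move=> ca; apply: (@continuous_comp_all _ _ _ (fun p : SP => (a p, p.2)) g); last exact: act_continuous.
exact: (@pair_continuous _ _ _ a (fun p : SP => p.2) ca (@snd_cts _ _)).
Qed.

Lemma untwist_continuous : continuous (fun p : SP => g (invS1 p.1, p.2)).
Proof. by apply: action_of_continuous; apply: invS1_continuous; exact: fst_cts. Qed.
Definition untwist : continuousType SP P := mkcts untwist_continuous.

Lemma shear_continuous : continuous (fun p : SP => (p.1, untwist p) : C).
Proof. exact: (@pair_continuous _ _ _ (fun p : SP => p.1) untwist (@fst_cts _ _) (@cts_fun _ _ untwist)). Qed.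
(** Straightens the diagonal action into rotation of the first factor, so that the results on the
    covering apply. *)
Definition shear : continuousType SP C := mkcts shear_continuous.

Lemma unshear_continuous : continuous (fun p : C => (p.1, g (p.1, p.2)) : SP).
Proof.
apply: (@pair_continuous _ _ _ (fun p : C => p.1) (fun p => g (p.1, p.2))); first exact: fst_cts.
by apply: action_of_continuous; exact: fst_cts.
Qed.
Definition unshear : continuousType C SP := mkcts unshear_continuous.

Lemma shearK p : unshear (shear p) = p.
Proof. by case: p => x y; rewrite -[LHS]/(x, g (x, g (invS1 x, y))) -actM mulS1V act1. Qed.

Definition rotpath : continuousType (I01 R * P)%type SP := unshear \o pathC R P.

Lemma rot_insert x : rot (ins x) = cone rotpath x.
Proof.
rewrite -[sC k R 1](@cmap_id _ _ _ idfun)//.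
have -> : pr (actc gS) (cmap idfun (sC k R 1)) (ins x) = pr (mkcts (@continuous_comp_all _ _ _ _ _
   (@cts_fun _ _ (prodmap idfun (insert P))) (@cts_fun _ _ (actc gS)))) (sC k R 1) x.
  exact: pr_cmap.
by apply: pr_sC1 => t y; rewrite -[RHS]/(mulS1 _ _, _) mulS11.
Qed.

Lemma susp_cycle (c : chains k R SP) : bd c = 0 -> exists a c' b,
  [/\ bd a = 0, bd c' = 0 & c = ins a + rot (ins c') + bd b].
Proof.
move=> dc; have [|a [c' [b [da dc' cE]]]] := @circle_cycle k R P (cmap shear c).
  by rewrite -cmap_bd dc; apply: lin0; lin.
exists a, c', (cmap unshear b); split=> //.
have lu : linear (cmap (k := k) (R := R) unshear) by lin.
rewrite rot_insert -[LHS](@cmap_id _ _ _ (unshear \o shear)); last by move=> p; exact: shearK.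
rewrite -cmap_comp cE !(linD _ _ lu) cmap_bd cmap_cone cmap_comp.
congr (_ + _ + _); apply: cmap_ext => w.
by rewrite -[LHS]/(oneS1 R, g (oneS1 R, w)) act1.
Qed.

Lemma susp_boundary (a : chains k R P) b : bd a = 0 -> rot (ins a) = bd b -> exists a', a = bd a'.
Proof.
rewrite rot_insert => da ab; apply: (@circle_boundary k R P a (cmap shear b) da).
rewrite -cmap_bd -ab cmap_cone; have e : shear \o rotpath = pathC R P :> continuousType _ _.
  apply/continuousEP => -[t w]; rewrite -[LHS]/(expi R (set_val t), g (invS1 (expi R (set_val t)), g (expi R (set_val t), w))).
  by rewrite -actM mulVS1 act1.
by rewrite e.
Qed.

Lemma untwist_insert x : cmap untwist (ins x) = x.
Proof.
rewrite cmap_comp cmap_id// => y.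
by rewrite -[LHS]/(g (invS1 (oneS1 R), y)) invS1_1 act1.
Qed.

Section TopTerm.
Notation tw := (freemod k (tw_cell R SP)).
Notation lower n := (supp (k := k) (fun b : tw_cell R SP => (b.1 < n)%N)).

Definition term n (z : tw) : chains k R SP :=
  flift (fun b : tw_cell R SP => if b.1 == n then fbasis k b.2 else 0) z.
Lemma lin_term n : linear (term n). Proof. by move=> a x y; rewrite /term linearP. Qed.

Lemma term_twg n m x : term n (twg m x) = if m == n then x else 0.
Proof.
have lt := lin_term; have lg := @lin_twg k R SP.
move: x; apply: flin_ext => [||c].
- exact: (@lin_comp _ _ _ _ _ _ (lt _) (lg _)).
- by case: (m == n); [exact: lin_id|exact: lin_zero].
by rewrite twg_basis /term flift_fbasis.
Qed.

Lemma lower_twg n m (x : chains k R SP) : (m < n)%N -> lower n (twg m x).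
Proof.
move=> mn; apply: (@supp_lin _ _ _ (fun=> True)) => [|c _|//]; first by lin.
by rewrite twg_basis; exact: supp_basis.
Qed.

Lemma lower_split n z : lower n.+1 z -> lower n (z - twg n (term n z)).
Proof.
have lt := lin_term; have lg := @lin_twg k R SP; move=> lz.
apply: (supp_lin (f := fun z => z - twg n (term n z)) _ _ lz).
  by apply: lin_add; [exact: lin_id|apply: lin_opp; exact: (@lin_comp _ _ _ _ _ _ (lg _) (lt _))].
move=> [m c] /= mn; rewrite -twg_basis term_twg; case: eqP => [->|/eqP nm].
  by rewrite subrr; exact: supp0.
rewrite (lin0 (lg _)) subr0 twg_basis; apply: supp_basis => /=.
by rewrite ltn_neqAle nm -ltnS.
Qed.

Lemma lower_bound z : exists n, lower n z.
Proof.
have [s [_ sE]] := fsum_eq z; set N := (\max_(b <- s) b.1)%N; exists N.+1.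
rewrite -[z]flift_id sE big_seq; apply: supp_sum => b bs; apply: suppZ; apply: supp_basis.
by rewrite ltnS; exact: (@leq_bigmax_seq _ s xpredT (fun b : tw_cell R SP => b.1) b bs isT).
Qed.

Lemma term_twd_twg n m (x : chains k R SP) : term n (twd gS (twg m x)) =
  (if m == n then bd x else 0) - (if (n < m.+1)%N then pr (actc gS) (sC k R (m - n)) x else 0).
Proof.
have lt := lin_term; rewrite twd_twg (linD _ _ (lt _)) (linN _ (lt _)) term_twg; congr (_ - _).
rewrite (linsum _ _ _ (lt _)) -(@big_ord1_eq _ 0 +%R (fun j => pr (actc gS) (sC k R (m - j)) x)).
by rewrite [RHS]big_mkcond; apply: eq_bigr => j _; rewrite term_twg.
Qed.

Lemma lin_twdS : linear (@twd k R SP gS). Proof. by lin. Qed.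

Lemma pr_sC0 x : pr (actc gS) (sC k R 0) x = 0 :> chains k R SP.
Proof. by rewrite sC0; have [lp _] := @bilin_pr k R _ _ _ (actc gS); rewrite (lin0 (lp _)). Qed.

Lemma term_twd n z : lower n.+1 z -> term n (twd gS z) = bd (term n z).
Proof.
have lt := lin_term; have ld := lin_twdS; have lb : linear (@bd k R SP) by lin.
move=> lz; apply: (lin_supp_ext (f := fun z => term n (twd gS z)) (g := fun z => bd (term n z)) _ _ lz).
- exact: (@lin_comp _ _ _ _ _ _ (lt _) ld).
- exact: (@lin_comp _ _ _ _ _ _ lb (lt _)).
move=> [m c] /= mn; rewrite -twg_basis term_twd_twg term_twg.
have [->|mn'] := eqVneq m n; first by rewrite ltnSn subnn pr_sC0 subr0.
by rewrite ltnS leqNgt ltn_neqAle mn' -ltnS mn /= subr0 (lin0 lb).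
Qed.

Lemma twd_top n x : lower n (twd gS (twg n x) - twg n (bd x)).
Proof.
rewrite twd_twg addrAC subrr add0r; apply: suppN; rewrite big_ord_recr /= subnn pr_sC0.
rewrite (lin0 (@lin_twg k R SP n)) addr0; apply: supp_sum => j _; exact: lower_twg.
Qed.

(** For a cycle x this shows how v(n + 1) (x) x removes a leading coefficient [rot x] at v(n). *)
Lemma twd_top2 n x : lower n (twd gS (twg n.+1 x) - twg n.+1 (bd x) + twg n (rot x)).
Proof.
rewrite twd_twg [twg _ _ - _]addrC addrK addrC !big_ord_recr /= subnn pr_sC0 subSnn.
rewrite (lin0 (@lin_twg k R SP n.+1)) addr0 opprD addrCA subrr addr0.
by apply: suppN; apply: supp_sum => j _; exact: lower_twg.
Qed.

Section Evaluation.
Variable f0 : tw -> chains k R P.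
Hypothesis lf0 : linear f0.
Hypothesis f0_bd : forall z, f0 (twd gS z) = bd (f0 z).
Hypothesis f0_twg0 : forall x, f0 (twg 0 x) = cmap untwist x.

(** Descent on the leading index. By [susp_cycle] the leading coefficient of a cycle can be reduced
    to the form [ins a]; the next coefficient then forces [rot (ins a)] to bound, so [a] bounds by
    [susp_boundary] and the leading term can be removed. *)
Lemma evaluation_inj n z : lower n z -> twd gS z = 0 -> (exists y', f0 z = bd y') ->
  exists y, z = twd gS y.
Proof.
have lt := lin_term; have ld := lin_twdS; have lb : linear (@bd k R SP) by lin.
have lg := @lin_twg k R SP; have li : linear ins by lin.
elim: n z => [|n IH] z lz dz [y' fz].
  exists 0; rewrite (lin0 ld); apply: freemod_eqP => b; rewrite coef0.
  by apply/eqP; apply: contraPT isT => /lz.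
have dx : bd (term n z) = 0 by rewrite -term_twd// dz (lin0 (lt n)).
have [a [c' [b [da dc' xE]]]] := susp_cycle dx.
(* The first term removes [bd b] from the leading coefficient, the second one removes [rot (ins c')]
   by [twd_top2]. *)
pose y1 := twg n b - twg n.+1 (ins c').
pose z1 := z - twd gS y1.
have dz1 : twd gS z1 = 0 by rewrite /z1 (linD _ _ ld) (linN _ ld) dz twdK subr0.
have lz1 : lower n (z1 - twg n (ins a)).
  have -> : z1 - twg n (ins a) = (z - twg n (term n z)) - (twd gS (twg n b) - twg n (bd b)) +
      (twd gS (twg n.+1 (ins c')) - twg n.+1 (bd (ins c')) + twg n (rot (ins c'))).
    rewrite /z1 /y1 (linD _ _ ld) (linN _ ld) xE !(linD _ _ (lg n)).
    rewrite -[bd (ins c')]cmap_bd dc' (lin0 li) (lin0 (lg n.+1)); zring.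
  apply: suppD; last exact: twd_top2.
  by apply: suppD; [exact: lower_split|apply: suppN; exact: twd_top].
suff [y yE] : exists y, z1 = twd gS y.
  by exists (y + y1); rewrite (linD _ _ ld) -yE /z1 subrK.
have fz1 : f0 z1 = bd (y' - f0 y1).
  by rewrite bdD bdN -f0_bd -fz /z1 (linD _ _ lf0) (linN _ lf0).
clear lz dx xE; clearbody z1 y1; case: n lz1 IH => [|n] lz1 IH.
  (* At index 0 there is no further coefficient to compare with; here the assumption on [f0] shows
     that [a] bounds. *)
  have zE : z1 = twg 0 (ins a).
    apply/eqP; rewrite -subr_eq0; apply/eqP/freemod_eqP => e; rewrite coef0.
    by apply/eqP; apply: contraPT isT => /lz1.
  move: fz1; rewrite zE f0_twg0 untwist_insert => aE.
  exists (twg 0 (ins (y' - f0 y1))).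
  rewrite twd_twg big_ord1 subnn pr_sC0 (lin0 (lg 0%N)) subr0 -cmap_bd -aE.
  by [].
set w := z1 - _ in lz1; have z1E : z1 = twg n.+1 (ins a) + w by rewrite /w addrC subrK.
(* The coefficient of v(n) in [twd gS z1 = 0], the leading term being at v(n + 1). *)
have rE : rot (ins a) = bd (term n w).
  have := congr1 (term n) dz1; rewrite z1E (linD _ _ ld) (linD _ _ (lt n)) (term_twd lz1).
  rewrite term_twd_twg gtn_eqF// ltnW// subSnn (lin0 (lt n)) sub0r addrC => /eqP.
  by rewrite subr_eq0 => /eqP.
have [a' aE] := susp_boundary da rE.
have [|||y2 y2E] := IH (z1 - twd gS (twg n.+1 (ins a'))).
- have -> : z1 - twd gS (twg n.+1 (ins a')) =
    w - (twd gS (twg n.+1 (ins a')) - twg n.+1 (bd (ins a'))).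
    by rewrite z1E -cmap_bd -aE; zring.
  by apply: suppD => //; apply: suppN; exact: twd_top.
- by rewrite (linD _ _ ld) (linN _ ld) dz1 twdK subr0.
- exists (y' - f0 y1 - f0 (twg n.+1 (ins a'))).
  by rewrite (linD _ _ lf0) (linN _ lf0) f0_bd fz1 [in RHS]bdD bdN.
by exists (y2 + twg n.+1 (ins a')); rewrite (linD _ _ ld) -y2E subrK.
Qed.

Lemma evaluation_surj x' : bd x' = 0 -> exists z, twd gS z = 0 /\ f0 z = x'.
Proof.
have lg := @lin_twg k R SP; have li : linear ins by lin.
move=> dx'; exists (twg 0 (ins x')); rewrite f0_twg0 untwist_insert; split=> //.
rewrite twd_twg big_ord1 subnn pr_sC0 (lin0 (lg 0%N)) subr0 -cmap_bd dx'.
by rewrite (lin0 li) (lin0 (lg 0%N)).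
Qed.
End Evaluation.
End TopTerm.
End FreeSuspension.

Section BasedExamples.
Variables (k : comPzRingType) (R : realType).

Lemma lin_bd (X : topologicalType) : linear (@bd k R X). Proof. by lin. Qed.
Definition cu_cx (X : topologicalType) : bcx k := BCx (@lin_bd X) (@supp_bd k R X) (@bdK k R X).

Lemma lin_twd (Y : topologicalType) (g : circle_action R Y) : linear (@twd k R Y g). Proof. by lin. Qed.
Definition tw_cx (Y : topologicalType) (g : circle_action R Y) : bcx k :=
  BCx (@lin_twd Y g) (@supp_twd k R Y g) (@twdK k R Y g).
End BasedExamples.

(** * The Borel construction of a product with the circle *)

Section BorelSuspension.
Variables (k : comPzRingType) (R : realType) (P : aspace R).
Local Notation S1 := (S1 R).
Notation E := (milnorE R).
Notation g := (aact P).
Notation gS := (diag_act P).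
Notation SP := (S1 * P)%type.
Notation Sh := (homotopy_orbits gS).
Notation e0 := (basepoint R).

(** Every orbit has exactly one representative with circle coordinate 1; its other two coordinates
    identify the orbit space with E x P. *)
Lemma unspin_exists : exists2 F : continuousType Sh (E * P)%type, True &
  forall p, F (orb gS p) = (milnor_act p.1 p.2.1, untwist P p.2).
Proof.
have c1 : continuous (fun p : E * SP => milnor_act p.1 p.2.1).
  apply: (@continuous_comp_all _ _ _ (fun p : E * SP => (p.1, p.2.1)) (milnor_actc R)); last exact: cts_fun.
  apply: (@pair_continuous _ _ _ (fun p : E * SP => p.1) (fun p => p.2.1)); first exact: fst_cts.
  by apply: (@continuous_comp_all _ _ _ snd fst); [exact: snd_cts|exact: fst_cts].
have c2 : continuous (fun p : E * SP => untwist P p.2).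
  by apply: (@continuous_comp_all _ _ _ snd (untwist P)); [exact: snd_cts|exact: cts_fun].
apply: (orb_descent (@pair_continuous _ _ _ _ _ c1 c2)) => e a [x z].
congr (_, _); first by rewrite /= milnor_actM.
rewrite -[LHS]/(g (invS1 x, z)) -[RHS]/(g (invS1 (mulS1 a x), g (a, z))).
by rewrite invS1M -actM -mulS1A mulVS1 mulS11.
Qed.
Definition unspin := s2val (cid2 unspin_exists).
Lemma unspinE p : unspin (orb gS p) = (milnor_act p.1 p.2.1, untwist P p.2).
Proof. exact: (s2valP' (cid2 unspin_exists)). Qed.

Definition spin : continuousType (E * P)%type Sh := orb gS \o prodmap idfun (insert P).

Lemma unspinK z : spin (unspin z) = z.
Proof.
have [[e [x y]] ->] := orb_repr z; rewrite unspinE.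
rewrite -[LHS]/(orb gS (milnor_act e x, (oneS1 R, g (invS1 x, y)))) orb_act.
by rewrite -[gS _]/(mulS1 x (oneS1 R), g (x, g (invS1 x, y))) mulS11 -actM mulS1V act1.
Qed.

Definition fibre_map : continuousType Sh P := mkcts (@snd_cts E P) \o unspin.
Notation tot := (cmap (k := k) (R := R) fibre_map).

(** The contraction of E deforms the cycle into the fibre over the base point, where it is the image
    of [tot x]. *)
Lemma total_iso_fibre_inj (x : chains k R Sh) : bd x = 0 -> (exists y', tot x = bd y') -> exists y, x = bd y.
Proof.
move=> dx [y' xy]; pose u := cmap unspin x.
have du : bd u = 0 by rewrite /u -cmap_bd dx; apply: lin0; lin.
have cE : cmap (collapse e0 P) u = bd (cmap (inpair P e0) y').
  rewrite -cmap_bd -xy /u !cmap_comp; exact: cmap_ext.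
have uE : u = bd (cone (slide (hE R) P) u + cmap (inpair P e0) y').
  rewrite bdD -cE (bd_slide (@hE0 R) (@hE1 R)) du cone0 subr0 subrK.
  by [].
exists (cmap spin (cone (slide (hE R) P) u + cmap (inpair P e0) y')).
rewrite -cmap_bd -uE /u cmap_comp cmap_id// => z; exact: unspinK.
Qed.

Notation f := (borel_fun (k := k) gS).

Lemma tot_borel0 x : tot (f (twg 0 x)) = cmap (untwist P) x.
Proof.
rewrite borel_twg Phi0 letter_ltr /iota !cmap_comp; apply: cmap_ext => p.
by rewrite -[LHS]/(unspin (orb gS _)).2 unspinE.
Qed.

(** Two out of three: the composite with [tot] is the evaluation, bijective on homology, and [tot]
    is injective there. *)
Lemma borel_susp : @total_iso k (tw_cx k gS) (cu_cx k R Sh) f.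
Proof.
have lf := @lin_borel_fun k R _ gS; have lt : linear tot by lin.
have lf0 : linear (fun z => tot (f z)) by exact: (@lin_comp _ _ _ _ _ _ lt lf).
have f0_bd z : tot (f (twd gS z)) = bd (tot (f z)) by rewrite borel_bd cmap_bd.
split=> [x dx [y' fx]|x' dx'].
  have [n lx] := lower_bound x.
  apply: (evaluation_inj lf0 f0_bd tot_borel0 lx dx).
  by exists (tot y'); rewrite fx -cmap_bd.
change (bd x' = 0) in dx'; have dtx : bd (tot x') = 0 by rewrite -cmap_bd dx' (lin0 lt).
have [z [dz zE]] := evaluation_surj (f0 := fun z => tot (f z)) tot_borel0 dtx.
have [||y yE] := @total_iso_fibre_inj (x' - f z).
- by rewrite bdD bdN dx' -borel_bd dz (lin0 lf) subr0.
- by exists 0; rewrite (linD _ _ lt) (linN _ lt) zE subrr (lin0 (@lin_bd k R _)).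
exists z, y; split; first exact: dz.
by rewrite -[RHS]/(f z + bd y) -yE addrC subrK.
Qed.
End BorelSuspension.

(** * The comparison for all spaces with a circle action *)

Section Functors.
Variables (k : comPzRingType) (R : realType).

Lemma supp_twmap (Y Y' : topologicalType) (f : continuousType Y Y') n (z : freemod k (tw_cell R Y)) :
  supp (fun b => tw_deg b = n) z -> supp (fun b => tw_deg b = n) (twmap f z).
Proof.
apply: supp_lin => [|[m c] <-]; first exact: lin_twmap.
rewrite -twg_basis twmap_twg; apply: supp_twg; apply: supp_cmap; exact: supp_basis.
Qed.

Lemma twmap_id (Y : topologicalType) (f : continuousType Y Y) (z : freemod k (tw_cell R Y)) :
  (forall y, f y = y) -> twmap f z = z.
Proof.
move=> fy; move: z; apply: tw_ext => [||n x]; [exact: lin_twmap|exact: lin_id|].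
by rewrite twmap_twg cmap_id.
Qed.

Lemma twmap_comp (Y Y' Y'' : topologicalType) (f : continuousType Y Y') (h : continuousType Y' Y'')
    (z : freemod k (tw_cell R Y)) : twmap h (twmap f z) = twmap (h \o f) z.
Proof.
move: z; apply: tw_ext => [||n x]; last by rewrite !twmap_twg cmap_comp.
- exact: (@lin_comp _ _ _ _ _ _ (@lin_twmap k R _ _ h) (@lin_twmap k R _ _ f)).
- exact: lin_twmap.
Qed.

Definition tw_functor : gfun k R :=
  @GFun k R (fun P => tw_cx k (aact P)) (fun P Q f => twmap f)
    (fun P Q f => @lin_twmap k R P Q f) (fun P Q f n z => @supp_twmap P Q f n z)
    (fun P Q f ef z => twmap_twd ef z) (fun P f fy z => twmap_id z fy)
    (fun P Q W f h z => twmap_comp f h z).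

Lemma gmap_bd (P Q : aspace R) (f : continuousType P Q) : equivariant f ->
  forall x, gmap (aact P) (aact Q) f (@bd k R _ x) = bd (gmap (aact P) (aact Q) f x).
Proof. by move=> ef x; rewrite !(gmap_orbmap ef) cmap_bd. Qed.

Lemma gmap_id_ext (P : aspace R) (f : continuousType P P) : (forall y, f y = y) ->
  forall x, @gmap k R _ _ (aact P) (aact P) f x = x.
Proof. by move=> fy x; have -> : f = idfun; [exact/continuousEP|exact: gmap_id]. Qed.

Definition orbit_functor : gfun k R :=
  @GFun k R (fun P => cu_cx k R (homotopy_orbits (aact P))) (fun P Q f => gmap (aact P) (aact Q) f)
    (fun P Q f => @lin_gmap k R P Q _ _ f) (fun P Q f n z => @supp_gmap k R P Q _ _ f n z)
    gmap_bd gmap_id_ext (fun P Q W f h z => @gmap_comp k R P Q W (aact P) (aact Q) (aact W) f h z).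

Lemma borel_cmor (P : aspace R) : @cmor k (tw_functor P) (orbit_functor P) (borel_fun (aact P)).
Proof. by split; [exact: lin_borel_fun|exact: supp_borel|exact: borel_bd]. Qed.

Lemma borel_quasi_iso (Y : topologicalType) (g : circle_action R Y) :
  @quasi_iso k (twisted_tensor k g) (CU k R (homotopy_orbits g)) (borel_fun g).
Proof.
move=> n; have := @comparison k R tw_functor orbit_functor (fun P => borel_fun (aact P))
  borel_cmor _ (fun P => @borel_susp k R P) (ASpace g) n.
rewrite /homology_inj /homology_surj /homogeneous /= bd.unlock twd.unlock; apply.
move=> P Q f ef x; rewrite -[LHS]/(borel_fun (aact Q) (twmap f x)) (borel_nat ef).
by rewrite -(gmap_orbmap ef).
Qed.
End Functors.

(** * Cohomology *)

Section Contraction.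
Variables (k : comPzRingType) (A : bcx k).
Notation mod A := (freemod k (bgen A)).
Notation hom := homogeneous.
Notation d := (@bdif k A).
Notation deg := (@bdeg k A).
Hypothesis acyclic : forall n (x : mod A), hom n x -> bdif x = 0 -> exists2 y, hom n.+1 y & x = bdif y.

Lemma prim_exists n (z : mod A) : exists y : mod A, hom n.+1 y /\ (hom n z -> bdif z = 0 -> z = bdif y).
Proof.
have [[hz dz]|nz] := pselect (hom n z /\ bdif z = 0).
  by have [y hy zy] := acyclic hz dz; exists y.
by exists 0; split=> [|hz dz]; [exact: supp0|case: nz].
Qed.
Definition prim n z : mod A := projT1 (cid (prim_exists n z)).
Lemma hom_prim n z : hom n.+1 (prim n z).
Proof. by have [] := projT2 (cid (prim_exists n z)). Qed.
Lemma primE n z : hom n z -> bdif z = 0 -> z = bdif (prim n z).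
Proof. by have [_] := projT2 (cid (prim_exists n z)); apply. Qed.

Definition pstep (h : mod A -> mod A) : mod A -> mod A :=
  flift (fun b => prim (deg b) (fbasis k b - h (d (fbasis k b)))).
(** The n-th iterate is final in degrees below n ([papp_stable]), so [contract] can take each basis
    element at a late enough stage. *)
Definition papp n := iter n pstep (fun=> 0).
Lemma lin_papp n : linear (papp n).
Proof. by case: n => [|n]; [exact: lin_zero|move=> a x y; rewrite /= /pstep linearP]. Qed.

Lemma supp_dif_basis n b : (deg b < n.+1)%N -> supp (fun c => (deg c < n)%N) (d (fbasis k b)).
Proof.
move=> bn; have := bdif_supp (@supp_basis k _ (fun c => deg c = deg b) b erefl).
by apply: suppW => c cb; rewrite -ltnS cb.
Qed.

Lemma papp_stable n N M (x : mod A) : (n <= N)%N -> (n <= M)%N -> supp (fun b => (deg b < n)%N) x ->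
  papp N x = papp M x.
Proof.
elim: n N M x => [|n IH] [|N] [|M] x // nN nM sx;
  apply: (lin_supp_ext (@lin_papp _) (@lin_papp _) sx) => b bn //.
rewrite /= /pstep !flift_fbasis -!/(papp _); congr (prim _ (_ - _)).
by apply: IH => //; exact: supp_dif_basis.
Qed.

Definition contract (x : mod A) : mod A := flift (fun b => papp (deg b).+1 (fbasis k b)) x.
Lemma lin_contract : linear contract. Proof. by move=> a x y; rewrite /contract linearP. Qed.

Lemma contract_papp n x : supp (fun b => (deg b < n)%N) x -> contract x = papp n x.
Proof.
move=> sx; apply: (lin_supp_ext lin_contract (@lin_papp _) sx) => b bn.
rewrite /contract flift_fbasis; apply: (@papp_stable (deg b).+1) => //.
exact: supp_basis.
Qed.

Lemma contract_basis b : contract (fbasis k b) = prim (deg b) (fbasis k b - contract (d (fbasis k b))).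
Proof.
by rewrite {1}/contract flift_fbasis /= /pstep flift_fbasis (contract_papp (supp_dif_basis (ltnSn _))).
Qed.

Lemma hom_contract n x : hom n x -> hom n.+1 (contract x).
Proof. by apply: supp_lin => [|b <-]; [exact: lin_contract|rewrite contract_basis; exact: hom_prim]. Qed.

(** By the equation one degree below, b minus the contraction of its boundary is a cycle, and the
    contraction of b was chosen as a primitive of it. Freeness allows this choice basis element by
    basis element. *)
Lemma contractE x : d (contract x) + contract (d x) = x.
Proof.
have lc := lin_contract; have ld := @bdif_lin k A.
have lE : linear (fun x => d (contract x) + contract (d x)).
  by apply: lin_add; [exact: (@lin_comp _ _ _ _ _ _ ld lc)|exact: (@lin_comp _ _ _ _ _ _ lc ld)].
suff H n b : (deg b < n)%N -> d (contract (fbasis k b)) + contract (d (fbasis k b)) = fbasis k b.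
  by move: x; apply: flin_ext => [|?|b]; [exact: lE|exact: lin_id|exact: H (ltnSn _)].
elim: n b => // n IH b bn.
have hb : hom (deg b) (fbasis k b) by exact: supp_basis.
rewrite contract_basis -primE ?subrK//.
  apply: homD => //; apply: homN; case e: (deg b) hb => [|m] hb.
    by rewrite (dif_hom0 hb) (lin0 lc); exact: supp0.
  by apply: hom_contract; exact: hom_dif.
rewrite difD difN.
have := lin_supp_ext lE (@lin_id k (mod A)) (supp_dif_basis bn) IH.
by rewrite bdifK (lin0 lc) addr0 => ->; rewrite subrr.
Qed.
End Contraction.

(** * Mapping cones and homotopy inverses *)

Section MappingCone.
Variables (k : comPzRingType) (A B : bcx k).
Notation mod A := (freemod k (bgen A)).
Notation hom := homogeneous.
Variable f : mod A -> mod B.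
Hypothesis fm : cmor f.

Definition mc_gen : choiceType := (bgen A + bgen B)%type.
Definition mc_deg (s : mc_gen) : nat := match s with inl b => (bdeg b).+1 | inr c => bdeg c end.
Notation mc := (freemod k mc_gen).

Definition mcl (x : mod A) : mc := flift (fun b => fbasis k (inl b : mc_gen)) x.
Definition mcr (x : mod B) : mc := flift (fun b => fbasis k (inr b : mc_gen)) x.
Definition mcprl (z : mc) : mod A := flift (fun s : mc_gen => if s is inl b then fbasis k b else 0) z.
Definition mcprr (z : mc) : mod B := flift (fun s : mc_gen => if s is inr b then fbasis k b else 0) z.
Definition mcd (z : mc) : mc := flift (fun s : mc_gen => match s with
  | inl b => mcr (f (fbasis k b)) - mcl (bdif (fbasis k b)) | inr c => mcr (bdif (fbasis k c)) end) z.

Lemma lin_mcl : linear mcl. Proof. by move=> a x y; rewrite /mcl linearP. Qed.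
Lemma lin_mcr : linear mcr. Proof. by move=> a x y; rewrite /mcr linearP. Qed.
Lemma lin_mcprl : linear mcprl. Proof. by move=> a x y; rewrite /mcprl linearP. Qed.
Lemma lin_mcprr : linear mcprr. Proof. by move=> a x y; rewrite /mcprr linearP. Qed.
Lemma lin_mcd : linear mcd. Proof. by move=> a x y; rewrite /mcd linearP. Qed.
Hint Resolve lin_mcl lin_mcr lin_mcprl lin_mcprr lin_mcd : core.

Lemma mc_ext (V : lmodType k) (p q : mc -> V) : linear p -> linear q ->
  (forall x, p (mcl x) = q (mcl x)) -> (forall x, p (mcr x) = q (mcr x)) -> forall z, p z = q z.
Proof.
move=> lp lq pql pqr; apply: flin_ext => // -[b|b].
  by have := pql (fbasis k b); rewrite /mcl flift_fbasis.
by have := pqr (fbasis k b); rewrite /mcr flift_fbasis.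
Qed.

Lemma mcprl_l x : mcprl (mcl x) = x.
Proof.
move: x; apply: flin_ext => [||b]; [exact: (@lin_comp _ _ _ _ _ _ lin_mcprl lin_mcl)|exact: lin_id|].
by rewrite /mcl /mcprl !flift_fbasis.
Qed.
Lemma mcprl_r x : mcprl (mcr x) = 0.
Proof.
move: x; apply: flin_ext => [||b]; [exact: (@lin_comp _ _ _ _ _ _ lin_mcprl lin_mcr)|exact: lin_zero|].
by rewrite /mcr /mcprl !flift_fbasis.
Qed.
Lemma mcprr_l x : mcprr (mcl x) = 0.
Proof.
move: x; apply: flin_ext => [||b]; [exact: (@lin_comp _ _ _ _ _ _ lin_mcprr lin_mcl)|exact: lin_zero|].
by rewrite /mcl /mcprr !flift_fbasis.
Qed.
Lemma mcprr_r x : mcprr (mcr x) = x.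
Proof.
move: x; apply: flin_ext => [||b]; [exact: (@lin_comp _ _ _ _ _ _ lin_mcprr lin_mcr)|exact: lin_id|].
by rewrite /mcr /mcprr !flift_fbasis.
Qed.
Lemma mc_split z : z = mcl (mcprl z) + mcr (mcprr z).
Proof.
move: z; apply: mc_ext => [||x|x]; [exact: lin_id| | |].
- by apply: lin_add; [exact: (@lin_comp _ _ _ _ _ _ lin_mcl lin_mcprl)|exact: (@lin_comp _ _ _ _ _ _ lin_mcr lin_mcprr)].
- by rewrite mcprl_l mcprr_l (lin0 lin_mcr) addr0.
- by rewrite mcprl_r mcprr_r (lin0 lin_mcl) add0r.
Qed.

Lemma mcd_l x : mcd (mcl x) = mcr (f x) - mcl (bdif x).
Proof.
move: x; apply: flin_ext => [||b]; last by rewrite /mcd /mcl !flift_fbasis.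
  exact: (@lin_comp _ _ _ _ _ _ lin_mcd lin_mcl).
apply: lin_add; first exact: (@lin_comp _ _ _ _ _ _ lin_mcr (cmor_lin fm)).
by apply: lin_opp; exact: (@lin_comp _ _ _ _ _ _ lin_mcl (@bdif_lin k A)).
Qed.
Lemma mcd_r x : mcd (mcr x) = mcr (bdif x).
Proof.
move: x; apply: flin_ext => [||b]; last by rewrite /mcd /mcr !flift_fbasis.
  exact: (@lin_comp _ _ _ _ _ _ lin_mcd lin_mcr).
exact: (@lin_comp _ _ _ _ _ _ lin_mcr (@bdif_lin k B)).
Qed.
Lemma mcprl_d z : mcprl (mcd z) = - bdif (mcprl z).
Proof.
rewrite {1}[z]mc_split (linD _ _ lin_mcd) mcd_l mcd_r.
by rewrite !(linD _ _ lin_mcprl) (linN _ lin_mcprl) !mcprl_r mcprl_l add0r addr0.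
Qed.
Lemma mcprr_d z : mcprr (mcd z) = bdif (mcprr z) + f (mcprl z).
Proof.
rewrite {1}[z]mc_split (linD _ _ lin_mcd) mcd_l mcd_r.
by rewrite !(linD _ _ lin_mcprr) (linN _ lin_mcprr) !mcprr_r mcprr_l subr0 addrC.
Qed.

Lemma mcdK z : mcd (mcd z) = 0.
Proof.
rewrite [LHS]mc_split mcprl_d mcprr_d mcprl_d mcprr_d (linN _ (cmor_lin fm)) (cmor_dif fm).
by rewrite difN opprK difD !bdifK add0r subrr (lin0 lin_mcl) (lin0 lin_mcr) addr0.
Qed.

Lemma supp_mcl (Q : mc_gen -> Prop) x : supp (fun b => Q (inl b)) x -> supp Q (mcl x).
Proof. by apply: supp_lin => // b Qb; rewrite /mcl flift_fbasis; exact: supp_basis. Qed.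
Lemma supp_mcr (Q : mc_gen -> Prop) x : supp (fun b => Q (inr b)) x -> supp Q (mcr x).
Proof. by apply: supp_lin => // b Qb; rewrite /mcr flift_fbasis; exact: supp_basis. Qed.

Lemma mcd_supp n z : supp (fun s => mc_deg s = n) z -> supp (fun s => (mc_deg s).+1 = n) (mcd z).
Proof.
apply: supp_lin => // -[b|c] <- /=.
  have hb : hom (bdeg b) (fbasis k b) by exact: supp_basis.
  rewrite -[fbasis k (inl b)]/(fbasis k (inl b : mc_gen)).
  have -> : fbasis k (inl b : mc_gen) = mcl (fbasis k b) by rewrite /mcl flift_fbasis.
  rewrite mcd_l; apply: suppD.
    by apply: supp_mcr => /=; apply: suppW (cmor_hom fm hb) => c ->.
  by apply: suppN; apply: supp_mcl => /=; apply: suppW (bdif_supp hb) => c ->.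
have -> : fbasis k (inr c : mc_gen) = mcr (fbasis k c) by rewrite /mcr flift_fbasis.
rewrite mcd_r; apply: supp_mcr => /=.
exact: (bdif_supp (@supp_basis k _ (fun b => bdeg b = bdeg c) c erefl)).
Qed.
Definition mcone : bcx k := BCx lin_mcd mcd_supp mcdK.

Lemma hom_mcprl n (z : mod mcone) : hom n.+1 z -> hom n (mcprl z).
Proof.
apply: supp_lin => // -[b|b] /= bn; rewrite /mcprl flift_fbasis; last exact: supp0.
by apply: supp_basis; case: bn.
Qed.
Lemma mcprl_hom0 (z : mod mcone) : hom 0 z -> mcprl z = 0.
Proof.
move=> hz; apply: (lin_supp_ext lin_mcprl (@lin_zero k mc (mod A)) hz) => -[b|b] //= _.
by rewrite /mcprl flift_fbasis.
Qed.
Lemma hom_mcprr n (z : mod mcone) : hom n z -> hom n (mcprr z).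
Proof.
apply: supp_lin => // -[b|b] /= bn; rewrite /mcprr flift_fbasis; first exact: supp0.
exact: supp_basis.
Qed.
Lemma hom_mcl n x : hom n x -> @homogeneous k mcone n.+1 (mcl x).
Proof. by move=> hx; apply: supp_mcl; apply: suppW hx => b /= ->. Qed.
Lemma hom_mcr n x : hom n x -> @homogeneous k mcone n (mcr x).
Proof. by move=> hx; exact: supp_mcr. Qed.

Hypothesis fiso : forall n, homology_inj f n /\ homology_surj f n.

(** For a cycle of the cone the first component is a cycle with bounding image, hence bounds by
    injectivity; surjectivity then corrects the second component. *)
Lemma mcone_acyclic n (z : mod mcone) : hom n z -> bdif z = 0 -> exists2 y, hom n.+1 y & z = bdif y.
Proof.
move=> hz dz; change (mcd z = 0) in dz.
have dx : bdif (mcprl z) = 0.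
  by apply/eqP; rewrite -oppr_eq0 -mcprl_d dz (lin0 lin_mcprl).
have fx : f (mcprl z) = bdif (- mcprr z).
  apply/eqP; rewrite -subr_eq0 difN opprK addrC -mcprr_d dz; apply/eqP.
  exact: lin0 lin_mcprr.
have [x1 hx1 xE] : exists2 x1, hom n x1 & mcprl z = bdif x1.
  case: n hz => [|n] hz; first by exists 0; [exact: supp0|rewrite (mcprl_hom0 hz) dif0].
  apply: (fiso n).1; [exact: hom_mcprl|exact: dx|].
  by exists (- mcprr z) => //; apply: homN; exact: hom_mcprr.
have [||p [q [hp dp hq yE]]] := (fiso n).2 (mcprr z + f x1).
- by apply: homD; [exact: hom_mcprr|exact: (cmor_hom fm)].
- by rewrite difD -(cmor_dif fm) -xE fx difN subrr.
exists (mcl (p - x1) + mcr q).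
  by apply: homD; [apply: hom_mcl; apply: homD => //; exact: homN|exact: hom_mcr].
rewrite -[RHS]/(mcd _) (linD _ _ lin_mcd) mcd_l mcd_r difD difN dp sub0r -xE.
rewrite (linN _ lin_mcl) opprK addrAC -(linD _ _ lin_mcr) addrC {1}[z]mc_split; congr (_ + mcr _).
by rewrite (linD _ _ (cmor_lin fm)) (linN _ (cmor_lin fm)) addrAC -yE addrK.
Qed.

(** The entries of a contraction of the cone, written as a matrix: an off-diagonal one is the
    inverse, and the diagonal ones are the homotopies, one of them up to sign. *)
Lemma homotopy_inverse : exists (g : mod B -> mod A) (s : mod B -> mod B) (t : mod A -> mod A),
  [/\ cmor g, linear s /\ (forall n x, hom n x -> hom n.+1 (s x)),
      linear t /\ (forall n x, hom n x -> hom n.+1 (t x)),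
      forall y, f (g y) = y + bdif (s y) + s (bdif y) &
      forall x, g (f x) = x + bdif (t x) + t (bdif x)].
Proof.
pose h := contract mcone_acyclic; have lh : linear h by exact: lin_contract.
have hE z : mcd (h z) + h (mcd z) = z := contractE mcone_acyclic z.
have hh n z : @homogeneous k mcone n z -> @homogeneous k mcone n.+1 (h z) := @hom_contract _ _ mcone_acyclic n z.
exists (fun y => mcprl (h (mcr y))), (fun y => - mcprr (h (mcr y))), (fun x => mcprl (h (mcl x))).
have lhr : linear (fun y => h (mcr y)) by exact: (@lin_comp _ _ _ _ _ _ lh lin_mcr).
have lhl : linear (fun y => h (mcl y)) by exact: (@lin_comp _ _ _ _ _ _ lh lin_mcl).
split.
- split; first exact: (@lin_comp _ _ _ _ _ _ lin_mcprl lhr).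
    by move=> n x hx; apply: hom_mcprl; apply: hh; exact: hom_mcr.
  move=> y; have := congr1 mcprl (hE (mcr y)).
  rewrite (linD _ _ lin_mcprl) mcprl_d mcd_r mcprl_r addrC => /eqP.
  by rewrite subr_eq0 => /eqP.
- split; first by apply: lin_opp; exact: (@lin_comp _ _ _ _ _ _ lin_mcprr lhr).
  by move=> n x hx; apply: homN; apply: hom_mcprr; apply: hh; exact: hom_mcr.
- split; first exact: (@lin_comp _ _ _ _ _ _ lin_mcprl lhl).
  by move=> n x hx; apply: hom_mcprl; apply: hh; exact: hom_mcl.
- move=> y; have := congr1 mcprr (hE (mcr y)).
  rewrite (linD _ _ lin_mcprr) mcprr_d mcd_r mcprr_r => {2}<-.
  by rewrite difN; zring.
- move=> x; have := congr1 mcprl (hE (mcl x)).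
  rewrite (linD _ _ lin_mcprl) mcprl_d mcd_l (linD _ _ lh) (linN _ lh).
  rewrite (linD _ _ lin_mcprl) (linN _ lin_mcprl) mcprl_l => {2}<-.
  by zring.
Qed.
End MappingCone.

Section Evaluation.
Variables (k : comPzRingType) (C : precoalg k).

Lemma lin_ceval n (u : cochain C n) : linear (ceval u : _ -> k^o).
Proof. by move=> a x y; rewrite /ceval linearP. Qed.

Lemma ceval_out n (u : cochain C n) x : supp (fun b => cdeg b <> n) x -> ceval u x = 0.
Proof.
move=> sx; apply: (@lin_supp_ext k _ k^o _ _ (fun=> 0) x (lin_ceval u) _ sx); first exact: lin_zero.
by move=> b /eqP bn; exact: ceval_deg.
Qed.

Lemma ceval_codiff_lin (HC : chain_coalgebra C) n (u : cochain C n) x :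
  ceval (codiff u) x = (-1) ^+ n.+1 * ceval u (cdiff C x).
Proof.
move: x; apply: (@flin_ext k _ k^o) => [||b]; [exact: lin_ceval| |exact: ceval_codiff].
by move=> a x y; rewrite linearP (lin_ceval u) mulrDr mulrCA.
Qed.
Lemma cohomology_pi_eq n (x y : cocycle C n) : x - y \in @is_coboundary k C n ->
  \pi_(cohomology C n)%qT x = \pi_(cohomology C n)%qT y.
Proof. by move=> xy; apply/eqP; rewrite cohomology_eqP. Qed.

Lemma cohomology_pi_scale n a (x : cocycle C n) :
  a *: (\pi_(cohomology C n)%qT x : cohomology C n) = \pi_(cohomology C n)%qT (a *: x).
Proof. exact: cohomology_piZ. Qed.
End Evaluation.

(** * Maps induced in cohomology *)

Section Pullback.
Variables (k : comPzRingType) (C C' : precoalg k).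
Hypothesis HC' : chain_coalgebra C'.
Notation mod C := (freemod k (cgen C)).

Record chainmor (D D' : precoalg k) (p : mod D -> mod D') : Prop := ChainMor {
  chainmor_lin : linear p;
  chainmor_hom : forall n x, supp (fun b => cdeg b = n) x -> supp (fun b => cdeg b = n) (p x);
  chainmor_dif : forall x, p (cdiff D x) = cdiff D' (p x)
}.

Variable p : mod C -> mod C'.
Hypothesis pm : chainmor p.

Definition pull n (u : cochain C' n) : cochain C n := fun b => ceval u (p (fbasis k (val b))).

Lemma ceval_pull n (u : cochain C' n) x : ceval (pull u) x = ceval u (p x).
Proof.
move: x; apply: (@flin_ext k _ k^o) => [||b]; first exact: lin_ceval.
  exact: (@lin_comp k _ _ k^o _ _ (lin_ceval u) (chainmor_lin pm)).
have [bn|bn] := eqVneq (cdeg b) n.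
  have bP : cdeg b == n by rewrite bn.
  by rewrite -[b in LHS]/(val (Sub b bP : cgenn C n)) ceval_val /pull SubK.
rewrite ceval_deg// ceval_out//.
have := chainmor_hom pm (@supp_basis k _ (fun c => cdeg c = cdeg b) b erefl).
by apply: suppW => c ->; exact/eqP.
Qed.

Lemma pull_linear n : linear (@pull n).
Proof. by move=> a u v; apply/funext => b; rewrite /pull ceval_linearl. Qed.

Lemma codiff_pull n (u : cochain C' n) : codiff (pull u) = pull (codiff u).
Proof.
apply/funext => b; rewrite /codiff ceval_pull (chainmor_dif pm).
by rewrite -(ceval_codiff_lin HC') /pull.
Qed.

Lemma pull_cocycle n (z : cocycle C' n) : pull (cochain_of z) \in @is_cocycle k C n.
Proof.
rewrite unfold_in codiff_pull; have := cocycleP z; rewrite unfold_in => /eqP->.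
by apply/eqP/funext => b; rewrite /pull /ceval /flift fsbig1// => c _; case: insub => [?|] /=; rewrite scaler0.
Qed.
Definition zpull n (z : cocycle C' n) : cocycle C n := Cocycle (pull_cocycle z).

Lemma zpull_linear n a (x y : cocycle C' n) : zpull (a *: x + y) = a *: zpull x + zpull y.
Proof. by apply/val_inj; exact: pull_linear. Qed.

Lemma zpull_coboundary n (z : cocycle C' n) : z \in @is_coboundary k C' n -> zpull z \in @is_coboundary k C n.
Proof.
case: n z => [|n] z; rewrite !unfold_in /=.
  move=> /eqP->; apply/eqP/val_inj; have := @zpull_linear 0 (-1) 0 0.
  by rewrite !scaleN1r oppr0 addr0 addNr => /(congr1 val).
by move=> /asboolP[v zv]; apply/asboolP; exists (pull v); rewrite codiff_pull /= zv.
Qed.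

Definition hpull n (x : cohomology C' n) : cohomology C n := \pi_(cohomology C n)%qT (zpull (repr x)).

Lemma hpull_pi n (z : cocycle C' n) : hpull (\pi_(cohomology C' n)%qT z) = \pi_(cohomology C n)%qT (zpull z).
Proof.
rewrite /hpull; apply: cohomology_pi_eq.
set z' := repr _; have e : z' - z \in @is_coboundary k C' n by rewrite -cohomology_eqP reprK.
have -> : zpull z' - zpull z = zpull (z' - z); last exact: zpull_coboundary.
by rewrite addrC -scaleN1r -zpull_linear scaleN1r addrC.
Qed.

Lemma hpull_linear n : linear (@hpull n).
Proof.
move=> a; elim/quotW=> x; elim/quotW=> y.
rewrite (cohomology_pi_scale a x) -cohomology_piD !hpull_pi zpull_linear cohomology_piD.
by rewrite cohomology_pi_scale.
Qed.
End Pullback.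

Section PullbackHomotopy.
Variables (k : comPzRingType) (C C' : precoalg k).
Hypotheses (HC : chain_coalgebra C) (HC' : chain_coalgebra C').
Notation mod C := (freemod k (cgen C)).
Variables (p : mod C -> mod C') (q : mod C' -> mod C).
Hypotheses (pm : chainmor p) (qm : chainmor q).

(** On a cocycle the term with the outer differential vanishes, and the other one is a coboundary up
    to sign; in degree 0 it is zero. *)
Lemma hpullK (s : mod C' -> mod C') : linear s ->
  (forall n x, supp (fun b => cdeg b = n) x -> supp (fun b => cdeg b = n.+1) (s x)) ->
  (forall y, p (q y) = y + cdiff C' (s y) + s (cdiff C' y)) ->
  forall n (x : cohomology C' n), hpull HC qm (hpull HC' pm x) = x.
Proof.
move=> ls hs pq n; elim/quotW=> z; rewrite (hpull_pi HC' pm z) (hpull_pi HC qm); apply: cohomology_pi_eq.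
set e := _ - z; have eE b : cochain_of e b = ceval (cochain_of z) (s (cdiff C' (fbasis k (val b)))).
  rewrite -[LHS]/(pull q (pull p (cochain_of z)) b - cochain_of z b) {1}/pull ceval_pull// pq.
  rewrite !(linD _ _ (lin_ceval _)) cocycle_ceval// addr0 ceval_val.
  by rewrite addrAC subrr add0r.
case: n z e eE => [|n] z e eE.
  rewrite (_ : e = 0) ?rpred0//; apply/val_inj/funext => b; rewrite /= eE.
  rewrite (_ : cdiff C' _ = 0) ?(lin0 ls) ?(lin0 (lin_ceval _))//.
  apply: freemod_eqP => c; rewrite coef0; apply/eqP; apply: contraPT isT => /(cdiff_deg HC').
  by rewrite (eqP (valP b)).
apply: (@is_coboundaryI _ _ _ e n (fun c => ceval (cochain_of z) (s (fbasis k (val c)))) 1) => // b.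
rewrite eE mul1r; symmetry.
have sb : supp (fun c => cdeg c = n) (cdiff C' (fbasis k (val b))).
  by move=> c /(cdiff_deg HC'); rewrite (eqP (valP b)) => -[].
apply: (@lin_supp_ext k _ k^o _ _ (fun x => ceval (cochain_of z) (s x)) _ (lin_ceval _) _ sb).
  exact: (@lin_comp k _ _ k^o _ _ (lin_ceval _) ls).
move=> c cn; have cP : cdeg c == n by rewrite cn.
by rewrite -[c in LHS]/(val (Sub c cP : cgenn C' n)) ceval_val SubK.
Qed.
End PullbackHomotopy.

(** * Multiplicativity from the second map of the DCSH family *)

Section Multiplicativity.
Variables (k : comPzRingType) (C C' : precoalg k).
Hypotheses (HC : chain_coalgebra C) (HC' : chain_coalgebra C').
Notation mod C := (freemod k (cgen C)).
Variables (p : mod C -> mod C') (pm : chainmor p).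
Variable phi : nat -> {linear mod C -> freemod k (word C')}.
Hypotheses (Hphi : dcsh_family phi) (phi1 : forall x, phi 1%N x = word1 (p x)).

Lemma lin_pairing (D : precoalg k) m n (u : cochain D m) (v : cochain D n) : linear (pairing u v : _ -> k^o).
Proof. by move=> a x y; rewrite /pairing linearP. Qed.
Lemma lin_word_pairing (D : precoalg k) m n (u : cochain D m) (v : cochain D n) :
  linear (word_pairing u v : _ -> k^o).
Proof. by move=> a x y; rewrite /word_pairing linearP. Qed.

Lemma pairing_tns m n (u : cochain C' m) (v : cochain C' n) x y :
  pairing u v (tns x y) = (-1) ^+ (n * m) * (ceval u x * ceval v y).
Proof.
have lp := lin_pairing u v; have bt := @bilin_tns k (cgen C') (cgen C').
have lu := lin_ceval u; have lv := lin_ceval v.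
move: x; apply: (@flin_ext k _ k^o) => [||a].
- exact: (@lin_comp k _ _ k^o _ _ lp (bt.1 _)).
- by move=> c s t; rewrite lu; rewrite -[_ *: _]/(c * _) -[X in _ = X + _]/(c * _); ring.
move: y; apply: (@flin_ext k _ k^o) => [||b].
- exact: (@lin_comp k _ _ k^o _ _ lp (bt.2 _)).
- by move=> c s t; rewrite lv; rewrite -[_ *: _]/(c * _) -[X in _ = X + _]/(c * _); ring.
by rewrite tns_basis /pairing flift_fbasis.
Qed.

Lemma word_pairing_tens m n (u : cochain C' m) (v : cochain C' n) y :
  word_pairing u v (tens_map 0 (phi 1%N) (phi 1%N) y) = pairing (pull p u) (pull p v) y.
Proof.
move: y; apply: (@flin_ext k _ k^o) => [||[a b]].
- apply: (@lin_comp k _ _ k^o _ _ (lin_word_pairing u v)).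
  by move=> c x y; rewrite /tens_map linearP.
- exact: lin_pairing.
rewrite /tens_map flift_fbasis /= mul0n expr0 scale1r !phi1 fcat_word1 word_pairing2 pairing_tns.
by rewrite /pairing flift_fbasis /= !ceval_pull.
Qed.

Lemma tcomul0_word1 x : tcomul 0 (word1 x) = word2 (ccomul C' x).
Proof.
move: x; apply: flin_ext => [||b].
- exact: (@lin_comp _ _ _ _ _ _ (@lin_tcomul k C' 0) (@lin_word1 k C')).
- by move=> a x y; rewrite linearP (@lin_word2 k C').
by rewrite word1_basis /tcomul flift_fbasis /= fcat_nil.
Qed.

Lemma word_pairing_tdiff m n (u : cocycle C' m) (v : cocycle C' n) (w : freemod k (word C')) :
  (forall t, w t != 0 -> size t = 2) -> word_pairing (cochain_of u) (cochain_of v) (tdiff w) = 0.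
Proof.
move=> sw; have lW := lin_word_pairing (cochain_of u) (cochain_of v).
apply: (@lin_supp_ext k _ k^o (fun t => size t = 2) (fun w => word_pairing (cochain_of u) (cochain_of v) (tdiff w)) (fun=> 0)).
- exact: (@lin_comp k _ _ k^o _ _ lW (@lin_tdiff k C')).
- exact: lin_zero.
- exact: sw.
move=> [|a [|b []]] // _; rewrite /tdiff flift_fbasis word_pairing_diff//.
by rewrite !cocycle_ceval// !(mul0r, mulr0, addr0).
Qed.

(** The equation of index 2, paired with two cocycles; pairing kills the boundary of [phi 2 x], so
    [phi 2] is a homotopy between the two cup products. *)
Lemma cup_homotopy m n (u : cocycle C' m) (v : cocycle C' n) x :
  word_pairing (cochain_of u) (cochain_of v) (phi 2 (cdiff C x)) =
  pairing (pull p (cochain_of u)) (pull p (cochain_of v)) (ccomul C x) -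
  pairing (cochain_of u) (cochain_of v) (ccomul C' (p x)).
Proof.
have [sz eqn] := Hphi (ltn0Sn 1); have lW := lin_word_pairing (cochain_of u) (cochain_of v).
have := congr1 (word_pairing (cochain_of u) (cochain_of v)) (eqn x).
rewrite big_nat1 big_nat1 /= expr0 scale1r sqrrN expr1n !scale1r phi1 tcomul0_word1.
rewrite !(linD _ _ lW) (linN _ lW) word_pairing_tens word_pairing2.
rewrite word_pairing_tdiff ?add0r// => t.
rewrite -[phi 2 x]flift_id => nz.
have : supp (fun t : word C' => size t = 2) (phi 2 x).
  apply: (@supp_lin k _ _ (fun=> True) _ (phi 2)) => // [a y z|b _ t' /sz []//].
  by rewrite linearP.
by move=> h; apply: h; rewrite flift_id in nz.
Qed.

Lemma hpull_cup m n (x : cohomology C' m) (y : cohomology C' n) :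
  hpull HC' pm (hcup x y) = hcup (hpull HC' pm x) (hpull HC' pm y).
Proof.
elim/quotW: x => u; elim/quotW: y => v.
rewrite (hpull_pi HC' pm u) (hpull_pi HC' pm v) (hcup_pi HC') (hcup_pi HC).
pose w1 := Cocycle (cup_cocycle HC' u v); pose w2 := Cocycle (cup_cocycle HC (zpull HC' pm u) (zpull HC' pm v)).
rewrite -[cup (cochain_of u) _]/(cochain_of w1) -[cup (cochain_of (zpull _ _ u)) _]/(cochain_of w2).
rewrite !class_ofE (hpull_pi HC' pm w1); apply/esym/cohomology_pi_eq.
set e := w2 - _.
have eE b : cochain_of e b = word_pairing (cochain_of u) (cochain_of v) (phi 2 (cdiff C (fbasis k (val b)))).
  rewrite cup_homotopy -(ceval_cup HC') -(ceval_pull pm) ceval_val.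
  by rewrite -(cupE (pull p (cochain_of u)) (pull p (cochain_of v)) b).
have d0 b : cdeg b = 0%N -> cdiff C (fbasis k b) = 0.
  move=> b0; apply: freemod_eqP => c; rewrite coef0; apply/eqP; apply: contraPT isT => /(cdiff_deg HC).
  by rewrite b0.
have [mn0|mn0] := posnP (m + n)%N.
  rewrite (_ : e = 0) ?rpred0//; apply/val_inj/funext => b.
  rewrite -[LHS]/(cochain_of e b) eE d0; last by rewrite (eqP (valP b)).
  by rewrite linear0 (lin0 (lin_word_pairing _ _)).
pose h : cochain C (m + n).-1 := fun b => word_pairing (cochain_of u) (cochain_of v) (phi 2 (fbasis k (val b))).
apply: (@is_coboundaryI _ _ _ e _ h 1) => [|b]; first by rewrite prednK.
rewrite eE mul1r; symmetry.
have sb : supp (fun c => cdeg c = (m + n).-1) (cdiff C (fbasis k (val b))).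
  by move=> c /(cdiff_deg HC); rewrite (eqP (valP b)) => <-.
apply: (@lin_supp_ext k _ k^o _ _ (fun x => word_pairing (cochain_of u) (cochain_of v) (phi 2 x)) _ (lin_ceval _) _ sb).
  by apply: (@lin_comp k _ _ k^o _ _ (lin_word_pairing _ _)) => a y z; rewrite linearP.
move=> c cn; have cP : cdeg c == (m + n).-1 by rewrite cn.
by rewrite -[c in LHS]/(val (Sub c cP : cgenn C (m + n).-1)) ceval_val /h SubK.
Qed.
End Multiplicativity.

Section Unit.
Variables (k : comPzRingType) (C : precoalg k).
Hypothesis HC : chain_coalgebra C.

Lemma ceval_counit x : ceval (@counit_cochain k C) x = ccounit C x.
Proof.
move: x; apply: (@flin_ext k _ k^o) => [||b]; [exact: lin_ceval|by move=> a x y; rewrite linearP|].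
have [b0|b0] := eqVneq (cdeg b) 0%N.
  have bP : cdeg b == 0%N by rewrite b0.
  by rewrite -[b in LHS]/(val (Sub b bP : cgenn C 0)) ceval_val.
rewrite ceval_deg//; apply/eqP; rewrite eq_sym; apply/negPn/negP => /(ccounit_deg HC) e.
by rewrite e eqxx in b0.
Qed.

Lemma counit_cocycle : @counit_cochain k C \in @is_cocycle k C 0.
Proof.
rewrite unfold_in; apply/eqP/funext => b.
by rewrite /codiff ceval_counit ccounit_diff// mulr0.
Qed.

Lemma cup_counitr (u : cochain C 0) : cup u (@counit_cochain k C) = u.
Proof.
apply/funext => b; rewrite /cup -[RHS]ceval_val -[fbasis k (val b) in RHS](ccounitr HC) [RHS]flift_comp.
congr flift; apply/funext => -[x y] /=; rewrite mul0n expr0 mul1r ceval_counit mulrC.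
by rewrite -[RHS]/(ceval u _) (linZ _ _ (lin_ceval u)).
Qed.

Lemma cup_counitl (u : cochain C 0) : cup (@counit_cochain k C) u = u.
Proof.
apply/funext => b; rewrite /cup -[RHS]ceval_val -[fbasis k (val b) in RHS](ccounitl HC) [RHS]flift_comp.
congr flift; apply/funext => -[x y] /=; rewrite mul0n expr0 mul1r ceval_counit.
by rewrite -[RHS]/(ceval u _) (linZ _ _ (lin_ceval u)).
Qed.

Lemma honeE : hone C = \pi_(cohomology C 0)%qT (Cocycle counit_cocycle).
Proof. by rewrite -class_ofE. Qed.

Lemma hcup1 (x : cohomology C 0) : hcup x (hone C) = x.
Proof.
elim/quotW: x => z; rewrite honeE (hcup_pi HC) /= cup_counitr; exact: class_ofE.
Qed.

Lemma hcup1l (x : cohomology C 0) : hcup (hone C) x = x.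
Proof.
elim/quotW: x => z; rewrite honeE (hcup_pi HC) /= cup_counitl; exact: class_ofE.
Qed.
End Unit.

Section CohomologyIso.
Variables (k : comPzRingType) (C C' : precoalg k).

Lemma cdiff_supp (D : precoalg k) (HD : chain_coalgebra D) n (x : freemod k (cgen D)) :
  supp (fun b => cdeg b = n) x -> supp (fun b => (cdeg b).+1 = n) (cdiff D x).
Proof.
by apply: supp_lin => [|b <-]; [move=> a y z; rewrite linearP|exact: (cdiff_deg HD)].
Qed.

Lemma lin_cdiff (D : precoalg k) : linear (cdiff D).
Proof. by move=> a y z; rewrite linearP. Qed.

Definition precoalg_cx (D : precoalg k) (HD : chain_coalgebra D) : bcx k :=
  BCx (lin_cdiff (D := D)) (cdiff_supp HD) (cdiffK HD).

(** The isomorphism goes from the cohomology of [C] to that of [C'], so it is the pullback along the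
    homotopy inverse [g]. Its multiplicativity is deduced from that of the pullback along [f], of
    which it is the inverse. *)
Lemma dcsh_cohomology (f : {linear freemod k (cgen C) -> freemod k (cgen C')}) :
  dcsh_quasi_iso f -> graded_alg_iso C C'.
Proof.
move=> [[HC HC' [fd fc] [phi Hphi phi1]] qf].
have lf : linear f by move=> a x y; rewrite linearP.
have hf n x : supp (fun b => cdeg b = n) x -> supp (fun b => cdeg b = n) (f x).
  by apply: supp_lin => // b <-; exact: fd.
have fm : chainmor f by split.
have fcm : @cmor k (precoalg_cx HC) (precoalg_cx HC') f by split.
have [g [s [t [[lg hg gd] [ls hs] [lt ht] fg gf]]]] := homotopy_inverse fcm qf.
have gm : chainmor g by split.
have gfK n (x : cohomology C n) : hpull HC' fm (hpull HC gm x) = x.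
  exact: (hpullK HC' HC gm fm lt ht gf).
have fgK n (x : cohomology C' n) : hpull HC gm (hpull HC' fm x) = x.
  exact: (hpullK HC HC' fm gm ls hs fg).
exists (fun n => linpack (@hpull_linear _ _ _ HC _ gm n)); split=> [n|m n x y|].
- by exists (@hpull _ _ _ HC' _ fm n) => x; [exact: gfK|exact: fgK].
- rewrite !linpackE -[x in LHS]gfK -[y in LHS]gfK -(hpull_cup HC HC' fm Hphi phi1).
  exact: fgK.
(* A multiplicative bijection preserves the neutral element. *)
rewrite linpackE -[RHS](fgK 0%N); congr hpull.
rewrite -[RHS](hcup1 HC) -{2}[hone C](gfK 0%N) -(hpull_cup HC HC' fm Hphi phi1).
by rewrite (hcup1l HC') gfK.
Qed.
End CohomologyIso.

Theorem theorem6p7 (k : comPzRingType) (R : realType) (Y : topologicalType)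
    (g : circle_action R Y) :
  (exists f : {linear freemod k (cgen (twisted_tensor k g)) ->
                      freemod k (cgen (CU k R (homotopy_orbits g)))},
     dcsh_quasi_iso f) /\
  graded_alg_iso (twisted_tensor k g) (CU k R (homotopy_orbits g)).
Proof.
have q : dcsh_quasi_iso (borel_map k g).
  by split; [exact: borel_dcsh|exact: borel_quasi_iso].
by split; [exists (borel_map k g)|exact: dcsh_cohomology q].
Qed.
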